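(* Let $W_j\in\mathcal{A}_{\partial\Delta_j}$ for $j\ge1$, and for $X\in\mathcal{A}_{loc}$ let $$\delta_j(X)=[X,W_j],\qquad \delta_j^\dagger(X)=(\delta_j(X^* ))^*=[W_j^*,X],\qquad \mathcal{L}(X)=\frac12\sum_{j=1}^\infty\{W_j^*\delta_j(X)+\delta_j^\dagger(X)W_j\}.$$ Then there exists a homomorphic co-cycle $J_t:\mathcal{A}\to\mathcal{A}''\otimes\mathcal{B}(\Gamma_{sym})$, $t\ge 0$, satisfying, for $X\in\mathcal{A}_{loc}$, the Evans--Hudson equation $$J_t(X)=X\otimes I+\int_0^tJ_s(\mathcal{L}(X))\,ds+\sum_{j=1}^\infty\int_0^tJ_s(\delta_j(X))\,a_j^\dagger(ds)+\sum_{j=1}^\infty\int_0^tJ_s(\delta_j^\dagger(X))\,a_j(ds).$$ The expectation semi-group $(\mathcal{T}_t)_{t\ge0}$ of $J_t$ is the conservative minimal semi-group associated with the Lindbladian $\mathcal{L}$.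
   Context: Algebra. Fix positive integers $N,d$. $\mathcal{A}=\overline{\bigotimes_{j\in\mathbb{Z}^d}M_N(\mathbb{C})}^{\,c^*}$ is the UHF $C^*$-algebra (the $C^*$-inductive limit of the finite tensor products of copies of $M_N(\mathbb{C})$ indexed by finite subsets of $\mathbb{Z}^d$). For $\Delta\subset\mathbb{Z}^d$, $\mathcal{A}_\Delta$ is the $*$-subalgebra generated by elements supported in $\Delta$ (i.e. equal to the identity in every tensor component outside $\Delta$). For $j\in\mathbb{Z}^d$ put $\|j\|=\max_i|j_i|$, $\Delta_n=\{j:\|j\|\le n\}$, $\partial\Delta_n=\{j:\|j\|=n\}$; $\mathcal{A}_{loc}=\bigcup_n\mathcal{A}_{\Delta_n}$ is the $*$-algebra of local elements. $tr$ is the unique normalized trace on $\mathcal{A}$, $\mathcal{H}=L^2(\mathcal{A},tr)$ is its GNS Hilbert space, $\mathcal{A}$ is represented on $\mathcal{H}$ by left multiplication, and $\mathcal{A}''\subseteq\mathcal{B}(\mathcal{H})$ is the generated von Neumann algebra. For $X\in\mathcal{A}_{\Delta_n}$ one has $\delta_k(X)=\delta_k^\dagger(X)=0$ for $k>n$, so all sums over $j$ in the claim are finite for local $X$. Fock space. $\mathbf{k}$ is a separable Hilbert space with orthonormal basis $\{e_j:j\ge1\}$, $\Gamma_{sym}=\Gamma_{sym}(L^2(\mathbb{R}_+,\mathbf{k}))$ is the symmetric Fock space with exponential vectors $e(f)=\bigoplus_{n\ge0}\frac{1}{\sqrt{n!}}f^{\otimes n}$, and $a_j^\dagger,a_j$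 are the creation and annihilation processes in the direction $e_j$. The integrals are Hudson--Parthasarathy quantum stochastic integrals of adapted processes. In terms of matrix elements on exponential vectors, with $f_j(s)=\langle e_j,f(s)\rangle$, the equation says that for $u,v\in\mathcal{H}$ and $f,g\in L^2(\mathbb{R}_+,\mathbf{k})$ $$\langle u\otimes e(f),J_t(X)\,v\otimes e(g)\rangle=\langle u\otimes e(f),(X\otimes I)\,v\otimes e(g)\rangle+\int_0^t\Big\langle u\otimes e(f),J_s\Big(\mathcal{L}(X)+\sum_j\overline{f_j(s)}\,\delta_j(X)+\sum_jg_j(s)\,\delta_j^\dagger(X)\Big)v\otimes e(g)\Big\rangle ds.$$ Co-cycle. A homomorphic co-cycle is an adapted family of unital $*$-homomorphisms $J_t$ with $J_0(X)=X\otimes I$ satisfying the co-cycle identity $J_{s+t}=\widehat{J}_s\circ\sigma_s\circ J_t$ with respect to the time shift on Fock space (here $\sigma_s$ shifts the Fock component from $[0,\infty)$ to $[s,\infty)$, and $\widehat{J}_s$ is $J_s$ applied to the algebra component and the identity on operators on the Fock space over $[s,\infty)$; the identity is understood on $\mathcal{A}_{loc}$). Semi-groups. The (vacuum) expectation semi-group is defined by $\langle u,\mathcal{T}_t(X)v\rangle=\langle u\otimes e(0),J_t(X)\,v\otimes e(0)\rangle$ for $u,v\in\mathcal{H}$. It is conservative if $\mathcal{T}_t(I)=I$ for all $t$. A semi-group of completely positive contractions $(\mathcal{T}_t)$ on $\mathcal{A}$ is associated with $\mathcal{L}$ if $\mathcal{T}_t(X)=X+\int_0^t\mathcal{T}_s(\mathcal{L}(X))\,ds$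 for all $X\in\mathcal{A}_{loc}$, $t\ge0$; it is minimal if $\mathcal{T}_t(X)\le\mathcal{T}'_t(X)$ for all $t\ge 0$, all $X\ge0$ in $\mathcal{A}$ and every other such semi-group $(\mathcal{T}'_t)$ associated with $\mathcal{L}$. *)

(* Defs.v *)
From HB Require Import structures.
From mathcomp Require Import all_boot all_order all_algebra.
From mathcomp Require Import complex.
From mathcomp Require Import all_classical all_reals all_analysis.
Set Implicit Arguments.
Unset Strict Implicit.
Unset Printing Implicit Defensive.
Import Order.TTheory GRing.Theory Num.Theory.
Import numFieldNormedType.Exports.
Local Open Scope classical_set_scope.
Local Open Scope ring_scope.
Local Open Scope complex_scope.

(* The library has this notation for extended reals only. *)
Notation "\sum_ ( m <= i '<oo' ) F" :=
  (\big[+%R/0%R]_(m <= i <oo) F%R) : ring_scope.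

(* The inner product is linear in its second argument. *)
HB.mixin Record isHilbert (R : realType) H of CompleteNormedModule R[i] H := {
  dot : H -> H -> R[i] ;
  dot_linear : forall (a : R[i]) x y z,
    dot x (a *: y + z) = a * dot x y + dot x z ;
  dot_conj : forall x y, dot y x = Num.conj (dot x y) ;
  dot_norm : forall x : H, dot x x = `|x| ^+ 2 }.

#[short(type="hilbertType")]
HB.structure Definition Hilbert (R : realType) :=
  {H of isHilbert R H & CompleteNormedModule R[i] H}.

(* Unital C*-algebras.  The product is a field of the mixin because the library's
   ring and normed-module structures can only be joined above [numDomainType]. *)
HB.mixin Record isCStar (R : realType) A of CompleteNormedModule R[i] A := {
  amul : A -> A -> A ;
  aone : A ;
  star : A -> A ;
  mul_assoc : forall x y z, amul x (amul y z) = amul (amul x y) z ;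
  mul_unitl : forall x, amul aone x = x ;
  mul_unitr : forall x, amul x aone = x ;
  unit_neq0 : aone <> 0 ;
  mul_linearl : forall (a : R[i]) x y z,
    amul (a *: x + y) z = a *: amul x z + amul y z ;
  mul_linearr : forall (a : R[i]) x y z,
    amul z (a *: x + y) = a *: amul z x + amul z y ;
  star_linear : forall (a : R[i]) x y,
    star (a *: x + y) = Num.conj a *: star x + star y ;
  star_mul : forall x y, star (amul x y) = amul (star y) (star x) ;
  star_invol : forall x, star (star x) = x ;
  norm_mul : forall x y, `|amul x y| <= `|x| * `|y| ;
  norm_star : forall x, `|amul (star x) x| = `|x| ^+ 2 }.

#[short(type="cstarType")]
HB.structure Definition CStar (R : realType) :=
  {A of isCStar R A & CompleteNormedModule R[i] A}.

Notation "x ** y" := (amul x y) (at level 40, left associativity) : ring_scope.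

Definition apositive (R : realType) (A : cstarType R) (x : A) : Prop :=
  exists y : A, x = star y ** y.

Definition ale (R : realType) (A : cstarType R) (x y : A) : Prop :=
  apositive (y - x).

(* [P] is of the form [B^* B] in the C*-algebra of n x n matrices over [A]. *)
Definition mx_positive (R : realType) (A : cstarType R) (n : nat)
    (P : 'M[A]_n) : Prop :=
  exists B : 'M[A]_n, forall i j, P i j = \sum_l star (B l i) ** B l j.

Definition completely_positive (R : realType) (A : cstarType R)
    (T : A -> A) : Prop :=
  linear T /\
  forall (n : nat) (P : 'M[A]_n), mx_positive P -> mx_positive (map_mx T P).

Definition star_subalgebra (R : realType) (A : cstarType R) (S : set A) : Prop :=
  [/\ S aone,
      forall (a : R[i]) x y, S x -> S y -> S (a *: x + y),
      forall x y, S x -> S y -> S (x ** y) &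
      forall x, S x -> S (star x)].

(* [A_Delta]; [site j m] is the matrix [m] in the tensor component [j] and the
   identity in all the others. *)
Definition supported (R : realType) (A : cstarType R) (N d : nat)
    (site : 'rV[int]_d -> 'M[R[i]]_N -> A) (Delta : set 'rV[int]_d) : set A :=
  smallest (@star_subalgebra R A)
    [set x | exists j m, Delta j /\ x = site j m].

(* [A] is the inductive limit of the tensor products of copies of [M_N(C)]: the
   copies are unital *-subalgebras, copies at distinct sites commute, and together
   they generate a dense *-subalgebra.  Since [M_N(C)] is simple and nuclear, this
   determines [(A, site)] up to isomorphism: for finite [Delta], [supported Delta]
   is the tensor product of the copies over [Delta]. *)
Record is_uhf (R : realType) (A : cstarType R) (N d : nat)
    (site : 'rV[int]_d -> 'M[R[i]]_N -> A) : Prop := {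
  site_linear : forall j, linear (site j) ;
  site_mul : forall j a b, site j (a *m b) = site j a ** site j b ;
  site_unit : forall j, site j 1%:M = aone ;
  site_star : forall j a, site j (map_mx Num.conj a^T) = star (site j a) ;
  site_comm : forall i j a b, i != j ->
    site i a ** site j b = site j b ** site i a ;
  site_dense : dense (supported site setT) }.

Definition znorm (d : nat) (j : 'rV[int]_d) : nat := \max_(i < d) `|j ord0 i|%N.
Definition box (d n : nat) : set 'rV[int]_d := [set j | (znorm j <= n)%N].
Definition shell (d n : nat) : set 'rV[int]_d := [set j | znorm j = n].
Arguments box : clear implicits.
Arguments shell : clear implicits.

Definition local_elt (R : realType) (A : cstarType R) (N d : nat)
    (site : 'rV[int]_d -> 'M[R[i]]_N -> A) : set A :=
  \bigcup_n supported site (box d n).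

Record is_trace (R : realType) (A : cstarType R) (tr : A -> R[i]) : Prop := {
  trace_linear : forall (a : R[i]) x y, tr (a *: x + y) = a * tr x + tr y ;
  trace_ge0 : forall x, 0 <= tr (star x ** x) ;
  trace_unit : tr aone = 1 ;
  trace_comm : forall x y, tr (x ** y) = tr (y ** x) }.

Definition bounded_op (R : realType) (H : hilbertType R) : set (H -> H) :=
  [set T | linear T /\ exists M : R[i], forall x, `|T x| <= M * `|x|].

Definition lin_span (R : realType) (H : hilbertType R) (S : set H) : set H :=
  [set x | exists n (c : 'I_n -> R[i]) (v : 'I_n -> H),
     (forall i, S (v i)) /\ x = \sum_i c i *: v i].

Definition total_set (R : realType) (H : hilbertType R) (S : set H) : Prop :=
  dense (lin_span S).

Definition commutant (R : realType) (H : hilbertType R) (S : set (H -> H)) :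
    set (H -> H) :=
  [set T | bounded_op T /\ forall X, S X -> T \o X = X \o T].

Definition bicommutant (R : realType) (H : hilbertType R) (S : set (H -> H)) :
    set (H -> H) := commutant (commutant S).

(* [H = L^2(A, tr)]: [Lam] is the canonical map from [A] to its completion for
   [<X, Y> = tr(X^* Y)], and [lmul X] is the left multiplication by [X]. *)
Record is_gns (R : realType) (A : cstarType R) (tr : A -> R[i])
    (H : hilbertType R) (Lam : A -> H) (lmul : A -> H -> H) : Prop := {
  gns_linear : linear Lam ;
  gns_dot : forall x y, dot (Lam x) (Lam y) = tr (star x ** y) ;
  gns_dense : dense (range Lam) ;
  gns_bounded : forall x, bounded_op (lmul x) ;
  gns_lmul : forall x y, lmul x (Lam y) = Lam (x ** y) }.

(* [K] is the Hilbert space tensor product of [H] and [G], [tens x y] being the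
   elementary tensor of [x] and [y]. *)
Record is_tensor (R : realType) (H G K : hilbertType R) (tens : H -> G -> K) :
    Prop := {
  tens_linearl : forall (a : R[i]) x x' y,
    tens (a *: x + x') y = a *: tens x y + tens x' y ;
  tens_linearr : forall (a : R[i]) x y y',
    tens x (a *: y + y') = a *: tens x y + tens x y' ;
  tens_dot : forall x x' y y',
    dot (tens x y) (tens x' y') = dot x x' * dot y y' ;
  tens_total : total_set [set z | exists x y, z = tens x y] }.

(* The von Neumann algebra generated by the [S (x) T] with [S] in [M], [T] in [L]. *)
Definition vN_tensor (R : realType) (H G K : hilbertType R) (tens : H -> G -> K)
    (M : set (H -> H)) (L : set (G -> G)) : set (K -> K) :=
  bicommutant [set Z | bounded_op Z /\ exists S T, [/\ M S, L T &
    forall x y, Z (tens x y) = tens (S x) (T y)]].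

Definition Rplus (R : realType) : set R := `[0, +oo[.
Arguments Rplus : clear implicits.

Definition cintegrable (R : realType) (D : set R) (f : R -> R[i]) : Prop :=
  (@lebesgue_measure R).-integrable D (EFin \o (fun s => complex.Re (f s))) /\
  (@lebesgue_measure R).-integrable D (EFin \o (fun s => complex.Im (f s))).

Definition cintegral (R : realType) (D : set R) (f : R -> R[i]) : R[i] :=
  (\int[@lebesgue_measure R]_(s in D) complex.Re (f s)) +i*
  (\int[@lebesgue_measure R]_(s in D) complex.Im (f s)).

Record is_onb (R : realType) (k : hilbertType R) (e : nat -> k) : Prop := {
  onb_dot : forall i j, (0 < i)%N -> (0 < j)%N ->
    dot (e i) (e j) = (i == j)%:R ;
  onb_total : total_set [set x | exists j, (0 < j)%N /\ x = e j] }.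

(* [f] represents an element of [L^2(R_+, k)].  As [k] is separable, weak
   measurability is measurability. *)
Definition L2 (R : realType) (k : hilbertType R) (f : R -> k) : Prop :=
  (forall x : k,
    measurable_fun (Rplus R) (fun s => complex.Re (dot x (f s))) /\
    measurable_fun (Rplus R) (fun s => complex.Im (dot x (f s)))) /\
  (\int[@lebesgue_measure R]_(s in Rplus R)
     (complex.Re (`|f s| ^+ 2))%:E < +oo)%E.

Definition L2dot (R : realType) (k : hilbertType R) (f g : R -> k) : R[i] :=
  cintegral (Rplus R) (fun s => dot (f s) (g s)).

(* [G] is the symmetric Fock space over [L^2(R_+, k)], where [pow n f] is the
   n-particle vector [f (x) ... (x) f].  By polarization the [pow n f] span the
   n-particle space. *)
Record is_sym_fock (R : realType) (k G : hilbertType R)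
    (pow : nat -> (R -> k) -> G) : Prop := {
  pow_dot : forall n m f g, L2 f -> L2 g ->
    dot (pow n f) (pow m g) = if n == m then L2dot f g ^+ n else 0 ;
  pow_total : total_set [set x | exists n f, L2 f /\ x = pow n f] }.

Definition expv (R : realType) (k G : hilbertType R)
    (pow : nat -> (R -> k) -> G) (f : R -> k) : G :=
  \sum_(0 <= n <oo) ((Num.sqrt (n`!%:R : R))^-1)%:C *: pow n f.

Definition before (R : realType) (k : hilbertType R) (t : R) (f : R -> k) : R -> k :=
  fun s => if s < t then f s else 0.
Definition after (R : realType) (k : hilbertType R) (t : R) (f : R -> k) : R -> k :=
  fun s => if s < t then 0 else f s.

(* The operators [T0 (x) I] under the factorization at time [t],
   [e(f) = e(f on [0,t)) (x) e(f on [t,oo))], given by their matrix elements. *)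
Definition fock_op_before (R : realType) (k G : hilbertType R)
    (pow : nat -> (R -> k) -> G) (t : R) : set (G -> G) :=
  [set T | bounded_op T /\ forall f g, L2 f -> L2 g ->
     dot (expv pow f) (T (expv pow g)) =
     dot (expv pow (before t f)) (T (expv pow (before t g))) *
     dot (expv pow (after t f)) (expv pow (after t g))].

(* [T' = I (x) T_s] under the factorization at time [s], where [T_s] is the copy of
   [T] on the Fock space over [s, oo) obtained by the time shift. *)
Definition fock_shift (R : realType) (k G : hilbertType R)
    (pow : nat -> (R -> k) -> G) (s : R) (T T' : G -> G) : Prop :=
  bounded_op T' /\ forall f g, L2 f -> L2 g ->
    dot (expv pow f) (T' (expv pow g)) =
    dot (expv pow (before s f)) (expv pow (before s g)) *
    dot (expv pow (fun r => f (r + s))) (T (expv pow (fun r => g (r + s)))).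

Record star_hom (R : realType) (A : cstarType R) (K : hilbertType R)
    (J : A -> K -> K) : Prop := {
  hom_bounded : forall x, bounded_op (J x) ;
  hom_linear : forall (a : R[i]) x y z,
    J (a *: x + y) z = a *: J x z + J y z ;
  hom_mul : forall x y, J (x ** y) = J x \o J y ;
  hom_unit : J aone = id ;
  hom_star : forall x z z', dot (J (star x) z) z' = dot z (J x z') }.

(* [Z' = (Jhat_s o sigma_s)(Z)] for [Z = sum_i Y_i (x) T_i] in the algebraic tensor
   product of [A_loc] and [B(G)], with [Js] for [J_s]: [Jhat_s] is the map
   [Y (x) I (x) T_s |-> J_s(Y) (I (x) T_s)].  Applied to [x (x) y], the operator
   [I (x) T_s] on [K] gives [x (x) T'_i y].  Taking the [Y_i] linearly independent
   shows that [Z] determines [Z']. *)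
Definition hat_shift (R : realType) (A : cstarType R) (N d : nat)
    (site : 'rV[int]_d -> 'M[R[i]]_N -> A) (k H G K : hilbertType R)
    (lmul : A -> H -> H) (pow : nat -> (R -> k) -> G) (tens : H -> G -> K)
    (s : R) (Js : A -> K -> K) (Z Z' : K -> K) : Prop :=
  exists n (Y : 'I_n -> A) (T T' : 'I_n -> G -> G),
  [/\ forall i, [/\ local_elt site (Y i), bounded_op (T i) &
                    fock_shift pow s (T i) (T' i)],
      forall x y, Z (tens x y) = \sum_i tens (lmul (Y i) x) (T i y) &
      forall x y, Z' (tens x y) = \sum_i Js (Y i) (tens x (T' i y))].

Record homomorphic_cocycle (R : realType) (A : cstarType R) (N d : nat)
    (site : 'rV[int]_d -> 'M[R[i]]_N -> A) (k H G K : hilbertType R)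
    (lmul : A -> H -> H) (pow : nat -> (R -> k) -> G) (tens : H -> G -> K)
    (J : R -> A -> K -> K) : Prop := {
  cocycle_hom : forall t, 0 <= t -> star_hom (J t) ;
  cocycle_codomain : forall t x, 0 <= t ->
    vN_tensor tens (bicommutant (range lmul)) (@bounded_op R G) (J t x) ;
  cocycle_adapted : forall t x, 0 <= t ->
    vN_tensor tens (bicommutant (range lmul)) (fock_op_before pow t) (J t x) ;
  cocycle_initial : forall x u y, J 0 x (tens u y) = tens (lmul x u) y ;
  cocycle_identity : forall s t x, 0 <= s -> 0 <= t -> local_elt site x ->
    hat_shift site lmul pow tens s (J s) (J t x) (J (s + t) x) }.

Definition delta (R : realType) (A : cstarType R) (W : nat -> A) (j : nat)
    (x : A) : A := x ** W j - W j ** x.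

Definition delta_dag (R : realType) (A : cstarType R) (W : nat -> A) (j : nat)
    (x : A) : A := star (delta W j (star x)).

Definition lindblad (R : realType) (A : cstarType R) (W : nat -> A) (x : A) : A :=
  2^-1 *: \sum_(1 <= j <oo)
    (star (W j) ** delta W j x + delta_dag W j x ** W j).

(* The equation in terms of its matrix elements on exponential vectors. *)
Definition evans_hudson (R : realType) (A : cstarType R) (N d : nat)
    (site : 'rV[int]_d -> 'M[R[i]]_N -> A) (k H G K : hilbertType R)
    (e : nat -> k) (lmul : A -> H -> H) (pow : nat -> (R -> k) -> G)
    (tens : H -> G -> K) (W : nat -> A) (J : R -> A -> K -> K) : Prop :=
  forall (x : A) (t : R) (u v : H) (f g : R -> k),
  local_elt site x -> 0 <= t -> L2 f -> L2 g ->
  let F s := dot (tens u (expv pow f))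
    (J s (lindblad W x
          + \sum_(1 <= j <oo) Num.conj (dot (e j) (f s)) *: delta W j x
          + \sum_(1 <= j <oo) dot (e j) (g s) *: delta_dag W j x)
       (tens v (expv pow g))) in
  cintegrable `[0, t] F /\
  dot (tens u (expv pow f)) (J t x (tens v (expv pow g))) =
  dot (tens u (expv pow f)) (tens (lmul x v) (expv pow g)) + cintegral `[0, t] F.

Definition expectation_semigroup (R : realType) (A : cstarType R)
    (k H G K : hilbertType R) (lmul : A -> H -> H) (pow : nat -> (R -> k) -> G)
    (tens : H -> G -> K) (J : R -> A -> K -> K) (T : R -> A -> A) : Prop :=
  forall (t : R) (x : A) (u v : H), 0 <= t ->
  dot u (lmul (T t x) v) =
  dot (tens u (expv pow (fun=> 0))) (J t x (tens v (expv pow (fun=> 0)))).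

Record cp_contraction_semigroup (R : realType) (A : cstarType R)
    (T : R -> A -> A) : Prop := {
  semigroup0 : forall x, T 0 x = x ;
  semigroupD : forall s t x, 0 <= s -> 0 <= t -> T (s + t) x = T s (T t x) ;
  semigroup_cp : forall t, 0 <= t -> completely_positive (T t) ;
  semigroup_contraction : forall t x, 0 <= t -> `|T t x| <= `|x| }.

Definition conservative (R : realType) (A : cstarType R) (T : R -> A -> A) : Prop :=
  forall t, 0 <= t -> T t aone = aone.

(* The [A]-valued integral is tested against all bounded linear functionals. *)
Definition associated (R : realType) (A : cstarType R) (N d : nat)
    (site : 'rV[int]_d -> 'M[R[i]]_N -> A) (L : A -> A) (T : R -> A -> A) : Prop :=
  forall (x : A) (t : R) (phi : A -> R[i]), local_elt site x -> 0 <= t ->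
  (forall (a : R[i]) y z, phi (a *: y + z) = a * phi y + phi z) ->
  (exists M : R[i], forall y, `|phi y| <= M * `|y|) ->
  cintegrable `[0, t] (fun s => phi (T s (L x))) /\
  phi (T t x) = phi x + cintegral `[0, t] (fun s => phi (T s (L x))).

Definition minimal_associated (R : realType) (A : cstarType R) (N d : nat)
    (site : 'rV[int]_d -> 'M[R[i]]_N -> A) (L : A -> A) (T : R -> A -> A) : Prop :=
  [/\ cp_contraction_semigroup T, associated site L T &
      forall T' : R -> A -> A,
      cp_contraction_semigroup T' -> associated site L T' ->
      forall t x, 0 <= t -> apositive x -> ale (T t x) (T' t x)].

(* Main.v *)
Require Import Defs.
From mathcomp Require Import all_boot all_order all_algebra.
From mathcomp Require Import complex.
From mathcomp Require Import all_classical all_reals all_analysis.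
From mathcomp Require Import measurable_realfun.
From mathcomp Require Import ring lra zify.
Set Implicit Arguments.
Unset Strict Implicit.
Unset Printing Implicit Defensive.
Import Order.TTheory GRing.Theory Num.Theory.
Import numFieldNormedType.Exports.
Local Open Scope classical_set_scope.
Local Open Scope ring_scope.
Local Open Scope complex_scope.

(** In terms of matrix elements on exponential vectors, the equation for local [X] is a linear
    equation for maps phi_{s,t}^{f,g} of the finite-dimensional algebra of a box into itself, with
    the generator L + sum conj(f_j) delta_j + sum g_j delta_j^dagger, and
    <u (x) e(f), J_t(X) v (x) e(g)> = <u, phi_{0,t}^{f,g}(X) v> exp <f, g>.
    Its Euler steps have a Kraus form which keeps the kernel
    <u, phi^{f,g}(X^* Y) v> exp <f, g> positive; by the C*-identity, J_t(X) is then an operator of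
    norm at most |X|.  The defect D_t(X) = <J_t(X^* X)> - |J_t(X)|^2 is nonnegative, and by the Ito
    formula D_t(X) <= D_s(phi_{s,t} X) + (t - s) sum D_s(delta_j X) up to a second-order error,
    whence D = 0 and J_t is multiplicative.  Each J_t(X) is a finite sum of tensor products, whose
    Fock components are slices of J_t; the co-cycle identity for them is the flow property of phi.
    The equation of the semi-group has a unique solution on every box, which gives minimality. *)

(** * Norms and limits *)

(** Since $W_l$ commutes with the box of radius $n$ for $l > n$, every box is invariant and the
    equation there is a finite linear system. Its constants depend on the box and on the controls
    $f$, $g$; the only bound uniform in both comes from positivity, which the approximations must
    therefore preserve exactly. This dictates the coefficients of the Euler step: they are quotients
    of inner products of exponential vectors, so that the form after the step is the form before it,
    taken at more points. The controls are merely square-integrable, so local errors are measured by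
    $\epsilon_j$, the integral of [rate] over the $j$-th grid interval, and not by its length. They
    are $O(\epsilon_j^2)$, and by Cauchy-Schwarz $\sum_j \epsilon_j^2$ is at most the mesh times the
    integral of the squared rate. The same estimate makes the Euler steps converge and the defect
    vanish. The defect is followed for one vector $v \otimes e(f)$ at a time: as the defect kernel
    is positive, it is zero once its diagonal is. *)

Section RealNorm.
Context (R : realType).
Local Notation C := R[i].

Lemma conjE (x : C) : Num.conj x = conjc x.
Proof. by []. Qed.

(** The norm of a normed module over [R[i]] is a complex number; [nm] is the same number as a real
    one, to which real arithmetic applies. *)
Definition nm (V : normedZmodType C) (x : V) : R := complex.Re `|x|.

Lemma normE (V : normedZmodType C) (x : V) : `|x| = (nm x)%:C.
Proof.
rewrite /nm; have := normr_ge0 x; case: `|x| => a b /=.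
by rewrite lecE /= => /andP[/eqP -> _].
Qed.

Section Zmod.
Context (V : normedZmodType C).
Implicit Types x y : V.

Lemma nm_ge0 x : 0 <= nm x.
Proof. by have := normr_ge0 x; rewrite normE ler0c. Qed.

Lemma nm0 : nm (0 : V) = 0.
Proof. by rewrite /nm normr0. Qed.

Lemma nm_eq0 x : nm x = 0 -> x = 0.
Proof. by move=> h; apply/eqP; rewrite -normr_eq0 normE h. Qed.

Lemma nmD x y : nm (x + y) <= nm x + nm y.
Proof. by rewrite -lecR -normE rmorphD /= -!normE ler_normD. Qed.

Lemma nmN x : nm (- x) = nm x.
Proof. by rewrite /nm normrN. Qed.

Lemma nmBC x y : nm (x - y) = nm (y - x).
Proof. by rewrite -nmN opprB. Qed.

Lemma nmB x y : nm (x - y) <= nm x + nm y.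
Proof. by rewrite -(nmN y); apply: nmD. Qed.

Lemma nmB_trans y x z : nm (x - z) <= nm (x - y) + nm (y - z).
Proof. by have := nmD (x - y) (y - z); rewrite subrKA. Qed.

Lemma nm_sum I (s : seq I) (P : pred I) (F : I -> V) :
  nm (\sum_(i <- s | P i) F i) <= \sum_(i <- s | P i) nm (F i).
Proof.
elim/big_ind2: _ => //; first by rewrite nm0.
by move=> x a y b h1 h2; apply: le_trans (nmD _ _) (lerD h1 h2).
Qed.

Lemma nm_distB x y : `|nm x - nm y| <= nm (x - y).
Proof.
rewrite ler_norml; apply/andP; split.
  by have := nmD (y - x) x; rewrite subrK nmBC; lra.
by have := nmD (x - y) y; rewrite subrK; lra.
Qed.

End Zmod.

Lemma nmZ (V : normedModType C) (a : C) (x : V) : nm (a *: x) = nm a * nm x.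
Proof. by apply: complexI; rewrite -normE normrZ !normE rmorphM. Qed.

Lemma nmM (a b : C) : nm (a * b) = nm a * nm b.
Proof. by apply: complexI; rewrite -normE normrM !normE rmorphM. Qed.

Lemma nmX (a : C) n : nm (a ^+ n) = nm a ^+ n.
Proof. by apply: complexI; rewrite -normE normrX !normE rmorphXn. Qed.

Lemma nm1 : nm (1 : C) = 1.
Proof. by rewrite /nm normr1. Qed.

Lemma nm_conj (a : C) : nm (Num.conj a) = nm a.
Proof. by rewrite /nm norm_conjC. Qed.

Lemma nm_real (a : R) : nm (a%:C : C) = `|a|.
Proof. by rewrite /nm normc_def /= expr0n /= addr0 sqrtr_sqr. Qed.

Lemma nm_sq (a : C) : (nm a ^+ 2)%:C = a * Num.conj a.
Proof. by rewrite rmorphXn /= -normE normCK. Qed.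

Lemma nm_Re (a : C) : `|complex.Re a| <= nm a.
Proof.
rewrite /nm normc_def /= -sqrtr_sqr; apply: ler_wsqrtr.
by rewrite lerDl sqr_ge0.
Qed.

Lemma nm_Im (a : C) : `|complex.Im a| <= nm a.
Proof.
rewrite /nm normc_def /= -sqrtr_sqr; apply: ler_wsqrtr.
by rewrite lerDr sqr_ge0.
Qed.

Lemma nm_ReIm (a : C) : nm a <= `|complex.Re a| + `|complex.Im a|.
Proof.
rewrite /nm normc_def /=.
rewrite -[leRHS]ger0_norm ?addr_ge0 // -sqrtr_sqr ler_wsqrtr //.
by rewrite sqrrD !real_normK ?num_real // lerD2r lerDl mulrn_wge0.
Qed.

Lemma nm_sqE (a : C) : nm a ^+ 2 = complex.Re a ^+ 2 + complex.Im a ^+ 2.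
Proof. by rewrite /nm normc_def /= sqr_sqrtr // addr_ge0 // sqr_ge0. Qed.

Lemma cjD (a b : C) : Num.conj (a + b) = Num.conj a + Num.conj b.
Proof. exact: rmorphD. Qed.
Lemma cjB (a b : C) : Num.conj (a - b) = Num.conj a - Num.conj b.
Proof. exact: rmorphB. Qed.
Lemma cjN (a : C) : Num.conj (- a) = - Num.conj a.
Proof. exact: rmorphN. Qed.
Lemma cjM (a b : C) : Num.conj (a * b) = Num.conj a * Num.conj b.
Proof. exact: rmorphM. Qed.
Lemma cjX (a : C) n : Num.conj (a ^+ n) = Num.conj a ^+ n.
Proof. exact: rmorphXn. Qed.
Lemma cj1 : Num.conj (1 : C) = 1.
Proof. exact: rmorph1. Qed.
Lemma cj0 : Num.conj (0 : C) = 0.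
Proof. exact: rmorph0. Qed.
Lemma cjR (a : R) : Num.conj (a%:C : C) = a%:C.
Proof. exact: conjc_real. Qed.
Lemma cjK (a : C) : Num.conj (Num.conj a) = a.
Proof. exact: conjCK. Qed.
Lemma cj_sum I (s : seq I) (P : pred I) (F : I -> C) :
  Num.conj (\sum_(i <- s | P i) F i) = \sum_(i <- s | P i) Num.conj (F i).
Proof. exact: rmorph_sum. Qed.

Lemma ReD (a b : C) : complex.Re (a + b) = complex.Re a + complex.Re b.
Proof. by case: a; case: b. Qed.
Lemma ImD (a b : C) : complex.Im (a + b) = complex.Im a + complex.Im b.
Proof. by case: a; case: b. Qed.
Lemma ReB (a b : C) : complex.Re (a - b) = complex.Re a - complex.Re b.
Proof. by case: a; case: b. Qed.
Lemma ReM (a b : C) : complex.Re (a * b) =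
  complex.Re a * complex.Re b - complex.Im a * complex.Im b.
Proof. by case: a; case: b. Qed.
Lemma ImM (a b : C) : complex.Im (a * b) =
  complex.Re a * complex.Im b + complex.Im a * complex.Re b.
Proof. by case: a => ? ?; case: b => ? ? /=. Qed.
Lemma ReJ (a : C) : complex.Re (Num.conj a) = complex.Re a.
Proof. by case: a. Qed.
Lemma ImJ (a : C) : complex.Im (Num.conj a) = - complex.Im a.
Proof. by case: a. Qed.
Lemma Re_sum I (s : seq I) (P : pred I) (F : I -> C) :
  complex.Re (\sum_(i <- s | P i) F i) = \sum_(i <- s | P i) complex.Re (F i).
Proof. by elim/big_ind2: _ => // x a y b <- <-; rewrite ReD. Qed.
Lemma Im_sum I (s : seq I) (P : pred I) (F : I -> C) :
  complex.Im (\sum_(i <- s | P i) F i) = \sum_(i <- s | P i) complex.Im (F i).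
Proof. by elim/big_ind2: _ => // x a y b <- <-; rewrite ImD. Qed.
Lemma ReMr (a : R) (b : C) : complex.Re (a%:C * b) = a * complex.Re b.
Proof. by case: b => ? ? /=; rewrite mul0r subr0. Qed.
Lemma nm_Re_le (a : C) : complex.Re a <= nm a.
Proof. exact: le_trans (ler_norm _) (nm_Re a). Qed.

Lemma ge0_Re (a : C) : 0 <= a -> (complex.Re a)%:C = a /\ 0 <= complex.Re a.
Proof. by case: a => a b; rewrite lecE /= => /andP[/eqP -> ->]. Qed.

(** For $z = -t\bar b$ with $t$ real the hypothesis is a real quadratic polynomial in $t$; its value
    at $t = 1/d$ gives the bound. The inner product, positive kernels and the first variation in
    [riesz] all use this form. *)
Lemma quad_CS (a d : R) (b : C) : 0 <= d ->
  (forall z : C, 0 <= a + 2 * complex.Re (z * b) + nm z ^+ 2 * d) ->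
  nm b ^+ 2 <= a * d.
Proof.
move=> d0 h; set n := nm b ^+ 2.
have n0 : 0 <= n by rewrite sqr_ge0.
have key t : 0 <= a - 2 * t * n + t ^+ 2 * n * d.
  have := h (- (t%:C * Num.conj b)); rewrite nmN nmM nm_real nm_conj.
  have -> : complex.Re (- (t%:C * Num.conj b) * b) = - (t * n).
    by rewrite mulNr -mulrA (mulrC (Num.conj b)) -nm_sq -rmorphM.
  by rewrite exprMn real_normK ?num_real // -/n; lra.
have [d00|dn0] := eqVneq d 0.
  have [->|nn0] := eqVneq n 0; first by rewrite d00 mulr0.
  (* For $d = 0$ the polynomial is affine, and this value of $t$ would make it $-1$. *)
  have := key ((a + 1) / (2 * n)); rewrite d00.
  have -> : 2 * ((a + 1) / (2 * n)) * n = a + 1 by field.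
  by lra.
have dp : 0 < d by rewrite lt_def dn0.
have := key d^-1.
have -> : a - 2 * d^-1 * n + d^-1 ^+ 2 * n * d = (a * d - n) / d by field.
by rewrite pmulr_lge0 ?invr_gt0 // subr_ge0.
Qed.

(* The C*-identity gives bounds on 2^k-th powers only. *)
Lemma pow2_le (a b c : R) : 0 <= a -> 0 <= b ->
  (forall k, a ^+ (2 ^ k) <= c * b ^+ (2 ^ k)) -> a <= b.
Proof.
move=> a0 b0 h; rewrite leNgt; apply/negP => ba.
have ap : 0 < a by lra.
have [b00|bn0] := eqVneq b 0.
  have := h 0%N; rewrite b00 expn0 !expr1 mulr0; lra.
have bp : 0 < b by rewrite lt_def bn0.
set q := a / b.
have q1 : 1 < q by rewrite /q ltr_pdivlMr // mul1r.
have hq k : q ^+ (2 ^ k) <= c.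
  by rewrite /q expr_div_n ler_pdivrMr ?exprn_gt0.
(* Bernoulli's inequality: the powers of $q > 1$ are unbounded, whereas [hq] bounds those with
   exponent $2^k$ by [c]. *)
have bern n : 1 + n%:R * (q - 1) <= q ^+ n.
  elim: n => [|n IH]; first by rewrite mul0r addr0 expr0.
  rewrite exprS -natr1; have hn : 0 <= n%:R :> R by [].
  have := ler_wpM2l (ltW (lt_trans ltr01 q1)) IH.
  have : 0 <= n%:R * (q - 1) * (q - 1) by rewrite !mulr_ge0 //; lra.
  nra.
have c1 : 0 < c - 1 + 1.
  by have := hq 0%N; rewrite expn0 expr1; lra.
have := archi_boundP (ltW (divr_gt0 c1 (_ : 0 < q - 1))).
rewrite subr_gt0 => /(_ q1); set n := Num.bound _ => hn.
have hle : (n <= 2 ^ n)%N by apply: ltnW; apply: ltn_expl.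
have := hq n; apply/negP; rewrite -ltNge.
apply: lt_le_trans (_ : q ^+ n <= _); last by rewrite ler_eXn2l.
apply: lt_le_trans (bern n).
by move: hn; rewrite ltr_pdivrMr ?subr_gt0 //; lra.
Qed.

End RealNorm.

Section RealConv.
Context (R : realType).
Local Notation C := R[i].

(** Convergence with a real threshold, available in every normed group and so for scalars as well as
    for vectors; [to_cvg] relates it to the filter limit. *)
Definition to (V : normedZmodType C) (u : nat -> V) (l : V) :=
  forall e : R, 0 < e -> exists N, forall n, (N <= n)%N -> nm (u n - l) < e.

Lemma to_le (V W : normedZmodType C) (u : nat -> V) (v : nat -> W) l m (c : R) :
  (forall n, nm (v n - m) <= c * nm (u n - l)) -> to u l -> to v m.
Proof.
move=> h ul e e0.
have c0 : 0 < `|c| + 1 by have := normr_ge0 c; lra.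
have [N H] := ul _ (divr_gt0 e0 c0); exists N => n hn.
apply: le_lt_trans (h n) _; have := H n hn; rewrite ltr_pdivlMr //.
have := nm_ge0 (u n - l); have := ler_norm c; nra.
Qed.

Section Gen.
Context (V : normedZmodType C).
Implicit Types (u v : nat -> V) (l m : V).

Lemma to_unique u l m : to u l -> to u m -> l = m.
Proof.
move=> ul um; apply/eqP; rewrite -subr_eq0; apply/eqP/nm_eq0/eqP.
rewrite eq_le nm_ge0 andbT leNgt; apply/negP => h.
have h2 : 0 < nm (l - m) / 2 by lra.
have [N1 H1] := ul _ h2; have [N2 H2] := um _ h2.
have := nmB_trans (u (maxn N1 N2)) l m; rewrite (nmBC l (u _)).
have := H1 _ (leq_maxl N1 N2); have := H2 _ (leq_maxr N1 N2); lra.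
Qed.

Lemma to_cst l : to (fun=> l) l.
Proof. by move=> e e0; exists 0%N => n _; rewrite subrr nm0. Qed.

Lemma to_ev u v l : (exists N, forall n, (N <= n)%N -> u n = v n) ->
  to u l -> to v l.
Proof.
move=> [N1 H1] ul e e0; have [N2 H2] := ul e e0; exists (maxn N1 N2) => n.
by rewrite geq_max => /andP[h1 h2]; rewrite -H1 // H2.
Qed.

Lemma toD u v l m : to u l -> to v m -> to (fun n => u n + v n) (l + m).
Proof.
move=> ul vm e e0; have e2 : 0 < e / 2 by lra.
have [N1 H1] := ul _ e2; have [N2 H2] := vm _ e2; exists (maxn N1 N2) => n.
rewrite geq_max => /andP[/H1 h1 /H2 h2].
by have := nmD (u n - l) (v n - m); rewrite addrACA -opprD; lra.
Qed.

Lemma toN u l : to u l -> to (fun n => - u n) (- l).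
Proof. by apply: (to_le (c := 1)) => n; rewrite -opprD nmN mul1r. Qed.

Lemma toB u v l m : to u l -> to v m -> to (fun n => u n - v n) (l - m).
Proof. by move=> ul vm; apply: toD => //; apply: toN. Qed.

Lemma to_sum I (s : seq I) (F : I -> nat -> V) (L : I -> V) :
  (forall i, to (F i) (L i)) ->
  to (fun n => \sum_(i <- s) F i n) (\sum_(i <- s) L i).
Proof.
move=> h; elim: s => [|i s IH].
  by rewrite big_nil; apply: to_ev (to_cst _); exists 0%N => n _; rewrite big_nil.
rewrite big_cons; apply: to_ev (toD (h i) IH).
by exists 0%N => n _; rewrite big_cons.
Qed.

Lemma to_nm_le u l (b : R) : to u l -> (forall n, nm (u n) <= b) -> nm l <= b.
Proof.
move=> ul h; rewrite leNgt; apply/negP => hb.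
have [N H] := ul (nm l - b) ltac:(lra).
have := H N (leqnn _); have := h N; have := nmD (u N - l) (- u N).
by rewrite addrAC subrr add0r !nmN; lra.
Qed.

Lemma to_bounded u l : to u l -> exists b, forall n, nm (u n) <= b.
Proof.
move=> /(_ 1 ltr01)[N H].
exists (nm l + 1 + \sum_(i < N) nm (u i)) => n.
have s0 : 0 <= \sum_(i < N) nm (u i) by apply: sumr_ge0 => i _; apply: nm_ge0.
have [hn|hn] := leqP N n.
  by have := H n hn; have := nmD (u n - l) l; rewrite subrK; lra.
have := nm_ge0 l; rewrite (bigD1 (Ordinal hn)) //=.
have : 0 <= \sum_(i < N | i != Ordinal hn) nm (u i).
  by apply: sumr_ge0 => i _; apply: nm_ge0.
lra.
Qed.

Lemma to_shift u l N : to u l -> to (fun n => u (n + N)%N) l.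
Proof.
move=> ul e /ul[M H]; exists M => n hn; apply: H.
exact: leq_trans hn (leq_addr _ _).
Qed.

Lemma to_small (b : nat -> R) u l :
  (forall n, nm (u n - l) <= b n) ->
  (forall e : R, 0 < e -> exists N, forall n, (N <= n)%N -> b n < e) ->
  to u l.
Proof.
by move=> h hb e /hb[N H]; exists N => n /H; apply: le_lt_trans.
Qed.

End Gen.

Lemma toZ (V : normedModType C) (u : nat -> V) l (a : nat -> C) b :
  to u l -> to a b -> to (fun n => a n *: u n) (b *: l).
Proof.
move=> ul ab; have [M hM] := to_bounded ab.
have -> : b *: l = (b *: l - b *: l) + b *: l by rewrite subrK.
have h1 : to (fun n => a n *: (u n - l)) 0.
  refine (to_le (c := M) _ ul) => n; rewrite subr0 nmZ.
  by rewrite ler_wpM2r ?nm_ge0.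
have h2 : to (fun n => (a n - b) *: l) 0.
  move=> e e0; have [|N H] := ab (e / (nm l + 1)).
    by rewrite divr_gt0 //; have := nm_ge0 l; lra.
  exists N => n /H; rewrite subr0 nmZ ltr_pdivlMr; last first.
    by have := nm_ge0 l; lra.
  by have := nm_ge0 (a n - b); nra.
have := toD (toD h1 h2) (to_cst (b *: l)); rewrite subrr addr0 add0r.
apply: to_ev; exists 0%N => n _.
by rewrite scalerBr scalerBl addrA subrK subrK.
Qed.

Lemma toM (u a : nat -> C) l b :
  to u l -> to a b -> to (fun n => a n * u n) (b * l).
Proof. exact: (@toZ C^o). Qed.

Lemma to_conj (u : nat -> C) l : to u l ->
  to (fun n => Num.conj (u n)) (Num.conj l).
Proof. by apply: (to_le (c := 1)) => n; rewrite -rmorphB nm_conj mul1r. Qed.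

Lemma to_ge0 (u : nat -> C) l : to u l -> (forall n, 0 <= u n) -> 0 <= l.
Proof.
move=> ul h.
have -> : l = (nm l)%:C.
  apply: (to_unique ul).
  refine (to_le (c := 1) _ ul) => n; rewrite mul1r.
  have [<- r0] := ge0_Re (h n).
  rewrite -rmorphB nm_real; apply: le_trans (nm_distB _ _).
  by rewrite nm_real (ger0_norm r0).
by rewrite ler0c nm_ge0.
Qed.

Lemma geo_small (q c : R) : 0 <= q < 1 -> forall e : R, 0 < e ->
  exists N, forall n, (N <= n)%N -> c * q ^+ n < e.
Proof.
move=> /andP[q0 q1] e e0.
have c1 : 0 < `|c| + 1 by have := normr_ge0 c; lra.
have := @cvg_expr R q; rewrite ger0_norm // => /(_ q1) /cvgrPdist_lt.
move=> /(_ _ (divr_gt0 e0 c1)) [N _ H]; exists N => n /H /=.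
rewrite sub0r normrN ger0_norm ?exprn_ge0 // ltr_pdivlMr // => h.
have := exprn_ge0 n q0; have := ler_norm c; nra.
Qed.

Lemma inv_small (c : R) : forall e : R, 0 < e ->
  exists N, forall n, (N <= n)%N -> c / n.+1%:R < e.
Proof.
move=> e e0; have c1 : 0 < `|c| + 1 by have := normr_ge0 c; lra.
exists (Num.bound ((`|c| + 1) / e)) => n hn.
have := archi_boundP (ltW (divr_gt0 c1 e0)).
rewrite !ltr_pdivrMr // => h; have := ler_norm c.
have : (Num.bound ((`|c| + 1) / e))%:R <= n.+1%:R :> R by rewrite ler_nat leqW.
by nra.
Qed.

Section Complete.
Context (V : completeNormedModType C).

Lemma to_cvg (u : nat -> V) l : to u l <-> u @ \oo --> l.
Proof.
split=> [ul|/cvgrPdist_lt ul e e0].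
  apply/cvgrPdist_lt => e; rewrite ltcE /= => /andP[/eqP ei er].
  have [N H] := ul _ er; exists N => // n /= /H.
  by rewrite normE nmBC => h; rewrite ltcE /= ei eqxx.
have [|N _ H] := ul e%:C; first by rewrite ltcR.
by exists N => n /H /=; rewrite normE ltcR nmBC.
Qed.

Lemma cauchy_to (u : nat -> V) :
  (forall e : R, 0 < e -> exists N, forall n m, (N <= n)%N -> (N <= m)%N ->
     nm (u n - u m) < e) -> exists l, to u l.
Proof.
move=> h; suff /cvg_ex[l hl] : cvgn u by exists l; apply/to_cvg.
apply/cauchy_cvgP/cauchy_ballP => e.
rewrite ltcE /= => /andP[/eqP ei er]; have [N H] := h _ er.
exists (u @` [set n | (N <= n)%N], u @` [set n | (N <= n)%N]) => /=.
  by split; exists N => // n hn; exists n.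
move=> [_ _] /= [[n hn <-] [m hm <-]]; rewrite -ball_normE /= normE.
by rewrite ltcE /= ei eqxx; apply: H.
Qed.

(** The bounds telescope to $\|u_m - u_n\| \le a_m - a_n$ for $n \le m$, and a bounded nondecreasing
    sequence is Cauchy. The iteration of [matrix_sqrt] converges by this criterion. *)
Lemma increments_to (u : nat -> V) (a : nat -> R) (b : R) :
  (forall n, nm (u n.+1 - u n) <= a n.+1 - a n) -> (forall n, a n <= b) ->
  exists l, to u l.
Proof.
move=> h hb; have amono n m : (n <= m)%N -> nm (u m - u n) <= a m - a n.
  move=> /subnK <-; elim: (m - n)%N => [|p IH].
    by rewrite add0n !subrr nm0.
  rewrite addSn; apply: le_trans (nmB_trans (u (p + n)%N) _ _) _.
  by have := h (p + n)%N; lra.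
have and_ n m : (n <= m)%N -> a n <= a m.
  by move=> /amono; have := nm_ge0 (u m - u n); lra.
apply: cauchy_to => e e0.
have [s hs] : exists s, sup (range a) - e / 2 < a s.
  have hsup : has_sup (range a).
    by split; [exists (a 0%N), 0%N | exists b => _ [n _ <-]].
  have e2 : 0 < e / 2 by lra.
  by have [_ [s _ <-] hs] := sup_adherent e2 hsup; exists s.
have hub n : a n <= sup (range a).
  apply: ub_le_sup; last by exists n.
  by exists b => _ [p _ <-].
exists s => n m hn hm.
have := nmB_trans (u s) (u n) (u m); rewrite (nmBC (u s)).
have := amono _ _ hn; have := amono _ _ hm; have := hub n; have := hub m; lra.
Qed.

End Complete.

End RealConv.

(** * Hilbert spaces *)

Section Dot.
Context (R : realType) (H : hilbertType R).
Local Notation C := R[i].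
Implicit Types (x y z : H) (a b : C).

Lemma dotDr x y z : dot x (y + z) = dot x y + dot x z.
Proof. by have := dot_linear 1 x y z; rewrite scale1r mul1r. Qed.

Lemma dot0r x : dot x 0 = 0.
Proof. by apply: (addrI (dot x 0)); rewrite -dotDr !addr0. Qed.

Lemma dotZr a x y : dot x (a *: y) = a * dot x y.
Proof. by have := dot_linear a x y 0; rewrite addr0 dot0r addr0. Qed.

Lemma dotDl x y z : dot (y + z) x = dot y x + dot z x.
Proof. by rewrite !(dot_conj x) dotDr rmorphD. Qed.

Lemma dotZl a x y : dot (a *: y) x = Num.conj a * dot y x.
Proof. by rewrite !(dot_conj x) dotZr rmorphM. Qed.

Lemma dot0l x : dot 0 x = 0.
Proof. by rewrite dot_conj dot0r rmorph0. Qed.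

Lemma dotNr x y : dot x (- y) = - dot x y.
Proof. by rewrite -scaleN1r dotZr mulN1r. Qed.

Lemma dotNl x y : dot (- x) y = - dot x y.
Proof. by rewrite !(dot_conj y) dotNr rmorphN. Qed.

Lemma dotBr x y z : dot x (y - z) = dot x y - dot x z.
Proof. by rewrite dotDr dotNr. Qed.

Lemma dotBl x y z : dot (y - z) x = dot y x - dot z x.
Proof. by rewrite dotDl dotNl. Qed.

Lemma dot_sumr I (s : seq I) (P : pred I) (F : I -> H) x :
  dot x (\sum_(i <- s | P i) F i) = \sum_(i <- s | P i) dot x (F i).
Proof.
by elim/big_rec2: _ => [|i u v _ <-]; rewrite ?dot0r ?dotDr.
Qed.

Lemma dot_suml I (s : seq I) (P : pred I) (F : I -> H) x :
  dot (\sum_(i <- s | P i) F i) x = \sum_(i <- s | P i) dot (F i) x.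
Proof.
by elim/big_rec2: _ => [|i u v _ <-]; rewrite ?dot0l ?dotDl.
Qed.

Lemma dotxx x : dot x x = (nm x ^+ 2)%:C.
Proof. by rewrite dot_norm normE rmorphXn. Qed.

Lemma nm_sqD x y : nm (x + y) ^+ 2 =
  nm x ^+ 2 + 2 * complex.Re (dot x y) + nm y ^+ 2.
Proof.
have -> : nm (x + y) ^+ 2 = complex.Re (dot (x + y) (x + y)) by rewrite dotxx.
rewrite dotDr !dotDl !dotxx (dot_conj x y) !ReD ReJ /=.
by ring.
Qed.

Lemma CS x y : nm (dot x y) <= nm x * nm y.
Proof.
rewrite -(@ler_pXn2r _ 2) // ?nnegrE ?mulr_ge0 ?nm_ge0 //.
rewrite exprMn; apply: quad_CS; first exact: sqr_ge0.
move=> z; have := sqr_ge0 (nm (x + z *: y)).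
by rewrite nm_sqD dotZr nmZ exprMn.
Qed.

Lemma to_dotr (u : nat -> H) l x : to u l -> to (fun n => dot x (u n)) (dot x l).
Proof. by apply: (to_le (c := nm x)) => n; rewrite -dotBr CS. Qed.

Lemma to_dotl (u : nat -> H) l x : to u l -> to (fun n => dot (u n) x) (dot l x).
Proof. by apply: (to_le (c := nm x)) => n; rewrite -dotBl mulrC CS. Qed.

Lemma dot_eq0 x : (forall y, dot y x = 0) -> x = 0.
Proof.
move=> /(_ x); rewrite dotxx => /complexI /eqP.
by rewrite expf_eq0 /= => /eqP /nm_eq0.
Qed.

Lemma dot_inj x y : (forall z, dot z x = dot z y) -> x = y.
Proof.
move=> h; apply/eqP; rewrite -subr_eq0; apply/eqP/dot_eq0 => z.
by rewrite dotBr h subrr.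
Qed.

(* The representing vector minimizes [nm x ^+ 2 - 2 * Re (phi x)]. *)
Lemma riesz (D : set H) (phi : H -> C) (M : R) : D 0 -> 0 <= M ->
  (forall a x y, D x -> D y -> D (a *: x + y)) ->
  (forall a x y, D x -> D y -> phi (a *: x + y) = a * phi x + phi y) ->
  (forall x, D x -> nm (phi x) <= M * nm x) ->
  exists p, [/\ exists u, (forall n, D (u n)) /\ to u p, nm p <= M &
    forall x, D x -> phi x = dot p x].
Proof.
move=> D0 M0 Dl phil phiM.
have DZ a x : D x -> D (a *: x) by move=> Dx; rewrite -[_ *: _]addr0; apply: Dl.
have DD x y : D x -> D y -> D (x + y).
  by move=> Dx Dy; rewrite -[x]scale1r; apply: Dl.
have phi0 : phi 0 = 0.
  by apply: (addrI (phi 0)); have := phil 1 0 0 D0 D0; rewrite scale1r mul1r !addr0.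
have phiZ a x : D x -> phi (a *: x) = a * phi x.
  by move=> Dx; have := phil a x 0 Dx D0; rewrite !addr0 phi0 addr0.
have phiD x y : D x -> D y -> phi (x + y) = phi x + phi y.
  by move=> Dx Dy; have := phil 1 x y Dx Dy; rewrite scale1r mul1r.
pose J x := nm x ^+ 2 - 2 * complex.Re (phi x).
have Jlow x : D x -> - M ^+ 2 <= J x.
  move=> /phiM h; rewrite /J; have := nm_Re_le (phi x); have := sqr_ge0 (nm x - M).
  have := nm_ge0 x; nra.
pose S := [set r | exists2 x, D x & r = J x].
have hS : has_inf S.
  by split; [exists (J 0), 0 | exists (- M ^+ 2) => _ [x Dx ->]; apply: Jlow].
set m := inf S.
have mJ x : D x -> m <= J x.
  by move=> Dx; apply: ge_inf; [exact: hS.2 | exists x].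
have /choice[u hu] : forall n : nat, exists x, D x /\ J x < m + 1 / n.+1%:R.
  move=> n; have e0 : 0 < 1 / n.+1%:R :> R by rewrite divr_gt0.
  by have [_ [x Dx ->] h] := inf_adherent e0 hS; exists x.
(* The parallelogram law: close to the infimum the right side is small, so that the minimizing
   sequence is Cauchy. *)
have para x y : D x -> D y ->
    nm (x - y) ^+ 2 = 2 * J x + 2 * J y - 4 * J (2^-1 *: (x + y)).
  move=> Dx Dy; rewrite /J nmZ phiZ ?phiD //; last exact: DD.
  have -> : (2^-1 : C) = (2^-1 : R)%:C by rewrite fmorphV rmorph_nat.
  rewrite nm_real ReMr exprMn !nm_sqD dotNr nmN !ReD.
  rewrite (_ : complex.Re (- dot x y) = - complex.Re (dot x y)); last first.
    by case: (dot x y).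
  by rewrite ger0_norm ?invr_ge0 //; field.
have [p up] : exists p, to u p.
  apply: cauchy_to => e e0.
  have [N HN] := inv_small (4 : R) (exprn_gt0 2 e0).
  exists N => n k hn hk.
  rewrite -(@ltr_pXn2r _ 2) ?nnegrE ?nm_ge0 ?(ltW e0) //.
  have [[Dn Jn] [Dk Jk]] := (hu n, hu k).
  rewrite para //; have := mJ _ (DZ 2^-1 _ (DD _ _ Dn Dk)).
  have := HN n hn; have := HN k hk.
  set h1 := 1 / _ in Jn; set h2 := 1 / _ in Jk.
  have -> : 4 / k.+1%:R = 4 * h2 by rewrite /h2 div1r.
  have -> : 4 / n.+1%:R = 4 * h1 by rewrite /h1 div1r.
  by move=> *; lra.
(* First variation. The limit [p] may lie outside [D], so the perturbation by a multiple of [x] is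
   made at a late [u n]: a negative [q] would push [J] below its infimum [m]. *)
have pE x : D x -> phi x = dot p x.
  move=> Dx; apply/eqP; rewrite -subr_eq0; apply/eqP/nm_eq0/eqP.
  rewrite -sqrf_eq0 eq_le sqr_ge0 andbT.
  rewrite -[leRHS](mul0r (nm x ^+ 2)).
  apply: quad_CS => [|z]; first exact: sqr_ge0.
  rewrite add0r leNgt; apply/negP => h.
  set b := phi x - dot p x in h.
  pose q := 2 * complex.Re (z * b) + nm z ^+ 2 * nm x ^+ 2.
  have q0 : 0 < - q / 2 by rewrite /q; lra.
  have [N1 H1] := inv_small (1 : R) q0.
  have q1 : 0 < - q / 2 / (2 * (nm z * nm x + 1)).
    rewrite divr_gt0 // mulr_gt0 //.
    by have := mulr_ge0 (nm_ge0 z) (nm_ge0 x); lra.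
  have [N2 H2] := up _ q1.
  set n := maxn N1 N2; have [Dn Jn] := hu n.
  have := mJ _ (Dl (- z) _ _ Dx Dn).
  rewrite [X in J X]addrC /J phiD //; last exact: DZ.
  rewrite phiZ // nm_sqD dotZr nmZ nmN.
  have h1 := H1 n (leq_maxl _ _).
  have h2 := H2 n (leq_maxr _ _).
  rewrite ltr_pdivlMr in h2; last first.
    by have := mulr_ge0 (nm_ge0 z) (nm_ge0 x); lra.
  have h3 : `|complex.Re (z * (dot (u n) x - dot p x))| <= nm z * nm x * nm (u n - p).
    apply: le_trans (nm_Re _) _; rewrite nmM -mulrA ler_wpM2l ?nm_ge0 //.
    by rewrite -dotBl mulrC CS.
  rewrite ReD exprMn.
  have -> : complex.Re (- z * dot (u n) x) =
      - complex.Re (z * (dot (u n) x - dot p x)) - complex.Re (z * dot p x).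
    by rewrite mulrBr ReB mulNr; case: (z * dot (u n) x) => * /=; lra.
  have -> : complex.Re (- z * phi x) = - complex.Re (z * b) - complex.Re (z * dot p x).
    by rewrite /b mulrBr ReB mulNr; case: (z * phi x) => * /=; lra.
  move: Jn h3; rewrite /J ler_norml => Jn /andP[h3 h4].
  have := nm_ge0 (u n - p); rewrite /q in h1 h2.
  move: h1 h2 h3 h4 Jn.
  set t1 := complex.Re (z * b); set t2 := complex.Re (z * (_ - _)).
  set t3 := nm (u n - p); set t4 := nm z * nm x; set t5 := complex.Re (z * dot p x).
  set t6 := nm z ^+ 2 * nm x ^+ 2; set t7 := complex.Re (phi (u n)).
  set t8 := nm (u n) ^+ 2; set t9 := 1 / _; rewrite mulrDr mulr1 => *.
  have : t4 * t3 = t3 * t4 by rewrite mulrC.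
  have : t3 * (2 * t4) = 2 * (t3 * t4) by rewrite mulrCA.
  by lra.
exists p; split => //; first by exists u; split => // n; case: (hu n).
have [->|p0] := eqVneq (nm p) 0; first by [].
rewrite -(@ler_pM2r _ (nm p)) ?lt_def ?p0 ?nm_ge0 //.
rewrite -expr2 -[leLHS]ger0_norm ?sqr_ge0 // -nm_real -dotxx.
apply: le_trans (_ : nm (dot p p) <= _) _; first by [].
rewrite leNgt; apply/negP => h.
(* [p] is again replaced by some [u N] in [D], where [phiM] applies; [e] is so small that the errors
   do not fill the gap. *)
pose e := (nm (dot p p) - M * nm p) / (2 * (M + nm p + 1)).
have e0 : 0 < e.
  by rewrite /e divr_gt0 //; [lra|have := nm_ge0 p; lra].
have [N HN] := up _ e0; have hN := HN N (leqnn _).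
have [DN _] := hu N; have := phiM _ DN; rewrite pE // => h5.
have h6 : nm (dot p p) <= nm (dot p (u N)) + nm p * nm (u N - p).
  have := nmD (dot p (u N)) (- dot p (u N - p)).
  by rewrite nmN dotBr opprB addrCA subrr addr0; have := CS p (u N - p); rewrite dotBr; lra.
have h7 : nm (u N) <= nm p + nm (u N - p).
  by have := nmD (u N - p) p; rewrite subrK; lra.
move: hN; rewrite /e ltr_pdivlMr; last by have := nm_ge0 p; lra.
have := nm_ge0 p; have := nm_ge0 (u N - p); nra.
Qed.

(** [p] represents the functional [dot x] on [D] and is a limit of elements of [D], hence it is the
    orthogonal projection of [x] on the closure of [D]. *)
Lemma projection (D : set H) x : D 0 ->
  (forall a x y, D x -> D y -> D (a *: x + y)) ->
  exists p, (exists u, (forall n, D (u n)) /\ to u p) /\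
    forall y, D y -> dot y (x - p) = 0.
Proof.
move=> D0 Dl.
have [||p [up _ pE]] := @riesz D (dot x) (nm x) D0 (nm_ge0 x) Dl.
- by move=> a y z _ _; rewrite dotDr dotZr.
- by move=> y _; apply: CS.
- exists p; split => // y Dy; apply/eqP.
  by rewrite dotBr subr_eq0 dot_conj [dot y p]dot_conj pE.
Qed.

End Dot.

Section Dense.
Context (R : realType).
Local Notation C := R[i].

Lemma denseP (V : completeNormedModType C) (S : set V) :
  dense S <-> forall x, exists u, (forall n, S (u n)) /\ to u x.
Proof.
split=> [dS x|h O [x Ox] oO].
  have /choice[u hu] : forall n : nat, exists y, S y /\ nm (y - x) < 1 / n.+1%:R.
    move=> n; have e0 : 0 < (1 / n.+1%:R : R)%:C by rewrite ltcR divr_gt0.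
    have [||y [hy Sy]] := dS (ball x (1 / n.+1%:R : R)%:C).
    - by exists x; apply: ballxx.
    - exact: ball_open.
    by exists y; split=> //; move: hy; rewrite -ball_normE /= normE ltcR nmBC.
  exists u; split=> [n|]; first by case: (hu n).
  apply: (@to_small _ _ (fun n => 1 / n.+1%:R)); last exact: inv_small.
  by move=> n; apply: ltW; case: (hu n).
have [u [Su /to_cvg ux]] := h x.
have /ux[N _ HN] := open_nbhs_nbhs (conj oO Ox).
by exists (u N); split => //; apply: (HN N) => /=.
Qed.

Lemma linear_ext (X : completeNormedModType C) (Y : completeNormedModType C)
    (D : set X) (f : X -> Y) (c : R) :
  (forall a x y, D x -> D y -> D (a *: x + y)) ->
  (forall a x y, D x -> D y -> f (a *: x + y) = a *: f x + f y) ->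
  (forall x, D x -> nm (f x) <= c * nm x) ->
  (forall x, exists u, (forall n, D (u n)) /\ to u x) ->
  exists F : X -> Y, [/\ forall a x y, F (a *: x + y) = a *: F x + F y,
    forall x, nm (F x) <= c * nm x & forall x, D x -> F x = f x].
Proof.
move=> Dl fl fc Dd.
have fB x y : D x -> D y -> nm (f x - f y) <= c * nm (x - y).
  move=> Dx Dy; have := fc _ (Dl (-1) _ _ Dy Dx).
  by rewrite fl // !scaleN1r addrC [- y + _]addrC.
have fto u x y : (forall n, D (u n)) -> to u x ->
    (forall v, (forall n, D (v n)) -> to v x -> to (fun n => f (v n)) y -> True) ->
    exists z, to (fun n => f (u n)) z.
  move=> Du ux _; apply: cauchy_to => e e0.
  have c0 : 0 < `|c| + 1 by have := normr_ge0 c; lra.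
  have e1 : 0 < e / (`|c| + 1) / 2 by rewrite !divr_gt0.
  have [N HN] := ux _ e1; exists N => n m hn hm.
  apply: le_lt_trans (fB _ _ (Du n) (Du m)) _.
  have : nm (u n - u m) < e / (`|c| + 1).
    by have := nmB_trans x (u n) (u m); rewrite (nmBC x); have := HN n hn; have := HN m hm; lra.
  rewrite ltr_pdivlMr // => h; have := ler_norm c; have := nm_ge0 (u n - u m); nra.
have /choice[F hF] : forall x, exists y, forall u, (forall n, D (u n)) -> to u x ->
    to (fun n => f (u n)) y.
  move=> x; have [u [Du ux]] := Dd x; have [//|y uy] := fto u x 0 Du ux.
  exists y => v Dv vx; rewrite -[y]addr0.
  have h : to (fun n => f (v n) - f (u n)) 0.
    refine (to_le (c := c) _ (toB vx ux)) => n.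
    by rewrite !subrr !subr0 fB.
  apply: to_ev (toD uy h); exists 0%N => n _.
  by rewrite addrC subrK.
exists F; split=> [a x y|x|x Dx].
- have [u [Du ux]] := Dd x; have [v [Dv vy]] := Dd y.
  apply: (to_unique (u := fun n => f (a *: u n + v n))).
    apply: hF => [n|]; first exact: Dl.
    by apply: toD vy; apply: toZ ux _; apply: to_cst.
  apply: (to_ev (u := fun n => a *: f (u n) + f (v n))).
    by exists 0%N => n _; rewrite fl.
  apply: toD (hF _ _ Dv vy); apply: (toZ (hF _ _ Du ux)); exact: to_cst.
- have [u [Du ux]] := Dd x; have h := hF _ _ Du ux.
  rewrite leNgt; apply/negP => hlt.
  have c0 : 0 < `|c| + 1 by have := normr_ge0 c; lra.
  have e1 : 0 < (nm (F x) - c * nm x) / 2 / (`|c| + 1).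
    by rewrite !divr_gt0 //; lra.
  have e2 : 0 < (nm (F x) - c * nm x) / 2 by lra.
  have [N1 H1] := ux _ e1; have [N2 H2] := h _ e2.
  have := H1 _ (leq_maxl N1 N2); rewrite ltr_pdivlMr //.
  have := H2 _ (leq_maxr N1 N2); set n := maxn _ _.
  have := fc _ (Du n); have := nm_distB (u n) x.
  rewrite ler_norml => /andP[g1 g2].
  have := nmB_trans (f (u n)) (F x) 0; rewrite !subr0 (nmBC (F x)).
  have := ler_norm c; have := ler_norm (- c); rewrite normrN.
  have := nm_ge0 (u n - x) => g3 g4 g5 g6 g7 g8 g9.
  have : c * (nm (u n) - nm x) <= (`|c| + 1) * nm (u n - x).
    apply: le_trans (ler_norm _) _; rewrite normrM.
    have : `|nm (u n) - nm x| <= nm (u n - x) by rewrite ler_norml g1 g2.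
    by have := normr_ge0 c; nra.
  move: g8 g9; set t := nm (f (u n) - F x); set w := nm (u n - x) in g1 g2 g3 *.
  by rewrite -/t in g6; rewrite mulrBr (mulrC _ w) => *; lra.
- by apply: to_unique (hF x (fun=> x) _ (to_cst x)) (to_cst _).
Qed.

End Dense.

(** * Positive kernels, and operators given by their kernels *)

Section Kernel.
Context (R : realType).
Local Notation C := R[i].

Section Forms.
Context (T : Type).
Implicit Types (s t : seq (C * T)) (kap : T -> T -> C).

(** A formal linear combination is a list, possibly with repeated points, so that concatenation is
    addition; this is the sesquilinear form of [kap] on such combinations. *)
Definition form kap s t : C :=
  \sum_(p <- s) \sum_(q <- t) Num.conj p.1 * q.1 * kap p.2 q.2.

Definition cscale (z : C) s : seq (C * T) := [seq (z * p.1, p.2) | p <- s].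

Lemma form_catl kap s s' t : form kap (s ++ s') t = form kap s t + form kap s' t.
Proof. by rewrite /form big_cat. Qed.

Lemma form_catr kap s t t' : form kap s (t ++ t') = form kap s t + form kap s t'.
Proof.
by rewrite /form -big_split /=; apply: eq_bigr => p _; rewrite big_cat.
Qed.

Lemma form_scalel kap z s t : form kap (cscale z s) t = Num.conj z * form kap s t.
Proof.
rewrite /form big_map mulr_sumr; apply: eq_bigr => p _.
rewrite mulr_sumr; apply: eq_bigr => q _.
by rewrite rmorphM !mulrA.
Qed.

Lemma form_scaler kap z s t : form kap s (cscale z t) = z * form kap s t.
Proof.
rewrite /form mulr_sumr; apply: eq_bigr => p _.
rewrite big_map mulr_sumr; apply: eq_bigr => q _ /=.
by rewrite -!mulrA [RHS]mulrCA.
Qed.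

Lemma form1 kap x y : form kap [:: (1, x)] [:: (1, y)] = kap x y.
Proof. by rewrite /form !big_seq1 /= rmorph1 !mul1r. Qed.

Definition psd kap := forall s, 0 <= form kap s s.

Lemma psd_CS kap s t : psd kap ->
  nm (form kap s t) ^+ 2 <=
  complex.Re (form kap s s) * complex.Re (form kap t t).
Proof.
move=> hk.
have [_ hs] := ge0_Re (hk s); have [_ ht] := ge0_Re (hk t).
apply: quad_CS => // z.
have key w : 0 <= form kap s s + w * form kap s t + Num.conj w * form kap t s
    + w * Num.conj w * form kap t t.
  have := hk (s ++ cscale w t).
  rewrite form_catl !form_catr !form_scalel !form_scaler.
  by rewrite [_ * (w * _)]mulrCA mulrA !addrA [w * _ * _]mulrAC -!mulrA.
have [es _] := ge0_Re (hk s); have [et _] := ge0_Re (hk t).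
(* Hermitian symmetry comes from positivity: the values at $w = 1$ and $w = i$ have vanishing
   imaginary part. *)
have hc : form kap t s = Num.conj (form kap s t).
  have := key 1; have := key 'i.
  rewrite -es -et; case: (form kap s t) => a b; case: (form kap t s) => c d.
  rewrite !lecE /= => /andP[/eqP h1 _] /andP[/eqP h2 _].
  by congr (_ +i* _); lra.
have := key z; rewrite hc -rmorphM -nm_sq -es -et.
case: (z * form kap s t) => a b; rewrite lecE /= => /andP[_]; lra.
Qed.

Section Vec.
Context (K : hilbertType R) (v : T -> K).
Implicit Types x y : T.

Definition vec s : K := \sum_(p <- s) p.1 *: v p.2.

Lemma vec_cat s t : vec (s ++ t) = vec s + vec t.
Proof. by rewrite /vec big_cat. Qed.

Lemma vec_scale z s : vec (cscale z s) = z *: vec s.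
Proof.
rewrite /vec big_map scaler_sumr; apply: eq_bigr => p _ /=.
by rewrite scalerA.
Qed.

Lemma vec1 x : vec [:: (1, x)] = v x.
Proof. by rewrite /vec big_seq1 scale1r. Qed.

Lemma dot_vec s t : dot (vec s) (vec t) = form (fun x y => dot (v x) (v y)) s t.
Proof.
rewrite /vec dot_suml; apply: eq_bigr => p _.
rewrite dot_sumr; apply: eq_bigr => q _.
by rewrite dotZl dotZr mulrA.
Qed.

Definition total := forall x : K, (forall t : T, dot (v t) x = 0) -> x = 0.

Lemma total_inj (x y : K) : total ->
  (forall t : T, dot (v t) x = dot (v t) y) -> x = y.
Proof.
move=> tv h; apply/eqP; rewrite -subr_eq0; apply/eqP/tv => t.
by rewrite dotBr h subrr.
Qed.

(** The difference between [x] and its projection on the closed span is orthogonal to every [v t],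
    hence zero. *)
Lemma total_dense : total -> forall x : K, exists u : nat -> seq (C * T),
  to (fun n => vec (u n)) x.
Proof.
move=> tv x; pose D := [set y | exists s, y = vec s].
have Dl a (y z : K) : D y -> D z -> D (a *: y + z).
  move=> [s ->] [t ->]; exists (cscale a s ++ t).
  by rewrite vec_cat vec_scale.
have D0 : D 0 by exists [::]; rewrite /vec big_nil.
have [p [[u [/choice[w hw] up]] pE]] := projection x D0 Dl.
have -> : x = p.
  apply: total_inj tv _ => t; apply/eqP; rewrite -subr_eq0 -dotBr.
  by apply/eqP/pE; exists [:: (1, t)]; rewrite vec1.
by exists w; apply: to_ev up; exists 0%N => n _; rewrite hw.
Qed.

(** By the bound, [form kap] depends on the combinations only through their vectors, so it is a
    bounded sesquilinear form on a dense subspace and is given by an operator. Adjoints, $1 \otimes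
    T$, the flow operators and their slices are all obtained in this way. *)
Lemma kernel_op kap (c : R) : total -> 0 <= c ->
  (forall s t, nm (form kap s t) <= c * (nm (vec s) * nm (vec t))) ->
  exists Z : K -> K, [/\ forall a (x y : K), Z (a *: x + y) = a *: Z x + Z y,
    forall x : K, nm (Z x) <= c * nm x &
    forall x y, dot (v x) (Z (v y)) = kap x y].
Proof.
move=> tv c0 hk.
pose D := [set y | exists s, y = vec s].
have Dl a (y z : K) : D y -> D z -> D (a *: y + z).
  move=> [s ->] [t ->]; exists (cscale a s ++ t).
  by rewrite vec_cat vec_scale.
have D0 : D 0 by exists [::]; rewrite /vec big_nil.
have Dd (x : K) : exists u, (forall n, D (u n)) /\ to u x.
  have [u hu] := total_dense tv x; exists (fun n => vec (u n)); split => // n.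
  by exists (u n).
(* The formal difference of [s] and [s'] has vector 0, and there the bound is 0. *)
have form_eq s s' t : vec s = vec s' -> form kap s t = form kap s' t.
  move=> e; apply/eqP; rewrite -subr_eq0; apply/eqP/nm_eq0/eqP.
  rewrite eq_le nm_ge0 andbT.
  have := hk (s ++ cscale (-1) s') t.
  rewrite form_catl form_scalel vec_cat vec_scale e scaleN1r subrr nm0 mul0r mulr0.
  by rewrite rmorphN1 mulN1r.
have /choice[g hg] : forall y : K, exists s, D y -> y = vec s.
  by move=> y; have [[s hs]|h] := pselect (D y); [exists s|exists [::]].
(* The form is antilinear in [s], whereas [riesz] represents linear functionals; hence the
   conjugate. *)
have /choice[zt hzt] : forall t, exists z, nm z <= c * nm (vec t) /\
    forall s, dot (vec s) z = form kap s t.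
  move=> t.
  have [|||||z [_ hz1 hz2]] := @riesz _ K D (fun y : K => Num.conj (form kap (g y) t))
    (c * nm (vec t)).
  - by [].
  - by rewrite mulr_ge0 ?nm_ge0.
  - exact: Dl.
  - move=> a x' y' Dx Dy.
    rewrite (form_eq _ (cscale a (g x') ++ g y')); last first.
      by rewrite vec_cat vec_scale -!hg //; apply: Dl.
    by rewrite form_catl form_scalel cjD cjM cjK.
  - move=> x' Dx; rewrite nm_conj; apply: le_trans (hk _ _) _.
    by rewrite -hg // mulrAC mulrA.
  exists z; split => // s.
  have Ds : D (vec s) by exists s.
  have := hz2 _ Ds; rewrite (form_eq _ s); last by rewrite -hg.
  by rewrite (dot_conj z) => <-; rewrite cjK.
have zt_lin a (x y : K) : D x -> D y -> zt (g (a *: x + y)) = a *: zt (g x) + zt (g y).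
  move=> Dx Dy; apply: total_inj tv _ => p.
  have hz q t : dot (v q) (zt t) = form kap [:: (1, q)] t.
    by rewrite -(hzt t).2 vec1.
  rewrite dotDr dotZr !hz -form_scaler -form_catr.
  have sym t t' : vec t = vec t' -> form kap [:: (1, p)] t = form kap [:: (1, p)] t'.
    move=> e; apply/eqP; rewrite -subr_eq0; apply/eqP/nm_eq0/eqP.
    rewrite eq_le nm_ge0 andbT.
    have := hk [:: (1, p)] (t ++ cscale (-1) t').
    rewrite form_catr form_scaler vec_cat vec_scale e scaleN1r subrr nm0 !mulr0.
    by rewrite mulN1r.
  by apply: sym; rewrite vec_cat vec_scale -!hg //; apply: Dl.
have [|Z [Zl Zb ZE]] := linear_ext (c := c) Dl zt_lin _ Dd.
- by move=> x Dx; have [h _] := hzt (g x); rewrite {2}(hg _ Dx).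
exists Z; split => // x y.
have Dv (p : T) : D (v p) by exists [:: (1, p)]; rewrite vec1.
rewrite ZE // -{1}(vec1 x) (hzt _).2 -form1.
have e : vec (g (v y)) = vec [:: (1, y)] by rewrite -hg // vec1.
apply/eqP; rewrite -subr_eq0; apply/eqP/nm_eq0/eqP.
rewrite eq_le nm_ge0 andbT.
have := hk [:: (1, x)] (g (v y) ++ cscale (-1) [:: (1, y)]).
rewrite form_catr form_scaler vec_cat vec_scale e scaleN1r subrr nm0 !mulr0.
by rewrite mulN1r.
Qed.

End Vec.
End Forms.

Lemma total_setP (K : hilbertType R) (S : set K) x : total_set S ->
  (forall y, S y -> dot y x = 0) -> x = 0.
Proof.
move=> /denseP /(_ x)[u [hu ux]] h.
have : dot x x = 0 :> C.
  apply: to_unique (to_dotl x ux) _.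
  apply: to_ev (to_cst _); exists 0%N => n _.
  have [m [c [w [hw ->]]]] := hu n.
  by rewrite dot_suml big1 // => i _; rewrite dotZl h // mulr0.
by rewrite dotxx => /complexI /eqP; rewrite sqrf_eq0 => /eqP /nm_eq0.
Qed.

End Kernel.

Section Operators.
Context (R : realType).
Local Notation C := R[i].

Lemma bounded_opP (K : hilbertType R) (T : K -> K) : bounded_op T <->
  (forall a x y, T (a *: x + y) = a *: T x + T y) /\
  exists c : R, 0 <= c /\ forall x, nm (T x) <= c * nm x.
Proof.
split=> [[lT [M hM]]|[lT [c [c0 hc]]]]; split=> //; last first.
  by exists c%:C => x; rewrite !normE -rmorphM lecR.
exists (nm M); split=> [|x]; first exact: nm_ge0.
have := hM x; rewrite !normE lecE /= => /andP[_].
rewrite [M * _]mulrC ReMr mulrC => h; apply: le_trans h _.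
by rewrite ler_wpM2r ?nm_ge0 ?nm_Re_le.
Qed.

Lemma opD (V W : lmodType C) (T : V -> W) : (forall a x y, T (a *: x + y) = a *: T x + T y) ->
  forall x y, T (x + y) = T x + T y.
Proof. by move=> h x y; have := h 1 x y; rewrite !scale1r. Qed.

Lemma op0 (V W : lmodType C) (T : V -> W) : (forall a x y, T (a *: x + y) = a *: T x + T y) ->
  T 0 = 0.
Proof. by move=> h; apply: (addrI (T 0)); rewrite -opD // !addr0. Qed.

Lemma opZ (V W : lmodType C) (T : V -> W) : (forall a x y, T (a *: x + y) = a *: T x + T y) ->
  forall a x, T (a *: x) = a *: T x.
Proof. by move=> h a x; have := h a x 0; rewrite (op0 h) !addr0. Qed.

Lemma opB (V W : lmodType C) (T : V -> W) : (forall a x y, T (a *: x + y) = a *: T x + T y) ->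
  forall x y, T (x - y) = T x - T y.
Proof. by move=> h x y; rewrite -scaleN1r (opD h) (opZ h) scaleN1r. Qed.

Lemma op_sum (V W : lmodType C) (T : V -> W) :
  (forall a x y, T (a *: x + y) = a *: T x + T y) ->
  forall I (s : seq I) (P : pred I) F,
  T (\sum_(i <- s | P i) F i) = \sum_(i <- s | P i) T (F i).
Proof.
move=> h I s P F.
by elim/big_rec2: _ => [|i u v _ <-]; rewrite ?(op0 h) ?(opD h).
Qed.

Lemma to_op (K L : completeNormedModType C) (T : K -> L) (c : R) u l :
  (forall a x y, T (a *: x + y) = a *: T x + T y) ->
  (forall x, nm (T x) <= c * nm x) ->
  to u l -> to (fun n => T (u n)) (T l).
Proof. by move=> lT hT; apply: (to_le (c := c)) => n; rewrite -(opB lT). Qed.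

Lemma adjoint (K : hilbertType R) (T : K -> K) (c : R) : 0 <= c ->
  (forall a x y, T (a *: x + y) = a *: T x + T y) ->
  (forall x, nm (T x) <= c * nm x) ->
  exists S, [/\ forall a x y, S (a *: x + y) = a *: S x + S y,
    forall x, nm (S x) <= c * nm x & forall x y, dot (T x) y = dot x (S y)].
Proof.
move=> c0 lT hT.
have [|||Z [Zl Zb ZE]] := @kernel_op _ K K id (fun x y => dot (T x) y) c.
- by move=> x h; apply: dot_eq0.
- by [].
- move=> s t.
  have -> : form (fun x y => dot (T x) y) s t = dot (T (vec id s)) (vec id t).
    rewrite /vec (op_sum lT) dot_suml; apply: eq_bigr => p _.
    rewrite dot_sumr; apply: eq_bigr => q _.
    by rewrite (opZ lT) dotZl dotZr mulrA.
  apply: le_trans (CS _ _) _; rewrite mulrA ler_wpM2r ?nm_ge0 //.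
by exists Z; split => // x y; rewrite ZE.
Qed.

End Operators.

(** * Integrals and Volterra equations *)

Section RealIntegral.
Context (R : realType).
Notation mu := (@lebesgue_measure R).
Implicit Types (f g h : R -> R) (a b c t : R).

Definition intg a b f := mu.-integrable `[a, b] (EFin \o f).
Definition itg a b f : R := \int[mu]_(s in `[a, b]) f s.

(** Bounded measurable functions are multipliers of the integrable ones ([intg_mul]). Solutions of
    the equations are of this kind, while the coefficients are only integrable. *)
Definition bm a b h := measurable_fun `[a, b] h /\
  exists C : R, forall x, a <= x <= b -> `|h x| <= C.

Lemma intg_meas a b f : intg a b f -> measurable_fun `[a, b] f.
Proof. by move=> /integrableP[/measurable_EFinP]. Qed.

Lemma intg_sub a b c d f : a <= c -> d <= b -> intg a b f -> intg c d f.
Proof.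
move=> ac db; apply: integrableS => //.
by apply: subset_itv; rewrite bnd_simp.
Qed.

Lemma intgD a b f g : intg a b f -> intg a b g -> intg a b (fun x => f x + g x).
Proof. by move=> hf hg; exact: (@integrableD _ _ _ mu _ _ _ _ hf hg). Qed.

Lemma intgZ a b (k : R) f : intg a b f -> intg a b (fun x => k * f x).
Proof. by move=> hf; exact: (@integrableZl _ _ _ mu _ _ k _ hf). Qed.

Lemma intgB a b f g : intg a b f -> intg a b g -> intg a b (fun x => f x - g x).
Proof. by move=> hf hg; exact: (@integrableB _ _ _ mu _ _ _ _ hf hg). Qed.

Lemma eq_intg a b f g : (forall x, a <= x <= b -> f x = g x) ->
  intg a b f -> intg a b g.
Proof.
move=> fg; apply: eq_integrable => // x; rewrite inE /= in_itv /= => h.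
by rewrite fg.
Qed.

Lemma intg0 a b : intg a b (fun=> 0).
Proof.
apply: (eq_integrable _ (fun=> 0%E)) => //; exact: integrable0.
Qed.

Lemma intg_sum a b (I : Type) (s : seq I) (F : I -> R -> R) :
  (forall i, intg a b (F i)) -> intg a b (fun x => \sum_(i <- s) F i x).
Proof.
move=> h; elim: s => [|i s IH].
  by apply: eq_intg (intg0 a b) => x _; rewrite big_nil.
by apply: eq_intg (intgD (h i) IH) => x _; rewrite big_cons.
Qed.

Lemma intg_norm a b f : intg a b f -> intg a b (fun x => `|f x|).
Proof. by move=> hf; exact: (integrable_abse hf). Qed.

Lemma intg_le a b f g : measurable_fun `[a, b] f -> intg a b g ->
  (forall x, a <= x <= b -> `|f x| <= g x) -> intg a b f.
Proof.
move=> mf ig h; apply: (le_integrable _ _ _ ig) => //.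
  exact/measurable_EFinP.
move=> x; rewrite /= in_itv /= => hx; rewrite lee_fin (le_trans (h x hx)) //.
exact: ler_norm.
Qed.

Lemma intg_mul a b h f : bm a b h -> intg a b f -> intg a b (fun x => h x * f x).
Proof.
move=> [mh [C hC]] hf.
apply: (@intg_le _ _ _ (fun x => C * `|f x|)).
- by apply: measurable_funM => //; apply: intg_meas.
- by apply: intgZ; apply: intg_norm.
- by move=> x hx; rewrite normrM ler_wpM2r // hC.
Qed.

Lemma bm_intg a b h : bm a b h -> intg a b h.
Proof.
move=> [mh [C hC]]; apply: measurable_bounded_integrable => //.
  by rewrite /= lebesgue_measure_itv /=; case: ifP => // _; rewrite -EFinB ltry.
exists C; split; first exact: num_real.
move=> M hM x; rewrite /= in_itv /= => hx.
exact: le_trans (hC x hx) (ltW hM).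
Qed.

Lemma bm_cst a b (k : R) : bm a b (fun=> k).
Proof. by split; [exact: measurable_cst | exists `|k|]. Qed.

Lemma bmM a b f g : bm a b f -> bm a b g -> bm a b (fun x => f x * g x).
Proof.
move=> [mf [C hC]] [mg [D hD]]; split; first exact: measurable_funM.
exists (C * D) => x hx; rewrite normrM; apply: ler_pM => //; [exact: hC|exact: hD].
Qed.

Lemma bmD a b f g : bm a b f -> bm a b g -> bm a b (fun x => f x + g x).
Proof.
move=> [mf [C hC]] [mg [D hD]]; split; first exact: measurable_funD.
exists (C + D) => x hx; apply: le_trans (ler_normD _ _) _.
by apply: lerD; [exact: hC|exact: hD].
Qed.

Lemma bm_sum a b (I : Type) (s : seq I) (F : I -> R -> R) :
  (forall i, bm a b (F i)) -> bm a b (fun x => \sum_(i <- s) F i x).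
Proof.
move=> h; elim: s => [|i s IH].
  have -> : (fun x => \sum_(i <- [::]) F i x) = (fun=> 0) :> (R -> R).
    by apply/funext => x; rewrite big_nil.
  exact: bm_cst.
have -> : (fun x => \sum_(j <- i :: s) F j x) =
    (fun x => F i x + \sum_(j <- s) F j x).
  by apply/funext => x; rewrite big_cons.
exact: bmD.
Qed.

Lemma bm_sub a b c d f : a <= c -> d <= b -> bm a b f -> bm c d f.
Proof.
move=> ac db [mf [C hC]]; split.
  by apply: measurable_funS mf => //; apply: subset_itv; rewrite bnd_simp.
by exists C => x /andP[h1 h2]; apply: hC; lra.
Qed.

Lemma itg_aa a f : itg a a f = 0.
Proof. by rewrite /itg set_itv1 Rintegral_set1. Qed.

Lemma itg_add a b c f : a <= b -> b <= c -> intg a c f ->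
  itg a c f = itg a b f + itg b c f.
Proof.
move=> ab bc hf.
have hb : mu.-integrable `]b, c] (EFin \o f).
  by apply: integrableS hf => //; apply: subset_itv; rewrite bnd_simp.
rewrite /itg -(Rintegral_itv_obnd_cbnd hb).
by rewrite -(@Rintegral_itvB _ _ _ _ b hf) ?bnd_simp // addrC subrK.
Qed.

Lemma itgD a b f g : intg a b f -> intg a b g ->
  itg a b (fun x => f x + g x) = itg a b f + itg a b g.
Proof. by move=> hf hg; exact: RintegralD. Qed.

Lemma itgB a b f g : intg a b f -> intg a b g ->
  itg a b (fun x => f x - g x) = itg a b f - itg a b g.
Proof. by move=> hf hg; exact: RintegralB. Qed.

Lemma itgZ a b (k : R) f : intg a b f -> itg a b (fun x => k * f x) = k * itg a b f.
Proof. by move=> hf; exact: RintegralZl. Qed.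

Lemma eq_itg a b f g : (forall x, a <= x <= b -> f x = g x) ->
  itg a b f = itg a b g.
Proof.
move=> fg; apply: eq_Rintegral => x; rewrite inE /= in_itv /=; exact: fg.
Qed.

Lemma itg0 a b : itg a b (fun=> 0) = 0.
Proof. by rewrite /itg Rintegral_cst // mul0r. Qed.

Lemma itg_sum a b (I : Type) (s : seq I) (F : I -> R -> R) :
  (forall i, intg a b (F i)) ->
  itg a b (fun x => \sum_(i <- s) F i x) = \sum_(i <- s) itg a b (F i).
Proof.
move=> h; elim: s => [|i s IH].
  by rewrite big_nil -[RHS](itg0 a b); apply: eq_itg => x _; rewrite big_nil.
rewrite big_cons -IH -itgD //; last exact: intg_sum.
by apply: eq_itg => x _; rewrite big_cons.
Qed.

Lemma itg_norm a b f : intg a b f -> `|itg a b f| <= itg a b (fun x => `|f x|).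
Proof. by move=> hf; apply: le_normr_Rintegral. Qed.

Lemma itg_le a b f g : intg a b f -> intg a b g ->
  (forall x, a <= x <= b -> f x <= g x) -> itg a b f <= itg a b g.
Proof.
by move=> hf hg h; apply: le_Rintegral => // x; rewrite /= in_itv /=; apply: h.
Qed.

Lemma itg_ge0 a b f : (forall x, a <= x <= b -> 0 <= f x) -> 0 <= itg a b f.
Proof.
by move=> h; apply: Rintegral_ge0 => x; rewrite /= in_itv /=; apply: h.
Qed.

Lemma itg_cst a b (k : R) : a <= b -> itg a b (fun=> k) = k * (b - a).
Proof.
move=> ab; rewrite /itg Rintegral_cst //= lebesgue_measure_itv /=.
case: ifP => [_|]; first by rewrite -EFinB.
rewrite lte_fin => /negbT; rewrite -leNgt => h.
have -> : b = a by lra.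
by rewrite subrr.
Qed.

Lemma intg_cst a b (k : R) : intg a b (fun=> k).
Proof. exact: bm_intg (bm_cst _ _ _). Qed.

Lemma itg_continuous a b f : a <= b -> intg a b f ->
  {within `[a, b], continuous (fun x => itg a x f)}.
Proof. by move=> ab hf; exact: parameterized_integral_continuous. Qed.

Lemma itg_bm a b f : intg a b f -> bm a b (fun x => itg a x f).
Proof.
move=> hf; have [ab|ba] := leP a b; last first.
  split; last by exists 0 => x hx; lra.
  by rewrite set_itv_ge ?bnd_simp -?ltNge //; exact: measurable_fun_set0.
split; first by apply: subspace_continuous_measurable_fun => //; exact: itg_continuous.
exists (itg a b (fun x => `|f x|)) => x /andP[ax xb].
have hx : intg a x f by apply: intg_sub hf.
apply: le_trans (itg_norm hx) _.
rewrite [leRHS](itg_add ax xb); last exact: intg_norm.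
by rewrite lerDl itg_ge0.
Qed.

Lemma continuous_bm a b f : continuous f -> bm a b f.
Proof.
move=> cf; have [ab|ba] := leP a b; last first.
  split; last by exists 0 => x hx; lra.
  by rewrite set_itv_ge ?bnd_simp -?ltNge //; exact: measurable_fun_set0.
split.
  by apply: measurable_funTS; exact: continuous_measurable_fun.
have cn : {within `[a, b], continuous (fun x => `|f x|)}.
  apply: continuous_subspaceT => x; apply: continuous_comp; first exact: cf.
  exact: norm_continuous.
have [c _ hc] := EVT_max ab cn; exists `|f c| => x hx.
by apply: hc; rewrite in_itv.
Qed.

Lemma itg_exp a t (c : R) : 0 < c -> a <= t ->
  itg a t (fun r => expR (c * (r - t))) <= c^-1.
Proof.
move=> c0; rewrite le_eqVlt => /predU1P[->|at_].
  by rewrite itg_aa invr_ge0 ltW.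
pose F r := c^-1 * expR (c * (r - t)) : R^o.
have dF (x : R) : is_derive x 1 F (expR (c * (x - t))).
  have h : is_derive x 1 (fun r : R => c * (r - t)) c.
    have h0 : is_derive x 1 (fun r : R => r - t) (1 - 0).
      by apply: is_deriveB.
    by have := is_deriveZ c h0; rewrite subr0 /GRing.scale /= mulr1.
  have h2 := @is_derive1_comp _ expR (fun r => c * (r - t)) x _ _
    (is_derive_expR (c * (x - t))) h.
  have := is_deriveZ c^-1 h2.
  by rewrite /GRing.scale /= mulrCA mulVf ?mulr1 ?gt_eqF.
have cE : continuous (fun r : R => expR (c * (r - t))).
  move=> x; apply: continuous_comp; last exact: continuous_expR.
  by apply: cvgMr; apply: cvgB; [exact: cvg_id | exact: cvg_cst].
have cF : continuous F by move=> x; apply: cvgMr; exact: cE.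
have := @continuous_FTC2 R _ F a t at_ (continuous_subspaceT cE).
move=> /(_ _ _) hF.
have hd : derivable_oo_LRcontinuous F a t.
  split.
  - by move=> x _; case: (dF x).
  - by apply: cvg_at_right_filter; exact: cF.
  - by apply: cvg_at_left_filter; exact: cF.
have he : {in `]a, t[, F^`()%classic =1 (fun r : R => expR (c * (r - t)))}.
  by move=> x _; rewrite derive1E; case: (dF x).
have := hF hd he => {}hF.
rewrite /itg /Rintegral hF /= /F subrr mulr0 expR0 mulr1.
by rewrite gerBl mulr_ge0 ?invr_ge0 ?expR_ge0 // ltW.
Qed.

(* With [b = 2 K + 1], both terms of [2 g e <= g^2 / b + b e^2] integrate to at most 1/2. *)
Lemma exp_weight a t (K b : R) g : a <= t -> (forall x, a <= x <= t -> 0 <= g x) ->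
  intg a t g -> intg a t (fun x => g x ^+ 2) ->
  itg a t (fun x => g x ^+ 2) <= K -> b = 2 * K + 1 ->
  itg a t (fun r => g r * expR (b * (r - a))) <= 2^-1 * expR (b * (t - a)).
Proof.
move=> at_ g0 ig ig2 hK bE.
have K0 : 0 <= K by apply: le_trans hK; apply: itg_ge0 => x _; exact: sqr_ge0.
have b0 : 0 < b by lra.
have cE (c d : R) : continuous (fun r : R => expR (c * (r - d))).
  move=> x; apply: continuous_comp; last exact: continuous_expR.
  by apply: cvgMr; apply: cvgB; [exact: cvg_id | exact: cvg_cst].
have bE2 := bm_intg (continuous_bm a t (cE (2 * b) t)).
pose G r := expR (b * (t - a)) * ((2 * b)^-1 * g r ^+ 2 + b / 2 * expR (2 * b * (r - t))).
have iG : intg a t G by apply: intgZ; apply: intgD; apply: intgZ.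
apply: (@le_trans _ _ (itg a t G)).
  apply: itg_le => // [|x hx].
    apply: eq_intg (intg_mul (continuous_bm a t (cE b a)) ig) => x _.
    by rewrite mulrC.
  have -> : expR (b * (x - a)) = expR (b * (t - a)) * expR (b * (x - t)).
    by rewrite -expRD; congr expR; ring.
  rewrite mulrCA /G ler_wpM2l ?expR_ge0 //.
  have -> : expR (2 * b * (x - t)) = expR (b * (x - t)) ^+ 2.
    by rewrite expr2 -expRD; congr expR; ring.
  set e := expR _; set y := g x.
  have -> : (2 * b)^-1 * y ^+ 2 + b / 2 * e ^+ 2 = y * e + (y - b * e) ^+ 2 / (2 * b).
    by field; lra.
  by rewrite lerDl divr_ge0 ?sqr_ge0 //; lra.
rewrite itgZ; last by apply: intgD; apply: intgZ.
rewrite mulrC ler_wpM2r ?expR_ge0 //.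
rewrite itgD; [|exact: intgZ..]; rewrite !itgZ //.
have h1 := itg_exp (_ : 0 < 2 * b) at_.
have {}h1 : itg a t (fun r => expR (2 * b * (r - t))) <= (2 * b)^-1.
  by apply: h1; lra.
have h2 : (2 * b)^-1 * itg a t (fun x => g x ^+ 2) <= (2 * b)^-1 * (b / 2).
  by rewrite ler_wpM2l ?invr_ge0 //; lra.
have h3 : b / 2 * itg a t (fun r => expR (2 * b * (r - t))) <= b / 2 * (2 * b)^-1.
  by rewrite ler_wpM2l //; lra.
have e1 : (2 * b)^-1 * (b / 2) = 4^-1 by field; lra.
have e2 : b / 2 * (2 * b)^-1 = 4^-1 by field; lra.
lra.
Qed.

End RealIntegral.

(** * Linear Volterra systems with square-integrable coefficients *)

Section Volterra.
Context (R : realType) (I : finType).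
Implicit Types (y : R -> I -> R) (c : I -> R).

Definition vop (a : R) (g : R -> I -> I -> R) y (t : R) (i : I) : R :=
  itg a t (fun r => \sum_j y r j * g r j i).

Definition n1 c : R := \sum_i `|c i|.

(** The rows of [g] are dominated in $l^1$ by [beta], whose squared $L^2$ norm is at most [K]; this
    number alone controls the growth of solutions. *)
Record kernel_on (a b : R) (g : R -> I -> I -> R) (beta : R -> R) (K : R) := {
  ker_le : a <= b;
  ker_intg : forall i j, intg a b (fun r => g r j i);
  ker_bound : forall r j, a <= r <= b -> \sum_i `|g r j i| <= beta r;
  ker_ge0 : forall r, a <= r <= b -> 0 <= beta r;
  ker_beta : intg a b beta;
  ker_beta2 : intg a b (fun r => beta r ^+ 2);
  ker_K : itg a b (fun r => beta r ^+ 2) <= K }.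

Lemma kernel_on_sub (a b c d : R) g beta K : a <= c -> c <= d -> d <= b ->
  kernel_on a b g beta K -> kernel_on c d g beta K.
Proof.
move=> ac cd db [ab h1 h2 h3 h4 h5 h6]; split => //.
- by move=> i j; apply: intg_sub (h1 i j).
- by move=> r j /andP[? ?]; apply: h2; lra.
- by move=> r /andP[? ?]; apply: h3; lra.
- by apply: intg_sub h4.
- by apply: intg_sub h5.
apply: le_trans h6; rewrite (@itg_add _ a c b) //; [|lra].
rewrite (@itg_add _ c d b) //; last by apply: intg_sub h5.
have g0 (x y : R) : 0 <= itg x y (fun r => beta r ^+ 2).
  by apply: itg_ge0 => z _; exact: sqr_ge0.
by have := g0 a c; have := g0 d b; lra.
Qed.

Section Fixed.
Context (a b : R) (g : R -> I -> I -> R) (beta : R -> R) (K : R).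
Context (hg : kernel_on a b g beta K).

Let ab : a <= b := ker_le hg.

Definition bmv y := forall i, bm a b (fun r => y r i).

Lemma vop_intg y i : bmv y -> intg a b (fun r => \sum_j y r j * g r j i).
Proof.
by move=> hy; apply: intg_sum => j; apply: intg_mul; [exact: hy|exact: (ker_intg hg)].
Qed.

Lemma vop_bm y : bmv y -> bmv (vop a g y).
Proof. by move=> hy i; apply: itg_bm; exact: vop_intg. Qed.

Lemma n1_bm y : bmv y -> bm a b (fun r => n1 (y r)).
Proof.
move=> hy; apply: bm_sum => i; have [my [C hC]] := hy i; split.
  exact: measurableT_comp.
by exists C => x hx; rewrite normr_id hC.
Qed.

Lemma vop_n1 y t : bmv y -> a <= t <= b ->
  n1 (vop a g y t) <= itg a t (fun r => n1 (y r) * beta r).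
Proof.
move=> hy /andP[at_ tb].
have hi i : intg a t (fun r => \sum_j y r j * g r j i).
  by apply: intg_sub (vop_intg i hy).
have hb : intg a t (fun r => n1 (y r) * beta r).
  apply: intg_mul; first exact: bm_sub (n1_bm hy).
  by apply: intg_sub (ker_beta hg).
apply: le_trans (_ : \sum_i itg a t (fun r => `|\sum_j y r j * g r j i|) <= _).
  by apply: ler_sum => i _; apply: itg_norm.
rewrite -itg_sum; last by move=> i; apply: intg_norm.
apply: itg_le => // [|x /andP[ax xt]].
  by apply: intg_sum => i; apply: intg_norm.
apply: le_trans (_ : \sum_i \sum_j `|y x j| * `|g x j i| <= _).
  apply: ler_sum => i _; apply: le_trans (ler_norm_sum _ _ _) _.
  by apply: ler_sum => j _; rewrite normrM.
rewrite exchange_big /= /n1 mulr_suml; apply: ler_sum => j _.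
rewrite -mulr_sumr ler_wpM2l // (ker_bound hg) //; lra.
Qed.

Let lam := 2 * K + 1.
Let E t := expR (lam * (t - a)).

(** In the norm weighted by $e^{(2K+1)(t-a)}$ the operator is a contraction by $1/2$ on the whole
    interval, whatever its length; [exp_weight] provides the factor. *)
Lemma vop_weight y (C : R) : bmv y -> 0 <= C ->
  (forall t, a <= t <= b -> n1 (y t) <= C * E t) ->
  forall t, a <= t <= b -> n1 (vop a g y t) <= 2^-1 * C * E t.
Proof.
move=> hy C0 hE t /andP[at_ tb]; apply: le_trans (vop_n1 hy _) _; first lra.
have hs := kernel_on_sub (lexx a) at_ tb hg.
have hEb : bm a t E.
  apply: continuous_bm => x; apply: continuous_comp; last exact: continuous_expR.
  by apply: cvgMr; apply: cvgB; [exact: cvg_id | exact: cvg_cst].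
have i1 : intg a t (fun r => beta r * E r).
  apply: eq_intg (intg_mul hEb (ker_beta hs)) => x _; exact: mulrC.
apply: le_trans (_ : itg a t (fun r => C * (beta r * E r)) <= _).
  apply: itg_le; last first.
  - move=> x /andP[ax xt]; rewrite mulrCA mulrC.
    rewrite ler_wpM2l ?(ker_ge0 hs) //; first by lra.
    by apply: hE; lra.
  - exact: intgZ.
  - apply: intg_mul; last exact: ker_beta hs.
    by apply: bm_sub (n1_bm hy).
rewrite itgZ // mulrAC [leRHS]mulrC ler_wpM2l //.
apply: (exp_weight (K := K) at_) => //.
- by move=> x; exact: (ker_ge0 hs).
- exact: (ker_beta hs).
- exact: (ker_beta2 hs).
- exact: (ker_K hs).
Qed.

Lemma E_ge1 t : a <= t -> 1 <= E t.
Proof.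
move=> at_; rewrite -expR0 ler_expR mulr_ge0 //; last by lra.
have := ker_K hg; have : 0 <= itg a b (fun r => beta r ^+ 2).
  by apply: itg_ge0 => x _; exact: sqr_ge0.
by rewrite /lam; lra.
Qed.

Lemma E_le t : a <= t <= b -> E t <= E b.
Proof.
move=> /andP[at_ tb]; rewrite ler_expR ler_wpM2l; [by []| |by lra].
have := ker_K hg; have : 0 <= itg a b (fun r => beta r ^+ 2).
  by apply: itg_ge0 => x _; exact: sqr_ge0.
by rewrite /lam; lra.
Qed.

(** Each application of [vop_weight] to $y = Vy$ halves the weighted bound of [y]. *)
Lemma volterra_uniq y : bmv y ->
  (forall t i, a <= t <= b -> y t i = vop a g y t i) ->
  forall t i, a <= t <= b -> y t i = 0.
Proof.
move=> hy hv.
have [C C0 hC] : exists2 C : R, 0 <= C & forall t, a <= t <= b -> n1 (y t) <= C.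
  have [_ [C hC]] := n1_bm hy; exists `|C| => // t ht.
  exact: le_trans (ler_norm _) (le_trans (hC t ht) (ler_norm _)).
have key n t : a <= t <= b -> n1 (y t) <= C * 2^-1 ^+ n * E t.
  elim: n t => [|n IH] t ht.
    rewrite expr0 mulr1; apply: le_trans (hC t ht) _.
    by rewrite ler_peMr // E_ge1 //; case/andP: ht.
  have -> : n1 (y t) = n1 (vop a g y t).
    by apply: eq_bigr => i _; rewrite hv.
  rewrite exprS mulrCA; apply: vop_weight => //.
  by rewrite mulr_ge0 // exprn_ge0.
move=> t i ht.
have hi : `|y t i| <= n1 (y t).
  by rewrite /n1 (bigD1 i) //= lerDl sumr_ge0.
apply/eqP; rewrite -normr_eq0 eq_le normr_ge0 andbT leNgt; apply/negP => h.
have [|N /(_ N (leqnn _))] := @geo_small R 2^-1 (C * E t) _ _ h.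
  by apply/andP; split; [rewrite invr_ge0|rewrite invf_lt1 ?ltr1n].
by have := key N t ht; rewrite mulrAC; lra.
Qed.

End Fixed.

Section Existence.
Context (a : R) (g : R -> I -> I -> R).
Context (hg : forall b, a <= b -> exists beta K, kernel_on a b g beta K).
Context (c : I -> R).

(** The terms $V^n c$ of the Neumann series; the solution is the limit of the partial sums [S]. *)
Fixpoint iterv n : R -> I -> R :=
  if n is n'.+1 then vop a g (iterv n') else fun=> c.

Let S n t i := \sum_(k < n) iterv k t i.

Lemma iterv_bm b n : a <= b -> bmv a b (iterv n).
Proof.
move=> ab; have [beta [K hK]] := hg ab.
elim: n => [|n IH]; first by move=> i; exact: bm_cst.
exact: (vop_bm hK).
Qed.

Lemma iterv_le b beta K n : kernel_on a b g beta K -> forall t, a <= t <= b ->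
  n1 (iterv n t) <= n1 c * 2^-1 ^+ n * expR ((2 * K + 1) * (t - a)).
Proof.
move=> hK; elim: n => [|n IH] t ht.
  rewrite expr0 mulr1 ler_peMr //; first by apply: sumr_ge0.
  by apply: (E_ge1 hK); case/andP: ht.
rewrite exprS mulrCA; apply: (vop_weight hK) => //.
  by apply: iterv_bm; exact: ker_le hK.
by rewrite mulr_ge0 ?exprn_ge0 //; apply: sumr_ge0.
Qed.

Lemma n1_ge (d : I -> R) i : `|d i| <= n1 d.
Proof. by rewrite /n1 (bigD1 i) //= lerDl sumr_ge0. Qed.

Lemma volterra_ex : exists y, [/\
  forall b, a <= b -> bmv a b y,
  forall t i, a <= t -> y t i = c i + vop a g y t i &
  forall b beta K, kernel_on a b g beta K -> forall t, a <= t <= b ->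
    n1 (y t) <= 2 * n1 c * expR ((2 * K + 1) * (t - a))].
Proof.
have geoS (n m : nat) : \sum_(n <= k < n + m) 2^-1 ^+ k <= 2 * 2^-1 ^+ n :> R.
  suff h : \sum_(n <= k < n + m) 2^-1 ^+ k = 2 * 2^-1 ^+ n - 2 * 2^-1 ^+ (n + m) :> R.
    by rewrite h gerBl mulr_ge0 // exprn_ge0.
  elim: m => [|m IH]; first by rewrite addn0 subrr big_geq.
  by rewrite addnS big_nat_recr ?leq_addr //= IH exprS; field.
have Sdiff b beta K (hK : kernel_on a b g beta K) n m t : a <= t <= b ->
    n1 (fun i => S (n + m) t i - S n t i) <=
    2 * n1 c * 2^-1 ^+ n * expR ((2 * K + 1) * (t - a)).
  move=> ht.
  have -> : n1 (fun i => S (n + m) t i - S n t i) =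
      n1 (fun i => \sum_(n <= k < n + m) iterv k t i).
    apply: eq_bigr => i _; congr (`|_|).
    rewrite /S -!(big_mkord xpredT (fun k => iterv k t i)).
    by rewrite (@big_cat_nat _ _ _ n 0 (n + m)) //= ?leq_addr // addrAC subrr add0r.
  apply: le_trans (_ : \sum_(n <= k < n + m) n1 (iterv k t) <= _).
    rewrite /n1 exchange_big /=; apply: ler_sum => i _; exact: ler_norm_sum.
  apply: le_trans (_ : \sum_(n <= k < n + m)
      n1 c * 2^-1 ^+ k * expR ((2 * K + 1) * (t - a)) <= _).
    by apply: ler_sum => k _; exact: iterv_le hK _ ht.
  rewrite -mulr_suml -mulr_sumr ler_wpM2r ?expR_ge0 //.
  rewrite -mulrA mulrCA ler_wpM2l ?geoS //; exact: sumr_ge0.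
have cvS t i : a <= t -> cvgn (fun n => S n t i).
  move=> at_; have [beta [K hK]] := hg at_.
  apply/cauchy_cvgP/cauchy_ballP => e e0.
  have q01 : 0 <= (2^-1 : R) < 1.
    by apply/andP; split; [rewrite invr_ge0|rewrite invf_lt1 ?ltr1n].
  have e2 : 0 < e / 2 by rewrite divr_gt0.
  have [N HN] := geo_small (2 * n1 c * expR ((2 * K + 1) * (t - a))) q01 e2.
  have hN n : (N <= n)%N -> `|S n t i - S N t i| < e / 2.
    move=> Nn; rewrite -(subnKC Nn).
    apply: le_lt_trans (n1_ge (fun i => S (N + (n - N)) t i - S N t i) i) _.
    apply: le_lt_trans (Sdiff _ _ _ hK N (n - N)%N t _) _; first by rewrite at_ lexx.
    by have := HN N (leqnn _); rewrite mulrAC.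
  pose Q := [set S n t i | n in [set n | (N <= n)%N]].
  exists (Q, Q) => /=.
    by split; exists N => // n hn; exists n.
  move=> [_ _] /= [[n hn <-] [m hm <-]]; rewrite -ball_normE /=.
  have := ler_distD (S N t i) (S n t i) (S m t i); rewrite (distrC (S N t i)).
  by have := hN n hn; have := hN m hm; lra.
pose y : R -> I -> R := fun t i => limn (fun n => S n t i).
have cvy t i : a <= t -> S n t i @[n --> \oo] --> y t i by move=> /cvS.
(* [Sdiff] in the limit of infinitely many terms. For $n = 0$, where the partial sum is empty, this
   is the growth bound of the solution. *)
have tail b beta K (hK : kernel_on a b g beta K) n t : a <= t <= b ->
    n1 (fun i => y t i - S n t i) <=
    2 * n1 c * 2^-1 ^+ n * expR ((2 * K + 1) * (t - a)).
  move=> ht; have at_ : a <= t by case/andP: ht.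
  rewrite leNgt; apply/negP; set B := _ * expR _; move=> hB.
  have e0 : 0 < (n1 (fun i => y t i - S n t i) - B) / (#|I|%:R + 1).
    by rewrite divr_gt0 //; lra.
  have : \forall m \near \oo, forall i, `|y t i - S m t i| <
      (n1 (fun i => y t i - S n t i) - B) / (#|I|%:R + 1).
    apply: filter_forall => i.
    exact: (@cvgrPdist_lt _ _ _ _ _ _ _).1 (cvy t i at_) _ e0.
  move=> [M _ HM].
  have {HM} := HM (n + M)%N (leq_addl _ _) => /= HM.
  have := Sdiff _ _ _ hK n M t ht; rewrite -/B.
  have h1 : n1 (fun i => y t i - S n t i) <=
      n1 (fun i => y t i - S (n + M) t i) + n1 (fun i => S (n + M) t i - S n t i).
    by rewrite /n1 -big_split /=; apply: ler_sum => i _; exact: ler_distD.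
  have h2 : n1 (fun i => y t i - S (n + M) t i) <=
      #|I|%:R * ((n1 (fun i => y t i - S n t i) - B) / (#|I|%:R + 1)).
    rewrite /n1; apply: le_trans (_ : \sum_(i : I) ((n1 (fun i => y t i - S n t i) - B) / (#|I|%:R + 1)) <= _).
      by apply: ler_sum => i _; apply: ltW.
    by rewrite sumr_const mulr_natl.
  have h3 : #|I|%:R * ((n1 (fun i => y t i - S n t i) - B) / (#|I|%:R + 1)) <
      n1 (fun i => y t i - S n t i) - B.
    rewrite mulrA ltr_pdivrMr; last by rewrite natr1 ltr0n.
    by rewrite mulrC ltr_pM2l; [rewrite ltrDl ltr01|lra].
  lra.
have ybm b : a <= b -> bmv a b y.
  move=> ab i; have [beta [K hK]] := hg ab; split.
    apply: (measurable_fun_cvg (h := fun n t => S n t i)) => [n|x].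
      have : bm a b (fun t => S n t i).
        rewrite /S; apply: (@bm_sum R a b _ _ (fun (k : 'I_n) t => iterv k t i)) => k.
        exact: iterv_bm.
      by case.
    by rewrite /= in_itv /= => /andP[ax _]; exact: cvy.
  exists (2 * n1 c * expR ((2 * K + 1) * (b - a))) => x hx.
  apply: le_trans (n1_ge (y x) i) _.
  have := tail _ _ _ hK 0%N x hx; rewrite expr0 mulr1.
  have -> : n1 (fun i => y x i - S 0 x i) = n1 (y x).
    by apply: eq_bigr => j _; rewrite /S big_ord0 subr0.
  move=> h; apply: le_trans h _; apply: ler_wpM2l.
    by rewrite mulr_ge0 //; exact: sumr_ge0.
  exact: (E_le hK).
exists y; split => //.
- move=> t i at_; have [beta [K hK]] := hg at_.
  have tt : a <= t <= t by rewrite at_ lexx.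
  apply/eqP; rewrite -subr_eq0 -normr_eq0 eq_le normr_ge0 andbT leNgt.
  apply/negP => h.
  have [|N /(_ N (leqnn _))] := @geo_small R 2^-1
      (3 * n1 c * expR ((2 * K + 1) * (t - a))) _ _ h.
    by apply/andP; split; [rewrite invr_ge0|rewrite invf_lt1 ?ltr1n].
  have Sbm n : bmv a t (S n).
    by move=> j; rewrite /S; apply: (@bm_sum R a t _ _ (fun (k : 'I_n) t => iterv k t j)) => k; exact: iterv_bm.
  have SV n : S n.+1 t i = c i + vop a g (S n) t i.
    rewrite /S big_ord_recl /=; congr (_ + _).
    rewrite /vop -itg_sum; last first.
      by move=> k; apply: (vop_intg hK); exact: iterv_bm.
    apply: eq_itg => x _; rewrite exchange_big /=.
    by apply: eq_bigr => j _; rewrite mulr_suml.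
  have dbm : bmv a t (fun r j => y r j - S N r j).
    move=> j; have -> : (fun r => y r j - S N r j) = (fun r => y r j + (-1) * S N r j).
      by apply/funext => r; rewrite mulN1r.
    by apply: bmD; [exact: ybm | apply: bmM; [exact: bm_cst|exact: Sbm]].
  have h1 : vop a g (fun r j => y r j - S N r j) t i = vop a g y t i - vop a g (S N) t i.
    rewrite /vop -itgB; last exact: (vop_intg hK).
      apply: eq_itg => x _; rewrite -sumrB; apply: eq_bigr => j _.
      by rewrite mulrBl.
    by apply: (vop_intg hK); exact: ybm.
  have C0 : 0 <= 2 * n1 c * 2^-1 ^+ N.
    by rewrite !mulr_ge0 ?exprn_ge0 //; exact: sumr_ge0.
  have h2 := vop_weight hK dbm C0 (fun s hs => tail _ _ _ hK N s hs) tt.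
  have h3 := n1_ge (vop a g (fun r j => y r j - S N r j) t) i.
  have h4 := tail _ _ _ hK N.+1 t tt.
  have h5 := n1_ge (fun j => y t j - S N.+1 t j) i.
  (* $y - (c + Vy) = (y - S_{N+1}) - V(y - S_N)$, and each of the two parts is at most $\|c\|
     2^{-N}$ times the weight; the constant 3 chosen above exceeds their sum. *)
  have : `|y t i - (c i + vop a g y t i)| <=
     `|y t i - S N.+1 t i| + `|vop a g (fun r j => y r j - S N r j) t i|.
    rewrite h1 SV.
    have -> : y t i - (c i + vop a g y t i) = (y t i - (c i + vop a g (S N) t i))
      - (vop a g y t i - vop a g (S N) t i) by ring.
    exact: ler_normB.
  move: h2 h4; rewrite exprS.
  set X := expR _; set q := 2^-1 ^+ N; set cc := n1 c.
  have -> : 2^-1 * (2 * cc * q) * X = cc * (q * X) by field.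
  have -> : 2 * cc * (2^-1 * q) * X = cc * (q * X) by field.
  have -> : 3 * cc * X * q = 3 * (cc * (q * X)) by ring.
  have : 0 <= cc * (q * X).
    by rewrite !mulr_ge0 ?expR_ge0 ?exprn_ge0 //; exact: sumr_ge0.
  lra.
- move=> b beta K hK t ht; have := tail _ _ _ hK 0%N t ht; rewrite expr0 mulr1.
  have -> // : n1 (fun i => y t i - S 0 t i) = n1 (y t).
  by apply: eq_bigr => j _; rewrite /S big_ord0 subr0.
Qed.

End Existence.
End Volterra.

(** * Square-integrable functions *)

Section SetIntegral.
Context (R : realType).
Local Notation C := R[i].
Notation mu := (@lebesgue_measure R).
Context (D : set R) (mD : measurable D).
Implicit Types (f g : R -> R) (h : R -> C).

Definition ig f := mu.-integrable D (EFin \o f).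

Lemma igD f g : ig f -> ig g -> ig (fun x => f x + g x).
Proof. by move=> hf hg; exact: (@integrableD _ _ _ mu _ _ _ _ hf hg). Qed.

Lemma igZ (k : R) f : ig f -> ig (fun x => k * f x).
Proof. by move=> hf; exact: (@integrableZl _ _ _ mu _ _ k _ hf). Qed.

Lemma igB f g : ig f -> ig g -> ig (fun x => f x - g x).
Proof. by move=> hf hg; exact: (@integrableB _ _ _ mu _ _ _ _ hf hg). Qed.

Lemma eq_ig f g : (forall x, D x -> f x = g x) -> ig f -> ig g.
Proof.
by move=> fg; apply: eq_integrable => // x; rewrite inE /= => h; rewrite fg.
Qed.

Lemma ig_le f g : measurable_fun D f -> ig g ->
  (forall x, D x -> `|f x| <= g x) -> ig f.
Proof.
move=> mf ig h; apply: (le_integrable _ _ _ ig) => //.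
  exact/measurable_EFinP.
by move=> x Dx; rewrite /= lee_fin (le_trans (h x Dx)) // ler_norm.
Qed.

Definition cig h := cintegrable D h.

Lemma cigD h h' : cig h -> cig h' -> cig (fun x => h x + h' x).
Proof.
move=> [a b] [c d]; split.
  by apply: eq_ig (igD a c) => x _; rewrite ReD.
by apply: eq_ig (igD b d) => x _; rewrite ImD.
Qed.

Lemma cigZ (z : C) h : cig h -> cig (fun x => z * h x).
Proof.
move=> [a b]; split.
  by apply: eq_ig (igB (igZ (complex.Re z) a) (igZ (complex.Im z) b)) => x _; rewrite ReM.
by apply: eq_ig (igD (igZ (complex.Re z) b) (igZ (complex.Im z) a)) => x _; rewrite ImM.
Qed.

Lemma cig_conj h : cig h -> cig (fun x => Num.conj (h x)).
Proof.
move=> [a b]; split; first by apply: eq_ig a => x _; rewrite ReJ.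
by apply: eq_ig (igZ (-1) b) => x _; rewrite ImJ mulN1r.
Qed.

Lemma eq_cig h h' : (forall x, D x -> h x = h' x) -> cig h -> cig h'.
Proof. by move=> hh [a b]; split; [apply: eq_ig a|apply: eq_ig b] => x /hh ->. Qed.

Lemma eq_cintegral h h' : (forall x, D x -> h x = h' x) ->
  cintegral D h = cintegral D h'.
Proof.
by move=> hh; congr (_ +i* _); apply: eq_Rintegral => x /[!inE] /hh ->.
Qed.

Lemma cintegralD h h' : cig h -> cig h' ->
  cintegral D (fun x => h x + h' x) = cintegral D h + cintegral D h'.
Proof.
move=> [a b] [c d]; rewrite /cintegral; congr (_ +i* _).
  by rewrite -RintegralD //; apply: eq_Rintegral => x _; rewrite ReD.
by rewrite -RintegralD //; apply: eq_Rintegral => x _; rewrite ImD.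
Qed.

Lemma cintegralZ (z : C) h : cig h ->
  cintegral D (fun x => z * h x) = z * cintegral D h.
Proof.
move=> [a b]; case: z => z1 z2; rewrite /cintegral; congr (_ +i* _).
  rewrite -!RintegralZl // -RintegralB //; [|exact: igZ..].
  by apply: eq_Rintegral => x _; rewrite ReM.
rewrite -!RintegralZl // -RintegralD //; [|exact: igZ..].
by apply: eq_Rintegral => x _; rewrite ImM.
Qed.

Lemma cintegral_conj h : cig h ->
  cintegral D (fun x => Num.conj (h x)) = Num.conj (cintegral D h).
Proof.
move=> [a b]; rewrite /cintegral conjE /=; congr (_ +i* _).
  by apply: eq_Rintegral => x _; rewrite ReJ.
rewrite -mulN1r -RintegralZl //.
by apply: eq_Rintegral => x _; rewrite ImJ mulN1r.
Qed.

Lemma cig0 : cig (fun=> 0).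
Proof.
by split; apply: (eq_integrable _ (fun=> 0%E)) => //; exact: integrable0.
Qed.

Lemma cintegral0 : cintegral D (fun=> 0) = 0.
Proof. by rewrite /cintegral !Rintegral_cst // !mul0r. Qed.

Lemma cig_sum (I : Type) (s : seq I) (F : I -> R -> C) :
  (forall i, cig (F i)) -> cig (fun x => \sum_(i <- s) F i x).
Proof.
move=> h; elim: s => [|i s IH].
  by apply: eq_cig cig0 => x _; rewrite big_nil.
by apply: eq_cig (cigD (h i) IH) => x _; rewrite big_cons.
Qed.

Lemma cintegral_sum (I : Type) (s : seq I) (F : I -> R -> C) :
  (forall i, cig (F i)) ->
  cintegral D (fun x => \sum_(i <- s) F i x) = \sum_(i <- s) cintegral D (F i).
Proof.
move=> h; elim: s => [|i s IH].
  by rewrite big_nil -[RHS]cintegral0; apply: eq_cintegral => x _; rewrite big_nil.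
rewrite big_cons -IH -cintegralD //; last exact: cig_sum.
by apply: eq_cintegral => x _; rewrite big_cons.
Qed.

(** The factor 2 stems from bounding the real and the imaginary part separately; it reappears in the
    constants of all later estimates. *)
Lemma cintegral_nm (h : R -> C) (g : R -> R) : cig h -> ig g ->
  (forall x, D x -> nm (h x) <= g x) ->
  nm (cintegral D h) <= 2 * \int[mu]_(x in D) g x.
Proof.
move=> [a b] hg hh; apply: le_trans (nm_ReIm _) _; rewrite /cintegral /=.
have key (f : R -> R) : ig f -> (forall x, D x -> `|f x| <= g x) ->
    `|\int[mu]_(x in D) f x| <= \int[mu]_(x in D) g x.
  move=> hf hfg; apply: le_trans (le_normr_Rintegral _ hf) _ => //.
  apply: le_Rintegral => //; exact: (integrable_abse hf).
rewrite mulr_natl mulr2n; apply: lerD.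
  exact: key _ a (fun x Dx => le_trans (nm_Re _) (hh x Dx)).
exact: key _ b (fun x Dx => le_trans (nm_Im _) (hh x Dx)).
Qed.

End SetIntegral.

(** * Translation invariance of the integral *)

Section Translation.
Context (R : realType).
Notation mu := (@lebesgue_measure R).

Let shiftr (s x : measurableTypeR R) : measurableTypeR R := x + s.

Lemma measurable_shiftr s : measurable_fun setT (shiftr s).
Proof. by apply: measurable_funD => //; exact: measurable_cst. Qed.

(** Lebesgue measure is determined by its values on half-open intervals, where the image measure
    takes the same values. *)
Lemma lebesgue_shift (s : R) (A : set R) : measurable A ->
  mu ((fun r => r + s) @^-1` A) = mu A.
Proof.
move=> mA; have := @lebesgue_measure_unique R (pushforward mu (shiftr s)).
move=> /(_ (measurable_shiftr s)) h; apply/esym; apply: (h _ A mA) => _ [[x y] _ <-]; rewrite /pushforward.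
rewrite -[RHS]/(mu (shiftr s @^-1` `]x, y])).
have -> : shiftr s @^-1` `]x, y] = `]x - s, y - s]%classic.
  by apply/seteqP; split => r /=; rewrite /shiftr !in_itv /= ltrBlDr lerBrDr.
rewrite /= !lebesgue_measure_itv /= !lte_fin ltrD2r.
by case: ifP => // _; rewrite -!EFinB; congr (_%:E); ring.
Qed.

Lemma integral_shift (s : R) (D : set R) (f : R -> \bar R) : measurable D ->
  measurable_fun D f ->
  (\int[mu]_(x in (fun r => r + s)%R @^-1` D) f (x + s)%R = \int[mu]_(x in D) f x)%E.
Proof.
move=> mD mf.
have h (g : R -> \bar R) : measurable_fun D g -> (forall x, D x -> (0 <= g x)%E) ->
   (\int[mu]_(x in (fun r => r + s)%R @^-1` D) g (x + s)%R = \int[mu]_(x in D) g x)%E.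
  move=> mg g0.
  rewrite -(@ge0_integral_pushforward _ _ _ _ _ (shiftr s) (measurable_shiftr s) mu D g) //.
    apply: eq_measure_integral; first exact: (measurable_shiftr s).
    by move=> ? B mB _; exact: (lebesgue_shift s mB).
  by move=> y; rewrite inE; exact: g0.
rewrite integralE [RHS]integralE; congr (_ - _)%E.
  rewrite -(h (f^\+)%E (measurable_funepos mf) (fun x _ => funepos_ge0 f x)).
  by apply: eq_integral => x _; rewrite !funeposE.
rewrite -(h (f^\-)%E (measurable_funeneg mf) (fun x _ => funeneg_ge0 f x)).
by apply: eq_integral => x _; rewrite !funenegE.
Qed.

Lemma integrable_shift (s : R) (D : set R) (f : R -> R) : measurable D ->
  ig D f -> ig ((fun r => r + s) @^-1` D) (fun x => f (x + s)).
Proof.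
move=> mD /integrableP[mf hf]; apply/integrableP; split.
  have -> : EFin \o (fun x => f (x + s)) = (EFin \o f) \o shiftr s by [].
  apply: (measurable_comp (F := D)) => //.
    by move=> _ [x Dx <-].
  by apply: measurable_funTS; exact: measurable_shiftr.
rewrite (_ : (fun x => `|(EFin \o (fun x => f (x + s)%R)) x|)%E =
   (fun x => (fun y => `|(EFin \o f) y|%E) (x + s))) //.
have -> // : (\int[mu]_(x in (fun r => r + s)%R @^-1` D) `|(EFin \o f) (x + s)%R| =
  \int[mu]_(x in D) `|(EFin \o f) x|)%E.
apply: (integral_shift s (f := fun x => `|(EFin \o f) x|%E)) => //.
exact: measurableT_comp.
Qed.

Lemma Rintegral_shift (s : R) (D : set R) (f : R -> R) : measurable D -> ig D f ->
  \int[mu]_(x in (fun r => r + s) @^-1` D) f (x + s) = \int[mu]_(x in D) f x.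
Proof.
move=> mD hf; congr fine.
by apply: (integral_shift s (f := EFin \o f)) => //; case/integrableP: hf.
Qed.

Lemma itg_shift (s a b : R) (f : R -> R) : intg (a + s) (b + s) f ->
  intg a b (fun x => f (x + s)) /\ itg a b (fun x => f (x + s)) = itg (a + s) (b + s) f.
Proof.
have e : (fun r => r + s) @^-1` `[a + s, b + s] = `[a, b]%classic.
  by apply/seteqP; split => r /=; rewrite !in_itv /= !lerD2r.
move=> h; split; first by have := integrable_shift s _ h; rewrite e; apply.
by rewrite /itg -(Rintegral_shift s _ h) // e.
Qed.

End Translation.

Section Parseval.
Context (R : realType) (k : hilbertType R) (e : nat -> k) (he : is_onb e).
Local Notation C := R[i].

Lemma onb_sum (n m : nat) (c : nat -> C) :
  nm (\sum_(n <= j < m) c j *: e j.+1) ^+ 2 = \sum_(n <= j < m) nm (c j) ^+ 2.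
Proof.
apply: complexI; rewrite -dotxx dot_suml rmorph_sum /=.
apply: eq_big_nat => j hj; rewrite dotZl dot_sumr (bigD1_seq j) ?iota_uniq //=; last first.
  by rewrite mem_index_iota.
rewrite dotZr (onb_dot he) // eqxx big1 => [|i ij].
  by rewrite addr0 mulr1 nm_sq mulrC.
by rewrite dotZr (onb_dot he) // eqSS eq_sym (negbTE ij) mulr0.
Qed.

(** By Bessel's inequality the partial sums of the expansion are Cauchy, and totality of the basis
    identifies their limit with [x]. The identity writes $\|f(s)\|^2$ as a limit of weakly
    measurable expressions ([nm_meas]). *)
Lemma parseval x :
  (\sum_(0 <= j < n) nm (dot (e j.+1) x) ^+ 2) @[n --> \oo] --> nm x ^+ 2.
Proof.
pose c j := dot (e j.+1) x.
pose p n := \sum_(0 <= j < n) c j *: e j.+1.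
pose s n := \sum_(0 <= j < n) nm (c j) ^+ 2.
have dp n : dot x (p n) = (s n)%:C.
  rewrite dot_sumr rmorph_sum; apply: eq_bigr => j _.
  by rewrite dotZr (dot_conj (e j.+1)) -nm_sq.
have bessel n : nm (x - p n) ^+ 2 = nm x ^+ 2 - s n.
  rewrite nm_sqD dotNr dp nmN /p onb_sum -/(s n) -rmorphN /=; ring.
have s_le n : s n <= nm x ^+ 2 by have := sqr_ge0 (nm (x - p n)); rewrite bessel subr_ge0.
have snd n m : (n <= m)%N -> s n <= s m.
  move=> nm_; rewrite /s (@big_cat_nat _ _ _ n 0 m) //= lerDl.
  by apply: sumr_ge0 => j _; exact: sqr_ge0.
have hs : has_sup (range s).
  by split; [exists (s 0%N), 0%N | exists (nm x ^+ 2) => _ [n _ <-]].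
have hub n : s n <= sup (range s).
  by apply: ub_le_sup; [exact: hs.2 | exists n].
have [l pl] : exists l, to p l.
  apply: cauchy_to => d d0.
  have [_ [N _ <-] hN] := sup_adherent (exprn_gt0 2 (divr_gt0 d0 (ltr0Sn R 1))) hs.
  have near n : (N <= n)%N -> nm (p n - p N) < d / 2.
    move=> Nn; rewrite -(@ltr_pXn2r _ 2) ?nnegrE ?nm_ge0 //; last by rewrite divr_ge0 ?ltW.
    have -> : p n - p N = \sum_(N <= j < n) c j *: e j.+1.
      by rewrite /p (@big_cat_nat _ _ _ N 0 n) //= addrAC subrr add0r.
    rewrite onb_sum; apply: le_lt_trans (_ : s n - s N < _).
      by rewrite /s (@big_cat_nat _ _ _ N 0 n) //= addrAC subrr add0r.
    by have := hub n; rewrite -/(2%:R); lra.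
  exists N => n m hn hm; have := nmB_trans (p N) (p n) (p m); rewrite (nmBC (p N)).
  by have := near n hn; have := near m hm; lra.
have -> : x = l.
  apply/eqP; rewrite -subr_eq0; apply/eqP.
  apply: (total_setP (onb_total he)) => _ [[|j] [// _ ->]].
  rewrite dotBr; apply/eqP; rewrite subr_eq0; apply/eqP.
  apply: to_unique (to_dotr (e j.+1) pl).
  apply: to_ev (to_cst _); exists j.+1 => n hn.
  rewrite dot_sumr (bigD1_seq j) ?iota_uniq //= ?mem_index_iota //.
  rewrite dotZr (onb_dot he) // eqxx mulr1 big1 ?addr0 // => i ij.
  by rewrite dotZr (onb_dot he) // eqSS eq_sym (negbTE ij) mulr0.
apply/cvgrPdist_lt => d d0.
have [M hM] := to_bounded pl.
have B0 : 0 < nm l + M + 1.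
  by have := nm_ge0 l; have := le_trans (nm_ge0 _) (hM 0%N); lra.
have [N HN] := pl _ (divr_gt0 d0 B0).
exists N => // n /= /HN; rewrite ltr_pdivlMr // => h.
have -> : \sum_(0 <= j < n) nm (dot (e j.+1) l) ^+ 2 = nm (p n) ^+ 2.
  rewrite /p onb_sum; apply: eq_bigr => j _; congr (nm _ ^+ 2).
  rewrite /c; apply: (to_unique (to_dotr (e j.+1) pl)).
  apply: to_ev (to_cst _); exists j.+1 => m hm.
  rewrite dot_sumr (bigD1_seq j) ?iota_uniq //= ?mem_index_iota //.
  rewrite dotZr (onb_dot he) // eqxx mulr1 big1 ?addr0 // => i ij.
  by rewrite dotZr (onb_dot he) // eqSS eq_sym (negbTE ij) mulr0.
rewrite subr_sqr normrM; have := nm_distB l (p n); rewrite nmBC => h2.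
have h3 : `|nm l + nm (p n)| <= nm l + M + 1.
  by rewrite ger0_norm ?addr_ge0 ?nm_ge0 //; have := hM n; lra.
apply: le_lt_trans h; apply: ler_pM => //.
Qed.

Lemma dot_e_le j x : (0 < j)%N -> nm (dot (e j) x) <= nm x.
Proof.
move=> j0; apply: le_trans (CS _ _) _; rewrite -[leRHS]mul1r ler_wpM2r ?nm_ge0 //.
rewrite -(@ler_pXn2r _ 2) ?nnegrE ?nm_ge0 // expr1n -lecR -dotxx (onb_dot he) //.
by rewrite eqxx.
Qed.

End Parseval.

Section L2.
Context (R : realType) (k : hilbertType R) (e : nat -> k) (he : is_onb e).
Local Notation C := R[i].
Notation mu := (@lebesgue_measure R).
Notation Rp := (Rplus R).
Implicit Types f g : R -> k.

Definition wmeas (D : set R) f := forall x : k,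
  measurable_fun D (fun s => complex.Re (dot x (f s))) /\
  measurable_fun D (fun s => complex.Im (dot x (f s))).

Lemma measurable_Rplus : measurable Rp.
Proof. exact: measurable_itv. Qed.
Hint Resolve measurable_Rplus : core.

Lemma wmeasD D f g : wmeas D f -> wmeas D g -> wmeas D (fun s => f s + g s).
Proof.
move=> hf hg x; have [a b] := hf x; have [c d] := hg x; split.
  by under eq_fun do rewrite dotDr ReD; exact: measurable_funD.
by under eq_fun do rewrite dotDr ImD; exact: measurable_funD.
Qed.

Lemma wmeasZ D f (z : C) : wmeas D f -> wmeas D (fun s => z *: f s).
Proof.
move=> hf x; have [a b] := hf x; split.
  under eq_fun do rewrite dotZr ReM.
  by apply: measurable_funB; apply: measurable_funM => //; exact: measurable_cst.
under eq_fun do rewrite dotZr ImM.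
by apply: measurable_funD; apply: measurable_funM => //; exact: measurable_cst.
Qed.

Lemma nm_meas D f : measurable D -> wmeas D f -> measurable_fun D (fun s => nm (f s) ^+ 2).
Proof.
move=> mD hf; apply: (measurable_fun_cvg
  (h := fun n s => \sum_(0 <= j < n) nm (dot (e j.+1) (f s)) ^+ 2)) => [n|s _].
  apply: measurable_sum => j; have [a b] := hf (e j.+1).
  under eq_fun do rewrite nm_sqE.
  by apply: measurable_funD; apply: measurable_funX.
exact: parseval.
Qed.

Lemma L2P f : L2 f <-> wmeas Rp f /\ ig Rp (fun s => nm (f s) ^+ 2).
Proof.
have E s : complex.Re (`|f s| ^+ 2) = nm (f s) ^+ 2 by rewrite normE -rmorphXn.
split=> [[hf hi]|[hf /integrableP[_ hi]]]; split => //.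
  apply/integrableP; split; first by apply/measurable_EFinP; exact: nm_meas.
  apply: le_lt_trans hi; rewrite le_eqVlt; apply/orP; left; apply/eqP.
  by apply: eq_integral => s _; rewrite /= ger0_norm ?sqr_ge0 // -E.
apply: le_lt_trans hi; rewrite le_eqVlt; apply/orP; left; apply/eqP.
by apply: eq_integral => s _; rewrite /= ger0_norm ?sqr_ge0 // -E.
Qed.

Lemma L2D f g : L2 f -> L2 g -> L2 (fun s => f s + g s).
Proof.
move=> /L2P[hf fi] /L2P[hg gi]; apply/L2P; split; first exact: wmeasD.
apply: (@ig_le _ _ _ _ (fun s => 2 * nm (f s) ^+ 2 + 2 * nm (g s) ^+ 2)) => //.
- by apply: nm_meas => //; exact: wmeasD.
- by apply: igD => //; apply: igZ.
- move=> s _; rewrite ger0_norm ?sqr_ge0 //.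
  have := nmD (f s) (g s); have := nm_ge0 (f s + g s).
  have := sqr_ge0 (nm (f s) - nm (g s)); have := nm_ge0 (f s); have := nm_ge0 (g s).
  nra.
Qed.

Lemma L2Z f (z : C) : L2 f -> L2 (fun s => z *: f s).
Proof.
move=> /L2P[hf fi]; apply/L2P; split; first exact: wmeasZ.
apply: eq_ig (igZ _ (nm z ^+ 2) fi) => // s _; by rewrite nmZ exprMn.
Qed.

Lemma L2_0 : L2 (fun=> 0 : k).
Proof.
apply/L2P; split; first by move=> x; rewrite dot0r; split; exact: measurable_cst.
apply: (eq_ig _ (f := fun=> 0)) => // [s _|]; first by rewrite nm0 expr0n.
by have [] := cig0 measurable_Rplus.
Qed.

(** The common form of [before], [after], [glue] and [ind], so that their weak measurability is
    settled by one argument. *)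
Definition patchf (D : set R) f g : R -> k := fun s => if s \in D then g s else f s.

Lemma L2_patch D f g : measurable D -> L2 f -> L2 g -> L2 (patchf D f g).
Proof.
move=> mD /L2P[hf fi] /L2P[hg gi].
have w : wmeas Rp (patchf D f g).
  have h (a b : R -> R) : measurable_fun Rp a -> measurable_fun Rp b ->
      measurable_fun Rp (fun s => if s \in D then a s else b s).
    move=> ma mb.
    have -> : (fun s => if s \in D then a s else b s) =
        (fun s => \1_D s * a s + (1 - \1_D s) * b s).
      apply/funext => s; rewrite indicE; case: ifP => _.
        by rewrite mul1r subrr mul0r addr0.
      by rewrite mul0r subr0 mul1r add0r.
    have m1 : measurable_fun Rp (\1_D : R -> R).
      by apply: measurable_funTS; exact: measurable_indic.
    apply: measurable_funD; apply: measurable_funM => //.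
    by apply: measurable_funB => //; exact: measurable_cst.
  move=> x; have [a b] := hf x; have [c d] := hg x; split.
    by have := h _ _ c a; congr measurable_fun; apply/funext => s; rewrite /patchf; case: ifP.
  by have := h _ _ d b; congr measurable_fun; apply/funext => s; rewrite /patchf; case: ifP.
apply/L2P; split => //.
apply: (@ig_le _ _ _ _ (fun s => nm (f s) ^+ 2 + nm (g s) ^+ 2)) => //.
- exact: nm_meas.
- exact: igD.
- move=> s _; rewrite ger0_norm ?sqr_ge0 // /patchf; case: ifP => _.
    by rewrite lerDr sqr_ge0.
  by rewrite lerDl sqr_ge0.
Qed.

Lemma measurable_ltset (t : R) : measurable [set s : R | s < t].
Proof.
rewrite (_ : [set s | _] = `]-oo, t[%classic) //.
Qed.

Lemma beforeE t f : before t f = patchf [set s | s < t] (fun=> 0) f.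
Proof.
apply/funext => s; rewrite /before /patchf.
have -> // : (s \in [set s | s < t]) = (s < t).
by apply/idP/idP => [/set_mem|h]; [|apply/mem_set].
Qed.

Lemma afterE t f : after t f = patchf [set s | s < t] f (fun=> 0).
Proof.
apply/funext => s; rewrite /after /patchf.
have -> // : (s \in [set s | s < t]) = (s < t).
by apply/idP/idP => [/set_mem|h]; [|apply/mem_set].
Qed.

Definition glue (t : R) f g : R -> k := fun s => if s < t then f s else g s.

Lemma glueE t f g : glue t f g = patchf [set s | s < t] g f.
Proof.
apply/funext => s; rewrite /glue /patchf.
have -> // : (s \in [set s | s < t]) = (s < t).
by apply/idP/idP => [/set_mem|h]; [|apply/mem_set].
Qed.

Lemma L2_before t f : L2 f -> L2 (before t f).
Proof. by move=> hf; rewrite beforeE; apply: L2_patch (measurable_ltset t) L2_0 hf. Qed.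

Lemma L2_after t f : L2 f -> L2 (after t f).
Proof. by move=> hf; rewrite afterE; apply: L2_patch (measurable_ltset t) hf L2_0. Qed.

Lemma L2_glue t f g : L2 f -> L2 g -> L2 (glue t f g).
Proof. by move=> hf hg; rewrite glueE; apply: L2_patch (measurable_ltset t) hg hf. Qed.

Lemma L2_shift s f : 0 <= s -> L2 f -> L2 (fun r => f (r + s)).
Proof.
move=> s0 /L2P[hf fi]; apply/L2P.
have sub : Rp `<=` (fun r => r + s) @^-1` Rp.
  move=> x; rewrite /preimage /Rplus /= !in_itv /= !andbT => x0.
  by rewrite addr_ge0.
have mS : measurable ((fun r => r + s) @^-1` Rp).
  rewrite -[X in measurable X]setTI; exact: measurable_shiftr.
split.
  have h (a : R -> R) : measurable_fun Rp a -> measurable_fun Rp (fun r => a (r + s)).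
    move=> ma; apply: (measurable_comp (F := Rp)) ma _ => //.
      by move=> _ [x hx <-]; apply: sub.
    by apply: measurable_funTS; exact: measurable_shiftr.
  by move=> x; have [a b] := hf x; split; [exact: h a|exact: h b].
by apply: integrableS (integrable_shift s _ fi).
Qed.

(** Added to a control, it stands for one more quantum in the direction [e l] during $[a,b)$; see
    [cadd]. *)
Definition ind (a b : R) (l : nat) : R -> k := fun s => if a <= s < b then e l else 0.

Lemma L2_ind a b l : L2 (ind a b l).
Proof.
have mI : measurable `[a, b[%classic by [].
have -> : ind a b l = patchf `[a, b[ (fun=> 0) (fun=> if a <= b then e l else 0).
  apply/funext => s; rewrite /ind /patchf.
  have -> : (s \in `[a, b[%classic) = (a <= s < b).
    by apply/idP/idP => [/set_mem|h]; [|apply/mem_set]; rewrite /= in_itv.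
  by case: ifP => // /andP[h1 h2]; rewrite (le_trans h1 (ltW h2)).
have w : wmeas Rp (patchf `[a, b[ (fun=> 0) (fun=> if a <= b then e l else 0)).
  have h (z : R) : measurable_fun Rp (fun s => if s \in `[a, b[%classic then z else 0).
    have -> : (fun s => if s \in `[a, b[%classic then z else 0) =
        (fun s => \1_(`[a, b[%classic) s * z).
      apply/funext => s; rewrite indicE; case: ifP => _.
        by rewrite mul1r.
      by rewrite mul0r.
    apply: measurable_funM; last exact: measurable_cst.
    by apply: measurable_funTS; exact: measurable_indic.
  move=> x; split.
    have := h (complex.Re (dot x (if a <= b then e l else 0))).
    by congr measurable_fun; apply/funext => s; rewrite /patchf; case: ifP => // _; rewrite dot0r.
  have := h (complex.Im (dot x (if a <= b then e l else 0))).
  by congr measurable_fun; apply/funext => s; rewrite /patchf; case: ifP => // _; rewrite dot0r.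
apply/L2P; split => //.
have i1 : ig `[a, b[ (fun=> nm (e l) ^+ 2).
  apply: integrableS (intg_cst a b (nm (e l) ^+ 2)) => //.
  by apply: subset_itv; rewrite bnd_simp.
have : ig (Rp `&` `[a, b[) (fun=> nm (e l) ^+ 2).
  by apply: integrableS i1 => //; exact: measurableI.
rewrite /ig => hI; have := (integrable_restrict mu mI measurable_Rplus
    (EFin \o (fun=> nm (e l) ^+ 2))).1 hI.
apply: eq_integrable => // s _.
rewrite /patchf /patch /=; case: ifP => // h.
  by have := set_mem h; rewrite /= in_itv /= => /andP[h1 h2]; rewrite (le_trans h1 (ltW h2)).
by rewrite nm0 expr0n.
Qed.

(** Polarization expresses the real part by $\|f+g\|^2$, $\|f\|^2$ and $\|g\|^2$; the imaginary part
    is the real part of $\langle f, -ig\rangle$. *)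
Lemma dot_cig f g : L2 f -> L2 g -> cig Rp (fun s => dot (f s) (g s)).
Proof.
have re f' g' : L2 f' -> L2 g' -> ig Rp (fun s => complex.Re (dot (f' s) (g' s))).
  move=> hf hg; have /L2P[_ h1] := L2D hf hg; have /L2P[_ h2] := hf; have /L2P[_ h3] := hg.
  apply: eq_ig (igZ _ 2^-1 (igB _ (igB _ h1 h2) h3)) => // s _.
  by rewrite nm_sqD; field.
move=> hf hg; split; first exact: re.
apply: eq_ig (re _ _ hf (L2Z (- 'i) hg)) => // s _.
by rewrite dotZr; case: (dot (f s) (g s)) => a b /=; ring.
Qed.

Lemma L2dotDl f f' g : L2 f -> L2 f' -> L2 g ->
  L2dot (fun s => f s + f' s) g = L2dot f g + L2dot f' g.
Proof.
move=> hf hf' hg; rewrite /L2dot -cintegralD //; [|exact: dot_cig..].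
by apply: eq_cintegral => s _; rewrite dotDl.
Qed.

Lemma L2dotDr f g g' : L2 f -> L2 g -> L2 g' ->
  L2dot f (fun s => g s + g' s) = L2dot f g + L2dot f g'.
Proof.
move=> hf hg hg'; rewrite /L2dot -cintegralD //; [|exact: dot_cig..].
by apply: eq_cintegral => s _; rewrite dotDr.
Qed.

Lemma L2dotZr (z : C) f g : L2 f -> L2 g -> L2dot f (fun s => z *: g s) = z * L2dot f g.
Proof.
move=> hf hg; rewrite /L2dot -cintegralZ //; last exact: dot_cig.
by apply: eq_cintegral => s _; rewrite dotZr.
Qed.

Lemma L2dotC f g : L2 f -> L2 g -> L2dot g f = Num.conj (L2dot f g).
Proof.
move=> hf hg; rewrite /L2dot -cintegral_conj //; last exact: dot_cig.
by apply: eq_cintegral => s _; rewrite dot_conj.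
Qed.

Lemma L2dotZl (z : C) f g : L2 f -> L2 g ->
  L2dot (fun s => z *: f s) g = Num.conj z * L2dot f g.
Proof.
move=> hf hg; rewrite (L2dotC hg (L2Z z hf)) L2dotZr // cjM.
by rewrite -(L2dotC hg hf).
Qed.

Lemma L2dot0r f : L2dot f (fun=> 0) = 0.
Proof. by rewrite /L2dot -[RHS](cintegral0 measurable_Rplus) //; apply: eq_cintegral => s _; rewrite dot0r. Qed.

Lemma L2dot_ge0 f : 0 <= L2dot f f.
Proof.
rewrite lecE /= /L2dot /cintegral /=; apply/andP; split.
  rewrite (_ : \int[mu]_(s in Rp) _ = \int[mu]_(s in Rp) 0); last first.
    by apply: eq_Rintegral => s _; rewrite dotxx.
  by rewrite Rintegral_cst // mul0r.
by apply: Rintegral_ge0 => s _; rewrite dotxx /= sqr_ge0.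
Qed.

Lemma L2dot_glue t f f' g g' : L2 f -> L2 f' -> L2 g -> L2 g' ->
  L2dot (glue t f f') (glue t g g') =
  L2dot (before t f) (before t g) + L2dot (after t f') (after t g').
Proof.
move=> hf hf' hg hg'; rewrite /L2dot -cintegralD //; last first.
- by apply: dot_cig; exact: L2_after.
- by apply: dot_cig; exact: L2_before.
apply: eq_cintegral => s _; rewrite /glue /before /after.
by case: ifP => _; rewrite dot0r ?addr0 ?add0r.
Qed.

Lemma glue_id t f : glue t f f = f.
Proof. by apply/funext => s; rewrite /glue if_same. Qed.

Lemma L2dot_split t f g : L2 f -> L2 g ->
  L2dot f g = L2dot (before t f) (before t g) + L2dot (after t f) (after t g).
Proof. by move=> hf hg; rewrite -L2dot_glue // !glue_id. Qed.

Lemma L2dot_shift s f g : 0 <= s -> L2 f -> L2 g ->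
  L2dot (after s f) (after s g) = L2dot (fun r => f (r + s)) (fun r => g (r + s)).
Proof.
move=> s0 hf hg.
have [i1 i2] := dot_cig (L2_after s hf) (L2_after s hg).
have sub : Rp `<=` (fun r => r + s) @^-1` Rp.
  move=> x; rewrite /preimage /Rplus /= !in_itv /= !andbT => x0.
  by rewrite addr_ge0.
have key (F : R -> R) : ig Rp F -> (forall r, r < s -> F r = 0) ->
    \int[mu]_(r in Rp) F r = \int[mu]_(r in Rp) F (r + s).
  move=> iF F0; rewrite -(Rintegral_shift s _ iF) //.
  rewrite Rintegral_mkcond [RHS]Rintegral_mkcond; apply: eq_Rintegral => r _.
  rewrite /patch; case: ifPn => [/set_mem h1|h1]; case: ifPn => [h2|h2] //.
    rewrite F0 //; move: h2; rewrite notin_setE /Rplus /= in_itv /= andbT => /negP.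
    by rewrite -ltNge => h2; rewrite -ltrBrDr subrr.
  by case/negP: h1; apply/mem_set/sub/set_mem.
rewrite /L2dot /cintegral; congr (_ +i* _).
  rewrite key //; last by move=> r h; rewrite /after h dot0r.
  apply: eq_Rintegral => r /set_mem; rewrite /Rplus /= in_itv /= andbT => r0.
  by rewrite /after ltNge (_ : s <= r + s) //=; lra.
rewrite key //; last by move=> r h; rewrite /after h dot0r.
apply: eq_Rintegral => r /set_mem; rewrite /Rplus /= in_itv /= andbT => r0.
by rewrite /after ltNge (_ : s <= r + s) //=; lra.
Qed.

End L2.

(** * Fock space *)

Section Exponential.

(** The left side is the triangle $i + j < N$ of the product of two partial sums; its last diagonal
    is a binomial expansion. *)
Lemma exp_cauchy_square (F : numFieldType) (z w : F) N :
  \sum_(0 <= i < N) \sum_(0 <= j < N - i) (z ^+ i / i`!%:R) * (w ^+ j / j`!%:R) =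
  \sum_(0 <= n < N) (z + w) ^+ n / n`!%:R.
Proof.
elim: N => [|N IH]; first by rewrite !big_geq.
have h : \sum_(0 <= i < N.+1) \sum_(0 <= j < N.+1 - i) (z ^+ i / i`!%:R) * (w ^+ j / j`!%:R) =
    \sum_(0 <= i < N.+1) (\sum_(0 <= j < N - i) (z ^+ i / i`!%:R) * (w ^+ j / j`!%:R) +
      (z ^+ i / i`!%:R) * (w ^+ (N - i) / (N - i)`!%:R)).
  by apply: eq_big_nat => i /= hi; rewrite subSn // big_nat_recr.
rewrite h big_split /= [X in X + _]big_nat_recr //=.
rewrite [X in _ + X + _]big_geq ?subnn // addr0 IH.
rewrite [RHS]big_nat_recr //=; congr (_ + _).
rewrite addrC exprDn mulr_suml big_mkord; apply: eq_bigr => i _.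
have iN : (i <= N)%N by rewrite -ltnS.
have fne m : (m`!%:R : F) != 0 by rewrite pnatr_eq0 -lt0n fact_gt0.
rewrite -[_ *+ 'C(N, i)]mulr_natr.
have -> : ('C(N, i)%:R : F) = N`!%:R / (i`!%:R * (N - i)`!%:R).
  by apply: (mulIf (mulf_neq0 (fne i) (fne (N - i)%N))); rewrite divfK ?mulf_neq0 // -!natrM bin_fact.
rewrite [w ^+ _ * _]mulrC; field; by rewrite !fne.
Qed.

Context (R : realType).
Local Notation C := R[i].

Lemma cauchy_toC (u : nat -> C) :
  (forall e : R, 0 < e -> exists N, forall n m, (N <= n)%N -> (N <= m)%N ->
     nm (u n - u m) < e) -> exists l, to u l.
Proof.
move=> h.
have real (v : nat -> R) : (forall e : R, 0 < e -> exists N, forall n m, (N <= n)%N -> (N <= m)%N ->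
     `|v n - v m| < e) -> exists l : R, forall e : R, 0 < e -> exists N, forall n, (N <= n)%N ->
     `|v n - l| < e.
  move=> hv; suff /cvg_ex[l hl] : cvgn v.
    exists l => e e0; have /cvgrPdist_lt/(_ _ e0)[N _ HN] := hl.
    by exists N => n hn; rewrite distrC; apply: (HN n hn).
  apply/cauchy_cvgP/cauchy_ballP => e e0; have [N H] := hv _ e0.
  exists (v @` [set n | (N <= n)%N], v @` [set n | (N <= n)%N]) => /=.
    by split; exists N => // n hn; exists n.
  move=> [_ _] /= [[n hn <-] [m hm <-]]; rewrite -ball_normE /=; exact: H.
have [a ha] : exists l : R, forall e : R, 0 < e -> exists N, forall n, (N <= n)%N ->
     `|complex.Re (u n) - l| < e.
  apply: real => e /h[N H]; exists N => n m hn hm.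
  by apply: le_lt_trans (H n m hn hm); rewrite -ReB nm_Re.
have [b hb] : exists l : R, forall e : R, 0 < e -> exists N, forall n, (N <= n)%N ->
     `|complex.Im (u n) - l| < e.
  apply: real => e /h[N H]; exists N => n m hn hm.
  apply: le_lt_trans (H n m hn hm); apply: le_trans (nm_Im (u n - u m)).
  by case: (u n) => ? ?; case: (u m) => ? ? /=.
exists (a +i* b) => e e0; have e2 : 0 < e / 2 by lra.
have [N1 H1] := ha _ e2; have [N2 H2] := hb _ e2; exists (maxn N1 N2) => n.
rewrite geq_max => /andP[/H1 h1 /H2 h2]; apply: le_lt_trans (nm_ReIm _) _.
by move: h1 h2; case: (u n) => x y /=; lra.
Qed.

Definition psum (z : C) N : C := \sum_(0 <= n < N) z ^+ n / n`!%:R.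

Lemma rsum_exp (a : R) : forall e : R, 0 < e -> exists N, forall n, (N <= n)%N ->
  `|\sum_(0 <= i < n) a ^+ i / i`!%:R - expR a| < e.
Proof.
move=> e e0; have cv : series (exp_coeff a) @ \oo --> expR a.
  by rewrite /expR; exact: is_cvg_series_exp_coeff.
have /cvgrPdist_lt/(_ _ e0)[N _ HN] := cv.
by exists N => n hn; rewrite distrC; exact: (HN n hn).
Qed.

Lemma nm_pcoef (z : C) n : nm (z ^+ n / n`!%:R) = nm z ^+ n / n`!%:R.
Proof.
rewrite nmM nmX; congr (_ * _).
have -> : (n`!%:R : C)^-1 = ((n`!%:R : R)^-1)%:C by rewrite fmorphV rmorph_nat.
by rewrite nm_real ger0_norm // invr_ge0.
Qed.

Lemma psum_tail (z : C) n m : (n <= m)%N ->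
  nm (psum z m - psum z n) <=
  \sum_(0 <= i < m) nm z ^+ i / i`!%:R - \sum_(0 <= i < n) nm z ^+ i / i`!%:R.
Proof.
move=> nm_; rewrite /psum (@big_cat_nat _ _ _ n 0 m) //= addrAC subrr add0r.
rewrite (@big_cat_nat _ _ _ n 0 m) //= addrAC subrr add0r.
by apply: le_trans (nm_sum _ _ _) _; apply: ler_sum => i _; rewrite nm_pcoef.
Qed.

Definition cexp (z : C) : C := xget 0 [set w | to (psum z) w].

Lemma cexp_to z : to (psum z) (cexp z).
Proof.
suff [w hw] : exists w, to (psum z) w by exact: (@xgetPex _ 0 [set w | to (psum z) w] (ex_intro _ w hw)).
apply: cauchy_toC => e e0; have e2 : 0 < e / 2 by lra.
have [N HN] := rsum_exp (nm z) e2; exists N => n m hn hm.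
wlog nm_ : n m hn hm / (n <= m)%N.
  by move=> H; have [h|/ltnW h] := leqP n m; [|rewrite nmBC]; apply: H.
rewrite nmBC; apply: le_lt_trans (psum_tail z nm_) _.
have := HN n hn; have := HN m hm; rewrite !ltr_norml => /andP[_ ?] /andP[? _].
by lra.
Qed.

Lemma cexp_unique z w : to (psum z) w -> cexp z = w.
Proof. exact: to_unique (cexp_to z). Qed.

Lemma cexp0 : cexp 0 = 1.
Proof.
apply: cexp_unique; apply: to_ev (to_cst _); exists 1%N => -[//|n] _.
rewrite /psum big_nat_recl // expr0 fact0 divr1 big1 ?addr0 // => i _.
by rewrite expr0n mul0r.
Qed.

(** The product of the partial sums differs from the partial sum of the product by the terms outside
    the triangle. They are dominated by the same terms for [nm z] and [nm w], where the addition
    formula of the real exponential is known. *)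
Lemma cexpD z w : cexp (z + w) = cexp z * cexp w.
Proof.
apply: cexp_unique; set a := nm z; set b := nm w.
have h := toM (cexp_to w) (cexp_to z).
suff d : to (fun N => psum (z + w) N - psum z N * psum w N) 0.
  have := toD d h; rewrite add0r; apply: to_ev; exists 0%N => n _.
  by rewrite subrK.
pose P (c : R) N := \sum_(0 <= i < N) c ^+ i / i`!%:R.
apply: (@to_small _ _ (fun N => P a N * P b N - P (a + b) N)) => [N|e e0].
  rewrite subr0 nmBC /psum -exp_cauchy_square /P -exp_cauchy_square.
  rewrite !mulr_suml -!sumrB; apply: le_trans (nm_sum _ _ _) _.
  apply: ler_sum_nat => i /= iN.
  rewrite !mulr_sumr (@big_cat_nat _ _ _ (N - i) 0 N) //= ?leq_subr //.
  rewrite addrAC subrr add0r [X in _ <= X - _](@big_cat_nat _ _ _ (N - i) 0 N) //= ?leq_subr //.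
  rewrite addrAC subrr add0r; apply: le_trans (nm_sum _ _ _) _.
  by apply: ler_sum => j _; rewrite nmM !nm_pcoef.
have M0 : 0 < expR a + expR b + 2.
  by have := expR_ge0 a; have := expR_ge0 b; lra.
(* If all three sums are within $d \le 1$ of their limits, the difference is less than $d(e^a + e^b
   + 1 + d)$. *)
pose d := Num.min 1 (e / (expR a + expR b + 2)).
have d0 : 0 < d by rewrite lt_min ltr01 divr_gt0.
have [N1 H1] := rsum_exp a d0; have [N2 H2] := rsum_exp b d0.
have [N3 H3] := rsum_exp (a + b) d0.
exists (maxn N1 (maxn N2 N3)) => n; rewrite !geq_max => /andP[/H1 h1 /andP[/H2 h2 /H3 h3]].
rewrite -/(P a n) in h1; rewrite -/(P b n) in h2; rewrite -/(P (a + b) n) in h3.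
have d1 : d <= 1 by rewrite ge_min lexx.
have de : d * (expR a + expR b + 2) <= e.
  by rewrite -ler_pdivlMr // ge_min lexx orbT.
move: h1 h2 h3; rewrite expRD !ltr_norml => /andP[h1 h1'] /andP[h2 h2'] /andP[h3 h3'].
have := expR_ge0 a; have := expR_ge0 b; nra.
Qed.

(* In the next two lemmas the exponentials are generalized first: unification would unfold them. *)
Lemma cexp_swap a b c d w : a + b = c + d -> cexp a * (w * cexp b) = cexp c * (w * cexp d).
Proof.
move=> h; have := cexpD a b; have := cexpD c d; rewrite -h.
move: (cexp (a + b)) (cexp a) (cexp b) (cexp c) (cexp d) => e0 ea eb ec ed -> h'.
by rewrite mulrCA -h' mulrCA.
Qed.

Lemma cexp_mul3 a b c d w : a + b + c = d -> cexp a * (cexp b * (cexp c * w)) = cexp d * w.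
Proof.
move=> <-; have := cexpD a b; have := cexpD (a + b) c.
move: (cexp (a + b + c)) (cexp (a + b)) (cexp a) (cexp b) (cexp c) => e1 e2 e3 e4 e5 -> ->.
by rewrite !mulrA.
Qed.

Lemma cexp_neq0 z : cexp z != 0.
Proof.
apply/eqP => h; have := cexpD z (- z); rewrite subrr cexp0 h mul0r => /eqP.
by rewrite oner_eq0.
Qed.

(** As $(i+2)! \ge 2^{i+1}$ and $|z| \le 1$, the remainder of the series is at most $|z|^2 \sum_i
    2^{-i-1}$. *)
Lemma cexp_small z : nm z <= 1 -> nm (cexp z - 1 - z) <= nm z ^+ 2.
Proof.
move=> z1; have := to_shift 2 (cexp_to z) => h.
have {}h : to (fun n => psum z (n + 2) - 1 - z) (cexp z - 1 - z).
  by apply: toB (to_cst z); apply: toB (to_cst 1).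
apply: (to_nm_le h) => n; rewrite addn2 /psum !big_nat_recl // expr0 fact0 expr1.
rewrite (_ : 1`! = 1%N) // !divr1; set S := \sum_(_ <= _ < _) _.
have -> : 1 + (z + S) - 1 - z = S by ring.
rewrite /S {S}.
apply: le_trans (nm_sum _ _ _) _.
have pw m : (2 ^ m.+1 <= m.+2`!)%N.
  elim: m => [//|m IH]; rewrite expnS factS; exact: leq_mul.
have geo m : \sum_(0 <= i < m) 2^-1 ^+ i.+1 <= 1 - 2^-1 ^+ m :> R.
  elim: m => [|m IH]; first by rewrite big_geq // expr0 subrr.
  rewrite big_nat_recr //= [X in _ <= 1 - X]exprS; move: IH; rewrite !exprS.
  by set s := \sum_(_ <= _ < _) _; lra.
apply: le_trans (_ : \sum_(0 <= i < n) nm z ^+ 2 * 2^-1 ^+ i.+1 <= _).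
  apply: ler_sum => i _; rewrite nm_pcoef; apply: ler_pM.
  - by rewrite exprn_ge0 // nm_ge0.
  - by rewrite invr_ge0.
  - by rewrite -addn2 exprD ler_piMl ?sqr_ge0 // exprn_ile1 // nm_ge0.
  - rewrite exprVn lef_pV2 ?posrE ?exprn_gt0 ?ltr0n ?fact_gt0 //.
    by rewrite -natrX ler_nat.
rewrite -mulr_sumr ler_piMr ?sqr_ge0 //; apply: le_trans (geo n) _.
by rewrite gerBl exprn_ge0 // invr_ge0.
Qed.

(* From [a n ^ 2 <= B * a (2 n)] the bound [a 1 <= B q] follows by extracting [2^k]-th roots. *)
Lemma dyadic_bound (a : nat -> R) (B M q : R) : 0 <= B -> 0 <= q ->
  (forall n, 0 <= a n) -> (forall n, a n ^+ 2 <= B * a n.*2) ->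
  (forall n, a n <= M * q ^+ n) -> a 1%N <= B * q.
Proof.
move=> B0 q0 a0 ha hM.
have [B00|Bn0] := eqVneq B 0.
  have := ha 1%N; rewrite B00 !mul0r => h.
  have /eqP : a 1%N ^+ 2 = 0 by apply/eqP; rewrite eq_le h sqr_ge0.
  by rewrite sqrf_eq0 => /eqP ->.
have Bp : 0 < B by rewrite lt_def Bn0.
apply: (pow2_le (c := M / B)) => //; first exact: mulr_ge0.
move=> j; rewrite mulrAC ler_pdivlMr // exprMn.
have key : a 1%N ^+ (2 ^ j) * B <= B ^+ (2 ^ j) * a (2 ^ j)%N.
  elim: j => [|j IH]; first by rewrite expn0 !expr1 mulrC.
  have h := ha (2 ^ j)%N; rewrite -mul2n -expnS in h.
  rewrite expnS mulnC !exprM.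
  set x := a 1%N ^+ (2 ^ j) in IH *; set y := B ^+ (2 ^ j) in IH *.
  set w := a (2 ^ j)%N in IH h; set v := a _ in h *.
  rewrite -(@ler_pM2r _ B) //.
  apply: le_trans (_ : (y * w) ^+ 2 <= _).
    rewrite -mulrA -expr2 -exprMn ler_pXn2r ?nnegrE ?mulr_ge0 ?exprn_ge0 //.
    exact: a0.
  rewrite exprMn -[leRHS]mulrA ler_wpM2l ?sqr_ge0 //.
  by rewrite (mulnC _ 2%N) -expnS mulrC.
by apply: le_trans key _; rewrite [leRHS]mulrCA ler_wpM2l ?exprn_ge0.
Qed.

End Exponential.

Section Fock.
Context (R : realType) (k : hilbertType R) (e : nat -> k) (he : is_onb e).
Context (G : hilbertType R) (pow : nat -> (R -> k) -> G) (hG : is_sym_fock pow).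
Local Notation C := R[i].
Implicit Types f g : R -> k.

(** Homogeneity follows from the inner products alone: they make the squared norm of the difference
    zero. *)
Lemma pow_scale n (z : C) f : L2 f -> pow n (fun s => z *: f s) = z ^+ n *: pow n f.
Proof.
move=> hf; have hz := L2Z he z hf.
apply/eqP; rewrite -subr_eq0; apply/eqP/nm_eq0/eqP; rewrite -sqrf_eq0.
apply/eqP/complexI; rewrite -dotxx dotBr !dotBl !dotZr !dotZl.
rewrite !(pow_dot hG) // eqxx !(L2dotZr he) // !(L2dotZl he) //.
by rewrite !exprMn cjX !mulrA; ring.
Qed.

Definition fterm f n : G := ((Num.sqrt (n`!%:R : R))^-1)%:C *: pow n f.

Lemma fterm_dot f g n m : L2 f -> L2 g ->
  dot (fterm f n) (fterm g m) = if n == m then L2dot f g ^+ n / n`!%:R else 0.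
Proof.
move=> hf hg; rewrite dotZl dotZr (pow_dot hG) // cjR.
case: eqP => [<-|_]; last by rewrite !mulr0.
rewrite mulrA -rmorphM -invfM -expr2 sqr_sqrtr ?ler0n //.
by rewrite mulrC fmorphV rmorph_nat.
Qed.

Lemma fsum_dot f g N : L2 f -> L2 g ->
  dot (\sum_(0 <= n < N) fterm f n) (\sum_(0 <= n < N) fterm g n) = psum (L2dot f g) N.
Proof.
move=> hf hg; rewrite dot_suml; apply: eq_big_nat => n hn.
rewrite dot_sumr (bigD1_seq n) ?iota_uniq ?mem_index_iota //=.
rewrite fterm_dot // eqxx big1 ?addr0 // => i ni.
by rewrite fterm_dot // eq_sym (negbTE ni).
Qed.

Lemma expv_to f : L2 f -> to (fun N => \sum_(0 <= n < N) fterm f n) (expv pow f).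
Proof.
move=> hf; set u := fun N => _.
suff [l hl] : exists l, to u l.
  have -> : expv pow f = l by apply/cvg_lim => //; apply/to_cvg.
  exact: hl.
apply: cauchy_to => d d0; have d2 : 0 < d ^+ 2 / 2 by rewrite divr_gt0 ?exprn_gt0.
have [z0 _] := ge0_Re (L2dot_ge0 f).
set r := complex.Re _ in z0.
have [N HN] := rsum_exp r d2; exists N => n m hn hm.
wlog nm_ : n m hn hm / (n <= m)%N.
  by move=> H; have [h|/ltnW h] := leqP n m; [|rewrite nmBC]; apply: H.
have E : nm (u m - u n) ^+ 2 =
    \sum_(0 <= i < m) r ^+ i / i`!%:R - \sum_(0 <= i < n) r ^+ i / i`!%:R.
  have -> : u m - u n = \sum_(n <= i < m) fterm f i.
    by rewrite /u (@big_cat_nat _ _ _ n 0 m) //= addrAC subrr add0r.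
  apply: complexI; rewrite -dotxx dot_suml.
  rewrite [X in (X - _)%:C](@big_cat_nat _ _ _ n 0 m) //= addrAC subrr add0r rmorph_sum.
  apply: eq_big_nat => i hi.
  rewrite dot_sumr (bigD1_seq i) ?iota_uniq ?mem_index_iota //=.
  rewrite fterm_dot // eqxx big1 ?addr0 => [|j ji]; last first.
    by rewrite fterm_dot // eq_sym (negbTE ji).
  by rewrite -z0 rmorphM fmorphV rmorph_nat rmorphXn.
rewrite nmBC -(@ltr_pXn2r _ 2) ?nnegrE ?nm_ge0 ?(ltW d0) // E.
have := HN n hn; have := HN m hm; rewrite !ltr_norml => /andP[_ ?] /andP[? _].
by lra.
Qed.

Lemma expv_dot f g : L2 f -> L2 g ->
  dot (expv pow f) (expv pow g) = cexp (L2dot f g).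
Proof.
move=> hf hg; apply/esym/cexp_unique.
have h1 N := to_dotr (\sum_(0 <= n < N) fterm f n) (expv_to hg).
have [M hM] := to_bounded (expv_to hg).
have h2 := to_dotl (expv pow g) (expv_to hf).
have h3 : to (fun N => dot (\sum_(0 <= n < N) fterm f n)
    (\sum_(0 <= n < N) fterm g n - expv pow g)) 0.
  have [B hB] := to_bounded (expv_to hf).
  refine (to_le (c := B) _ (expv_to hg)) => n; rewrite subr0.
  by apply: le_trans (CS _ _) _; rewrite ler_wpM2r ?nm_ge0.
have := toD h3 h2; rewrite add0r; apply: to_ev; exists 0%N => n _.
by rewrite dotBr subrK fsum_dot.
Qed.

Lemma expv0_dot : dot (expv pow (fun=> 0)) (expv pow (fun=> 0)) = 1.
Proof. by rewrite expv_dot ?L2dot0r ?cexp0 //; exact: (L2_0 he). Qed.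

Lemma nm_expv0 : nm (expv pow (fun=> 0)) = 1.
Proof.
have := expv0_dot; rewrite dotxx => /complexI /eqP.
by rewrite sqrp_eq1 ?nm_ge0 // => /eqP.
Qed.

(* The vectors [pow n f] are the Taylor coefficients of [z |-> expv (z f)] at 0. *)
Lemma expv_total x : (forall f, L2 f -> dot (expv pow f) x = 0) -> x = 0.
Proof.
move=> hx; apply: (total_setP (pow_total hG)) => _ [n [f [hf ->]]].
pose c j := dot (fterm f j) x.
suff c0 : forall j, c j = 0.
  have := c0 n; rewrite /c dotZl => /eqP; rewrite mulf_eq0 => /orP[|/eqP //].
  by rewrite cjR fmorph_eq0 invr_eq0 sqrtr_eq0 leNgt ?ltr0n ?fact_gt0.
(* The geometric decay comes from the vector [2 f], whose Taylor terms are $2^j$ times those of [f]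
   and still bounded, their squared norms being terms of an exponential series. *)
have [M M0 cM] : exists2 M, 0 <= M & forall j, nm (c j) <= M * 2^-1 ^+ j.
  have h2 := L2Z he 2%:R hf.
  have [z0 z1] := ge0_Re (L2dot_ge0 (fun s => 2%:R *: f s)).
  set r := complex.Re _ in z0 z1.
  exists (nm x * (expR r + 1)) => [|j]; first by rewrite mulr_ge0 ?nm_ge0 // addr_ge0 // expR_ge0.
  have e2 : fterm (fun s => 2%:R *: f s) j = 2%:R ^+ j *: fterm f j.
    by rewrite /fterm pow_scale // !scalerA mulrC.
  have -> : nm (c j) = nm (dot (fterm (fun s => 2%:R *: f s) j) x) * 2^-1 ^+ j.
    rewrite e2 dotZl nmM nm_conj nmX -/(c j) mulrAC -exprMn.
    have -> : nm (2%:R : C) = 2.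
      have -> : (2%:R : C) = (2 : R)%:C by rewrite rmorph_nat.
      by rewrite nm_real ger0_norm.
    by rewrite divff ?expr1n ?mul1r // pnatr_eq0.
  rewrite ler_wpM2r ?exprn_ge0 ?invr_ge0 //; apply: le_trans (CS _ _) _.
  rewrite mulrC ler_wpM2l ?nm_ge0 //.
  have sq : nm (fterm (fun s => 2%:R *: f s) j) ^+ 2 = r ^+ j / j`!%:R.
    apply: complexI; rewrite -dotxx fterm_dot // eqxx -z0.
    by rewrite rmorphM fmorphV rmorph_nat rmorphXn.
  have le1 : r ^+ j / j`!%:R <= expR r.
    rewrite leNgt; apply/negP => hlt.
    have d0 : 0 < r ^+ j / j`!%:R - expR r by rewrite subr_gt0.
    have [N HN] := rsum_exp r d0.
    have {HN} := HN (maxn N j.+1) (leq_maxl _ _).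
    rewrite ltr_norml => /andP[_].
    rewrite (@big_cat_nat _ _ _ j.+1 0 (maxn N j.+1)) ?leq_maxr //= big_nat_recr //=.
    have p1 : 0 <= \sum_(0 <= i < j) r ^+ i / i`!%:R.
      by apply: sumr_ge0 => i _; rewrite divr_ge0 // exprn_ge0.
    have p2 : 0 <= \sum_(j.+1 <= i < maxn N j.+1) r ^+ i / i`!%:R.
      by apply: sumr_ge0 => i _; rewrite divr_ge0 // exprn_ge0.
    by move: p1 p2; set s1 := \sum_(_ <= _ < j) _; set s2 := \sum_(_ <= _ < _) _; lra.
  rewrite -(@ler_pXn2r _ 2) ?nnegrE ?nm_ge0 ?addr_ge0 ?expR_ge0 //.
  by rewrite sq; have := expR_ge0 r; nra.
have series0 (z : R) : to (fun N => \sum_(0 <= i < N) z%:C ^+ i * c i) 0.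
  have hz := L2Z he z%:C hf.
  have := to_dotl x (expv_to hz); rewrite hx //; apply: to_ev; exists 0%N => N _.
  rewrite dot_suml; apply: eq_bigr => i _.
  rewrite /fterm pow_scale // scalerA mulrC -scalerA dotZl -/(fterm f i).
  by rewrite cjX cjR.
elim/ltn_ind => j IH.
apply: nm_eq0; apply/eqP; rewrite eq_le nm_ge0 andbT leNgt; apply/negP => cj.
set b := nm (c j) in cj.
have D0 : 0 < 4 * M + b + 1 by lra.
(* So small that the terms after the [j]-th sum up to at most $2Mz^{j+1} \le z^j b/2$; they cannot
   cancel the [j]-th term, of modulus $z^j b$, to less than half of it. *)
pose z := b / (4 * M + b + 1).
have z0 : 0 < z by rewrite divr_gt0.
have z1 : z <= 1 by rewrite /z ler_pdivrMr // mul1r; lra.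
have zM : 2 * M * z <= b / 2.
  by rewrite /z mulrA ler_pdivrMr //; nra.
have zj : 0 < z ^+ j by rewrite exprn_gt0.
have e0 : 0 < z ^+ j * b / 2 by rewrite divr_gt0 // mulr_gt0.
have [N HN] := series0 z _ e0.
have {HN} := HN (maxn N j.+1) (leq_maxl _ _); rewrite subr0.
rewrite (@big_cat_nat _ _ _ j.+1 0 (maxn N j.+1)) ?leq_maxr //= big_nat_recr //=.
rewrite big_nat big1 ?add0r => [|i /andP[_ ij]]; last by rewrite IH // mulr0.
set t := \sum_(_ <= _ < _) _ => h.
have tb : nm t <= 2 * M * z ^+ j.+1.
  apply: le_trans (nm_sum _ _ _) _.
  apply: le_trans (_ : \sum_(j.+1 <= i < maxn N j.+1) z ^+ j.+1 * (M * 2^-1 ^+ i) <= _).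
    apply: ler_sum_nat => i /andP[ji _].
    rewrite nmM nmX nm_real ger0_norm ?(ltW z0) //.
    apply: ler_pM; rewrite ?exprn_ge0 ?nm_ge0 ?(ltW z0) //.
    by rewrite ler_wiXn2l ?(ltW z0).
  rewrite -mulr_sumr -mulr_sumr mulrC ler_wpM2r ?exprn_ge0 ?(ltW z0) // mulrC ler_wpM2r //.
  have geo m : \sum_(0 <= i < m) 2^-1 ^+ i <= 2 - 2 * 2^-1 ^+ m :> R.
    elim: m => [|m IHm]; first by rewrite big_geq // expr0; lra.
    rewrite big_nat_recr //=; move: IHm; rewrite exprS.
    by set s := \sum_(_ <= _ < _) _; lra.
  have h1 := geo (maxn N j.+1).
  have h2 : 0 <= \sum_(0 <= i < j.+1) 2^-1 ^+ i :> R.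
    by apply: sumr_ge0 => i _; rewrite exprn_ge0 // invr_ge0.
  have h3 : 0 <= 2^-1 ^+ (maxn N j.+1) :> R by rewrite exprn_ge0 // invr_ge0.
  move: h1; rewrite (@big_cat_nat _ _ _ j.+1 0 (maxn N j.+1)) ?leq_maxr //=.
  by move: h2; set s1 := \sum_(0 <= _ < _) _; set s2 := \sum_(_ <= _ < _) _; lra.
have := nmD (z%:C ^+ j * c j + t) (- t); rewrite addrK nmN.
rewrite nmM nmX nm_real (ger0_norm (ltW z0)) -/b.
move: tb h; rewrite exprS => tb h h'.
have : 2 * M * z * z ^+ j <= b / 2 * z ^+ j by rewrite ler_wpM2r // ltW.
have -> : 2 * M * z * z ^+ j = 2 * M * (z * z ^+ j) by ring.
have -> : b / 2 * z ^+ j = z ^+ j * b / 2 by ring.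
by lra.
Qed.

End Fock.

(** * Tensor products of Hilbert spaces and the operators $1 \otimes T$ *)

Section Tensor.
Context (R : realType) (H G K : hilbertType R) (tens : H -> G -> K).
Context (hK : is_tensor tens).
Local Notation C := R[i].

Lemma nm_tens x y : nm (tens x y) = nm x * nm y.
Proof.
apply/eqP; rewrite -(@eqrXn2 _ 2) ?mulr_ge0 ?nm_ge0 //; apply/eqP/complexI.
by rewrite -dotxx (tens_dot hK) !dotxx -rmorphM exprMn.
Qed.

Lemma tens_total_pair : total (fun p : H * G => tens p.1 p.2).
Proof.
move=> x hx; apply: (total_setP (tens_total hK)) => _ [u [y ->]].
exact: (hx (u, y)).
Qed.

Lemma tens0r u : tens u 0 = 0.
Proof. by apply: (op0 (T := tens u)) => a y1 y2; exact: (tens_linearr hK). Qed.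
Lemma tensZr u a y : tens u (a *: y) = a *: tens u y.
Proof. by apply: (opZ (T := tens u)) => b y1 y2; exact: (tens_linearr hK). Qed.
Lemma tensDr u x y : tens u (x + y) = tens u x + tens u y.
Proof. by apply: (opD (T := tens u)) => b y1 y2; exact: (tens_linearr hK). Qed.
Lemma tensBr u x y : tens u (x - y) = tens u x - tens u y.
Proof. by apply: (opB (T := tens u)) => b y1 y2; exact: (tens_linearr hK). Qed.
Lemma tens_sumr I (s : seq I) (P : pred I) (F : I -> G) u :
  tens u (\sum_(i <- s | P i) F i) = \sum_(i <- s | P i) tens u (F i).
Proof. by elim/big_rec2: _ => [|i a b _ <-]; rewrite ?tens0r ?tensDr. Qed.

Lemma tens_to (y : nat -> G) l u : to y l -> to (fun n => tens u (y n)) (tens u l).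
Proof. by apply: (to_le (c := nm u)) => n; rewrite -tensBr nm_tens. Qed.

Lemma tens_totalr (T : Type) (v : T -> G) : total v ->
  total (fun p : H * T => tens p.1 (v p.2)).
Proof.
move=> tv x hx; apply: tens_total_pair => -[u y] /=.
have [s hs] := total_dense tv y.
apply: to_unique (to_dotl x (tens_to u hs)) _.
apply: to_ev (to_cst _); exists 0%N => n _.
rewrite /vec tens_sumr dot_suml big1 // => p _.
by rewrite tensZr dotZl (hx (u, p.2)) mulr0.
Qed.

Lemma iter_bound (L : hilbertType R) (T : L -> L) (c : R) n x : 0 <= c ->
  (forall x, nm (T x) <= c * nm x) -> nm (iter n T x) <= c ^+ n * nm x.
Proof.
move=> c0 hT; elim: n => [|n IH] /=; first by rewrite expr0 mul1r.
by apply: le_trans (hT _) _; rewrite exprS -mulrA ler_wpM2l.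
Qed.

Lemma dot_vec2 (T : Type) (v w : T -> K) (s t : seq (C * T)) :
  dot (vec v s) (vec w t) = form (fun x y => dot (v x) (w y)) s t.
Proof.
rewrite /vec dot_suml; apply: eq_bigr => p _.
rewrite dot_sumr; apply: eq_bigr => q _.
by rewrite dotZl dotZr mulrA.
Qed.

Lemma eq_form (T : Type) (k1 k2 : T -> T -> C) s t : (forall x y, k1 x y = k2 x y) ->
  form k1 s t = form k2 s t.
Proof.
by move=> h; apply: eq_bigr => p _; apply: eq_bigr => q _; rewrite h.
Qed.

(* [nm (1 (x) T)] is bounded through the powers of [T^* T]. *)
Lemma tens_op (T : G -> G) (c : R) : 0 <= c ->
  (forall a x y, T (a *: x + y) = a *: T x + T y) ->
  (forall x, nm (T x) <= c * nm x) ->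
  exists Z : K -> K, [/\ forall a x y, Z (a *: x + y) = a *: Z x + Z y,
    forall x, nm (Z x) <= c * nm x & forall x y, Z (tens x y) = tens x (T y)].
Proof.
move=> c0 lT hT; have [S [lS hS ST]] := adjoint c0 lT hT.
pose h y := S (T y).
have hh x : nm (h x) <= c ^+ 2 * nm x.
  by apply: le_trans (hS _) _; rewrite expr2 -mulrA ler_wpM2l.
have h1 a b : dot (h a) b = dot a (h b).
  by rewrite /h -ST dot_conj -ST -dot_conj.
have hsym n x y : dot (iter n h x) y = dot x (iter n h y).
  by elim: n x y => [//|n IH] x y; rewrite iterS h1 IH -iterSr.
pose v (p : H * G) := tens p.1 p.2.
pose w n (p : H * G) := tens p.1 (iter n h p.2).
pose vT (p : H * G) := tens p.1 (T p.2).
(* Cauchy-Schwarz and the symmetry of [h] give the doubling hypothesis of [dyadic_bound] for the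
   norms of [vec (w n) s]. *)
have vwv n s : nm (vec (w n) s) ^+ 2 <= nm (vec v s) * nm (vec (w n.*2) s).
  apply: le_trans (CS _ _); rewrite -[leLHS]ger0_norm ?sqr_ge0 // -nm_real.
  rewrite -dotxx !dot_vec2.
  have -> // : form (fun x y => dot (w n x) (w n y)) s s =
     form (fun x y => dot (v x) (w n.*2 y)) s s.
  apply: eq_form => p q; rewrite !(tens_dot hK); congr (_ * _).
  by rewrite hsym -iterD addnn.
have vTb s : nm (vec vT s) <= c * nm (vec v s).
  rewrite -(@ler_pXn2r _ 2) ?nnegrE ?mulr_ge0 ?nm_ge0 //.
  have e1 : nm (vec vT s) ^+ 2 <= nm (vec v s) * nm (vec (w 1%N) s).
    apply: le_trans (CS _ _); rewrite -[leLHS]ger0_norm ?sqr_ge0 // -nm_real.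
    rewrite -dotxx !dot_vec2.
    have -> // : form (fun x y => dot (vT x) (vT y)) s s =
      form (fun x y => dot (v x) (w 1%N y)) s s.
    by apply: eq_form => p q; rewrite !(tens_dot hK) ST.
  apply: le_trans e1 _; rewrite exprMn [leRHS]mulrC expr2 -mulrA ler_wpM2l ?nm_ge0 //.
  apply: (dyadic_bound (a := fun n => nm (vec (w n) s))
    (M := \sum_(p <- s) nm p.1 * (nm p.2.1 * nm p.2.2))).
  - exact: nm_ge0.
  - exact: sqr_ge0.
  - by move=> n; exact: nm_ge0.
  - by move=> n; exact: vwv.
  - move=> n; apply: le_trans (nm_sum _ _ _) _; rewrite mulr_suml.
    apply: ler_sum => p _; rewrite nmZ -!mulrA ler_wpM2l ?nm_ge0 // nm_tens.
    rewrite ler_wpM2l ?nm_ge0 // mulrC; apply: iter_bound => //; exact: sqr_ge0.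
have [|Z [lZ bZ ZE]] := kernel_op (kap := fun p q => dot (v p) (vT q)) tens_total_pair c0.
  move=> s t; rewrite -dot_vec2; apply: le_trans (CS _ _) _.
  by rewrite mulrCA ler_wpM2l ?nm_ge0.
exists Z; split => // x y; apply: (total_inj tens_total_pair) => p.
exact: (ZE p (x, y)).
Qed.

End Tensor.

(** * Square roots in C*-algebras *)

Section CStarAlgebra.
Context (R : realType) (A : cstarType R).
Local Notation C := R[i].
Implicit Types (x y z : A) (a b : C).

Lemma amulDl x y z : (x + y) ** z = x ** z + y ** z.
Proof. by have := mul_linearl 1 x y z; rewrite !scale1r. Qed.
Lemma amulDr x y z : z ** (x + y) = z ** x + z ** y.
Proof. by have := mul_linearr 1 x y z; rewrite !scale1r. Qed.
Lemma amul0l z : 0 ** z = 0.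
Proof. by apply: (addrI (0 ** z)); rewrite -amulDl !addr0. Qed.
Lemma amul0r z : z ** 0 = 0.
Proof. by apply: (addrI (z ** 0)); rewrite -amulDr !addr0. Qed.
Lemma amulZl a x z : (a *: x) ** z = a *: (x ** z).
Proof. by have := mul_linearl a x 0 z; rewrite amul0l !addr0. Qed.
Lemma amulZr a x z : z ** (a *: x) = a *: (z ** x).
Proof. by have := mul_linearr a x 0 z; rewrite amul0r !addr0. Qed.
Lemma amulNl x z : (- x) ** z = - (x ** z).
Proof. by rewrite -scaleN1r amulZl scaleN1r. Qed.
Lemma amulNr x z : z ** (- x) = - (z ** x).
Proof. by rewrite -scaleN1r amulZr scaleN1r. Qed.
Lemma amulBl x y z : (x - y) ** z = x ** z - y ** z.
Proof. by rewrite amulDl amulNl. Qed.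
Lemma amulBr x y z : z ** (x - y) = z ** x - z ** y.
Proof. by rewrite amulDr amulNr. Qed.
Lemma amul_suml I (s : seq I) (P : pred I) (F : I -> A) z :
  (\sum_(i <- s | P i) F i) ** z = \sum_(i <- s | P i) F i ** z.
Proof. by elim/big_rec2: _ => [|i u v _ <-]; rewrite ?amul0l ?amulDl. Qed.
Lemma amul_sumr I (s : seq I) (P : pred I) (F : I -> A) z :
  z ** (\sum_(i <- s | P i) F i) = \sum_(i <- s | P i) z ** F i.
Proof. by elim/big_rec2: _ => [|i u v _ <-]; rewrite ?amul0r ?amulDr. Qed.
Lemma starD x y : star (x + y) = star x + star y.
Proof. by have := star_linear 1 x y; rewrite !scale1r cj1 scale1r. Qed.
Lemma star0 : star (0 : A) = 0.
Proof. by apply: (addrI (star 0)); rewrite -starD !addr0. Qed.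
Lemma starZ a x : star (a *: x) = Num.conj a *: star x.
Proof. by have := star_linear a x 0; rewrite star0 !addr0. Qed.
Lemma starN x : star (- x) = - star x.
Proof. by rewrite -scaleN1r starZ cjN cj1 scaleN1r. Qed.
Lemma starB x y : star (x - y) = star x - star y.
Proof. by rewrite starD starN. Qed.
Lemma star1 : star (aone : A) = aone.
Proof. by rewrite -[star aone]mul_unitl -{1}(star_invol aone) -star_mul mul_unitl star_invol. Qed.
Lemma star_sum I (s : seq I) (P : pred I) (F : I -> A) :
  star (\sum_(i <- s | P i) F i) = \sum_(i <- s | P i) star (F i).
Proof. by elim/big_rec2: _ => [|i u v _ <-]; rewrite ?star0 ?starD. Qed.

Lemma nm_amul x y : nm (x ** y) <= nm x * nm y.
Proof. by have := norm_mul x y; rewrite !normE -rmorphM lecR. Qed.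
Lemma nm_cstar x : nm (star x ** x) = nm x ^+ 2.
Proof. by have := norm_star x; rewrite !normE -rmorphXn => /complexI. Qed.
Lemma nm_star x : nm (star x) = nm x.
Proof.
have h z : nm z <= nm (star z).
  have := nm_cstar z; have := nm_amul (star z) z; have := nm_ge0 z => z0 h1 h2.
  have [->|zn] := eqVneq (nm z) 0; first exact: nm_ge0.
  have zp : 0 < nm z by rewrite lt_def zn.
  by rewrite -(ler_pM2r zp) -expr2 -h2.
by apply/eqP; rewrite eq_le; apply/andP; split; [rewrite -{2}(star_invol x); exact: h|exact: h].
Qed.
Lemma nm_one : nm (aone : A) = 1.
Proof.
have := nm_cstar aone; rewrite star1 mul_unitl => h.
have n0 : nm (aone : A) != 0 by apply/eqP => /nm_eq0; exact: unit_neq0.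
by apply: (mulfI n0); rewrite mulr1 -expr2.
Qed.

Lemma to_amul (u v : nat -> A) x y : to u x -> to v y -> to (fun n => u n ** v n) (x ** y).
Proof.
move=> ux vy; have [M hM] := to_bounded vy.
have h1 : to (fun n => (u n - x) ** v n) 0.
  refine (to_le (c := M) _ ux) => n; rewrite subr0 mulrC.
  by apply: le_trans (nm_amul _ _) _; rewrite ler_wpM2l ?nm_ge0.
have h2 : to (fun n => x ** (v n - y)) 0.
  by refine (to_le (c := nm x) _ vy) => n; rewrite subr0 nm_amul.
have := toD (toD h1 h2) (to_cst (x ** y)); rewrite addr0 add0r.
apply: to_ev; exists 0%N => n _.
by rewrite amulBl amulBr addrA subrK subrK.
Qed.

Lemma to_star (u : nat -> A) x : to u x -> to (fun n => star (u n)) (star x).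
Proof. by apply: (to_le (c := 1)) => n; rewrite -starB nm_star mul1r. Qed.

Definition apow x n : A := iter n (amul x) aone.

Lemma apowD x n m : apow x n ** apow x m = apow x (n + m).
Proof.
elim: n => [|n IH]; first by rewrite mul_unitl.
by rewrite /apow addSn !iterS -mul_assoc IH.
Qed.

Lemma apow1 x : apow x 1 = x.
Proof. by rewrite /apow /= mul_unitr. Qed.

Lemma star_apow x n : star x = x -> star (apow x n) = apow x n.
Proof.
move=> hx; elim: n => [|n IH]; first exact: star1.
by rewrite /apow iterS star_mul IH hx -{2}(apow1 x) apowD addn1.
Qed.

Lemma nm_apow_le x n : nm (apow x n) <= nm x ^+ n.
Proof.
elim: n => [|n IH]; first by rewrite /apow nm_one.
by rewrite exprS; apply: le_trans (nm_amul _ _) _; rewrite ler_wpM2l ?nm_ge0.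
Qed.

Lemma nm_apow_pow2 x k : star x = x -> nm (apow x (2 ^ k)) = nm x ^+ (2 ^ k).
Proof.
move=> hx; elim: k => [|k IH]; first by rewrite expn0 apow1 expr1.
by rewrite expnS mul2n -addnn -apowD -{1}star_apow // nm_cstar IH -exprM muln2 addnn.
Qed.

(* The square root of [1 - Z] is [1 - y], where [y = (Z + y^2) / 2] is the limit of
   polynomials in [Z] with nonnegative coefficients of bounded sum. *)
Section SquareRoot.
Context (n : nat).
Local Notation Mx := ('I_n -> 'I_n -> A).
Implicit Types P Q : Mx.

Definition mmul P Q : Mx := fun i j => \sum_l P i l ** Q l j.
Definition mone : Mx := fun i j => if i == j then aone else 0.
Definition madd P Q : Mx := fun i j => P i j + Q i j.
Definition mscale (c : R) P : Mx := fun i j => c%:C *: P i j.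

Lemma mmulA P Q S : mmul P (mmul Q S) = mmul (mmul P Q) S.
Proof.
apply/funext => i; apply/funext => j; rewrite /mmul.
under eq_bigr do rewrite amul_sumr.
rewrite exchange_big /=; apply: eq_bigr => l _.
by rewrite amul_suml; apply: eq_bigr => m _; rewrite mul_assoc.
Qed.

Lemma mmul1l P : mmul mone P = P.
Proof.
apply/funext => i; apply/funext => j; rewrite /mmul (bigD1 i) //= big1 => [|l li].
  by rewrite addr0 /mone eqxx mul_unitl.
by rewrite /mone eq_sym (negbTE li) amul0l.
Qed.

Lemma mmulDl P Q S : mmul (madd P Q) S = madd (mmul P S) (mmul Q S).
Proof.
apply/funext => i; apply/funext => j; rewrite /mmul /madd -big_split /=.
by apply: eq_bigr => l _; rewrite amulDl.
Qed.
Lemma mmulDr P Q S : mmul S (madd P Q) = madd (mmul S P) (mmul S Q).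
Proof.
apply/funext => i; apply/funext => j; rewrite /mmul /madd -big_split /=.
by apply: eq_bigr => l _; rewrite amulDr.
Qed.
Lemma mmulZl c P S : mmul (mscale c P) S = mscale c (mmul P S).
Proof.
apply/funext => i; apply/funext => j; rewrite /mmul /mscale scaler_sumr.
by apply: eq_bigr => l _; rewrite amulZl.
Qed.
Lemma mmulZr c P S : mmul S (mscale c P) = mscale c (mmul S P).
Proof.
apply/funext => i; apply/funext => j; rewrite /mmul /mscale scaler_sumr.
by apply: eq_bigr => l _; rewrite amulZr.
Qed.

Definition mpow P k : Mx := iter k (mmul P) mone.

Context (Z : Mx) (M : R).
Context (Zherm : forall i j, star (Z i j) = Z j i).
Context (Zbound : forall k i j, nm (mpow Z k i j) <= M).

(** [cone P r] says that [P] is a polynomial in [Z] with nonnegative coefficients of sum [r]. Its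
    entries are then bounded by [M * r] ([cone_bound]), which takes the place of an operator norm on
    matrices. *)
Inductive cone : Mx -> R -> Prop :=
| cone_pow k : cone (mpow Z k) 1
| cone_add P Q r s : cone P r -> cone Q s -> cone (madd P Q) (r + s)
| cone_scale c P r : 0 <= c -> cone P r -> cone (mscale c P) (c * r).

Lemma mpowD k l : mmul (mpow Z k) (mpow Z l) = mpow Z (k + l).
Proof.
elim: k => [|k IH]; first exact: mmul1l.
by rewrite /mpow addSn !iterS -mmulA IH.
Qed.

Lemma mpow1 : mpow Z 1 = Z.
Proof.
apply/funext => i; apply/funext => j.
rewrite /mpow /= /mmul (bigD1 j) //= big1 => [|l lj].
  by rewrite addr0 /mone eqxx mul_unitr.
by rewrite /mone (negbTE lj) amul0r.
Qed.

Lemma cone_mul P Q r s : cone P r -> cone Q s -> cone (mmul P Q) (r * s).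
Proof.
move=> hP; elim: hP Q s => [k|P1 P2 r1 r2 _ IH1 _ IH2|c P1 r1 c0 _ IH] Q s hQ.
- rewrite mul1r; elim: hQ => [l|Q1 Q2 s1 s2 _ IH1 _ IH2|c Q1 s1 c0 _ IH].
  + by rewrite mpowD; exact: cone_pow.
  + by rewrite mmulDr; exact: cone_add.
  + by rewrite mmulZr; exact: cone_scale.
- by rewrite mmulDl mulrDl; apply: cone_add; [exact: IH1|exact: IH2].
- by rewrite mmulZl -mulrA; apply: cone_scale => //; exact: IH.
Qed.

Lemma mpow_herm k i j : star (mpow Z k i j) = mpow Z k j i.
Proof.
elim: k i j => [|k IH] i j.
  by rewrite /mpow /= /mone eq_sym; case: eqP; rewrite ?star1 ?star0.
have -> : mpow Z k.+1 j i = mmul (mpow Z k) Z j i.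
  by rewrite -addn1 -mpowD mpow1.
rewrite /mpow iterS /mmul star_sum; apply: eq_bigr => l _.
by rewrite star_mul Zherm -/(mpow Z k) IH.
Qed.

Lemma cone_bound P r : cone P r -> forall i j, nm (P i j) <= M * r.
Proof.
elim=> [k|P1 P2 r1 r2 _ IH1 _ IH2|c P1 r1 c0 _ IH] i j.
- by rewrite mulr1.
- by rewrite mulrDr; apply: le_trans (nmD _ _) _; rewrite lerD.
- by rewrite nmZ nm_real (ger0_norm c0) mulrCA ler_wpM2l.
Qed.

Lemma cone_herm P r : cone P r -> forall i j, star (P i j) = P j i.
Proof.
elim=> [k|P1 P2 r1 r2 _ IH1 _ IH2|c P1 r1 c0 _ IH] i j.
- exact: mpow_herm.
- by rewrite starD IH1 IH2.
- by rewrite starZ cjR IH.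
Qed.

(** [root_bound] is the same iteration with $Z = 1$, that is, the sum of the coefficients. The
    initial value is the zero matrix, written as an element of the cone. *)
Fixpoint root_iter m : Mx :=
  if m is m'.+1 then mscale 2^-1 (madd Z (mmul (root_iter m') (root_iter m')))
  else mscale 0 Z.
Fixpoint root_bound m : R :=
  if m is m'.+1 then 2^-1 * (1 + root_bound m' * root_bound m') else 0.

Lemma root_cone m : cone (root_iter m) (root_bound m).
Proof.
have cZ : cone Z 1 by rewrite -mpow1; exact: cone_pow.
elim: m => [|m IH] /=.
  by have := cone_scale (lexx 0) cZ; rewrite mul0r.
apply: cone_scale; first by rewrite invr_ge0.
by apply: cone_add => //; exact: cone_mul.
Qed.

Definition msub P Q : Mx := fun i j => P i j - Q i j.

(** Successive iterates differ by a polynomial with nonnegative coefficients, since $u^2 - v^2 =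
    (u-v)u + v(u-v)$. So the norms of the increments are bounded by the increments of
    [root_bound]. *)
Lemma root_cone_sub m :
  cone (msub (root_iter m.+1) (root_iter m)) (root_bound m.+1 - root_bound m).
Proof.
have cZ : cone Z 1 by rewrite -mpow1; exact: cone_pow.
elim: m => [|m IH].
  have -> : msub (root_iter 1) (root_iter 0) = root_iter 1.
    by apply/funext => i; apply/funext => j; rewrite /msub /= /mscale scale0r subr0.
  by rewrite subr0; exact: root_cone.
set u := root_iter m.+1 in IH *; set v := root_iter m in IH *.
set D := msub u v in IH.
have -> : msub (root_iter m.+2) u = mscale 2^-1 (madd (mmul D u) (mmul v D)).
  apply/funext => i; apply/funext => j.
  rewrite /msub /= -/u -/v {2}/u /= -/v /mscale /madd -scalerBr; congr (_ *: _).
  rewrite opprD addrACA subrr add0r /mmul -sumrB -big_split /=.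
  by apply: eq_bigr => l _; rewrite /D /msub amulBl amulBr addrA subrK.
have -> : root_bound m.+2 - root_bound m.+1 =
    2^-1 * ((root_bound m.+1 - root_bound m) * root_bound m.+1 +
            root_bound m * (root_bound m.+1 - root_bound m)).
  by rewrite /=; field.
apply: cone_scale; first by rewrite invr_ge0.
by apply: cone_add; apply: cone_mul => //; exact: root_cone.
Qed.

Lemma root_bound_le1 m : 0 <= root_bound m <= 1.
Proof.
elim: m => [|m /andP[h0 h1]]; first by rewrite /= lexx ler01.
by rewrite /=; apply/andP; split; nra.
Qed.

Lemma matrix_sqrt : exists B : Mx, forall i j,
  mone i j - Z i j = \sum_l star (B l i) ** B l j.
Proof.
have M0 (i0 : 'I_n) : 0 <= M by exact: le_trans (nm_ge0 _) (Zbound 0 i0 i0).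
have /choice[y hy] : forall ij : 'I_n * 'I_n, exists l, to (fun m => root_iter m ij.1 ij.2) l.
  move=> [i j] /=; apply: (@increments_to _ _ _ (fun m => M * root_bound m) M) => m.
    by rewrite -mulrBr; exact: cone_bound (root_cone_sub m) i j.
  by rewrite ler_piMr ?M0 //; case/andP: (root_bound_le1 m).
pose Y : Mx := fun i j => y (i, j).
have hY i j : to (fun m => root_iter m i j) (Y i j) by exact: hy (i, j).
have Yherm i j : star (Y i j) = Y j i.
  apply: to_unique (to_star (hY i j)) _; apply: to_ev (hY j i).
  by exists 0%N => m _; rewrite (cone_herm (root_cone m)).
(* The fixed point equation $2Y = Z + Y^2$ says that $(1-Y)^2 = 1-Z$, where $1-Y$ is
   self-adjoint. *)
have Yeq i j : Y i j + Y i j = Z i j + mmul Y Y i j.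
  have h1 : to (fun m => mmul (root_iter m) (root_iter m) i j) (mmul Y Y i j).
    by apply: to_sum => l; apply: to_amul.
  have h2 := toD (to_cst (Z i j)) h1.
  apply: to_unique _ h2; have h3 := to_shift 1 (hY i j).
  apply: to_ev (toD h3 h3); exists 0%N => m _; rewrite addn1 /=.
  rewrite /mscale -scalerDl -rmorphD /=.
  have -> : 2^-1 + 2^-1 = 1 :> R by field.
  by rewrite scale1r.
exists (fun i j => mone i j - Y i j) => i j.
have Bh l : star (mone l i - Y l i) = mone i l - Y i l.
  rewrite starB Yherm; congr (_ - _).
  by rewrite /mone eq_sym; case: eqP; rewrite ?star1 ?star0.
under eq_bigr do rewrite Bh amulBl !amulBr.
rewrite !sumrB.
have e1 : \sum_l mone i l ** mone l j = mone i j by rewrite -/(mmul mone mone i j) mmul1l.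
have e2 : \sum_l mone i l ** Y l j = Y i j by rewrite -/(mmul mone Y i j) mmul1l.
have e3 : \sum_l Y i l ** mone l j = Y i j.
  rewrite (bigD1 j) //= big1 => [|l lj]; first by rewrite addr0 /mone eqxx mul_unitr.
  by rewrite /mone (negbTE lj) amul0r.
rewrite e1 e2 e3 opprB addrACA -[\sum_l _]/(mmul Y Y i j).
have -> : mmul Y Y i j = Y i j + Y i j - Z i j by rewrite Yeq addrAC subrr add0r.
rewrite -addrA; congr (_ + _).
by rewrite -opprD addrAC subrr add0r.
Qed.

End SquareRoot.

End CStarAlgebra.

Lemma to_nm_le2 (R : realType) (V W : normedZmodType R[i]) (u : nat -> V) (v : nat -> W) l m :
  to u l -> to v m -> (forall n, nm (u n) <= nm (v n)) -> nm l <= nm m.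
Proof.
move=> ul vm h; apply/ler_addgt0Pr => e e0.
have e2 : 0 < e / 2 by lra.
have [N hN] := ul _ e2; have [M hM] := vm _ e2.
have := hN _ (leq_maxl N M); have := hM _ (leq_maxr N M); move: (maxn N M) => n.
have := nmB_trans (u n) l 0; have := nmB_trans m (v n) 0; rewrite !subr0 (nmBC l).
have := h n; lra.
Qed.

(** * The UHF algebra and its trace representation *)

Section GNS.
Context (R : realType) (A : cstarType R).
Local Notation C := R[i].
Implicit Types (x y z : A) (a b : C).

(** The $1 \times 1$ case of [matrix_sqrt], as the powers of $x^{*}x$ are bounded by 1. *)
Lemma one_sub_star x : nm x <= 1 -> exists y, aone - star x ** x = star y ** y.
Proof.
move=> x1; pose Z (i j : 'I_1) := star x ** x.
have [||B hB] := @matrix_sqrt _ _ _ Z 1.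
- by move=> i j; rewrite /Z star_mul star_invol.
- move=> k i j.
  have -> : mpow Z k i j = apow (star x ** x) k.
    elim: k i j => [|k IH] i j; first by rewrite /mpow /= /mone !ord1 eqxx.
    by rewrite /mpow iterS /mmul big_ord1 -/(mpow Z k) IH.
  apply: le_trans (nm_apow_le _ _) _; rewrite nm_cstar -exprM.
  by apply: exprn_ile1 => //; exact: nm_ge0.
exists (B ord0 ord0); have := hB ord0 ord0.
by rewrite big_ord1 /mone eqxx.
Qed.

Context (tr : A -> C) (htr : is_trace tr).

Lemma trD x y : tr (x + y) = tr x + tr y.
Proof. by have := trace_linear htr 1 x y; rewrite scale1r mul1r. Qed.
Lemma tr0 : tr 0 = 0.
Proof. by apply: (addrI (tr 0)); rewrite -trD !addr0. Qed.
Lemma trZ a x : tr (a *: x) = a * tr x.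
Proof. by have := trace_linear htr a x 0; rewrite tr0 !addr0. Qed.
Lemma trB x y : tr (x - y) = tr x - tr y.
Proof. by rewrite trD -scaleN1r trZ mulN1r. Qed.
Lemma tr_sum I (s : seq I) (P : pred I) (F : I -> A) :
  tr (\sum_(i <- s | P i) F i) = \sum_(i <- s | P i) tr (F i).
Proof. by elim/big_rec2: _ => [|i u v _ <-]; rewrite ?tr0 ?trD. Qed.

Context (H : hilbertType R) (Lam : A -> H) (lmul : A -> H -> H).
Context (hH : is_gns tr Lam lmul).
Implicit Types u v w : H.

Lemma LamE a x y : Lam (a *: x + y) = a *: Lam x + Lam y.
Proof. exact: gns_linear hH a x y. Qed.

Lemma lmulE x a u v : lmul x (a *: u + v) = a *: lmul x u + lmul x v.
Proof. by have [h _] := gns_bounded hH x; exact: h a u v. Qed.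

Lemma Lam_dense v : exists s : nat -> A, to (fun n => Lam (s n)) v.
Proof.
have [s [hs sv]] := (denseP (range Lam)).1 (gns_dense hH) v.
have /choice[s' hs'] : forall n, exists x, Lam x = s n.
  by move=> n; have [x _ hx] := hs n; exists x.
by exists s'; apply: to_ev sv; exists 0%N => n _; rewrite hs'.
Qed.

Lemma nm_Lam x : (nm (Lam x) ^+ 2)%:C = tr (star x ** x).
Proof. by rewrite -dotxx (gns_dot hH). Qed.

Lemma nm_Lam1 : nm (Lam aone) = 1.
Proof.
have := nm_Lam aone; rewrite star1 mul_unitl (trace_unit htr) => /complexI.
by move=> /eqP; rewrite sqrp_eq1 ?nm_ge0 // => /eqP.
Qed.

(** For the normalized element $x'$ of norm 1, [one_sub_star] writes $y^{*}y - y^{*}x'^{*}x'y$ as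
    $(zy)^{*}(zy)$, whose trace is nonnegative. *)
Lemma nm_Lam_mul x y : nm (Lam (x ** y)) <= nm x * nm (Lam y).
Proof.
have [x0|xn] := eqVneq (nm x) 0.
  by rewrite (nm_eq0 x0) amul0l (op0 LamE) !nm0 mul0r.
have xp : 0 < nm x by rewrite lt_def xn nm_ge0.
pose x' := (nm x)^-1%:C *: x.
have [|z hz] := @one_sub_star x'.
  by rewrite nmZ nm_real ger0_norm ?invr_ge0 ?nm_ge0 // mulVf.
have -> : x = (nm x)%:C *: x' by rewrite scalerA -rmorphM /= mulfV // scale1r.
rewrite [X in _ <= X * _](_ : _ = nm x); last first.
  by rewrite scalerA -rmorphM /= mulfV // scale1r.
rewrite amulZl (opZ LamE) nmZ nm_real (ger0_norm (nm_ge0 x)) ler_wpM2l ?nm_ge0 //.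
rewrite -(@ler_pXn2r _ 2) // ?nnegrE ?nm_ge0 // -lecR !nm_Lam -subr_ge0 -trB.
have -> : star y ** y - star (x' ** y) ** (x' ** y) = star (z ** y) ** (z ** y).
  rewrite !star_mul -(mul_assoc (star y) (star z)) (mul_assoc (star z)) -hz.
  by rewrite amulBl mul_unitl amulBr !mul_assoc.
exact: trace_ge0 htr _.
Qed.

(** The unspecified bound in [gns_bounded] is used only for continuity; the constant [nm x] is
    transported from the dense range of [Lam]. *)
Lemma lmul_le x v : nm (lmul x v) <= nm x * nm v.
Proof.
have [s sv] := Lam_dense v.
have [_ [c [c0 hc]]] := (bounded_opP (lmul x)).1 (gns_bounded hH x).
have h1 := to_op (lmulE x) hc sv.
have h2 : to (fun n => (nm x)%:C *: Lam (s n)) ((nm x)%:C *: v) by apply: toZ => //; exact: to_cst.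
have -> : nm x * nm v = nm ((nm x)%:C *: v) by rewrite nmZ nm_real (ger0_norm (nm_ge0 x)).
apply: to_nm_le2 h1 h2 _ => n.
by rewrite (gns_lmul hH) nmZ nm_real (ger0_norm (nm_ge0 x)) nm_Lam_mul.
Qed.

Lemma Lam_total : total Lam.
Proof.
move=> v h; have [s sv] := Lam_dense v.
have : dot v v = 0 :> C.
  apply: to_unique (to_dotl v sv) _.
  by apply: to_ev (to_cst _); exists 0%N => n _; rewrite h.
by rewrite dotxx => /complexI /eqP; rewrite expf_eq0 /= => /eqP /nm_eq0.
Qed.

Lemma lmul_star x u v : dot (lmul x u) v = dot u (lmul (star x) v).
Proof.
have key y z : dot (lmul x (Lam y)) (Lam z) = dot (Lam y) (lmul (star x) (Lam z)).
  by rewrite !(gns_lmul hH) !(gns_dot hH) star_mul mul_assoc.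
have [s su] := Lam_dense u; have [r rv] := Lam_dense v.
have k2 y : dot (lmul x (Lam y)) v = dot (Lam y) (lmul (star x) v).
  apply: to_unique (to_dotr _ rv) _.
  apply: to_ev (to_dotr (Lam y) (to_op (lmulE _) (lmul_le (star x)) rv)).
  by exists 0%N => n _; rewrite key.
apply: to_unique (to_dotl _ (to_op (lmulE x) (lmul_le x) su)) _.
by apply: to_ev (to_dotl _ su); exists 0%N => n _; rewrite k2.
Qed.

Lemma lmul1 v : lmul aone v = v.
Proof.
apply: (total_inj Lam_total) => z; rewrite -{1}star1 -lmul_star (gns_lmul hH).
by rewrite mul_unitl.
Qed.

Lemma lmulM x y v : lmul (x ** y) v = lmul x (lmul y v).
Proof.
apply: (total_inj Lam_total) => z.
rewrite -{1}(star_invol (x ** y)) -lmul_star (gns_lmul hH) star_mul -mul_assoc.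
by rewrite -!(gns_lmul hH) !lmul_star !star_invol.
Qed.

Lemma lmulEl a x y v : lmul (a *: x + y) v = a *: lmul x v + lmul y v.
Proof.
apply: (total_inj Lam_total) => z; rewrite dotDr dotZr.
have e (w : A) : dot (Lam z) (lmul w v) = dot (Lam (star w ** z)) v.
  by rewrite -(gns_lmul hH) lmul_star star_invol.
by rewrite !e starD starZ amulDl amulZl LamE dotDl dotZl cjK.
Qed.

Lemma lmulDl x y v : lmul (x + y) v = lmul x v + lmul y v.
Proof. exact: (opD (fun a x y => lmulEl a x y v)). Qed.
Lemma lmulZl a x v : lmul (a *: x) v = a *: lmul x v.
Proof. exact: (opZ (fun a x y => lmulEl a x y v)). Qed.
Lemma lmulBl x y v : lmul (x - y) v = lmul x v - lmul y v.
Proof. exact: (opB (fun a x y => lmulEl a x y v)). Qed.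
Lemma lmul0l v : lmul 0 v = 0.
Proof. exact: (op0 (fun a x y => lmulEl a x y v)). Qed.
Lemma lmul_suml I (s : seq I) (P : pred I) (F : I -> A) v :
  lmul (\sum_(i <- s | P i) F i) v = \sum_(i <- s | P i) lmul (F i) v.
Proof. exact: (op_sum (fun a x y => lmulEl a x y v)). Qed.
End GNS.

(** * Local algebras: orthonormal bases, density, faithfulness of the trace representation *)

Section UHF.
Context (R : realType) (A : cstarType R) (N d : nat).
Local Notation C := R[i].
Context (hN : (0 < N)%N) (site : 'rV[int]_d -> 'M[C]_N -> A) (hA : is_uhf site).
Implicit Types (x y z : A) (a b : C) (D E : set 'rV[int]_d).

Lemma siteE j a m m' : site j (a *: m + m') = a *: site j m + site j m'.
Proof. exact: site_linear hA j a m m'. Qed.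

Lemma supported_algebra D : star_subalgebra (supported site D).
Proof.
split.
- by move=> S [[h _ _ _] _].
- by move=> a x y hx hy S hS; case: (hS) => [[_ h _ _] _]; apply: h; [exact: hx|exact: hy].
- by move=> x y hx hy S hS; case: (hS) => [[_ _ h _] _]; apply: h; [exact: hx|exact: hy].
- by move=> x hx S hS; case: (hS) => [[_ _ _ h] _]; apply: h; exact: hx.
Qed.

Lemma supported1 D : supported site D aone.
Proof. by case: (supported_algebra D). Qed.
Lemma supportedE D a x y : supported site D x -> supported site D y -> supported site D (a *: x + y).
Proof. by case: (supported_algebra D) => _ h _ _; exact: h. Qed.
Lemma supportedM D x y : supported site D x -> supported site D y -> supported site D (x ** y).
Proof. by case: (supported_algebra D) => _ _ h _; exact: h. Qed.
Lemma supportedS D x : supported site D x -> supported site D (star x).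
Proof. by case: (supported_algebra D) => _ _ _ h; exact: h. Qed.
Lemma supported0 D : supported site D 0.
Proof. by rewrite -(subrr aone) -scaleN1r addrC; apply: supportedE; exact: supported1. Qed.
Lemma supportedZ D a x : supported site D x -> supported site D (a *: x).
Proof. by move=> h; rewrite -[_ *: _]addr0; apply: supportedE => //; exact: supported0. Qed.
Lemma supportedD D x y : supported site D x -> supported site D y -> supported site D (x + y).
Proof. by move=> h h'; rewrite -[x]scale1r; exact: supportedE. Qed.
Lemma supported_sum D I (s : seq I) (P : pred I) (F : I -> A) :
  (forall i, P i -> supported site D (F i)) -> supported site D (\sum_(i <- s | P i) F i).
Proof.
move=> h; elim/big_rec: _ => [|i x Pi]; first exact: supported0.
by apply: supportedD; exact: h.
Qed.
Lemma supported_site D j m : D j -> supported site D (site j m).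
Proof. by move=> Dj S [_ h]; apply: h; exists j, m. Qed.

Lemma supported_ind D (S : set A) : star_subalgebra S ->
  (forall j m, D j -> S (site j m)) -> supported site D `<=` S.
Proof. by move=> hS h x; apply; split=> // _ [j [m [Dj ->]]]; exact: h. Qed.

Lemma supported_mono D E : D `<=` E -> supported site D `<=` supported site E.
Proof.
by move=> DE; apply: supported_ind (supported_algebra E) _ => j m /DE; exact: supported_site.
Qed.

Lemma centralizer_algebra (S : set A) : (forall x, S x -> S (star x)) ->
  star_subalgebra [set x | forall y, S y -> x ** y = y ** x].
Proof.
move=> hS; split=> /=.
- by move=> y _; rewrite mul_unitl mul_unitr.
- by move=> a x x' h h' y Sy; rewrite amulDl amulDr amulZl amulZr h ?h'.
- by move=> x x' h h' y Sy; rewrite -mul_assoc h' // mul_assoc h // mul_assoc.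
- move=> x h y Sy; rewrite -(star_invol y) -!star_mul h //; exact: hS.
Qed.

(** [supported_ind] is used twice with a centralizer as subalgebra: that of the matrices at the
    sites of [E], then that of [supported site D]. *)
Lemma supported_comm D E x y : (forall j, D j -> E j -> False) ->
  supported site D x -> supported site E y -> x ** y = y ** x.
Proof.
move=> DE hx; have h1 : forall x j m, supported site D x -> E j -> x ** site j m = site j m ** x.
  move=> z j m hz Ej.
  pose S := [set w | exists j m, E j /\ w = site j m].
  have hS w : S w -> S (star w).
    by move=> [i [p [Ei ->]]]; exists i, (map_mx Num.conj p^T); rewrite (site_star hA).
  apply: (supported_ind (centralizer_algebra hS) _ hz) => [i p Di w [i' [p' [Ei' ->]]]|]; last by exists j, m.
  by rewrite (site_comm hA) //; apply/eqP => ii; apply: (DE i Di); rewrite ii.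
move=> hy.
have := supported_ind (centralizer_algebra (@supportedS D)) _ hy => h.
by rewrite h // => j m Ej w hw; rewrite h1.
Qed.

Context (tr : A -> C) (htr : is_trace tr).

(** Since [y] commutes with the site, [m |-> tr (y ** site j m)] is a trace on matrices, hence a
    multiple of the matrix trace; the unit matrix determines the factor. *)
Lemma tr_site j y p q : (forall m, y ** site j m = site j m ** y) ->
  N%:R * tr (y ** site j (delta_mx p q)) = (p == q)%:R * tr y.
Proof.
move=> yc; pose F m := tr (y ** site j m).
have FM m m' : F (m *m m') = F (m' *m m).
  by rewrite /F !(site_mul hA) !mul_assoc (trace_comm htr) mul_assoc -yc.
have Fd p' q' : F (delta_mx p' p') = F (delta_mx q' q').
  by rewrite -(mul_delta_mx q') FM mul_delta_mx.
have [<-|pq] := eqVneq p q; last first.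
  rewrite mul0r -/(F _) -(mul_delta_mx p) FM mul_delta_mx_0 1?eq_sym //.
  rewrite /F (op0 (siteE j)) amul0r (tr0 htr) mulr0 //.
rewrite mul1r -{2}(mul_unitr y) -(site_unit hA j) mx1_sum_delta.
rewrite (op_sum (siteE j)) amul_sumr (tr_sum htr).
under eq_bigr => i _ do rewrite -/(F (delta_mx i i)) (Fd i p).
by rewrite sumr_const card_ord /F mulr_natl.
Qed.

Lemma star_delta_mx (p q : 'I_N) : map_mx Num.conj (delta_mx p q : 'M[C]_N)^T = delta_mx q p.
Proof. by apply/matrixP => s t; rewrite !mxE andbC; case: (_ && _); rewrite ?cj1 ?cj0. Qed.

Definition slist (l : seq 'rV[int]_d) : set 'rV[int]_d := [set j | j \in l].

(** The algebra of one more site is that of matrices with entries in the old one: such sums form a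
    *-subalgebra, by the multiplication rule of matrix units, and contain the generators. *)
Lemma supported_cons j l x : j \notin l -> supported site (slist (j :: l)) x ->
  exists X : 'I_N -> 'I_N -> A, (forall p q, supported site (slist l) (X p q)) /\
    x = \sum_p \sum_q X p q ** site j (delta_mx p q).
Proof.
move=> jl; pose V := fun X : 'I_N -> 'I_N -> A => \sum_p \sum_q X p q ** site j (delta_mx p q).
have comm z m : supported site (slist l) z -> z ** site j m = site j m ** z.
  move=> hz; apply: (@supported_comm (slist l) [set j]) => //; last exact: supported_site.
  by move=> i il ij; rewrite ij /slist /= (negbTE jl) in il.
have diag z : V (fun p q => if p == q then z else 0) = z.
  rewrite /V -[RHS]mul_unitr -(site_unit hA j) mx1_sum_delta (op_sum (siteE j)) amul_sumr.
  apply: eq_bigr => p _; rewrite (bigD1 p) //= eqxx big1 ?addr0 // => q qp.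
  by rewrite eq_sym (negbTE qp) amul0l.
pose S := [set z | exists X : 'I_N -> 'I_N -> A,
  (forall p q, supported site (slist l) (X p q)) /\ z = V X].
apply: (@supported_ind _ S) => [|i m].
  split=> [|a z z' [X [hX ->]] [X' [hX' ->]]|z z' [X [hX ->]] [X' [hX' ->]]|z [X [hX ->]]].
  - exists (fun p q => if p == q then aone else 0); split => [p q|].
      by case: eqP => _; [exact: supported1|exact: supported0].
    by rewrite -/(V _) diag.
  - exists (fun p q => a *: X p q + X' p q); split => [p q|]; first exact: supportedE.
    rewrite scaler_sumr -big_split; apply: eq_bigr => p _ /=.
    rewrite scaler_sumr -big_split; apply: eq_bigr => q _ /=.
    by rewrite amulDl amulZl.
  - exists (fun p q => \sum_r X p r ** X' r q); split => [p q|].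
      by apply: supported_sum => r _; exact: supportedM.
    rewrite amul_suml; apply: eq_bigr => p _; rewrite amul_suml.
    under [RHS]eq_bigr do rewrite amul_suml.
    rewrite [RHS]exchange_big; apply: eq_bigr => r _ /=.
    rewrite amul_sumr (bigD1 r) //= [X in _ + X]big1 ?addr0 => [|r' rr'].
      rewrite amul_sumr; apply: eq_bigr => q _.
      rewrite mul_assoc -(mul_assoc (X p r)) -comm // mul_assoc -mul_assoc -(site_mul hA).
      by rewrite mul_delta_mx.
    rewrite amul_sumr big1 // => q _.
    rewrite mul_assoc -(mul_assoc (X p r)) -comm // mul_assoc -mul_assoc -(site_mul hA).
    by rewrite mul_delta_mx_0 1?eq_sym // (op0 (siteE j)) amul0r.
  - exists (fun p q => star (X q p)); split => [p q|]; first exact: supportedS.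
    rewrite /V star_sum; under eq_bigr do rewrite star_sum.
    rewrite exchange_big; apply: eq_bigr => p _; apply: eq_bigr => q _ /=.
    rewrite star_mul -(site_star hA) comm; last exact: supportedS.
    by rewrite star_delta_mx.
rewrite /slist /= inE => /orP[/eqP ->|il].
  exists (fun p q => m p q *: aone); split => [p q|]; first by apply: supportedZ; exact: supported1.
  rewrite {1}(matrix_sum_delta m) (op_sum (siteE j)); apply: eq_bigr => p _.
  rewrite (op_sum (siteE j)); apply: eq_bigr => q _.
  by rewrite (opZ (siteE j)) amulZl mul_unitl.
exists (fun p q => if p == q then site i m else 0); split => [p q|].
  by case: eqP => _; [exact: supported_site|exact: supported0].
by rewrite -/(V _) diag.
Qed.

(** Products of one matrix unit per site, each scaled by $\sqrt N$, are orthonormal for the trace by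
    [tr_site]. This is what makes boxes finite-dimensional, with coordinates given by the trace. *)
Lemma supported_basis l : uniq l -> exists (I : finType) (b : I -> A),
  [/\ forall i, supported site (slist l) (b i),
      forall i j, tr (star (b i) ** b j) = (i == j)%:R &
      forall x, supported site (slist l) x -> exists c : I -> C, x = \sum_i c i *: b i].
Proof.
elim: l => [_|j l IH /= /andP[jl /IH [I [b [bS bo bx]]]]].
  exists 'I_1, (fun=> aone); split => [i|i j|].
  - exact: supported1.
  - by rewrite !ord1 star1 mul_unitl (trace_unit htr).
  - pose S := [set z | exists c : 'I_1 -> C, z = \sum_i c i *: (aone : A)].
    apply: (@supported_ind _ S) => [|j m] //.
    split=> [|a x y [c ->] [c' ->]|x y [c ->] [c' ->]|x [c ->]].
    + by exists (fun=> 1); rewrite big_ord1 scale1r.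
    + exists (fun i => a * c i + c' i).
      by rewrite !big_ord1 scalerDl scalerA.
    + exists (fun i => c i * c' i).
      by rewrite !big_ord1 amulZl amulZr mul_unitl scalerA.
    + exists (fun i => Num.conj (c i)).
      by rewrite !big_ord1 starZ star1.
have comm z m : supported site (slist l) z -> z ** site j m = site j m ** z.
  move=> hz; apply: (@supported_comm (slist l) [set j]) => //; last exact: supported_site.
  by move=> i il ij; rewrite ij /slist /= (negbTE jl) in il.
have N0 : (0 : R) < N%:R by rewrite ltr0n.
pose r : C := (Num.sqrt (N%:R : R))%:C.
have rr : r * r = N%:R by rewrite -rmorphM -expr2 sqr_sqrtr ?ler0n // rmorph_nat.
have r0 : r != 0 by apply/eqP => r0; move: rr; rewrite r0 mul0r => /esym/eqP; rewrite pnatr_eq0 eqn0Ngt hN.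
exists (I * ('I_N * 'I_N))%type, (fun i => r *: (b i.1 ** site j (delta_mx i.2.1 i.2.2))).
have sub : supported site (slist l) `<=` supported site (slist (j :: l)).
  by apply: supported_mono => i il; rewrite /slist /= inE; apply/orP; right.
split => [i|[i [p q]] [i' [p' q']] /=|x].
- apply: supportedZ; apply: supportedM; first exact: (sub _ (bS _)).
  by apply: supported_site; rewrite /slist /= inE eqxx.
- rewrite starZ cjR amulZl amulZr scalerA rr (trZ htr) star_mul -(site_star hA).
  rewrite star_delta_mx.
  rewrite -mul_assoc (trace_comm htr) [star (b i) ** _]mul_assoc -mul_assoc -(site_mul hA).
  have cw : forall m, (star (b i) ** b i') ** site j m = site j m ** (star (b i) ** b i').
    by move=> m; apply: comm; apply: supportedM => //; exact: supportedS.
  rewrite mul_delta_mx_cond -!pair_eqE /= -!pair_eqE /= [q == q']eq_sym [p == p']eq_sym.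
  have [_|_] := eqVneq q' q; last by rewrite mulr0n (op0 (siteE j)) amul0r (tr0 htr) mulr0 !andbF.
  by rewrite mulr1n (tr_site _ _ cw) bo -natrM mulnb andbT andbC.
- move=> /(supported_cons jl)[X [hX ->]].
  have /choice[c hc] : forall pq : 'I_N * 'I_N, exists c : I -> C, X pq.1 pq.2 = \sum_i c i *: b i.
    by move=> pq; exact: bx.
  exists (fun i => r^-1 * c i.2 i.1).
  rewrite -(pair_bigA _ (fun i pq => (r^-1 * c pq i) *: (r *: (b i ** site j (delta_mx pq.1 pq.2))))) /=.
  rewrite [RHS]exchange_big [LHS]pair_bigA /=; apply: eq_bigr => pq _.
  rewrite hc amul_suml; apply: eq_bigr => i _.
  by rewrite scalerA mulrAC mulVf // mul1r amulZl.
Qed.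

Lemma box_list n : exists l, uniq l /\ slist l = box d n.
Proof.
pose F (f : {ffun 'I_d -> 'I_(n + n).+1}) : 'rV[int]_d := \row_i ((f i : nat)%:Z - n%:Z).
exists [seq j <- undup [seq F f | f <- enum {ffun 'I_d -> 'I_(n + n).+1}] | (znorm j <= n)%N].
split; first by rewrite filter_uniq // undup_uniq.
apply/seteqP; split => j; rewrite /slist /box /= mem_filter; first by case/andP.
move=> jn; rewrite jn mem_undup /=.
have ji i : (`|j ord0 i| <= n)%N by apply: leq_trans jn; rewrite /znorm (leq_bigmax i).
apply/mapP; exists [ffun i => inord (absz (j ord0 i + n%:Z))]; first by rewrite mem_enum.
apply/rowP => i; rewrite mxE ffunE; have := ji i; rewrite !ord1 => h.
move: (j 0 i) h => z h; have zn : (absz (z + n%:Z)%R < (n + n).+1)%N by lia.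
by rewrite inordK //; lia.
Qed.

Notation B n := (supported site (box d n)).

Lemma box_basis n : exists (I : finType) (b : I -> A),
  [/\ forall i, B n (b i),
      forall i j, tr (star (b i) ** b j) = (i == j)%:R &
      forall x, B n x -> x = \sum_i tr (star (b i) ** x) *: b i].
Proof.
have [l [ul <-]] := box_list n; have [I [b [bS bo bx]]] := supported_basis ul.
exists I, b; split => // x /bx[c ->]; apply: eq_bigr => i _; congr (_ *: _).
rewrite amul_sumr (tr_sum htr) (bigD1 i) //= big1 => [|j ji].
  by rewrite addr0 amulZr (trZ htr) bo eqxx mulr1.
by rewrite amulZr (trZ htr) bo eq_sym (negbTE ji) mulr0.
Qed.

Lemma box_mono m n : (m <= n)%N -> B m `<=` B n.
Proof. by move=> mn; apply: supported_mono => j /= h; exact: leq_trans h mn. Qed.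

Lemma local_algebra : star_subalgebra (local_elt site).
Proof.
have two x y : local_elt site x -> local_elt site y -> exists n, B n x /\ B n y.
  move=> [n _ hx] [m _ hy]; exists (maxn n m).
  by split; [apply: box_mono hx; exact: leq_maxl|apply: box_mono hy; exact: leq_maxr].
split.
- by exists 0%N => //; exact: supported1.
- by move=> a x y hx hy; have [n [h h']] := two _ _ hx hy; exists n => //; exact: supportedE.
- by move=> x y hx hy; have [n [h h']] := two _ _ hx hy; exists n => //; exact: supportedM.
- by move=> x [n _ h]; exists n => //; exact: supportedS.
Qed.

Lemma local_dense x : exists u, (forall n, local_elt site (u n)) /\ to u x.
Proof.
have [u [hu ux]] := (denseP _).1 (site_dense hA) x.
exists u; split => // n; apply: (supported_ind local_algebra _ (hu n)) => j m _.
by exists (znorm j) => //; apply: supported_site; rewrite /box /=.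
Qed.

Context (H : hilbertType R) (Lam : A -> H) (lmul : A -> H -> H).
Context (hH : is_gns tr Lam lmul).

(** On a finite-dimensional box the norm is at most a constant times the operator norm. Applied to
    the powers $(x^{*}x)^{2^k}$, whose norms are exact powers by the C*-identity, the comparison
    loses its constant. *)
Lemma nm_local_lmul n x c : B n x -> (forall v, nm (lmul x v) <= c * nm v) -> nm x <= c.
Proof.
move=> hx hc; have [I [b [bB bo bx]]] := box_basis n.
have c0 : 0 <= c.
  by apply: le_trans (nm_ge0 _) (le_trans (hc (Lam aone)) _); rewrite (nm_Lam1 htr hH) mulr1.
pose h := star x ** x.
have hh : star h = h by rewrite /h star_mul star_invol.
have hB m : B n (apow h m).
  elim: m => [|m IH]; first exact: supported1.
  by apply: supportedM => //; apply: supportedM => //; exact: supportedS.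
have hcs v : nm (lmul (star x) v) <= c * nm v.
  have h1 := CS v (lmul x (lmul (star x) v)).
  have h2 := hc (lmul (star x) v).
  have h3 : nm (lmul (star x) v) ^+ 2 <= nm v * (c * nm (lmul (star x) v)).
    rewrite -[leLHS]ger0_norm ?sqr_ge0 // -nm_real -dotxx (lmul_star htr hH) star_invol.
    by apply: le_trans h1 _; rewrite ler_wpM2l ?nm_ge0.
  have [->|an] := eqVneq (nm (lmul (star x) v)) 0; first by rewrite mulr_ge0 ?nm_ge0.
  have ap : 0 < nm (lmul (star x) v) by rewrite lt_def an nm_ge0.
  by rewrite -(ler_pM2r ap) -expr2; apply: le_trans h3 _; rewrite mulrCA mulrA.
have hm m v : nm (lmul (apow h m) v) <= (c ^+ 2) ^+ m * nm v.
  elim: m v => [|m IH] v; first by rewrite (lmul1 htr hH) mul1r.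
  rewrite /apow iterS (lmulM htr hH) -/(apow h m) /h (lmulM htr hH).
  apply: le_trans (hcs _) _; rewrite exprS expr2 -!mulrA ler_wpM2l //.
  by apply: le_trans (hc _) _; rewrite ler_wpM2l // mulrC.
suff : nm x ^+ 2 <= c ^+ 2 by rewrite ler_pXn2r // nnegrE ?nm_ge0.
(* The coefficient of $h^m$ at $b_i$ is $\langle \Lambda(b_i), h^m \Lambda(1)\rangle$, bounded by
   $\|\Lambda(b_i)\| c^{2m}$. *)
apply: (pow2_le (c := \sum_i nm (Lam (b i)) * nm (b i))) => [||k]; try exact: sqr_ge0.
rewrite -nm_cstar -/h -nm_apow_pow2 // {1}(bx _ (hB _)).
apply: le_trans (nm_sum _ _ _) _; rewrite mulr_suml; apply: ler_sum => i _.
rewrite nmZ mulrAC ler_wpM2r ?nm_ge0 // -[apow _ _]mul_unitr -(gns_dot hH) -(gns_lmul hH).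
by apply: le_trans (CS _ _) _; rewrite ler_wpM2l ?nm_ge0 //; have := hm (2 ^ k)%N (Lam aone); rewrite (nm_Lam1 htr hH) mulr1.
Qed.

Lemma nm_lmul x c : (forall v, nm (lmul x v) <= c * nm v) -> nm x <= c.
Proof.
move=> hc; have [u [hu ux]] := local_dense x.
apply/ler_addgt0Pr => e e0; have [|n hn] := ux (e / 2); first by rewrite divr_gt0.
have h1 : nm (u n) <= c + nm (u n - x).
  have [m _ hm] := hu n; apply: (nm_local_lmul hm) => v.
  have -> : lmul (u n) v = lmul x v + lmul (u n - x) v.
    by rewrite -(lmulDl htr hH) addrC subrK.
  rewrite mulrDl; apply: le_trans (nmD _ _) _; rewrite lerD //.
  exact: (lmul_le htr hH).
have := hn n (leqnn n); have := nmB_trans (u n) x 0; rewrite !subr0 nmBC => h2 h3.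
lra.
Qed.

Lemma lmul_inj x y : (forall v, lmul x v = lmul y v) -> x = y.
Proof.
move=> h; apply/eqP; rewrite -subr_eq0; apply/eqP/nm_eq0/eqP.
rewrite eq_le nm_ge0 andbT; apply: nm_lmul => v.
by rewrite (lmulBl htr hH) h subrr nm0 mul0r.
Qed.

Lemma lmul_test x y : (forall u v, dot u (lmul x v) = dot u (lmul y v)) -> x = y.
Proof. by move=> h; apply: lmul_inj => v; apply: dot_inj. Qed.

End UHF.

(** * The generator and its evolution *)

Section ComplexIntegral.
Context (R : realType).
Local Notation C := R[i].
Implicit Types (f g : R -> R) (h : R -> C) (a b c d t : R).

Definition cg a b h := cintegrable `[a, b] h.
Definition ci a b h : C := cintegral `[a, b] h.
Definition cbm a b h := bm a b (fun r => complex.Re (h r)) /\ bm a b (fun r => complex.Im (h r)).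

Let mi a b : measurable (`[a, b]%classic : set R). Proof. by []. Qed.

Lemma in_seg a b (P : R -> Prop) : (forall x, a <= x <= b -> P x) ->
  forall x, `[a, b]%classic x -> P x.
Proof. by move=> h x; rewrite /= in_itv /=; exact: h. Qed.

Lemma eq_cg a b h h' : (forall x, a <= x <= b -> h x = h' x) -> cg a b h -> cg a b h'.
Proof. by move=> e; apply: (eq_cig (mi a b)); exact: in_seg. Qed.
Lemma eq_ci a b h h' : (forall x, a <= x <= b -> h x = h' x) -> ci a b h = ci a b h'.
Proof. by move=> e; apply: eq_cintegral; exact: in_seg. Qed.
Lemma cgD a b h h' : cg a b h -> cg a b h' -> cg a b (fun x => h x + h' x).
Proof. exact: cigD. Qed.
Lemma cgZ a b (z : C) h : cg a b h -> cg a b (fun x => z * h x).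
Proof. exact: cigZ. Qed.
Lemma cgB a b h h' : cg a b h -> cg a b h' -> cg a b (fun x => h x - h' x).
Proof.
move=> hh hh'; apply: eq_cg (cgD hh (cgZ (-1) hh')) => x _; by rewrite mulN1r.
Qed.
Lemma cg_conj a b h : cg a b h -> cg a b (fun x => Num.conj (h x)).
Proof. exact: cig_conj. Qed.
Lemma cg_sum a b (I : Type) (s : seq I) (F : I -> R -> C) :
  (forall i, cg a b (F i)) -> cg a b (fun x => \sum_(i <- s) F i x).
Proof. exact: cig_sum. Qed.
Lemma ciD a b h h' : cg a b h -> cg a b h' -> ci a b (fun x => h x + h' x) = ci a b h + ci a b h'.
Proof. exact: cintegralD. Qed.
Lemma ciZ a b (z : C) h : cg a b h -> ci a b (fun x => z * h x) = z * ci a b h.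
Proof. exact: cintegralZ. Qed.
Lemma ciB a b h h' : cg a b h -> cg a b h' -> ci a b (fun x => h x - h' x) = ci a b h - ci a b h'.
Proof.
move=> hh hh'; rewrite -mulN1r -ciZ // -ciD //; last exact: cgZ.
by apply: eq_ci => x _; rewrite mulN1r.
Qed.
Lemma ci0 a b : ci a b (fun=> 0) = 0.
Proof. exact: cintegral0. Qed.
Lemma ci_conj a b h : cg a b h -> ci a b (fun x => Num.conj (h x)) = Num.conj (ci a b h).
Proof. exact: cintegral_conj. Qed.
Lemma ci_sum a b (I : Type) (s : seq I) (F : I -> R -> C) : (forall i, cg a b (F i)) ->
  ci a b (fun x => \sum_(i <- s) F i x) = \sum_(i <- s) ci a b (F i).
Proof. exact: cintegral_sum. Qed.
Lemma ci_nm a b h (g : R -> R) : cg a b h -> intg a b g ->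
  (forall x, a <= x <= b -> nm (h x) <= g x) -> nm (ci a b h) <= 2 * itg a b g.
Proof. by move=> h1 h2 h3; apply: cintegral_nm => //; exact: in_seg. Qed.
Lemma ci_aa a h : ci a a h = 0.
Proof. by rewrite /ci /cintegral -![\int[_]_(_ in _) _]/(itg _ _ _) !itg_aa. Qed.
Lemma cg_sub a b c d h : a <= c -> d <= b -> cg a b h -> cg c d h.
Proof. by move=> ac db [h1 h2]; split; [exact: intg_sub h1|exact: intg_sub h2]. Qed.
Lemma ci_add a b c h : a <= b -> b <= c -> cg a c h -> ci a c h = ci a b h + ci b c h.
Proof.
move=> ab bc [h1 h2]; rewrite /ci /cintegral -![\int[_]_(_ in _) _]/(itg _ _ _).
by rewrite (itg_add ab bc h1) (itg_add ab bc h2).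
Qed.
Lemma ci_shift s a b h : cg (a + s) (b + s) h ->
  cg a b (fun x => h (x + s)) /\ ci a b (fun x => h (x + s)) = ci (a + s) (b + s) h.
Proof.
move=> [h1 h2]; have [i1 e1] := itg_shift h1; have [i2 e2] := itg_shift h2.
by split; [split|rewrite /ci /cintegral; congr (_ +i* _); [exact: e1|exact: e2]].
Qed.
(** Controls changed by [before], [glue] or [ind] are compared on half-open intervals; the right
    endpoint has measure zero. *)
Lemma eq_ci_o a b h h' : cg a b h -> cg a b h' -> (forall x, a <= x < b -> h x = h' x) ->
  ci a b h = ci a b h'.
Proof.
move=> [h1 h2] [h3 h4] e.
have E (u v : R -> R) : intg a b u -> intg a b v -> (forall x, a <= x < b -> u x = v x) ->
    itg a b u = itg a b v.
  move=> iu iv uv; rewrite /itg -!Rintegral_itv_bndo_bndc; last first.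
  - by apply: integrableS iu => //; apply: subset_itv; rewrite bnd_simp.
  - by apply: integrableS iv => //; apply: subset_itv; rewrite bnd_simp.
  by apply: eq_Rintegral => x; rewrite inE /= in_itv /=; exact: uv.
rewrite /ci /cintegral; congr (_ +i* _); apply: E => // x /e -> //.
Qed.

Lemma cbm_cg a b h : cbm a b h -> cg a b h.
Proof. by move=> [h1 h2]; split; exact: bm_intg. Qed.
Lemma cbm_cst a b (z : C) : cbm a b (fun=> z).
Proof. by split; exact: bm_cst. Qed.
Lemma eq_bm a b f g : (forall x, a <= x <= b -> f x = g x) -> bm a b f -> bm a b g.
Proof.
move=> fg [mf [c hc]]; split; last by exists c => x hx; rewrite -fg // hc.
by apply: eq_measurable_fun mf => x; rewrite inE /= in_itv /=; exact: fg.
Qed.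
Lemma eq_cbm a b h h' : (forall x, a <= x <= b -> h x = h' x) -> cbm a b h -> cbm a b h'.
Proof. by move=> e [h1 h2]; split; [apply: eq_bm h1|apply: eq_bm h2] => x /e ->. Qed.
Lemma cbmD a b h h' : cbm a b h -> cbm a b h' -> cbm a b (fun x => h x + h' x).
Proof.
move=> [h1 h2] [h3 h4]; split.
  by apply: eq_bm (bmD h1 h3) => x _; rewrite ReD.
by apply: eq_bm (bmD h2 h4) => x _; rewrite ImD.
Qed.
Lemma bmB a b f g : bm a b f -> bm a b g -> bm a b (fun x => f x - g x).
Proof.
move=> hf hg; apply: eq_bm (bmD hf (bmM (bm_cst _ _ (-1)) hg)) => x _.
by rewrite mulN1r.
Qed.
Lemma cbmM a b h h' : cbm a b h -> cbm a b h' -> cbm a b (fun x => h x * h' x).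
Proof.
move=> [h1 h2] [h3 h4]; split.
  by apply: eq_bm (bmB (bmM h1 h3) (bmM h2 h4)) => x _; rewrite ReM.
by apply: eq_bm (bmD (bmM h1 h4) (bmM h2 h3)) => x _; rewrite ImM.
Qed.
Lemma cbmZ a b (z : C) h : cbm a b h -> cbm a b (fun x => z * h x).
Proof. by apply: cbmM; exact: cbm_cst. Qed.
Lemma cbmB a b h h' : cbm a b h -> cbm a b h' -> cbm a b (fun x => h x - h' x).
Proof.
move=> hh hh'; apply: eq_cbm (cbmD hh (cbmZ (-1) hh')) => x _; by rewrite mulN1r.
Qed.
Lemma cbm_sum a b (I : Type) (s : seq I) (F : I -> R -> C) :
  (forall i, cbm a b (F i)) -> cbm a b (fun x => \sum_(i <- s) F i x).
Proof.
move=> h; elim: s => [|i s IH].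
  by apply: eq_cbm (cbm_cst _ _ 0) => x _; rewrite big_nil.
by apply: eq_cbm (cbmD (h i) IH) => x _; rewrite big_cons.
Qed.
Lemma cbm_conj a b h : cbm a b h -> cbm a b (fun x => Num.conj (h x)).
Proof.
move=> [h1 h2]; split; first by apply: eq_bm h1 => x _; rewrite ReJ.
by apply: eq_bm (bmM (bm_cst _ _ (-1)) h2) => x _; rewrite ImJ mulN1r.
Qed.
Lemma cbm_sub a b c d h : a <= c -> d <= b -> cbm a b h -> cbm c d h.
Proof. by move=> ac db [h1 h2]; split; [exact: bm_sub h1|exact: bm_sub h2]. Qed.
Lemma cbm_ci a b h : cg a b h -> cbm a b (fun x => ci a x h).
Proof. by move=> [h1 h2]; split; exact: itg_bm. Qed.
Lemma cg_mul a b h h' : cbm a b h -> cg a b h' -> cg a b (fun x => h x * h' x).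
Proof.
move=> [h1 h2] [h3 h4]; split.
  by apply: eq_intg (intgB (intg_mul h1 h3) (intg_mul h2 h4)) => x _; rewrite ReM.
by apply: eq_intg (intgD (intg_mul h1 h4) (intg_mul h2 h3)) => x _; rewrite ImM.
Qed.
Lemma cbm_shift s a b h : cbm (a + s) (b + s) h -> cbm a b (fun x => h (x + s)).
Proof.
have E (f : R -> R) : bm (a + s) (b + s) f -> bm a b (fun x => f (x + s)).
  move=> hf; have [m [c hc]] := hf; split.
    by apply: intg_meas; case: (itg_shift (bm_intg hf)).
  by exists c => x hx; apply: hc; lra.
move=> [h1 h2]; split; first exact: (E (fun r => complex.Re (h r))).
exact: (E (fun r => complex.Im (h r))).
Qed.

End ComplexIntegral.

Section ComplexVolterra.
Context (R : realType) (I : finType).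
Local Notation C := R[i].
Implicit Types (y : R -> I -> C).

(** The complex analogue of [kernel_on]. The factor 2 in [cker_bound] pays for the two real entries
    into which [realify] splits each complex one. *)
Record cker (a b : R) (g : R -> I -> I -> C) (beta : R -> R) (K : R) : Prop := {
  cker_le : a <= b ;
  cker_cg : forall i j, cg a b (fun r => g r j i) ;
  cker_bound : forall r j, a <= r <= b -> 2 * \sum_i nm (g r j i) <= beta r ;
  cker_ge0 : forall r, a <= r <= b -> 0 <= beta r ;
  cker_beta : intg a b beta ;
  cker_beta2 : intg a b (fun r => beta r ^+ 2) ;
  cker_K : itg a b (fun r => beta r ^+ 2) <= K }.

(* A complex system is a real one indexed by [I * bool], the boolean marking imaginary parts. *)
Definition parts (z : C) (p : bool) : R := if p then complex.Im z else complex.Re z.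
Definition realify (g : R -> I -> I -> C) (r : R) (j i : I * bool) : R :=
  if j.2 == i.2 then complex.Re (g r j.1 i.1)
  else if i.2 then complex.Im (g r j.1 i.1) else - complex.Im (g r j.1 i.1).

Lemma sum_bool (V : nmodType) (F : I * bool -> V) :
  \sum_p F p = \sum_i (F (i, false) + F (i, true)).
Proof.
rewrite (eq_bigr (fun p => F (p.1, p.2))); last by case.
rewrite -(pair_bigA _ (fun i p => F (i, p))) /=; apply: eq_bigr => i _.
by rewrite big_bool addrC.
Qed.

Lemma realify_sum (g : R -> I -> I -> C) (y : I -> C) r i p :
  \sum_j parts (y j.1) j.2 * realify g r j (i, p) = parts (\sum_j y j * g r j i) p.
Proof.
rewrite sum_bool; case: p; rewrite /parts /realify /= ?Re_sum ?Im_sum.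
  by apply: eq_bigr => j _; rewrite ImM.
by apply: eq_bigr => j _; rewrite ReM mulrN.
Qed.

Lemma cker_real a b g beta K : cker a b g beta K -> kernel_on a b (realify g) beta K.
Proof.
move=> [ab h1 h2 h6 h3 h4 h5].
have h r j : a <= r <= b -> \sum_i `|realify g r j i| <= beta r.
  move=> hr; apply: le_trans (h2 r j.1 hr); rewrite sum_bool mulr_sumr; apply: ler_sum => i _.
  by case: j => j []; rewrite /realify /= ?normrN mulrDl mul1r lerD ?nm_Re ?nm_Im.
split => // -[i p] [j q].
have [? ?] := h1 i j; rewrite /realify /=; case: p; case: q => //=.
by apply: eq_intg (intgZ (-1) _) => [x _|]; [rewrite mulN1r|].
Qed.

Lemma parts_ci a b h p : parts (ci a b h) p = itg a b (fun r => parts (h r) p).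
Proof. by case: p. Qed.

Lemma parts_inj z w : (forall p, parts z p = parts w p) -> z = w.
Proof. by case: z w => [a b] [c d] h; have /= -> := h false; have /= -> := h true. Qed.

Lemma partsD z w p : parts (z + w) p = parts z p + parts w p.
Proof. by case: p; rewrite /= ?ReD ?ImD. Qed.

Lemma cvolterra_uniq a b g beta K y : cker a b g beta K ->
  (forall i, cbm a b (fun r => y r i)) ->
  (forall t i, a <= t <= b -> y t i = ci a t (fun r => \sum_j y r j * g r j i)) ->
  forall t i, a <= t <= b -> y t i = 0.
Proof.
move=> /cker_real hg hb hy t i ht; apply: parts_inj => p.
pose y' (r : R) (j : I * bool) := parts (y r j.1) j.2.
have : y' t (i, p) = 0; last by rewrite /y' /= => ->; case: p.
apply: (volterra_uniq hg _ _ (y := y')) => // [[j q]|{}t {p}[{}i p] {}ht].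
  by have [? ?] := hb j; case: q.
rewrite /y' /= hy // parts_ci; apply: eq_itg => r _.
by rewrite realify_sum.
Qed.

Lemma cvolterra_ex a g (c : I -> C) :
  (forall b, a <= b -> exists beta K, cker a b g beta K) ->
  exists y, [/\ forall b i, a <= b -> cbm a b (fun r => y r i),
    forall t i, a <= t -> y t i = c i + ci a t (fun r => \sum_j y r j * g r j i) &
    forall b beta K, cker a b g beta K -> forall t i, a <= t <= b ->
      nm (y t i) <= 4 * (\sum_i nm (c i)) * expR ((2 * K + 1) * (t - a))].
Proof.
move=> hg.
have hg' b : a <= b -> exists beta K, kernel_on a b (realify g) beta K.
  by move=> /hg[beta [K /cker_real h]]; exists beta, K.
have [y [y1 y2 y3]] := volterra_ex hg' (fun j => parts (c j.1) j.2).
pose z r i : C := y r (i, false) +i* y r (i, true).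
have zp r i p : parts (z r i) p = y r (i, p) by case: p.
exists z; split => [b i ab|t i at_|b beta K hK t i ht].
- by split; [exact: (y1 b ab (i, false))|exact: (y1 b ab (i, true))].
- apply: parts_inj => p; rewrite partsD parts_ci zp y2 //; congr (_ + _).
  apply: eq_itg => r _; rewrite -realify_sum; apply: eq_bigr => -[j q] _ /=.
  by rewrite zp.
- have h := y3 _ _ _ (cker_real hK) _ ht.
  apply: le_trans (nm_ReIm _) _ => /=.
  have h1 : `|y t (i, false)| + `|y t (i, true)| <= n1 (y t).
    by rewrite /n1 sum_bool (bigD1 i) //= lerDl; apply: sumr_ge0 => j _; exact: addr_ge0.
  apply: le_trans h1 (le_trans h _); rewrite ler_wpM2r ?expR_ge0 //.
  have -> : 4 * \sum_i nm (c i) = 2 * (2 * \sum_i nm (c i)) by rewrite mulrA -natrM.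
  rewrite ler_wpM2l // /n1 sum_bool mulr_sumr; apply: ler_sum => j _ /=.
  by rewrite mulrDl mul1r lerD ?nm_Re ?nm_Im.
Qed.

End ComplexVolterra.

Section SquareIntegrable.
Context (R : realType).
Implicit Types (a b : R) (u v : R -> R).

Definition sqi a b u := measurable_fun `[a, b] u /\ intg a b (fun r => u r ^+ 2).

Lemma sqi_cst a b (c : R) : sqi a b (fun=> c).
Proof. by split; [exact: measurable_cst|exact: intg_cst]. Qed.

Lemma sqiD a b u v : sqi a b u -> sqi a b v -> sqi a b (fun r => u r + v r).
Proof.
move=> [mu iu] [mv iv]; have m := measurable_funD mu mv; split => //.
apply: (intg_le _ (intgD (intgZ 2 iu) (intgZ 2 iv))) => [|x _].
  exact: measurable_funX.
rewrite ger0_norm ?sqr_ge0 //; have := sqr_ge0 (u x - v x); rewrite sqrrB sqrrD; lra.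
Qed.

Lemma sqi_sum a b (I : Type) (s : seq I) (F : I -> R -> R) :
  (forall i, sqi a b (F i)) -> sqi a b (fun x => \sum_(i <- s) F i x).
Proof.
move=> h; elim: s => [|i s IH].
  rewrite (_ : (fun x => _) = (fun=> 0)); first exact: sqi_cst.
  by apply/funext => x; rewrite big_nil.
rewrite (_ : (fun x => _) = (fun x => F i x + \sum_(i <- s) F i x)); first exact: sqiD.
by apply/funext => x; rewrite big_cons.
Qed.

Lemma sqi_norm a b u : sqi a b u -> sqi a b (fun r => `|u r|).
Proof.
move=> [mu iu]; split; first exact: measurableT_comp.
by apply: eq_intg iu => x _; rewrite real_normK ?num_real.
Qed.

Lemma sqi_intg a b u : sqi a b u -> intg a b u.
Proof.
move=> [mu iu]; apply: (intg_le mu (intgD (intg_cst a b 1) iu)) => x _.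
have := sqr_ge0 (`|u x| - 1); rewrite sqrrB real_normK ?num_real // expr1n mulr1.
have := sqr_ge0 (u x); lra.
Qed.

Lemma sqi_sub a b c d u : a <= c -> d <= b -> sqi a b u -> sqi c d u.
Proof.
move=> ac db [mu iu]; split; last exact: intg_sub iu.
by apply: measurable_funS mu => //; apply: subset_itv; rewrite bnd_simp.
Qed.

(* Cauchy-Schwarz on an interval of length [h], from [0 <= int (u - m)^2] with [m] the mean. *)
Lemma itg_sqr_le a b u : a <= b -> sqi a b u ->
  itg a b u ^+ 2 <= (b - a) * itg a b (fun r => u r ^+ 2).
Proof.
rewrite le_eqVlt => /predU1P[->|ab] hu; first by rewrite !itg_aa expr0n subrr mul0r.
have iu := sqi_intg hu; have [_ iu2] := hu.
set h := b - a; set m := itg a b u; have h0 : 0 < h by rewrite subr_gt0.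
have : 0 <= itg a b (fun r => u r ^+ 2 - 2 * (m / h) * u r + (m / h) ^+ 2).
  apply: itg_ge0 => x _; have := sqr_ge0 (u x - m / h); rewrite sqrrB; lra.
have i1 := intgZ (2 * (m / h)) iu.
rewrite (itgD (intgB iu2 i1) (intg_cst _ _ _)) (itgB iu2 i1) (itgZ _ iu).
rewrite itg_cst ?(ltW ab) // -/h -/m => H.
rewrite -subr_ge0; set q := itg a b _ in H *.
have -> : h * q - m ^+ 2 = h * (q - 2 * (m / h) * m + (m / h) ^+ 2 * h).
  by field; rewrite gt_eqF.
by rewrite mulr_ge0 // ltW.
Qed.

End SquareIntegrable.

(** * The generator on an increasing sequence of finite-dimensional algebras *)

Section Generator.
Context (R : realType) (A : cstarType R).
Local Notation C := R[i].
Implicit Types (x y z : A) (a b : C).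

Definition lin (V : lmodType C) (psi : A -> V) := forall a x y, psi (a *: x + y) = a *: psi x + psi y.

(** The properties of boxes and shells on which the construction of the flow rests. [co] is a dual
    basis defined on all of [A], so that coordinates are linear functionals of [A]. The $W_j$ are
    numbered from 1 and ordinals from 0, hence [l.+1]. *)
Record filtration (B : nat -> set A) (W : nat -> A) : Prop := {
  fil_alg : forall n, star_subalgebra (B n) ;
  fil_mono : forall m n, (m <= n)%N -> B m `<=` B n ;
  fil_fin : forall n, exists (I : finType) (b : I -> A) (co : I -> A -> C),
    [/\ forall i, B n (b i), forall i, lin (co i : A -> C^o),
        exists c : R, 0 <= c /\ forall i x, nm (co i x) <= c * nm x,
        forall i j, co i (b j) = (i == j)%:R &
        forall x, B n x -> x = \sum_i co i x *: b i] ;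
  fil_W : forall l, B l.+1 (W l.+1) ;
  fil_comm : forall n l x, (n <= l)%N -> B n x -> x ** W l.+1 = W l.+1 ** x }.

Context (B : nat -> set A) (W : nat -> A) (hB : filtration B W).

Lemma B1 n : B n aone. Proof. by case: (fil_alg hB n). Qed.
Lemma BE n a x y : B n x -> B n y -> B n (a *: x + y).
Proof. by case: (fil_alg hB n) => _ h _ _; exact: h. Qed.
Lemma BM n x y : B n x -> B n y -> B n (x ** y).
Proof. by case: (fil_alg hB n) => _ _ h _; exact: h. Qed.
Lemma BS n x : B n x -> B n (star x).
Proof. by case: (fil_alg hB n) => _ _ _ h; exact: h. Qed.
Lemma B0 n : B n 0.
Proof. by rewrite -(subrr aone) -scaleN1r addrC; apply: BE; exact: B1. Qed.
Lemma BZ n a x : B n x -> B n (a *: x).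
Proof. by move=> h; rewrite -[_ *: _]addr0; apply: BE => //; exact: B0. Qed.
Lemma BD n x y : B n x -> B n y -> B n (x + y).
Proof. by move=> h h'; rewrite -[x]scale1r; exact: BE. Qed.
Lemma BB n x y : B n x -> B n y -> B n (x - y).
Proof. by move=> h h'; rewrite addrC -scaleN1r; exact: BE. Qed.
Lemma Bsum n I (s : seq I) (P : pred I) (F : I -> A) :
  (forall i, P i -> B n (F i)) -> B n (\sum_(i <- s | P i) F i).
Proof. by move=> h; elim/big_rec: _ => [|i x Pi]; [exact: B0|apply: BD; exact: h]. Qed.
Lemma BWn n l : (l < n)%N -> B n (W l.+1).
Proof. by move=> ln; apply: (fil_mono hB ln); exact: (fil_W hB). Qed.

(** Linear functionals separate the points of a box. This reduces identities in the algebra to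
    scalar ones, accessible to [ring] and [field], and equations in the algebra to scalar integral
    equations. *)
Lemma B_inj n x y : B n x -> B n y -> (forall psi : A -> C^o, lin psi -> psi x = psi y) -> x = y.
Proof.
have [I [b [co [_ cl _ _ bx]]]] := fil_fin hB n => /bx hx /bx hy h; rewrite hx hy.
by apply: eq_bigr => i _; rewrite (h _ (cl i)).
Qed.

Local Notation dl l := (delta W l.+1).
Local Notation dd l := (delta_dag W l.+1).

Lemma delta_lin l : lin (delta W l).
Proof. by move=> a x y; rewrite /delta mul_linearl mul_linearr opprD addrACA -scalerBr. Qed.
Lemma delta_dagE l x : delta_dag W l x = star (W l) ** x - x ** star (W l).
Proof. by rewrite /delta_dag /delta starB !star_mul star_invol. Qed.
Lemma delta_dag_lin l : lin (delta_dag W l).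
Proof. by move=> a x y; rewrite !delta_dagE mul_linearl mul_linearr opprD addrACA -scalerBr. Qed.
Lemma star_delta l x : star (delta W l x) = delta_dag W l (star x).
Proof. by rewrite /delta_dag star_invol. Qed.
Lemma star_delta_dag l x : star (delta_dag W l x) = delta W l (star x).
Proof. by rewrite /delta_dag star_invol. Qed.
Lemma delta_far n l x : (n <= l)%N -> B n x -> dl l x = 0.
Proof. by move=> nl hx; rewrite /delta (fil_comm hB nl hx) subrr. Qed.
Lemma delta_dag_far n l x : (n <= l)%N -> B n x -> dd l x = 0.
Proof. by move=> nl hx; rewrite /delta_dag (delta_far nl (BS hx)) star0. Qed.
Lemma delta_B n l x : (l < n)%N -> B n x -> B n (dl l x).
Proof. by move=> ln hx; apply: BB; apply: BM => //; exact: BWn. Qed.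
Lemma delta_dag_B n l x : (l < n)%N -> B n x -> B n (dd l x).
Proof. by move=> ln hx; apply: BS; apply: delta_B => //; exact: BS. Qed.

Definition dissip n x := 2^-1 *: \sum_(l < n) (star (W l.+1) ** dl l x + dd l x ** W l.+1).
(** The generator seen between $e(f)$ and $e(g)$, cut off at [n]; on [B n] the later terms vanish
    ([gen_stable]). *)
Definition gen n (f g : R -> nat -> C) (r : R) x :=
  dissip n x + \sum_(l < n) (Num.conj (f r l) *: dl l x + g r l *: dd l x).

Lemma lin_sum (V : lmodType C) n (F : 'I_n -> A -> V) :
  (forall l, lin (F l)) -> lin (fun x => \sum_l F l x).
Proof.
by move=> h a x y; rewrite scaler_sumr -big_split; apply: eq_bigr => l _; exact: h.
Qed.

Lemma dissip_lin n : lin (dissip n).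
Proof.
move=> a x y; rewrite /dissip scalerA mulrC -scalerA -scalerDr; congr (_ *: _).
apply: (lin_sum (F := fun l x => star (W l.+1) ** dl l x + dd l x ** W l.+1)) => l {}a {}x {}y.
by rewrite delta_lin delta_dag_lin mul_linearl mul_linearr scalerDr addrACA.
Qed.

Lemma gen_lin n f g r : lin (gen n f g r).
Proof.
move=> a x y; rewrite /gen dissip_lin scalerDr addrACA; congr (_ + _).
apply: (lin_sum (F := fun l x => Num.conj (f r l) *: dl l x + g r l *: dd l x)) => l {}a {}x {}y.
by rewrite delta_lin delta_dag_lin !scalerDr !scalerA addrACA !(mulrC a).
Qed.

Lemma gen_B n f g r x : B n x -> B n (gen n f g r x).
Proof.
move=> hx; apply: BD.
  apply: BZ; apply: Bsum => l _; apply: BD; apply: BM; rewrite ?(delta_B, delta_dag_B) //.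
  - by apply: BS; exact: BWn.
  - exact: delta_B.
  - exact: delta_dag_B.
  - exact: BWn.
by apply: Bsum => l _; apply: BD; apply: BZ; [exact: delta_B|exact: delta_dag_B].
Qed.

Lemma gen_stable m n f g r x : (m <= n)%N -> B m x -> gen n f g r x = gen m f g r x.
Proof.
move=> mn hx.
have cut (F : nat -> A) : (forall l, (m <= l)%N -> F l = 0) -> \sum_(l < n) F l = \sum_(l < m) F l.
  move=> h; rewrite -!(big_mkord predT F) (@big_cat_nat _ _ _ m) //= [X in _ + X]big1_seq ?addr0 // => l.
  by rewrite mem_index_iota => /andP[_ /andP[ml _]]; exact: h.
congr (_ *: _ + _); first apply: (cut (fun l => star (W l.+1) ** dl l x + dd l x ** W l.+1)) => l ml.
  by rewrite (delta_far ml hx) (delta_dag_far ml hx) amul0r amul0l addr0.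
apply: (cut (fun l => Num.conj (f r l) *: dl l x + g r l *: dd l x)) => l ml.
by rewrite (delta_far ml hx) (delta_dag_far ml hx) !scaler0 addr0.
Qed.

Lemma dissip_star n x : star (dissip n x) = dissip n (star x).
Proof.
rewrite /dissip starZ; congr (_ *: _).
  by rewrite -[2^-1](_ : (2^-1 : R)%:C = _) ?cjR // fmorphV rmorph_nat.
rewrite star_sum; apply: eq_bigr => l _.
by rewrite starD !star_mul star_invol star_delta star_delta_dag addrC.
Qed.

Lemma gen_star n f g r x : star (gen n f g r x) = gen n g f r (star x).
Proof.
rewrite /gen starD dissip_star; congr (_ + _); rewrite star_sum; apply: eq_bigr => l _.
by rewrite starD !starZ cjK star_delta star_delta_dag addrC.
Qed.

Lemma gen1 n f g r : gen n f g r aone = 0.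
Proof.
have d1 l : delta W l aone = 0 by rewrite /delta mul_unitl mul_unitr subrr.
have e1 l : delta_dag W l aone = 0 by rewrite /delta_dag star1 d1 star0.
rewrite /gen /dissip !big1 ?scaler0 ?addr0 // => l _; rewrite d1 e1.
  by rewrite !scaler0 addr0.
by rewrite amul0l amul0r addr0.
Qed.

Definition size1 (z : C) : R := `|complex.Re z| + `|complex.Im z|.
(** The summand 1 makes the integral of the rate dominate the length of the interval as well;
    [size1] stands for the modulus because the controls are given by their real and imaginary
    parts. *)
Definition rate n (f g : R -> nat -> C) r : R := 1 + \sum_(l < n) (size1 (f r l) + size1 (g r l)).

Lemma rate_ge1 n f g r : 1 <= rate n f g r.
Proof. by rewrite lerDl; apply: sumr_ge0 => l _; rewrite /size1 !addr_ge0. Qed.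

Lemma rate_l n (f g : R -> nat -> C) r (l : 'I_n) : nm (f r l) <= rate n f g r /\ nm (g r l) <= rate n f g r.
Proof.
rewrite /rate (bigD1 l) //=; set S := \sum_(_ < _ | _) _.
have S0 : 0 <= S by apply: sumr_ge0 => i _; rewrite /size1 !addr_ge0.
have h (z : C) : nm z <= size1 z := nm_ReIm z.
have p (z : C) : 0 <= size1 z by rewrite /size1 addr_ge0.
have := h (f r l); have := h (g r l); have := p (f r l); have := p (g r l).
by split; lra.
Qed.

Lemma nm_delta l x : nm (delta W l x) <= 2 * nm (W l) * nm x.
Proof.
apply: le_trans (nmB _ _) _; have := nm_amul x (W l); have := nm_amul (W l) x; lra.
Qed.
Lemma nm_delta_dag l x : nm (delta_dag W l x) <= 2 * nm (W l) * nm x.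
Proof. by rewrite /delta_dag nm_star; apply: le_trans (nm_delta _ _) _; rewrite nm_star. Qed.

Lemma gen_bound n : exists c : R, 0 <= c /\ forall f g r x,
  nm (gen n f g r x) <= c * rate n f g r * nm x /\ nm (dissip n x) <= c * nm x.
Proof.
pose w := \sum_(l < n) nm (W l.+1); pose w2 := \sum_(l < n) nm (W l.+1) ^+ 2.
have w0 : 0 <= w by apply: sumr_ge0 => l _; exact: nm_ge0.
have w20 : 0 <= w2 by apply: sumr_ge0 => l _; exact: sqr_ge0.
have hd x : nm (dissip n x) <= 2 * w2 * nm x.
  rewrite nmZ (_ : nm (2^-1 : C) = 2^-1); last first.
    by rewrite -[2^-1](_ : (2^-1 : R)%:C = _) ?nm_real ?ger0_norm // ?fmorphV ?rmorph_nat // invr_ge0.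
  have : nm (\sum_(l < n) (star (W l.+1) ** dl l x + dd l x ** W l.+1)) <= 4 * w2 * nm x.
    apply: le_trans (nm_sum _ _ _) _; rewrite mulr_sumr mulr_suml; apply: ler_sum => l _.
    apply: le_trans (nmD _ _) _.
    have := nm_amul (star (W l.+1)) (dl l x); have := nm_amul (dd l x) (W l.+1); rewrite nm_star.
    have := nm_delta l.+1 x; have := nm_delta_dag l.+1 x; have := nm_ge0 (W l.+1).
    have := nm_ge0 x; set a := nm (W _); set b := nm x; set p := nm _; set q := nm _.
    set u := nm _; set v := nm _ => b0 a0 h1 h2 h3 h4; nra.
  lra.
exists (2 * w2 + 4 * w); split; first lra.
move=> f g r x; have x0 := nm_ge0 x; split; last first.
  by apply: le_trans (hd x) _; rewrite ler_wpM2r //; lra.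
have r1 := rate_ge1 n f g r; apply: le_trans (nmD _ _) _.
have : nm (\sum_(l < n) (Num.conj (f r l) *: dl l x + g r l *: dd l x)) <= 4 * w * rate n f g r * nm x.
  apply: le_trans (nm_sum _ _ _) _; rewrite -!mulrA mulrCA mulr_suml; apply: ler_sum => l _.
  apply: le_trans (nmD _ _) _; rewrite !nmZ nm_conj.
  have [h1 h2] := rate_l f g r l.
  have := nm_delta l.+1 x; have := nm_delta_dag l.+1 x; have := nm_ge0 (W l.+1).
  have h3 := nm_ge0 (f r l); have h4 := nm_ge0 (g r l).
  have h5 := nm_ge0 (dl l x); have h6 := nm_ge0 (dd l x).
  move=> w1 h7 h8.
  have := ler_pM h3 h5 h1 h8; have := ler_pM h4 h6 h2 h7; lra.
have := hd x; have : 2 * w2 * nm x <= 2 * w2 * nm x * rate n f g r by rewrite ler_peMr // !mulr_ge0.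
lra.
Qed.

End Generator.

Section Evolution.
Context (R : realType) (A : cstarType R).
Local Notation C := R[i].
Implicit Types (x y z : A) (a b : C) (f g : R -> nat -> C) (r s t T : R).
Context (B : nat -> set A) (W : nat -> A) (hB : filtration B W).
Local Notation gen := (gen W).

Definition control f := forall l (a b : R), 0 <= a ->
  sqi a b (fun r => complex.Re (f r l)) /\ sqi a b (fun r => complex.Im (f r l)).

Lemma control_cg f l (a b : R) : control f -> 0 <= a -> cg a b (fun r => f r l).
Proof. by move=> hf a0; have [h1 h2] := hf l a b a0; split; exact: sqi_intg. Qed.

Lemma rate_sqi n f g (a b : R) : control f -> control g -> 0 <= a -> sqi a b (rate n f g).
Proof.
move=> hf hg a0; apply: sqiD (sqi_cst _ _ _) _; apply: sqi_sum => l.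
have [h1 h2] := hf l a b a0; have [h3 h4] := hg l a b a0.
by apply: sqiD; apply: sqiD; exact: sqi_norm.
Qed.

Lemma psi_gen (psi : A -> C^o) n f g r x : lin psi ->
  psi (gen n f g r x) = psi (dissip W n x) +
    \sum_(l < n) (Num.conj (f r l) * psi (delta W l.+1 x) + g r l * psi (delta_dag W l.+1 x)).
Proof.
move=> hp; rewrite /gen (opD hp) (op_sum hp); congr (_ + _); apply: eq_bigr => l _.
by rewrite (opD hp) !(opZ hp).
Qed.

(** The evolution is meaningful on local elements only, so linearity is relative to a box. *)
Definition linB n (V : lmodType C) (F : A -> V) :=
  forall a x y, B n x -> B n y -> F (a *: x + y) = a *: F x + F y.

Lemma linB0 n (V : lmodType C) (F : A -> V) : linB n F -> F 0 = 0.
Proof.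
move=> hF; have := hF (-1) 0 0 (B0 hB n) (B0 hB n).
by rewrite scaler0 addr0 scaleN1r addNr.
Qed.

Lemma linBZ n (V : lmodType C) (F : A -> V) a x : linB n F -> B n x -> F (a *: x) = a *: F x.
Proof. by move=> hF hx; have := hF a x 0 hx (B0 hB n); rewrite (linB0 hF) !addr0. Qed.

Lemma linBD n (V : lmodType C) (F : A -> V) x y : linB n F -> B n x -> B n y -> F (x + y) = F x + F y.
Proof. by move=> hF hx hy; have := hF 1 x y hx hy; rewrite !scale1r. Qed.

Lemma linB_sum n (V : lmodType C) (F : A -> V) (J : Type) (s : seq J) (y : J -> A) : linB n F ->
  (forall j, B n (y j)) -> F (\sum_(j <- s) y j) = \sum_(j <- s) F (y j).
Proof.
move=> hF hy; elim: s => [|j s IH]; first by rewrite !big_nil (linB0 hF).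
by rewrite !big_cons (linBD hF) ?IH //; exact: (Bsum hB).
Qed.

Lemma lin_linB n (V : lmodType C) (F : A -> V) : lin F -> linB n F.
Proof. by move=> h a x y _ _; exact: h. Qed.

(* Time-dependent functionals are tested on a basis, which turns the equation into a Volterra
   system. *)
Section Coordinates.
Context (n : nat) (I : finType) (b : I -> A) (co : I -> A -> C).
Context (bB : forall i, B n (b i)).
Context (cl : forall i, lin (co i : A -> C^o)).
Context (c : R).
Context (c0 : 0 <= c).
Context (cb : forall i x, nm (co i x) <= c * nm x).
Context (bx : forall x, B n x -> x = \sum_i co i x *: b i).

Definition gmx f g r j i : C := co j (gen n f g r (b i)).

(** One [K] serves all subintervals of $[0,T]$; this makes the bound in [evol_ex] uniform in the
    initial time. *)
Lemma gmx_cker f g : control f -> control g -> forall T, exists K, 0 <= K /\ forall s t, 0 <= s -> s <= t -> t <= T ->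
  exists beta, cker s t (gmx f g) beta K.
Proof.
move=> hf hg T; have [c' [c'0 hc']] := gen_bound W n.
pose S := \sum_i nm (b i); have S0 : 0 <= S by apply: sumr_ge0 => i _; exact: nm_ge0.
pose m := 2 * (c * (c' * S)).
have m0 : 0 <= m by rewrite !mulr_ge0.
pose beta r := m * rate n f g r.
have bs (a t : R) : 0 <= a -> sqi a t (rate n f g) by exact: rate_sqi.
exists (itg 0 T (fun r => beta r ^+ 2)); split => [|s t s0 st tT]; first by apply: itg_ge0 => x _; exact: sqr_ge0.
exists beta.
have ib2 (a d : R) : 0 <= a -> intg a d (fun r => beta r ^+ 2).
  move=> a0; apply: eq_intg (intgZ (m ^+ 2) (bs a d a0).2) => x _.
  by rewrite /beta [RHS]exprMn.
split => //.
- move=> i j; rewrite /gmx; pose psi := co j.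
  apply: eq_cg (_ : cg s t (fun r => psi (dissip W n (b i)) + \sum_(l < n)
    (Num.conj (f r l) * psi (delta W l.+1 (b i)) + g r l * psi (delta_dag W l.+1 (b i))))) => [r _|].
    by rewrite (psi_gen _ _ _ _ _ (cl j)).
  apply: cgD; first exact/cbm_cg/cbm_cst.
  apply: cg_sum => l; apply: cgD.
    by apply: eq_cg (cgZ _ (cg_conj (control_cg l t hf s0))) => r _; rewrite mulrC.
  by apply: eq_cg (cgZ _ (control_cg l t hg s0)) => r _; rewrite mulrC.
- move=> r j hr; rewrite /beta /m -!mulrA ler_wpM2l // mulr_suml !mulr_sumr.
  apply: ler_sum => i _; apply: le_trans (cb _ _) _; rewrite ler_wpM2l //.
  by apply: le_trans (hc' f g r (b i)).1 _; rewrite -mulrA ler_wpM2l // mulrC.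
- by move=> r _; rewrite mulr_ge0 //; have := rate_ge1 n f g r; lra.
- by apply: intgZ; apply: sqi_intg; exact: bs.
- exact: ib2.
- have h0 : 0 <= T by lra.
  rewrite (itg_add s0 _ (ib2 0 T (lexx 0))) ?(le_trans st) //.
  rewrite (itg_add st tT (ib2 s T s0)).
  have p (a d : R) : 0 <= itg a d (fun r => beta r ^+ 2) by apply: itg_ge0 => x _; exact: sqr_ge0.
  by have := p 0 s; have := p t T; lra.
Qed.

Lemma linB_co (V : lmodType C) (F : A -> V) x : linB n F -> B n x ->
  F x = \sum_i co i x *: F (b i).
Proof.
move=> hF hx; rewrite {1}(bx hx) (linB_sum _ hF) => [|i]; last exact: (BZ hB).
by apply: eq_bigr => i _; rewrite (linBZ _ hF).
Qed.

Lemma gen_co (F : A -> C^o) f g r i : linB n F ->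
  F (gen n f g r (b i)) = \sum_j F (b j) * gmx f g r j i.
Proof.
move=> hF; rewrite (linB_co hF); last exact: (gen_B hB).
by apply: eq_bigr => j _; rewrite mulrC.
Qed.

End Coordinates.

Lemma gen_cg n s t f g (F : R -> A -> C^o) x : control f -> control g -> 0 <= s ->
  (forall r, s <= r <= t -> linB n (F r)) -> (forall y, B n y -> cbm s t (fun r => F r y)) ->
  B n x -> cg s t (fun r => F r (gen n f g r x)).
Proof.
move=> hf hg s0 hl hb hx.
have dB (l : 'I_n) : B n (delta W l.+1 x) by exact: (delta_B hB).
have dB' (l : 'I_n) : B n (delta_dag W l.+1 x) by exact: (delta_dag_B hB).
have LB : B n (dissip W n x).
  rewrite /dissip; apply: (BZ hB); apply: (Bsum hB) => l _.
  have WB := BWn hB (ltn_ord l).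
  by apply: (BD hB); apply: (BM hB) => //; exact: (BS hB).
apply: eq_cg (_ : cg s t (fun r => F r (dissip W n x) + \sum_(l < n)
  (F r (delta W l.+1 x) * Num.conj (f r l) + F r (delta_dag W l.+1 x) * g r l))) => [r hr|].
  rewrite /gen (linBD (hl r hr)) //; last first.
    by apply: (Bsum hB) => l _; apply: (BD hB); apply: (BZ hB).
  rewrite (linB_sum _ (hl r hr)) => [|l]; last by apply: (BD hB); apply: (BZ hB).
  congr (_ + _); apply: eq_bigr => l _.
  rewrite (linBD (hl r hr) (BZ hB _ (dB l)) (BZ hB _ (dB' l))).
  by rewrite (linBZ _ (hl r hr) (dB l)) (linBZ _ (hl r hr) (dB' l)); congr (_ + _); rewrite mulrC.
apply: cgD; first exact/cbm_cg/hb.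
apply: cg_sum => l; apply: cgD; apply: cg_mul; try exact: hb.
- by apply: cg_conj; exact: control_cg.
- exact: control_cg.
Qed.

(** Consistency of the boxes, the flow property, locality, time shift, adjoints and the uniqueness
    of the semi-group all follow by applying this to the difference of two sides, tested on a
    functional. *)
Lemma evol_uniq n s T f g (F : R -> A -> C^o) : control f -> control g -> 0 <= s ->
  (forall r, s <= r <= T -> linB n (F r)) -> (forall y, B n y -> cbm s T (fun r => F r y)) ->
  (forall t y, s <= t <= T -> B n y -> F t y = ci s t (fun r => F r (gen n f g r y))) ->
  forall t x, s <= t <= T -> B n x -> F t x = 0.
Proof.
move=> hf hg s0 hl hb he t x /andP[st tT] hx.
have [I [b [co [bB cl [c [c0 cb]] _ bx]]]] := fil_fin hB n.
have [K [_ hK]] := gmx_cker n b cl c0 cb hf hg T.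
have [beta hk] := hK s T s0 (le_trans st tT) (lexx _).
rewrite (linB_co bB bx (hl t _) hx) ?st // big1 // => i _.
rewrite (cvolterra_uniq hk (y := fun r i => F r (b i))) ?scaler0 ?st //.
- by move=> j; exact: hb.
- move=> r j /andP[sr rT]; rewrite he ?sr //; apply: eq_ci => q hq.
  by rewrite (gen_co bB bx) //; apply: hl; lra.
Qed.

(** In [ev_eq] the generator acts before the evolution, as in the Evans-Hudson equation. The
    equation is tested on linear functionals instead of using an integral with values in the
    algebra. *)
Record evol n s f g (P : R -> A -> A) : Prop := {
  ev_B : forall t x, s <= t -> B n x -> B n (P t x) ;
  ev_lin : forall t, s <= t -> linB n (P t) ;
  ev_bm : forall (psi : A -> C^o) t x, lin psi -> s <= t -> B n x ->
    cbm s t (fun r => psi (P r x)) ;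
  ev_eq : forall (psi : A -> C^o) t x, lin psi -> s <= t -> B n x ->
    psi (P t x) = psi x + ci s t (fun r => psi (P r (gen n f g r x))) }.

Lemma evol_ex n f g : control f -> control g -> exists M : R -> R, forall s, 0 <= s ->
  exists P, evol n s f g P /\ forall t T x, s <= t -> t <= T -> B n x ->
    nm (P t x) <= M T * nm x.
Proof.
move=> hf hg; have [I [b [co [bB cl [c [c0 cb]] bo bx]]]] := fil_fin hB n.
have /choice[K hK] := gmx_cker n b cl c0 cb hf hg.
exists (fun T => \sum_i \sum_(j : I) c * (4 * (\sum_k nm (co i (b k))) * expR ((2 * K T + 1) * T) * nm (b i))).
move=> s s0.
(* [y i t j] is to be the coefficient of [b i] in [P t (b j)]. For each [i] this is a Volterra
   system of its own, with the coordinates of the identity as initial value. *)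
have /choice[y hy] : forall i, exists y : R -> I -> C, [/\ forall d j, s <= d -> cbm s d (fun r => y r j),
    forall t j, s <= t -> y t j = co i (b j) + ci s t (fun r => \sum_k y r k * gmx n b co f g r k j) &
    forall d beta K, cker s d (gmx n b co f g) beta K -> forall t j, s <= t <= d ->
      nm (y t j) <= 4 * (\sum_k nm (co i (b k))) * expR ((2 * K + 1) * (t - s))].
  move=> i; apply: cvolterra_ex => d sd; have [_ h] := hK d.
  by have [beta hb] := h s d s0 sd (lexx d); exists beta, (K d).
pose P t x := \sum_i (\sum_j co j x * y i t j) *: b i.
have Pl t : lin (P t).
  move=> a x z; rewrite scaler_sumr -big_split; apply: eq_bigr => i _ /=.
  rewrite scalerA -scalerDl mulr_sumr -big_split; congr (_ *: _); apply: eq_bigr => j _ /=.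
  by rewrite (cl j) mulrDl mulrA.
have Pb t j : P t (b j) = \sum_i y i t j *: b i.
  apply: eq_bigr => i _; congr (_ *: _); rewrite (bigD1 j) //= bo eqxx mul1r big1 ?addr0 // => k kj.
  by rewrite bo (negbTE kj) mul0r.
have psiP (psi : A -> C^o) t j : lin psi -> psi (P t (b j)) = \sum_i psi (b i) * y i t j.
  by move=> hp; rewrite Pb (op_sum hp); apply: eq_bigr => i _; rewrite (opZ hp) mulrC.
have bmb (psi : A -> C^o) t j : lin psi -> s <= t -> cbm s t (fun r => psi (P r (b j))).
  move=> hp st; apply: eq_cbm (_ : cbm s t (fun r => \sum_i psi (b i) * y i r j)) => [r _|].
    by rewrite psiP.
  by apply: cbm_sum => i; apply: cbmZ; case: (hy i) => h _ _; exact: h.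
have psico (psi : A -> C^o) t x : lin psi -> B n x -> psi (P t x) = \sum_j co j x * psi (P t (b j)).
  move=> hp hx; rewrite (linB_co bB bx (lin_linB (Pl t)) hx) (op_sum hp).
  by apply: eq_bigr => j _; rewrite (opZ hp).
have bmP (psi : A -> C^o) t x : lin psi -> s <= t -> B n x -> cbm s t (fun r => psi (P r x)).
  move=> hp st hx; apply: eq_cbm (_ : cbm s t (fun r => \sum_j co j x * psi (P r (b j)))) => [r _|].
    by rewrite -psico.
  by apply: cbm_sum => j; apply: cbmZ; exact: bmb.
have PB t x : B n (P t x) by apply: (Bsum hB) => i _; exact: (BZ hB).
exists P; split; first split => //.
- by move=> t st; exact: lin_linB.
- move=> psi t x hp st hx.
  have cgb j : cg s t (fun r => psi (P r (gen n f g r (b j)))).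
    apply: (gen_cg (n := n) (F := fun r z => psi (P r z))) => //.
      by move=> r _; apply: lin_linB => a u v; rewrite Pl hp.
    by move=> z hz; exact: bmP.
  have key j : psi (P t (b j)) = psi (b j) + ci s t (fun r => psi (P r (gen n f g r (b j)))).
    have gE r : psi (P r (gen n f g r (b j))) =
        \sum_i psi (b i) * \sum_k y i r k * gmx n b co f g r k j.
      rewrite (gen_co bB bx (F := fun z => psi (P r z))); last first.
        by apply: lin_linB => a u v; rewrite Pl hp.
      under eq_bigr do rewrite psiP // mulr_suml.
      rewrite exchange_big; apply: eq_bigr => i _; rewrite mulr_sumr.
      by apply: eq_bigr => k _; rewrite mulrA.
    have cgi i : cg s t (fun r => \sum_k y i r k * gmx n b co f g r k j).
      have [_ h] := hK t; have [beta hb] := h s t s0 st (lexx t).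
      apply: cg_sum => k; apply: cg_mul; last exact: (cker_cg hb).
      by case: (hy i) => h' _ _; exact: h'.
    rewrite (eq_ci (h' := fun r => \sum_i psi (b i) * \sum_k y i r k * gmx n b co f g r k j)) //.
    rewrite ci_sum => [|i]; last exact: cgZ.
    have -> : psi (b j) = \sum_i psi (b i) * co i (b j).
      by rewrite {1}(bx _ (bB j)) (op_sum hp); apply: eq_bigr => i _; rewrite (opZ hp) mulrC.
    rewrite psiP // -big_split /=; apply: eq_bigr => i _.
    by case: (hy i) => _ h _; rewrite h // mulrDr ciZ.
  have E r : psi (P r (gen n f g r x)) = \sum_j co j x * psi (P r (gen n f g r (b j))).
    have l1 : lin (fun z => psi (P r (gen n f g r z)) : C^o).
      by move=> a u v; rewrite gen_lin Pl hp.
    by rewrite (linB_co bB bx (lin_linB l1) hx).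
  rewrite (eq_ci (h' := fun r => \sum_j co j x * psi (P r (gen n f g r (b j))))) //.
  rewrite ci_sum => [|j]; last exact: cgZ.
  have -> : psi x = \sum_j co j x * psi (b j).
    by rewrite {1}(bx _ hx) (op_sum hp); apply: eq_bigr => i _; rewrite (opZ hp).
  by rewrite psico // -big_split /=; apply: eq_bigr => j _; rewrite key mulrDr ciZ.
- move=> t T x st tT hx; rewrite mulr_suml; apply: le_trans (nm_sum _ _ _) _.
  apply: ler_sum => i _; rewrite nmZ mulr_suml.
  have h : nm (\sum_j co j x * y i t j) <= \sum_(j : I) c * nm x *
      (4 * (\sum_k nm (co i (b k))) * expR ((2 * K T + 1) * T)).
    apply: le_trans (nm_sum _ _ _) _; apply: ler_sum => j _; rewrite nmM.
    apply: ler_pM; rewrite ?nm_ge0 //.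
    have [K0 h] := hK T; have sT := le_trans st tT; have [beta hb] := h s T s0 sT (lexx T).
    case: (hy i) => _ _ h3; apply: le_trans (h3 T beta (K T) hb t j _) _; first by rewrite st.
    rewrite ler_wpM2l //; first by rewrite mulr_ge0 // sumr_ge0 // => k _; exact: nm_ge0.
    by rewrite ler_expR ler_wpM2l //; lra.
  apply: le_trans (ler_wpM2r (nm_ge0 _) h) _; rewrite mulr_suml; apply: ler_sum => j _.
  by rewrite le_eqVlt; apply/orP; left; apply/eqP; ring.
Qed.

End Evolution.

(** * The two-parameter evolution of all boxes together, and its symmetries *)

Section EvolutionFamily.
Context (R : realType) (A : cstarType R).
Local Notation C := R[i].
Implicit Types (x y z : A) (a b : C) (f g : R -> nat -> C) (r s t T : R).
Context (B : nat -> set A) (W : nat -> A) (hB : filtration B W).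
Local Notation gen := (gen W).

Record evolution (Phi : R -> R -> (R -> nat -> C) -> (R -> nat -> C) -> A -> A) : Prop := {
  phi_evol : forall n s f g, control f -> control g -> 0 <= s ->
    evol B W n s f g (fun t => Phi s t f g) ;
  phi_bd : forall n f g T, control f -> control g -> exists M : R, 0 <= M /\
    forall s t x, 0 <= s -> s <= t -> t <= T -> B n x -> nm (Phi s t f g x) <= M * nm x }.

(** Both evolutions solve the equation of the smaller box, where the two generators agree. *)
Lemma evol_consistent m n s f g (P Q : R -> A -> A) t x : control f -> control g -> 0 <= s ->
  (m <= n)%N -> evol B W n s f g P -> evol B W m s f g Q -> s <= t -> B m x -> P t x = Q t x.
Proof.
move=> hf hg s0 mn hP hQ st hx; have sub := fil_mono hB mn.
apply: (B_inj hB (n := n)); [by apply: (ev_B hP) => //; exact: sub|by apply/sub/(ev_B hQ)|move=> psi hp].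
pose F r y : C^o := psi (P r y) - psi (Q r y).
have : F t x = 0; last by move/eqP; rewrite subr_eq0 => /eqP.
apply: (evol_uniq hB hf hg s0 (n := m) (T := t)); rewrite ?lexx ?st //.
- move=> r /andP[sr _] a u v hu hv; rewrite /F (ev_lin hP sr a (sub _ hu) (sub _ hv)).
  by rewrite (ev_lin hQ) // !hp opprD addrACA -scalerBr.
- by move=> y hy; apply: cbmB; [apply: (ev_bm hP) => //; exact: sub|exact: (ev_bm hQ)].
- move=> u y /andP[su _] hy.
  rewrite /F (ev_eq hP hp su (sub _ hy)) (ev_eq hQ hp su hy).
  have e : ci s u (fun r => psi (P r (gen n f g r y))) = ci s u (fun r => psi (P r (gen m f g r y))).
    by apply: eq_ci => r _; rewrite (gen_stable hB f g r mn hy).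
  rewrite e [RHS]ciB; first by rewrite opprD addrACA subrr add0r.
  + apply: (gen_cg hB hf hg s0 (n := m) (F := fun r z => psi (P r z))) => //.
      by move=> r /andP[sr _] a v w hu hv; rewrite (ev_lin hP sr a (sub _ hu) (sub _ hv)) hp.
    by move=> z hz; apply: (ev_bm hP) => //; exact: sub.
  + apply: (gen_cg hB hf hg s0 (n := m) (F := fun r z => psi (Q r z))) => //.
      by move=> r /andP[sr _] a v w hu hv; rewrite (ev_lin hQ) // hp.
    by move=> z hz; exact: (ev_bm hQ).
Qed.

Lemma evolution_ex : exists Phi, evolution Phi.
Proof.
(* [lev x] is some box containing [x], and 0 for an [x] in no box. [E] below shows that any other
   box containing [x] gives the same value. *)
have /choice[lev hlev] : forall x, exists n, (exists m, B m x) -> B n x.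
  by move=> x; have [[m hm]|no] := pselect (exists m, B m x); [exists m|exists 0%N].
pose ctl := (R -> nat -> C)%type.
have /choice[M hM] : forall q : nat * (ctl * ctl), exists M : R -> R,
    control q.2.1 -> control q.2.2 -> forall s, 0 <= s ->
    exists P, evol B W q.1 s q.2.1 q.2.2 P /\ forall t T x, s <= t -> t <= T -> B q.1 x ->
      nm (P t x) <= M T * nm x.
  move=> [n [f g]] /=; have [[hf hg]|no] := pselect (control f /\ control g).
    by have [M h] := evol_ex hB n hf hg; exists M.
  by exists (fun=> 0) => hf hg; case: no.
have /choice[P hP] : forall q : (nat * (ctl * ctl)) * R, exists P,
    control q.1.2.1 -> control q.1.2.2 -> 0 <= q.2 ->
    evol B W q.1.1 q.2 q.1.2.1 q.1.2.2 P /\ forall t T x, q.2 <= t -> t <= T -> B q.1.1 x ->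
      nm (P t x) <= M q.1 T * nm x.
  move=> [[n [f g]] s] /=; have [[hf [hg s0]]|no] := pselect (control f /\ control g /\ 0 <= s).
    by have [P h] := hM (n, (f, g)) hf hg s s0; exists P.
  by exists (fun _ _ => 0) => hf hg s0; case: no.
pose Phi s t f g x := P ((lev x, (f, g)), s) t x.
have E n s t f g x : control f -> control g -> 0 <= s -> s <= t -> B n x ->
    Phi s t f g x = P ((n, (f, g)), s) t x.
  move=> hf hg s0 st hx; have hl : B (lev x) x by apply: hlev; exists n.
  have [e1 _] := hP ((lev x, (f, g)), s) hf hg s0; have [e2 _] := hP ((n, (f, g)), s) hf hg s0.
  have [le|le] := leqP n (lev x); first exact: (evol_consistent hf hg s0 le e1 e2).
  by apply/esym/(evol_consistent hf hg s0 (ltnW le) e2 e1).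
exists Phi; split => [n s f g hf hg s0|n f g T hf hg].
  have [[h1 h2 h3 h4] _] := hP ((n, (f, g)), s) hf hg s0; split.
  - by move=> t x st hx; rewrite (E n) //; exact: h1.
  - move=> t st a x y hx hy; rewrite !(E n) //; first exact: h2.
    exact: (BE hB).
  - move=> psi t x hp st hx; apply: eq_cbm (h3 psi t x hp st hx) => r /andP[sr _].
    by rewrite (E n).
  - move=> psi t x hp st hx; rewrite (E n) // (h4 psi t x hp st hx); congr (_ + _).
    by apply: eq_ci => r /andP[sr _]; rewrite (E n) //; exact: (gen_B hB).
exists `|M (n, (f, g)) T|; split => // s t x s0 st tT hx; rewrite (E n) //.
have [_ h] := hP ((n, (f, g)), s) hf hg s0.
by apply: le_trans (h t T x st tT hx) _; rewrite ler_wpM2r ?nm_ge0 ?ler_norm.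
Qed.

(** [phi_eq] asks for functionals linear on all of [A], whereas a functional composed with the
    evolution is linear on a box only. *)
Lemma lin_extend n (F : A -> C^o) : linB B n F ->
  exists psi : A -> C^o, lin psi /\ forall x, B n x -> psi x = F x.
Proof.
move=> hF; have [I [b [co [bB cl _ _ bx]]]] := fil_fin hB n.
exists (fun x => \sum_i co i x * F (b i)); split => [a x y|x hx].
  rewrite scaler_sumr -big_split; apply: eq_bigr => i _ /=.
  by rewrite (cl i) mulrDl; congr (_ + _); rewrite -[a *: co i x]/(a * co i x) -mulrA.
by rewrite (linB_co hB bB bx hF hx).
Qed.

Lemma control_shift f c : 0 <= c -> control f -> control (fun r => f (r + c)).
Proof.
move=> c0 hf l a b a0; have [h1 h2] := hf l (a + c) (b + c) (addr_ge0 a0 c0).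
have E (u : R -> R) : sqi (a + c) (b + c) u -> sqi a b (fun r => u (r + c)).
  move=> hu; split; first by apply: intg_meas; case: (itg_shift (sqi_intg hu)).
  by case: (itg_shift hu.2).
split; [exact: (E (fun r => complex.Re (f r l)))|exact: (E (fun r => complex.Im (f r l)))].
Qed.

Context (Phi : R -> R -> (R -> nat -> C) -> (R -> nat -> C) -> A -> A) (hPhi : evolution Phi).

Section Fixed.
Context (f g : R -> nat -> C) (hf : control f) (hg : control g) (s : R) (s0 : 0 <= s) (n : nat).

Let ev := phi_evol hPhi n hf hg s0.

Lemma phi_B t x : s <= t -> B n x -> B n (Phi s t f g x).
Proof. exact: ev_B ev _ _. Qed.
Lemma phi_lin t : s <= t -> linB B n (Phi s t f g).
Proof. exact: ev_lin ev _. Qed.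
Lemma phi_bm (psi : A -> C^o) t x : lin psi -> s <= t -> B n x ->
  cbm s t (fun r => psi (Phi s r f g x)).
Proof. exact: ev_bm ev _ _ _. Qed.
Lemma phi_eq (psi : A -> C^o) t x : lin psi -> s <= t -> B n x ->
  psi (Phi s t f g x) = psi x + ci s t (fun r => psi (Phi s r f g (gen n f g r x))).
Proof. exact: ev_eq ev _ _ _. Qed.
Lemma phi_cg (psi : A -> C^o) t x : lin psi -> s <= t -> B n x ->
  cg s t (fun r => psi (Phi s r f g (gen n f g r x))).
Proof.
move=> hp st hx; apply: (gen_cg hB hf hg s0 (n := n) (F := fun r z => psi (Phi s r f g z))) => //.
  by move=> r /andP[sr _] a u v hu hv; rewrite (phi_lin sr) // hp.
by move=> z hz; exact: phi_bm.
Qed.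
Lemma phi_id x : B n x -> Phi s s f g x = x.
Proof.
move=> hx; apply: (B_inj hB (n := n)) => // [|psi hp]; first exact: phi_B.
by rewrite phi_eq // ci_aa addr0.
Qed.
Lemma phi1 t : s <= t -> Phi s t f g aone = aone.
Proof.
move=> st; have h1 := B1 hB n; apply: (B_inj hB (n := n)) => // [|psi hp]; first exact: phi_B.
rewrite phi_eq // (eq_ci (h' := fun=> 0)) ?ci0 ?addr0 // => r /andP[sr _].
by rewrite gen1 (linB0 hB (phi_lin sr)) (op0 hp).
Qed.
End Fixed.

(** Tested on [psi], both sides solve the equation started at [r], the right one through [psi'],
    which is [psi] after the evolution from [s] to [r]. *)
Lemma phi_flow f g n s r t x : control f -> control g -> 0 <= s -> s <= r -> r <= t -> B n x ->
  Phi s t f g x = Phi s r f g (Phi r t f g x).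
Proof.
move=> hf hg s0 sr rt hx; have r0 := le_trans s0 sr; have st := le_trans sr rt.
apply: (B_inj hB (n := n)) => [||psi hp]; [exact: phi_B|by do 2!apply: phi_B => //|].
have [psi' [lp' ep']] : exists psi' : A -> C^o, lin psi' /\
    forall x, B n x -> psi' x = psi (Phi s r f g x).
  apply: (@lin_extend n (fun x => psi (Phi s r f g x))) => a u v hu hv.
  by rewrite (phi_lin hf hg s0 (n := n) sr) // hp.
pose F u y : C^o := psi (Phi s u f g y) - psi' (Phi r u f g y).
have : F t x = 0.
  2: by rewrite /F ep'; [move/eqP; rewrite subr_eq0 => /eqP|exact: phi_B].
have psiB u : s <= u -> linB B n (fun y => psi (Phi s u f g y)).
  by move=> su a v w hv hw; rewrite (phi_lin hf hg s0 (n := n) su) // hp.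
have psi'B u : r <= u -> linB B n (fun y => psi' (Phi r u f g y)).
  by move=> ru a v w hv hw; rewrite (phi_lin hf hg r0 (n := n) ru) // lp'.
apply: (evol_uniq hB hf hg r0 (n := n) (T := t)); rewrite ?lexx ?rt //.
- move=> u /andP[ru _] a v w hv hw; have su := le_trans sr ru.
  by rewrite /F psiB // psi'B // opprD addrACA -scalerBr.
- move=> y hy; apply: (cbmB (cbm_sub sr (lexx t) (phi_bm hf hg s0 hp st hy))).
  exact: (phi_bm hf hg r0 lp' rt hy).
- move=> u y /andP[ru _] hy; have su := le_trans sr ru.
  rewrite /F (phi_eq hf hg s0 hp su hy) (phi_eq hf hg r0 lp' ru hy) ep' //.
  rewrite (phi_eq hf hg s0 hp sr hy) (ci_add sr ru (phi_cg hf hg s0 hp su hy)).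
  rewrite [RHS]ciB; [by rewrite addrA [X in X - _]addrC addrKA|exact: cg_sub (lexx u) (phi_cg hf hg s0 hp su hy)|exact: phi_cg].
Qed.

Lemma phi_local f g f' g' n s t x : control f -> control g -> control f' -> control g' ->
  0 <= s -> s <= t -> (forall r, s <= r < t -> f r = f' r) ->
  (forall r, s <= r < t -> g r = g' r) -> B n x -> Phi s t f g x = Phi s t f' g' x.
Proof.
move=> hf hg hf' hg' s0 st ef eg hx.
apply: (B_inj hB (n := n)) => [||psi hp]; [exact: phi_B|exact: phi_B|].
pose F u y : C^o := psi (Phi s u f g y) - psi (Phi s u f' g' y).
have : F t x = 0; last by move=> /eqP; rewrite subr_eq0 => /eqP.
have psiB u : s <= u -> linB B n (fun y => psi (Phi s u f g y)).
  by move=> su a v w hv hw; rewrite (phi_lin hf hg s0 (n := n) su) // hp.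
have psiB' u : s <= u -> linB B n (fun y => psi (Phi s u f' g' y)).
  by move=> su a v w hv hw; rewrite (phi_lin hf' hg' s0 (n := n) su) // hp.
have FB u : s <= u -> linB B n (F u).
  by move=> su a v w hv hw; rewrite /F psiB // psiB' // opprD addrACA -scalerBr.
have Fbm y u : s <= u -> B n y -> cbm s u (fun r => F r y).
  by move=> su hy; exact: (cbmB (phi_bm hf hg s0 hp su hy) (phi_bm hf' hg' s0 hp su hy)).
apply: (evol_uniq hB hf hg s0 (n := n) (T := t)); rewrite ?lexx ?st //.
- by move=> u /andP[su _]; exact: FB.
- by move=> y hy; exact: Fbm.
- move=> u y /andP[su ut] hy.
  have c1 := phi_cg hf hg s0 hp su hy; have c2 := phi_cg hf' hg' s0 hp su hy.
  rewrite /F (phi_eq hf hg s0 hp su hy) (phi_eq hf' hg' s0 hp su hy).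
  rewrite opprD addrACA subrr add0r -ciB //; apply: eq_ci_o; first exact: cgB.
    apply: (gen_cg hB hf hg s0 (n := n) (F := F)) => //; last by move=> z hz; exact: Fbm.
    by move=> v /andP[sv _]; exact: FB.
  move=> v /andP[sv vu]; rewrite /F /gen ef ?eg //; apply/andP; split => //; exact: lt_le_trans ut.
Qed.

Lemma phi_shift f g n c s t x : control f -> control g -> 0 <= c -> 0 <= s -> s <= t -> B n x ->
  Phi (s + c) (t + c) f g x = Phi s t (fun r => f (r + c)) (fun r => g (r + c)) x.
Proof.
move=> hf hg c0 s0 st hx; have hf' := control_shift c0 hf; have hg' := control_shift c0 hg.
have sc0 : 0 <= s + c by exact: addr_ge0.
have le u : s <= u -> s + c <= u + c by rewrite lerD2r.
apply: (B_inj hB (n := n)) => [||psi hp]; [exact: (phi_B hf hg sc0 (le _ st))|exact: phi_B|].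
pose F u y : C^o := psi (Phi (s + c) (u + c) f g y) -
  psi (Phi s u (fun r => f (r + c)) (fun r => g (r + c)) y).
have : F t x = 0; last by move=> /eqP; rewrite subr_eq0 => /eqP.
have psiB u : s <= u -> linB B n (fun y => psi (Phi (s + c) (u + c) f g y)).
  by move=> /le su a v w hv hw; rewrite (phi_lin hf hg sc0 (n := n) su) // hp.
have psiB' u : s <= u -> linB B n (fun y => psi (Phi s u (fun r => f (r + c)) (fun r => g (r + c)) y)).
  by move=> su a v w hv hw; rewrite (phi_lin hf' hg' s0 (n := n) su) // hp.
apply: (evol_uniq hB hf' hg' s0 (n := n) (T := t)); rewrite ?lexx ?st //.
- by move=> u /andP[su _] a v w hv hw; rewrite /F psiB // psiB' // opprD addrACA -scalerBr.
- move=> y hy; apply: (cbmB _ (phi_bm hf' hg' s0 hp st hy)).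
  exact: (cbm_shift (phi_bm hf hg sc0 hp (le _ st) hy)).
- move=> u y /andP[su _] hy.
  have c1 := phi_cg hf hg sc0 hp (le _ su) hy; have c2 := phi_cg hf' hg' s0 hp su hy.
  rewrite /F (phi_eq hf hg sc0 hp (le _ su) hy) (phi_eq hf' hg' s0 hp su hy).
  have [c3 e3] := ci_shift c1.
  by rewrite opprD addrACA subrr add0r -e3 -ciB.
Qed.

Lemma phi_star f g n s t x : control f -> control g -> 0 <= s -> s <= t -> B n x ->
  star (Phi s t f g x) = Phi s t g f (star x).
Proof.
move=> hf hg s0 st hx; have hxs := BS hB hx.
apply: (B_inj hB (n := n)) => [||psi hp]; [by apply: (BS hB); exact: phi_B|exact: phi_B|].
(* The conjugate makes this functional linear again, so that [phi_eq] applies to it. *)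
pose psi' y : C^o := Num.conj (psi (star y)).
have hp' : lin psi' by move=> a u v; rewrite /psi' star_linear hp cjD cjM cjK.
pose F u y : C^o := psi (star (Phi s u f g (star y))) - psi (Phi s u g f y).
have : F t (star x) = 0.
  have psiB u : s <= u -> linB B n (fun y => psi (star (Phi s u f g (star y)))).
    move=> su a v w hv hw; rewrite star_linear (phi_lin hf hg s0 (n := n) su) ?star_linear ?cjK ?hp //; exact: (BS hB).
  have psiB' u : s <= u -> linB B n (fun y => psi (Phi s u g f y)).
    by move=> su a v w hv hw; rewrite (phi_lin hg hf s0 (n := n) su) // hp.
  apply: (evol_uniq hB hg hf s0 (n := n) (T := t)); rewrite ?lexx ?st //.
  - by move=> u /andP[su _] a v w hv hw; rewrite /F psiB // psiB' // opprD addrACA -scalerBr.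
  - move=> y hy; apply: (cbmB _ (phi_bm hg hf s0 hp st hy)).
    apply: eq_cbm (cbm_conj (phi_bm hf hg s0 hp' st (BS hB hy))) => r _.
    by rewrite /psi' cjK.
  - move=> u y /andP[su _] hy; have hys := BS hB hy.
    have c1 := phi_cg hf hg s0 hp' su hys; have c2 := phi_cg hg hf s0 hp su hy.
    rewrite /F (phi_eq hg hf s0 hp su hy).
    have -> : psi (star (Phi s u f g (star y))) = Num.conj (psi' (Phi s u f g (star y))).
      by rewrite /psi' cjK.
    rewrite (phi_eq hf hg s0 hp' su hys) cjD -ci_conj // /psi' cjK star_invol.
    rewrite opprD addrACA subrr add0r -ciB //; last by apply: cg_conj.
    by apply: eq_ci => r _; rewrite !cjK gen_star.
by rewrite /F star_invol => /eqP; rewrite subr_eq0 => /eqP.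
Qed.

(** The integral of [gen n f g r x] over $r \in [s,t]$, the first-order part of the evolution
    ([psi_gint]). *)
Definition gint n s t f g x := (t - s)%:C *: dissip W n x +
  \sum_(l < n) (Num.conj (ci s t (fun r => f r l)) *: delta W l.+1 x +
    ci s t (fun r => g r l) *: delta_dag W l.+1 x).

Lemma psi_gint (psi : A -> C^o) n s t f g x : control f -> control g -> 0 <= s -> s <= t ->
  lin psi -> cg s t (fun r => psi (gen n f g r x)) /\
  psi (gint n s t f g x) = ci s t (fun r => psi (gen n f g r x)).
Proof.
move=> hf hg s0 st hp; pose h r := psi (dissip W n x) + \sum_(l < n)
  (psi (delta W l.+1 x) * Num.conj (f r l) + psi (delta_dag W l.+1 x) * g r l).
have E r : psi (gen n f g r x) = h r.
  rewrite psi_gen //; congr (_ + _); apply: eq_bigr => l _.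
  by congr (_ + _); rewrite mulrC.
have c1 (l : nat) : cg s t (fun r => psi (delta W l.+1 x) * Num.conj (f r l)).
  by apply: cgZ; apply: cg_conj; exact: control_cg.
have c2 (l : nat) : cg s t (fun r => psi (delta_dag W l.+1 x) * g r l).
  by apply: cgZ; exact: control_cg.
have c3 : cg s t (fun=> psi (dissip W n x)) by exact/cbm_cg/cbm_cst.
have c4 : cg s t (fun r => \sum_(l < n)
    (psi (delta W l.+1 x) * Num.conj (f r l) + psi (delta_dag W l.+1 x) * g r l)).
  by apply: cg_sum => l; exact: cgD.
split; first by apply: eq_cg (cgD c3 c4) => r _; rewrite E.
rewrite (eq_ci (h' := h)) => [|r _]; last exact: E.
rewrite /h ciD // ci_sum => [|l]; last exact: cgD.
rewrite /gint (opD hp) (opZ hp) (op_sum hp); congr (_ + _).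
  rewrite /ci /cintegral -![\int[_]_(_ in _) _]/(itg _ _ _) !itg_cst //.
  rewrite mulrC; case: (psi _) => p q; rewrite -[_ *: _]/(_ * _).
  by apply/eqP; rewrite eq_complex /= !mul0r subr0 addr0 eqxx mulrC eqxx.
apply: eq_bigr => l _; rewrite (opD hp) !(opZ hp) ciD // !ciZ //; first last.
- by apply: cg_conj; exact: control_cg.
- exact: control_cg.
rewrite ci_conj; last exact: control_cg.
by congr (_ + _); rewrite mulrC.
Qed.

(** Each estimate, inserted under the integral sign of the equation, gives the next one. They are in
    powers of [eps] because the controls may be unbounded. *)
Lemma phi_estimates n f g T : control f -> control g -> exists M : R, 0 <= M /\
  forall s t x, 0 <= s -> s <= t -> t <= T -> B n x ->
  let eps := itg s t (rate n f g) in
  [/\ nm (Phi s t f g x) <= M * nm x, nm (Phi s t f g x - x) <= M * eps * nm x &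
      nm (Phi s t f g x - x - gint n s t f g x) <= M * eps ^+ 2 * nm x].
Proof.
move=> hf hg; have [M0 [M00 hM0]] := phi_bd hPhi n T hf hg.
have [c' [c'0 hc']] := gen_bound W n.
have [I [b [co [bB cl [c [c0 cb]] bo bx]]]] := fil_fin hB n.
pose S := \sum_i nm (b i); have S0 : 0 <= S by apply: sumr_ge0 => i _; exact: nm_ge0.
have toco z e : B n z -> (forall i, nm (co i z) <= e) -> nm z <= e * S.
  move=> hz he; rewrite (bx _ hz); apply: le_trans (nm_sum _ _ _) _.
  by rewrite mulr_sumr; apply: ler_sum => i _; rewrite nmZ ler_wpM2r ?nm_ge0.
have ri s t : 0 <= s -> intg s t (rate n f g) by move=> s0; apply: sqi_intg; exact: rate_sqi.
have [M1 M1E] : exists M1, M1 = 2 * (c * (M0 * c')) * S by eexists.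
have M10 : 0 <= M1 by rewrite M1E !mulr_ge0.
have h1 s t x : 0 <= s -> s <= t -> t <= T -> B n x ->
    nm (Phi s t f g x - x) <= M1 * itg s t (rate n f g) * nm x.
  move=> s0 st tT hx; have hP := phi_B hf hg s0 st hx.
  apply: le_trans (toco _ (2 * (c * (M0 * c') * nm x * itg s t (rate n f g))) _ _) _.
  - exact: (BB hB).
  - move=> i; rewrite (opB (cl i)) (phi_eq hf hg s0 (cl i) st hx) addrAC subrr add0r.
    rewrite -itgZ; last exact: ri.
    apply: ci_nm; [exact: (phi_cg hf hg s0 (cl i) st hx)|by apply: intgZ; exact: ri|].
    move=> r /andP[sr rt]; apply: le_trans (cb _ _) _.
    rewrite -!mulrA ler_wpM2l //.
    apply: le_trans (hM0 s r _ s0 sr (le_trans rt tT) (gen_B hB f g r hx)) _.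
    rewrite ler_wpM2l //; apply: le_trans (hc' f g r x).1 _.
    by rewrite -mulrA [rate _ _ _ _ * _]mulrC.
  - by rewrite le_eqVlt; apply/orP; left; apply/eqP; rewrite M1E; ring.
pose M2 := 2 * (c * (M1 * c')) * S.
have M20 : 0 <= M2 by rewrite !mulr_ge0.
exists (M0 + M1 + M2); split; first by rewrite !addr_ge0.
move=> s t x s0 st tT hx; set eps := itg s t _.
have e0 : 0 <= eps by apply: itg_ge0 => r _; have := rate_ge1 n f g r; lra.
have x0 := nm_ge0 x; split.
- by apply: le_trans (hM0 s t x s0 st tT hx) _; rewrite ler_wpM2r //; lra.
- apply: le_trans (h1 s t x s0 st tT hx) _; rewrite ler_wpM2r // ler_wpM2r //; lra.
have hP := phi_B hf hg s0 st hx.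
have hG : B n (gint n s t f g x).
  apply: (BD hB); first apply: (BZ hB).
    rewrite -[dissip _ _ _]addr0 -[0](_ : \sum_(l < n) (Num.conj (0 : C) *: delta W l.+1 x + 0 *: delta_dag W l.+1 x) = _).
      exact: (gen_B hB (fun _ _ => 0) (fun _ _ => 0) 0 hx).
    by rewrite big1 // => l _; rewrite cj0 !scale0r addr0.
  apply: (Bsum hB) => l _; apply: (BD hB); apply: (BZ hB); [exact: (delta_B hB)|exact: (delta_dag_B hB)].
apply: le_trans (toco _ (2 * (c * (M1 * c') * nm x * eps * eps)) _ _) _.
- by apply: (BB hB) => //; exact: (BB hB).
- move=> i; rewrite !(opB (cl i)) (phi_eq hf hg s0 (cl i) st hx) [_ - co i x]addrAC subrr add0r.
  have [cg2 ->] := psi_gint n x hf hg s0 st (cl i).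
  have cg1 := phi_cg hf hg s0 (cl i) st hx.
  rewrite -ciB // -[_ * eps * eps]/(_ * eps * itg s t _) -itgZ; last exact: ri.
  apply: ci_nm; [exact: cgB|by apply: intgZ; exact: ri|].
  move=> r /andP[sr rt]; rewrite -(opB (cl i)); apply: le_trans (cb _ _) _.
  rewrite -!mulrA ler_wpM2l //.
  apply: le_trans (h1 s r _ s0 sr (le_trans rt tT) (gen_B hB f g r hx)) _.
  rewrite -mulrA ler_wpM2l //.
  have er : itg s r (rate n f g) <= eps.
    rewrite /eps (itg_add sr rt (ri _ _ s0)) lerDl.
    by apply: itg_ge0 => q _; have := rate_ge1 n f g q; lra.
  have er0 : 0 <= itg s r (rate n f g).
    by apply: itg_ge0 => q _; have := rate_ge1 n f g q; lra.
  have -> : c' * (nm x * (eps * rate n f g r)) = eps * (c' * rate n f g r * nm x) by ring.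
  by apply: ler_pM => //; [exact: nm_ge0|exact: (hc' f g r x).1].
- rewrite expr2; have : M2 * (eps * eps) * nm x <= (M0 + M1 + M2) * (eps * eps) * nm x.
    by rewrite ler_wpM2r // ler_wpM2r ?mulr_ge0 //; lra.
  apply: le_trans; rewrite le_eqVlt; apply/orP; left; apply/eqP; rewrite /M2; ring.
Qed.

End EvolutionFamily.

(** * Positivity of the evolution *)

Section Grid.
Context (R : realType).
Implicit Types (s t : R) (u : R -> R).

Definition grid s t m j : R := s + (t - s) * (j%:R / m.+1%:R).

Lemma grid0 s t m : grid s t m 0 = s.
Proof. by rewrite /grid mul0r mulr0 addr0. Qed.
Lemma gridT s t m : grid s t m m.+1 = t.
Proof. by rewrite /grid divff ?pnatr_eq0 // mulr1 addrC subrK. Qed.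
Lemma gridS s t m j : grid s t m j.+1 - grid s t m j = (t - s) / m.+1%:R.
Proof.
rewrite /grid opprD addrACA subrr add0r -mulrBr -mulrBl -natr1.
by rewrite [_ + 1]addrC addrK div1r.
Qed.
Lemma grid_le s t m j : s <= t -> grid s t m j <= grid s t m j.+1.
Proof. by move=> st; rewrite -subr_ge0 gridS divr_ge0 // subr_ge0. Qed.
Lemma grid_mono s t m i j : s <= t -> (i <= j)%N -> grid s t m i <= grid s t m j.
Proof.
move=> st ij; rewrite lerD2l ler_wpM2l ?subr_ge0 // ler_wpM2r // ler_nat //.
Qed.
Lemma grid_ge s t m j : s <= t -> s <= grid s t m j.
Proof. by move=> st; rewrite -{1}(grid0 s t m); exact: grid_mono. Qed.
Lemma grid_leT s t m j : s <= t -> (j <= m.+1)%N -> grid s t m j <= t.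
Proof. by move=> st jm; rewrite -{2}(gridT s t m); exact: grid_mono. Qed.

Lemma grid_sum s t m j u : s <= t -> (j <= m.+1)%N -> intg s t u ->
  \sum_(i < j) itg (grid s t m i) (grid s t m i.+1) u = itg s (grid s t m j) u.
Proof.
move=> st; elim: j => [|j IH] jm iu; first by rewrite big_ord0 grid0 itg_aa.
rewrite big_ord_recr /= IH ?(ltnW jm) //; apply/esym/itg_add.
- exact: grid_ge.
- exact: grid_le.
- by apply: intg_sub iu => //; exact: grid_leT.
Qed.

(** The reason why second-order errors disappear in the limit: their sum is at most proportional to
    the mesh, even though [u] is merely square-integrable. *)
Lemma grid_sqr_sum s t m u : s <= t -> sqi s t u ->
  \sum_(i < m.+1) itg (grid s t m i) (grid s t m i.+1) u ^+ 2 <=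
  (t - s) / m.+1%:R * itg s t (fun r => u r ^+ 2).
Proof.
move=> st hu; have -> : itg s t (fun r => u r ^+ 2) = \sum_(i < m.+1)
    itg (grid s t m i) (grid s t m i.+1) (fun r => u r ^+ 2).
  by rewrite grid_sum // ?gridT //; case: hu.
rewrite mulr_sumr; apply: ler_sum => i _; rewrite -(gridS s t m i).
apply: itg_sqr_le; first exact: grid_le.
by apply: sqi_sub hu; [exact: grid_ge|apply: grid_leT => //; exact: ltn_ord].
Qed.

End Grid.

Lemma opN (R : realType) (U V : lmodType R[i]) (T : U -> V) :
  (forall a x y, T (a *: x + y) = a *: T x + T y) -> forall x, T (- x) = - T x.
Proof. by move=> h x; rewrite -scaleN1r (opZ h) scaleN1r. Qed.

(** * One Euler step and its consistency *)

Section EulerStep.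
Context (R : realType) (A : cstarType R).
Local Notation C := R[i].
Context (B : nat -> set A) (W : nat -> A) (hB : filtration B W).
Implicit Types (x y z : A) (F G : nat -> C) (h : R).

Lemma BN n x : B n x -> B n (- x).
Proof. by move=> hx; rewrite -scaleN1r; exact: (BZ hB). Qed.

Local Ltac inB := repeat first [assumption | apply: (BM hB) | apply: (BB hB) | apply: (BD hB)
  | apply: (BZ hB) | apply: BN | apply: (BS hB) | exact: (B1 hB)].

(** In a step, index 0 stands for no additional quantum and [l.+1] for one in the [l]-th
    direction. *)
Definition comp F i : C := if i is l.+1 then F l else 0.
(* An Euler step of the flow in Kraus form, for the integrals [F], [G] of the controls over an
   interval of length [h]: it agrees with [x + first_order n h F G x] up to second order, and its
   coefficients [cexp (step_exp h F G i j)] are quotients of Gram coefficients of exponential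
   vectors (see [L2dot_cadd]), so that it preserves the positivity of kernels exactly. *)
Definition drift n h F : A := - (\sum_(l < n) ((2^-1 * h)%:C *: (star (W l.+1) ** W l.+1) + F l *: star (W l.+1))).
(** All coefficients of [euler] are close to 1, so at order zero the step is $S^{*}xS'$ with $S$,
    $S'$ the sums of the operators. Subtracting the $W_l$ from the operator of index 0 makes these
    sums [aone] plus a small drift. *)
Definition step_op n h F i : A :=
  if i is l.+1 then W l.+1 else aone + drift n h F - \sum_(l < n) W l.+1.
Definition step_exp h F G i j : C :=
  comp G i + Num.conj (comp F j) + ((0 < i)%N && (i == j))%:R * h%:C.
Definition euler n h F G x : A :=
  \sum_(i < n.+1) \sum_(j < n.+1) cexp (step_exp h F G i j) *: (star (step_op n h F i) ** x ** step_op n h G j).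
Definition first_order n h F G x : A := h%:C *: dissip W n x +
  \sum_(l < n) (Num.conj (F l) *: delta W l.+1 x + G l *: delta_dag W l.+1 x).

Lemma drift_B n h F : B n (drift n h F).
Proof.
rewrite /drift -scaleN1r; apply: (BZ hB); apply: (Bsum hB) => l _.
have h1 := BWn hB (ltn_ord l); have h2 := BS hB h1.
by apply: (BD hB); apply: (BZ hB) => //; exact: (BM hB).
Qed.

Lemma step_op_B n h F (i : 'I_n.+1) : B n (step_op n h F i).
Proof.
case: i => -[|l] /= il; last exact: (BWn hB).
apply: (BB hB); first by apply: (BD hB); [exact: (B1 hB)|exact: drift_B].
by apply: (Bsum hB) => l _; exact: (BWn hB).
Qed.

Lemma euler_lin n h F G : lin (euler n h F G).
Proof.
move=> a x y; rewrite /euler scaler_sumr -big_split; apply: eq_bigr => i _ /=.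
rewrite scaler_sumr -big_split; apply: eq_bigr => j _ /=.
by rewrite mul_linearr mul_linearl scalerDr !scalerA mulrC.
Qed.

Lemma euler_B n h F G x : B n x -> B n (euler n h F G x).
Proof.
move=> hx; apply: (Bsum hB) => i _; apply: (Bsum hB) => j _; apply: (BZ hB).
apply: (BM hB); last exact: step_op_B.
by apply: (BM hB) => //; apply: (BS hB); exact: step_op_B.
Qed.

Lemma sum_step_op n h F : \sum_(i < n.+1) step_op n h F i = aone + drift n h F.
Proof. by rewrite big_ord_recl /= subrK. Qed.

(** The part $-F_l W_l^{*}$ of the drift completes $G_l W_l^{*}x$ and $\bar F_l xW_l$ to
    commutators, and the part $-\frac h2 W_l^{*}W_l$ completes $hW_l^{*}xW_l$ to the dissipator. *)
Lemma euler_linear_part n h F G x : B n x ->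
  star (drift n h F) ** x + x ** drift n h G + \sum_(l < n) G l *: (star (W l.+1) ** x) +
  \sum_(l < n) Num.conj (F l) *: (x ** W l.+1) + \sum_(l < n) h%:C *: (star (W l.+1) ** x ** W l.+1) =
  first_order n h F G x.
Proof.
move=> hx.
rewrite /drift starN star_sum amulNl amulNr amul_suml amul_sumr -!sumrN.
rewrite /first_order /dissip scalerA scaler_sumr -!big_split /=; apply: eq_bigr => l _.
have h1 := BWn hB (ltn_ord l); have h2 := BS hB h1.
rewrite starD !starZ cjR star_mul !star_invol /delta delta_dagE.
rewrite !(amulDl, amulDr, amulNl, amulNr, amulZl, amulZr) !mul_assoc.
set w := W l.+1 in h1 h2 *; set w' := star w in h1 h2 *.
apply: (B_inj hB (n := n)) => [||psi hp]; try by inB.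
rewrite !(opD hp, opN hp, opZ hp) /GRing.scale /= rmorphM fmorphV rmorph_nat.
by field.
Qed.

Definition err_exp h F G i j : C := cexp (step_exp h F G i j) - 1 - step_exp h F G i j.

Lemma sum_swap_scale n h F G x (a : nat -> C) :
  \sum_(i < n.+1) \sum_(j < n.+1) a i *: (star (step_op n h F i) ** x ** step_op n h G j) =
  (\sum_(i < n.+1) a i *: star (step_op n h F i)) ** x ** (aone + drift n h G).
Proof.
rewrite amul_suml amul_suml; apply: eq_bigr => i _.
rewrite -(sum_step_op n h G) -scaler_sumr !amulZl; congr (_ *: _).
by rewrite amul_sumr.
Qed.

(** In each coefficient [cexp z] the terms 1 and $z$ are separated from the remainder [err_exp].
    Since the operators sum to [aone] plus the drift, what is left beyond the linear part has two
    small factors or an [err_exp]. *)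
Lemma euler_expand n h F G x : B n x -> euler n h F G x - x - first_order n h F G x =
  star (drift n h F) ** x ** drift n h G +
  \sum_(l < n) G l *: (star (W l.+1) ** x ** drift n h G) +
  \sum_(l < n) Num.conj (F l) *: (star (drift n h F) ** x ** W l.+1) +
  \sum_(i < n.+1) \sum_(j < n.+1) err_exp h F G i j *: (star (step_op n h F i) ** x ** step_op n h G j).
Proof.
move=> hx; rewrite -(euler_linear_part h F G hx).
set D := drift n h F; set D' := drift n h G.
have s1 : \sum_(i < n.+1) \sum_(j < n.+1) (star (step_op n h F i) ** x ** step_op n h G j) =
    (aone + star D) ** x ** (aone + D').
  have := sum_swap_scale n h F G x (fun=> 1).
  under eq_bigr do under eq_bigr do rewrite scale1r.
  move=> ->; congr (_ ** _ ** _).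
  under eq_bigr do rewrite scale1r.
  by rewrite -star_sum sum_step_op starD star1.
have s2 : \sum_(i < n.+1) \sum_(j < n.+1) comp G i *: (star (step_op n h F i) ** x ** step_op n h G j) =
    \sum_(l < n) G l *: (star (W l.+1) ** x ** (aone + D')).
  rewrite sum_swap_scale big_ord_recl /= scale0r add0r amul_suml amul_suml.
  by apply: eq_bigr => l _; rewrite !amulZl.
have s3 : \sum_(i < n.+1) \sum_(j < n.+1) Num.conj (comp F j) *: (star (step_op n h F i) ** x ** step_op n h G j) =
    \sum_(l < n) Num.conj (F l) *: ((aone + star D) ** x ** W l.+1).
  rewrite exchange_big /= big_ord_recl /= cj0.
  under eq_bigr do rewrite scale0r.
  rewrite big1 // add0r; apply: eq_bigr => l _; rewrite -scaler_sumr -!amul_suml -star_sum.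
  by rewrite sum_step_op starD star1.
have s4 : \sum_(i < n.+1) \sum_(j < n.+1) (((0 < i)%N && (i == j :> nat))%:R * h%:C) *:
      (star (step_op n h F i) ** x ** step_op n h G j) =
    \sum_(l < n) h%:C *: (star (W l.+1) ** x ** W l.+1).
  rewrite big_ord_recl /= big1 ?add0r => [|j _]; last by rewrite mul0r scale0r.
  apply: eq_bigr => l _; rewrite (bigD1 (lift ord0 l)) //= eqxx mul1r big1 ?addr0 // => j jl.
  by rewrite (_ : (_ == _) = false) ?mul0r ?scale0r //; apply/negbTE; rewrite eq_sym.
have -> : euler n h F G x = (aone + star D) ** x ** (aone + D') +
    (\sum_(l < n) G l *: (star (W l.+1) ** x ** (aone + D')) +
     \sum_(l < n) Num.conj (F l) *: ((aone + star D) ** x ** W l.+1) +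
     \sum_(l < n) h%:C *: (star (W l.+1) ** x ** W l.+1)) +
    \sum_(i < n.+1) \sum_(j < n.+1) err_exp h F G i j *: (star (step_op n h F i) ** x ** step_op n h G j).
  rewrite -s1 -s2 -s3 -s4 -!big_split /=; apply: eq_bigr => i _; rewrite -!big_split /=.
  apply: eq_bigr => j _; rewrite -!scalerDl -[X in X + _ + _]scale1r -!scalerDl; congr (_ *: _).
  by rewrite /err_exp -/(step_exp h F G i j) addrACA; ring.
have -> : \sum_(l < n) G l *: (star (W l.+1) ** x ** (aone + D')) =
    \sum_(l < n) G l *: (star (W l.+1) ** x) + \sum_(l < n) G l *: (star (W l.+1) ** x ** D').
  by rewrite -big_split; apply: eq_bigr => l _ /=; rewrite amulDr mul_unitr scalerDr.
have -> : \sum_(l < n) Num.conj (F l) *: ((aone + star D) ** x ** W l.+1) =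
    \sum_(l < n) Num.conj (F l) *: (x ** W l.+1) + \sum_(l < n) Num.conj (F l) *: (star D ** x ** W l.+1).
  by rewrite -big_split; apply: eq_bigr => l _ /=; rewrite !amulDl mul_unitl scalerDr.
have -> : (aone + star D) ** x ** (aone + D') = x + (star D ** x + x ** D') + star D ** x ** D'.
  by rewrite !amulDl !amulDr !mul_unitl !mul_unitr; rewrite -!addrA; congr (_ + _); rewrite addrCA.
set p := star D ** x; set q := x ** D'; set r := p ** D'.
set u1 := \sum_(l < n) G l *: (star (W l.+1) ** x).
set u2 := \sum_(l < n) G l *: (star (W l.+1) ** x ** D').
set v1 := \sum_(l < n) Num.conj (F l) *: (x ** W l.+1).
set v2 := \sum_(l < n) Num.conj (F l) *: (p ** W l.+1).
set w := \sum_(l < n) h%:C *: _; set e := \sum_(i < n.+1) _.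
have inW (l : 'I_n) := BWn hB (ltn_ord l).
have DB : B n D := drift_B n h F.
have DB' : B n D' := drift_B n h G.
have rB : B n r by inB.
have pB : B n p by inB.
have qB : B n q by inB.
have u1B : B n u1 by apply: (Bsum hB) => l _; have := inW l => ?; inB.
have u2B : B n u2 by apply: (Bsum hB) => l _; have := inW l => ?; inB.
have v1B : B n v1 by apply: (Bsum hB) => l _; have := inW l => ?; inB.
have v2B : B n v2 by apply: (Bsum hB) => l _; have := inW l => ?; inB.
have wB : B n w by apply: (Bsum hB) => l _; have := inW l => ?; inB.
have eB : B n e.
  apply: (Bsum hB) => i _; apply: (Bsum hB) => j _; have := step_op_B h F i.
  by have := step_op_B h G j => ? ?; inB.
apply: (B_inj hB (n := n)) => [||psi hp]; try by inB.
by rewrite !(opD hp, opN hp); ring.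
Qed.

(** [3 * eps <= 1] bounds the three summands of [step_exp] by 1 in total, as [cexp_small] demands.
    The first four summands of the constant belong to the four terms of [euler_expand], the last two
    to [first_order]. *)
Lemma euler_estimate n : exists c : R, 0 <= c /\ forall h F G x eps,
  B n x -> 0 <= h -> h <= eps -> 3 * eps <= 1 ->
  (forall l : 'I_n, nm (F l) <= eps /\ nm (G l) <= eps) ->
  nm (euler n h F G x - x - first_order n h F G x) <= c * eps ^+ 2 * nm x /\
  nm (first_order n h F G x) <= c * eps * nm x.
Proof.
pose w := \sum_(l < n) nm (W l.+1); pose w2 := \sum_(l < n) nm (W l.+1) ^+ 2.
have w0 : 0 <= w by apply: sumr_ge0 => l _; exact: nm_ge0.
have w20 : 0 <= w2 by apply: sumr_ge0 => l _; exact: sqr_ge0.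
have wl (l : 'I_n) : nm (W l.+1) <= w.
  by rewrite /w (bigD1 l) //= lerDl sumr_ge0 // => i _; exact: nm_ge0.
pose k := w2 + w; have k0 : 0 <= k by rewrite addr_ge0.
pose mm := 1 + k + w + w; have mm0 : 0 <= mm by rewrite !addr_ge0.
have [c' [c'0 hc']] := gen_bound W n.
exists (k * k + w * k + k * w + (n.+1 * n.+1)%:R * (9 * (mm * mm)) + c' + 4 * w); split.
  by rewrite !addr_ge0 ?mulr_ge0.
move=> h F G x eps hx h0 he e1 hFG; have x0 := nm_ge0 x; have e0 : 0 <= eps by lra.
have drift_le (F' : nat -> C) : (forall l : 'I_n, nm (F' l) <= eps) -> nm (drift n h F') <= k * eps.
  move=> hF; rewrite nmN; apply: le_trans (nm_sum _ _ _) _.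
  rewrite /k -big_split mulr_suml; apply: ler_sum => l _ /=; apply: le_trans (nmD _ _) _.
  rewrite !nmZ nm_real nm_star nm_cstar ger0_norm ?mulr_ge0 ?invr_ge0 //.
  have a0 := nm_ge0 (W l.+1); have := hF l; have := nm_ge0 (F' l); have := sqr_ge0 (nm (W l.+1)).
  by move: (nm (W _)) a0 (nm (F' _)) => a a0 b *; nra.
have dF := drift_le F (fun l => (hFG l).1); have dG := drift_le G (fun l => (hFG l).2).
have step_le (F' : nat -> C) (i : 'I_n.+1) : nm (drift n h F') <= k * eps -> nm (step_op n h F' i) <= mm.
  move=> hd; case: i => -[|l] il /=; last first.
    by have := wl (Ordinal (il : (l < n)%N)); rewrite /mm /=; lra.
  apply: le_trans (nmB _ _) _; apply: le_trans (lerD (nmD _ _) (nm_sum _ _ _)) _.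
  rewrite nm_one -/w /mm; have : k * eps <= k by rewrite ler_piMr //; lra.
  by move: hd; lra.
have exp_le (i j : 'I_n.+1) : nm (err_exp h F G i j) <= 9 * eps ^+ 2.
  have cl (F' : nat -> C) (i' : 'I_n.+1) : (forall l : 'I_n, nm (F' l) <= eps) -> nm (comp F' i') <= eps.
    move=> hF; case: i' => -[|l] il /=; first by rewrite nm0.
    exact: (hF (Ordinal (il : (l < n)%N))).
  have z : nm (step_exp h F G i j) <= 3 * eps.
    apply: le_trans (nmD _ _) _; apply: le_trans (lerD (nmD _ _) (lexx _)) _.
    have := cl F j (fun l => (hFG l).1); have := cl G i (fun l => (hFG l).2); rewrite nm_conj.
    have : nm ((((0 < i)%N && (i == j :> nat))%:R : C) * h%:C) <= eps.
      by rewrite nmM nm_real ger0_norm //; case: (_ && _); rewrite ?nm1 ?nm0 ?mul1r ?mul0r.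
    by lra.
  apply: le_trans (cexp_small _) _; first lra.
  by have := nm_ge0 (step_exp h F G i j); nra.
split; last first.
  apply: le_trans (nmD _ _) _.
  have p1 : nm (h%:C *: dissip W n x) <= c' * eps * nm x.
    rewrite nmZ nm_real ger0_norm //; have := (hc' (fun _ _ => 0) (fun _ _ => 0) 0 x).2 => hd.
    by rewrite [c' * eps]mulrC -mulrA; apply: ler_pM => //; exact: nm_ge0.
  have p2 : nm (\sum_(l < n) (Num.conj (F l) *: delta W l.+1 x + G l *: delta_dag W l.+1 x)) <=
      4 * w * eps * nm x.
    apply: le_trans (nm_sum _ _ _) _; rewrite /w mulr_sumr !mulr_suml; apply: ler_sum => l _.
    apply: le_trans (nmD _ _) _; rewrite !nmZ nm_conj; have [f1 g1] := hFG l.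
    have := ler_pM (nm_ge0 _) (nm_ge0 _) f1 (nm_delta W l.+1 x).
    have := ler_pM (nm_ge0 _) (nm_ge0 _) g1 (nm_delta_dag W l.+1 x).
    lra.
  have q : 0 <= (k * k + w * k + k * w + (n.+1 * n.+1)%:R * (9 * (mm * mm))) * eps * nm x.
    by rewrite !mulr_ge0 // !addr_ge0 ?mulr_ge0.
  lra.
rewrite euler_expand //.
have b1 : nm (star (drift n h F) ** x ** drift n h G) <= k * k * eps ^+ 2 * nm x.
  apply: le_trans (nm_amul _ _) _; apply: le_trans (ler_wpM2r (nm_ge0 _) (nm_amul _ _)) _.
  rewrite nm_star; have := ler_pM (nm_ge0 _) (nm_ge0 _) dF dG => hh.
  have := ler_wpM2r x0 hh; rewrite expr2; lra.
have b2 : nm (\sum_(l < n) G l *: (star (W l.+1) ** x ** drift n h G)) <= w * k * eps ^+ 2 * nm x.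
  apply: le_trans (nm_sum _ _ _) _; rewrite /w !mulr_suml; apply: ler_sum => l _; rewrite nmZ.
  apply: le_trans (ler_wpM2l (nm_ge0 _) (nm_amul _ _)) _.
  apply: le_trans (ler_wpM2l (nm_ge0 _) (ler_wpM2r (nm_ge0 _) (nm_amul _ _))) _.
  rewrite nm_star; have := ler_pM (nm_ge0 _) (nm_ge0 _) (hFG l).2 dG => hh.
  have := ler_wpM2r (mulr_ge0 (nm_ge0 (W l.+1)) x0) hh; rewrite expr2; lra.
have b3 : nm (\sum_(l < n) Num.conj (F l) *: (star (drift n h F) ** x ** W l.+1)) <= k * w * eps ^+ 2 * nm x.
  apply: le_trans (nm_sum _ _ _) _; rewrite /w mulr_sumr !mulr_suml; apply: ler_sum => l _; rewrite nmZ nm_conj.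
  apply: le_trans (ler_wpM2l (nm_ge0 _) (nm_amul _ _)) _.
  apply: le_trans (ler_wpM2l (nm_ge0 _) (ler_wpM2r (nm_ge0 _) (nm_amul _ _))) _.
  rewrite nm_star; have := ler_pM (nm_ge0 _) (nm_ge0 _) (hFG l).1 dF => hh.
  have := ler_wpM2r (mulr_ge0 (nm_ge0 (W l.+1)) x0) hh; rewrite expr2; lra.
have b4 : nm (\sum_(i < n.+1) \sum_(j < n.+1) err_exp h F G i j *: (star (step_op n h F i) ** x ** step_op n h G j))
    <= (n.+1 * n.+1)%:R * (9 * (mm * mm)) * eps ^+ 2 * nm x.
  apply: le_trans (nm_sum _ _ _) _.
  apply: le_trans (_ : _ <= \sum_(i < n.+1) \sum_(j < n.+1) 9 * (mm * mm) * eps ^+ 2 * nm x) _; last first.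
    by rewrite !sumr_const !card_ord -mulrnA -[leLHS]mulr_natl !mulrA lexx.
  apply: ler_sum => i _; apply: le_trans (nm_sum _ _ _) _; apply: ler_sum => j _; rewrite nmZ.
  apply: le_trans (ler_wpM2l (nm_ge0 _) (nm_amul _ _)) _.
  apply: le_trans (ler_wpM2l (nm_ge0 _) (ler_wpM2r (nm_ge0 _) (nm_amul _ _))) _.
  rewrite nm_star; have h1 := step_le F i dF; have h2 := step_le G j dG.
  have q1 := mulr_ge0 (mulr_ge0 (nm_ge0 (step_op n h F i)) (nm_ge0 (step_op n h G j))) x0.
  have q2 := ler_wpM2r x0 (ler_pM (nm_ge0 (step_op n h F i)) (nm_ge0 (step_op n h G j)) h1 h2).
  have := ler_pM (nm_ge0 (err_exp h F G i j)) q1 (exp_le i j) q2; lra.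
have c0 : 0 <= (c' + 4 * w) * eps ^+ 2 * nm x by rewrite !mulr_ge0 ?sqr_ge0 // addr_ge0 ?mulr_ge0.
apply: le_trans (nmD _ _) _; apply: le_trans (lerD (nmD _ _) (lexx _)) _.
apply: le_trans (lerD (lerD (nmD _ _) (lexx _)) (lexx _)) _.
lra.
Qed.

End EulerStep.

Section NormSplit.
Context (R : realType) (V : normedZmodType R[i]).
Implicit Types x y z w : V.

Lemma nm_split x y z : nm x <= nm (x - y - z) + (nm y + nm z).
Proof.
have := nmB_trans (y + z) x 0; rewrite !subr0 opprD addrA => h.
by apply: le_trans h _; rewrite lerD2l nmD.
Qed.

Lemma nm_split2 x w y z : nm (x - w) <= nm (x - y - z) + nm (w - y - z).
Proof.
have := nmB_trans z (x - y) (w - y).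
by rewrite [nm (z - _)]nmBC opprB addrA subrK.
Qed.

End NormSplit.

Section Controls.
Context (R : realType) (k : hilbertType R) (e : nat -> k) (he : is_onb e).
Local Notation C := R[i].
Notation mu := (@lebesgue_measure R).
Implicit Types f g : R -> k.

(* Controls are indexed from 0, the components of [k] from 1. *)
Definition ctl f (r : R) (l : nat) : C := dot (e l.+1) (f r).

Lemma sub_Rplus (a b : R) : 0 <= a -> `[a, b]%classic `<=` Rplus R.
Proof.
move=> a0 r; rewrite /Rplus /= !in_itv /= andbT => /andP[ar _]; exact: le_trans ar.
Qed.

Lemma L2_control f : L2 f -> control (ctl f).
Proof.
move=> /(L2P he)[hm hi] l a b a0; have sub := @sub_Rplus a b a0.
have hi2 : intg a b (fun s => nm (f s) ^+ 2) by apply: integrableS hi => //; exact: measurable_Rplus.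
have bnd s : nm (ctl f s l) ^+ 2 <= nm (f s) ^+ 2.
  by rewrite ler_pXn2r ?nnegrE ?nm_ge0 //; exact: dot_e_le.
have [m1 m2] := hm (e l.+1).
have m1' : measurable_fun `[a, b] (fun s => complex.Re (ctl f s l)).
  by apply: measurable_funS m1 => //; exact: measurable_Rplus.
have m2' : measurable_fun `[a, b] (fun s => complex.Im (ctl f s l)).
  by apply: measurable_funS m2 => //; exact: measurable_Rplus.
split; split => //; apply: (intg_le _ hi2) => [|s _]; try exact: measurable_funX.
  rewrite ger0_norm ?sqr_ge0 //; apply: le_trans (bnd s); rewrite nm_sqE.
  by have := sqr_ge0 (complex.Im (ctl f s l)); lra.
rewrite ger0_norm ?sqr_ge0 //; apply: le_trans (bnd s); rewrite nm_sqE.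
by have := sqr_ge0 (complex.Re (ctl f s l)); lra.
Qed.

Lemma L2dot_ind g (a b : R) l : L2 g -> 0 <= a -> a <= b ->
  L2dot (ind e a b l.+1) g = ci a b (fun r => ctl g r l).
Proof.
move=> hg a0 ab; have hc := control_cg l b (L2_control hg) a0.
have E (F u : R -> R) : intg a b u -> (forall r, F r = if a <= r < b then u r else 0) ->
    \int[mu]_(r in Rplus R) F r = itg a b u.
  move=> iu hF; rewrite /itg -Rintegral_itv_bndo_bndc; last first.
    by apply: integrableS iu => //; apply: subset_itv; rewrite bnd_simp.
  rewrite Rintegral_mkcond [RHS]Rintegral_mkcond; apply: eq_Rintegral => r _.
  rewrite /patch hF; have -> : (r \in `[a, b[%classic) = (a <= r < b).
    by apply/idP/idP => [/set_mem|h]; [|apply/mem_set]; rewrite /= in_itv.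
  case: ifPn => [_|h]; case: ifPn => // /andP[ar rb].
  by case/negP: h; apply/mem_set; rewrite /Rplus /= in_itv /= andbT (le_trans a0 ar).
case: hc => h1 h2; rewrite /L2dot /cintegral /ci; congr (_ +i* _).
  by apply: E h1 _ => r; rewrite /ind /ctl; case: ifP => // _; rewrite dot0l.
by apply: E h2 _ => r; rewrite /ind /ctl; case: ifP => // _; rewrite dot0l.
Qed.

Definition cadd (a b : R) f i : R -> k := if i is l.+1 then (fun r => f r + ind e a b l.+1 r) else f.

Lemma L2_cadd a b f i : L2 f -> L2 (cadd a b f i).
Proof. by case: i => //= l hf; apply: (L2D he) => //; exact: (L2_ind he). Qed.

Lemma cadd_out a b f i r : ~~ (a <= r < b) -> cadd a b f i r = f r.
Proof. by case: i => //= l h; rewrite /ind (negbTE h) addr0. Qed.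

Definition coef (a b : R) f (l : nat) : C := ci a b (fun r => ctl f r l).

(** After exponentiation, the inner product of $e(f_i)$ and $e(g_j)$, with a quantum added to each
    control, is that of $e(f)$ and $e(g)$ times a coefficient of [euler]. So exponential vectors
    absorb these coefficients. *)
Lemma L2dot_cadd a b f g i j : L2 f -> L2 g -> 0 <= a -> a <= b ->
  L2dot (cadd a b f i) (cadd a b g j) =
  L2dot f g + step_exp (b - a) (coef a b f) (coef a b g) i j.
Proof.
move=> hf hg a0 ab; have hi l : L2 (ind e a b l) := L2_ind he a b l.
have li l : L2dot (ind e a b l.+1) g = coef a b g l by exact: L2dot_ind.
have ri l : L2dot f (ind e a b l.+1) = Num.conj (coef a b f l).
  by rewrite (L2dotC he (hi _) hf) (L2dot_ind l hf a0 ab).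
have ii l l' : L2dot (ind e a b l.+1) (ind e a b l'.+1) = (l == l')%:R * (b - a)%:C.
  rewrite (L2dot_ind l (hi _) a0 ab).
  rewrite (eq_ci_o (h' := fun=> (l == l')%:R)) => [|||r hr].
  - rewrite /ci /cintegral -![\int[_]_(_ in _) _]/(itg _ _ _) !itg_cst //.
    by case: eqP => _; rewrite ?mul1r ?mul0r.
  - by apply: control_cg => //; exact: L2_control.
  - exact/cbm_cg/cbm_cst.
  - by rewrite /ctl /ind hr (onb_dot he).
case: i => [|l]; case: j => [|l'] /=; rewrite /step_exp /= ?cj0 ?mul0r ?addr0 ?add0r //.
- by rewrite (L2dotDr he) // ri.
- by rewrite (L2dotDl he) // li.
- by rewrite (L2dotDl he) ?(L2dotDr he) ?li ?ri ?ii ?eqSS //; [ring|exact: (L2D he)].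
Qed.

End Controls.

Section Positivity.
Context (R : realType) (A : cstarType R) (tr : A -> R[i]) (htr : is_trace tr)
  (H : hilbertType R) (Lam : A -> H) (lmul : A -> H -> H) (hH : is_gns tr Lam lmul)
  (k : hilbertType R) (e : nat -> k) (he : is_onb e)
  (G : hilbertType R) (pow : nat -> (R -> k) -> G) (hG : is_sym_fock pow)
  (K : hilbertType R) (tens : H -> G -> K) (hK : is_tensor tens)
  (B : nat -> set A) (W : nat -> A) (hB : filtration B W).
Local Notation C := R[i].
Implicit Types (x y z : A) (f g : R -> k) (r s t : R).

Definition test n := {p : A * H * (R -> k) | B n p.1.1 /\ L2 p.2}.
(** The inner product that $J(X)(u \otimes e(f))$ and $J(Y)(v \otimes e(g))$ must have if $J$, with
    matrix elements given by [psi], is to be a *-homomorphism. *)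
Definition kk n (psi : (R -> k) -> (R -> k) -> A -> A) (p q : test n) : C :=
  dot (sval p).1.2 (lmul (psi (sval p).2 (sval q).2 (star (sval p).1.1 ** (sval q).1.1)) (sval q).1.2)
  * cexp (L2dot (sval p).2 (sval q).2).

Lemma psd_id n : psd (@kk n (fun _ _ x => x)).
Proof.
move=> s; pose v (p : test n) := tens (lmul (sval p).1.1 (sval p).1.2) (expv pow (sval p).2).
suff -> : form (@kk n (fun _ _ x => x)) s s = dot (vec v s) (vec v s).
  by rewrite dotxx lecR sqr_ge0.
rewrite dot_vec; apply: eq_form => p q; rewrite /v (tens_dot hK) (expv_dot hG).
- by rewrite /kk (lmul_star htr hH) (lmulM htr hH).
- exact: (proj2 (svalP p)).
- exact: (proj2 (svalP q)).
Qed.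

Section Step.
Context (n : nat) (psi : (R -> k) -> (R -> k) -> A -> A) (a b : R).
Context (a0 : 0 <= a) (ab : a <= b).
Context (psi_lin : forall f g, lin (psi f g)).
Context (psi_loc : forall f f' g g' x, L2 f -> L2 f' -> L2 g -> L2 g' -> B n x ->
  (forall r, r < a -> f r = f' r) -> (forall r, r < a -> g r = g' r) ->
  psi f g x = psi f' g' x).

Definition euler_next f g x :=
  psi f g (euler W n (b - a) (coef e a b f) (coef e a b g) x).

Definition shift_test (p : test n) (i : 'I_n.+1) : test n :=
  exist _ ((sval p).1.1 ** step_op W n (b - a) (coef e a b (sval p).2) i, (sval p).1.2,
    cadd e a b (sval p).2 i)
  (conj (BM hB (proj1 (svalP p)) (step_op_B hB (b - a) (coef e a b (sval p).2) i))
    (L2_cadd he a b i (proj2 (svalP p)))).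

(** Every point of [s] is replaced by $n+1$ points: the operators of the step go into the algebra
    component, the coefficients into the exponential vectors. [psi] does not notice the added
    quanta, since they live after time [a]. *)
Lemma psd_step : psd (@kk n psi) -> psd (@kk n euler_next).
Proof.
move=> hp s; pose s' := [seq (q.1, shift_test q.2 i) | q <- s, i <- index_enum 'I_n.+1].
suff -> : form (@kk n euler_next) s s = form (@kk n psi) s' s' by exact: hp.
have E p q : kk euler_next p q = \sum_i \sum_j kk psi (shift_test p i) (shift_test q j).
  case: p => -[[X u] f] [/= hX hf]; case: q => -[[Y v] g] [/= hY hg].
  rewrite /kk /euler_next /= /euler (op_sum (psi_lin f g)) (lmul_suml htr hH) dot_sumr mulr_suml.
  apply: eq_bigr => i _; rewrite (op_sum (psi_lin f g)) (lmul_suml htr hH) dot_sumr mulr_suml.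
  apply: eq_bigr => j _; rewrite (opZ (psi_lin f g)) (lmulZl htr hH) dotZr.
  rewrite (L2dot_cadd he i j hf hg a0 ab) [cexp (_ + _)]cexpD star_mul.
  rewrite (psi_loc (f' := f) (g' := g)) //; first last.
  - by move=> r ra; apply: cadd_out; rewrite leNgt ra.
  - by move=> r ra; apply: cadd_out; rewrite leNgt ra.
  - have h1 := step_op_B hB (b - a) (coef e a b f) i; have h2 := step_op_B hB (b - a) (coef e a b g) j.
    by do 2?[apply: (BM hB)] => //; apply: (BS hB).
  - exact: (L2_cadd he).
  - exact: (L2_cadd he).
  rewrite !mul_assoc; move: (cexp _) (cexp _) (dot _ _) => q1 q2 q3.
  by rewrite mulrAC mulrC [q1 * q2]mulrC.
rewrite /s' /form big_allpairs_dep; apply: eq_bigr => p _ /=.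
under [RHS]eq_bigr do rewrite big_allpairs_dep.
rewrite exchange_big; apply: eq_bigr => q _ /=.
rewrite E mulr_sumr; apply: eq_bigr => i _; rewrite mulr_sumr.
by [].
Qed.
End Step.

(** The step on the last interval acts first, as in the flow property, where the evolution of the
    later interval is applied first. *)
Fixpoint euler_chain n s t m j : (R -> k) -> (R -> k) -> A -> A :=
  if j is j'.+1 then euler_next n (euler_chain n s t m j') (grid s t m j') (grid s t m j'.+1)
  else fun _ _ x => x.

Lemma euler_chain_lin n s t m j f g : lin (euler_chain n s t m j f g).
Proof. by elim: j => [|j IH] a x y //=; rewrite /euler_next euler_lin IH. Qed.

Lemma euler_chain_local n s t m j f f' g g' x : 0 <= s -> s <= t -> 
  L2 f -> L2 f' -> L2 g -> L2 g' -> B n x ->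
  (forall r, r < grid s t m j -> f r = f' r) -> (forall r, r < grid s t m j -> g r = g' r) ->
  euler_chain n s t m j f g x = euler_chain n s t m j f' g' x.
Proof.
move=> s0 st hf hf' hg hg'; elim: j x => [|j IH] x hx ef eg //=; rewrite /euler_next.
have lej := grid_le m j st; have g0 : 0 <= grid s t m j := le_trans s0 (grid_ge m j st).
have E (h h' : R -> k) : L2 h -> L2 h' -> (forall r, r < grid s t m j.+1 -> h r = h' r) ->
    coef e (grid s t m j) (grid s t m j.+1) h = coef e (grid s t m j) (grid s t m j.+1) h'.
  move=> lh lh' eh; apply/funext => l; apply: eq_ci_o.
  - by apply: control_cg => //; exact: (L2_control he).
  - by apply: control_cg => //; exact: (L2_control he).
  - by move=> r /andP[_ rj]; rewrite /ctl eh.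
rewrite (E f f') ?(E g g') //; apply: IH; first exact: (euler_B hB).
- by move=> r rj; apply: ef; exact: lt_le_trans lej.
- by move=> r rj; apply: eg; exact: lt_le_trans lej.
Qed.

Lemma euler_chain_psd n s t m j : 0 <= s -> s <= t -> psd (@kk n (euler_chain n s t m j)).
Proof.
move=> s0 st; elim: j => [|j IH]; first exact: psd_id.
apply: psd_step => //.
- exact: le_trans (grid_ge m j st).
- exact: grid_le.
- by move=> f g; exact: euler_chain_lin.
- by move=> f f' g g' x *; exact: euler_chain_local.
Qed.

Context (Phi : R -> R -> (R -> nat -> C) -> (R -> nat -> C) -> A -> A) (hPhi : evolution B W Phi).
Definition flow s t f g := Phi s t (ctl e f) (ctl e g).
Local Notation phik := flow.

(** A telescoping sum exchanges the exact evolution for Euler steps, one interval at a time; the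
    local errors are of order $\epsilon_j^2$ and are not amplified by more than a fixed factor. *)
Lemma euler_chain_to n s t f g x : 0 <= s -> s <= t -> L2 f -> L2 g -> B n x ->
  to (fun m => euler_chain n s t m m.+1 f g x) (phik s t f g x).
Proof.
move=> s0 st /(L2_control he) cf /(L2_control he) cg hx.
have [M [M0 hM]] := phi_estimates hB hPhi n t cf cg.
have [c [c0 hc]] := euler_estimate hB n.
pose rt := rate n (ctl e f) (ctl e g).
have rt1 r : 1 <= rt r by exact: rate_ge1.
have sq a b : 0 <= a -> sqi a b rt by exact: rate_sqi.
have iq a b : 0 <= a -> intg a b rt by move=> /sq h; exact: sqi_intg.
pose q := itg s t (fun r => rt r ^+ 2).
pose eps m j := itg (grid s t m j) (grid s t m j.+1) rt.
have gs m j : 0 <= grid s t m j := le_trans s0 (grid_ge m j st).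
have eps0 m j : 0 <= eps m j by apply: itg_ge0 => r _; have := rt1 r; lra.
have sum2 m : \sum_(i < m.+1) eps m i ^+ 2 <= (t - s) / m.+1%:R * q.
  by apply: grid_sqr_sum => //; exact: sq.
have one m (j : 'I_m.+1) : eps m j ^+ 2 <= (t - s) / m.+1%:R * q.
  apply: le_trans (sum2 m); rewrite (bigD1 j) //= lerDl; apply: sumr_ge0 => i _; exact: sqr_ge0.
(* [Q] bounds the growth of the Euler chains. In [D], the factor [4 * c + M] bounds the distance of
   one Euler step from the exact one in units of $\epsilon_j^2$, and the last [M] the exact
   evolution after that step. *)
pose Q := expR (4 * c * itg s t rt).
pose D := Q * (4 * c + M) * M * nm x.
have D0 : 0 <= D by rewrite !mulr_ge0 ?expR_ge0 ?nm_ge0 ?addr_ge0 ?mulr_ge0.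
have q0 : 0 <= q by apply: itg_ge0 => r _; exact: sqr_ge0.
have coefle m (j : 'I_m.+1) (l : 'I_n) :
    nm (coef e (grid s t m j) (grid s t m j.+1) f l) <= 2 * eps m j /\
    nm (coef e (grid s t m j) (grid s t m j.+1) g l) <= 2 * eps m j.
  split; apply: ci_nm; try exact: iq.
  - exact: control_cg.
  - by move=> r _; exact: (rate_l (ctl e f) (ctl e g) r l).1.
  - exact: control_cg.
  - by move=> r _; exact: (rate_l (ctl e f) (ctl e g) r l).2.
have hle m j : grid s t m j.+1 - grid s t m j <= 2 * eps m j.
  have : grid s t m j.+1 - grid s t m j <= eps m j.
    rewrite -[leLHS]mul1r -itg_cst ?grid_le //; apply: itg_le => //; [exact: intg_cst|exact: iq].
  by have := eps0 m j; lra.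
have h0 m j : 0 <= grid s t m j.+1 - grid s t m j by rewrite subr_ge0 grid_le.
(* [euler_estimate] is used with [2 * eps m j], since [ci_nm] costs a factor 2. Its condition is
   then $6\epsilon_j \le 1$, and $36 = 6^2$. *)
have main m : 36 * ((t - s) / m.+1%:R * q) <= 1 ->
    nm (euler_chain n s t m m.+1 f g x - phik s t f g x) <= D * ((t - s) / m.+1%:R * q).
  move=> small; have e6 (j : 'I_m.+1) : 3 * (2 * eps m j) <= 1.
    have := one m j; have := eps0 m j; set a := eps m j => a0 a2.
    rewrite leNgt; apply/negP => h.
    have : 0 < (6 * a - 1) * (6 * a + 1) by apply: mulr_gt0; lra.
    have a3 : 36 * a ^+ 2 <= 1 by apply: le_trans small; rewrite ler_wpM2l.
    by rewrite expr2 in a3; lra.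
  pose st_ j y := euler W n (grid s t m j.+1 - grid s t m j)
    (coef e (grid s t m j) (grid s t m j.+1) f) (coef e (grid s t m j) (grid s t m j.+1) g) y.
  have est (j : 'I_m.+1) y : B n y ->
      nm (st_ j y - y - gint W n (grid s t m j) (grid s t m j.+1) (ctl e f) (ctl e g) y) <= 4 * c * eps m j ^+ 2 * nm y /\
      nm (gint W n (grid s t m j) (grid s t m j.+1) (ctl e f) (ctl e g) y) <= 2 * c * eps m j * nm y.
    move=> hy; have [e1 e2] := hc _ _ _ _ _ hy (h0 m j) (hle m j) (e6 j) (coefle m j).
    split; first by apply: le_trans e1 _; rewrite le_eqVlt; apply/orP; left; apply/eqP; ring.
    by apply: le_trans e2 _; rewrite le_eqVlt; apply/orP; left; apply/eqP; ring.
  have grow j y : (j <= m.+1)%N -> B n y -> nm (euler_chain n s t m j f g y) <=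
      expR (4 * c * \sum_(i < j) eps m i) * nm y.
    elim: j y => [|j IH] y jm hy; first by rewrite big_ord0 mulr0 expR0 mul1r.
    apply: le_trans (IH _ (ltnW jm) (euler_B hB _ _ _ hy)) _.
    rewrite big_ord_recr /= mulrDr expRD -[leRHS]mulrA ler_wpM2l ?expR_ge0 //.
    have [e1 e2] := est (Ordinal jm) y hy.
    have h1 := nm_split (st_ j y) y (gint W n (grid s t m j) (grid s t m j.+1) (ctl e f) (ctl e g) y).
    have h3 := expR_ge1Dx (4 * c * eps m j); have h4 := ler_wpM2r (nm_ge0 y) h3.
    have h5 : 4 * c * eps m j ^+ 2 * nm y <= 2 * c * eps m j * nm y.
      rewrite ler_wpM2r ?nm_ge0 // expr2 mulrA -mulrA; have := e6 (Ordinal jm) => /= h6.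
      have := eps0 m j => h7; have : c * eps m j * (2 * eps m j) <= c * eps m j * 1.
        by rewrite ler_wpM2l ?mulr_ge0 //; lra.
      lra.
    apply: le_trans h4; apply: le_trans h1 _.
    apply: le_trans (lerD e1 (lerD (lexx (nm y)) e2)) _; move: h5 => /=; lra.
  have growQ j y : (j <= m.+1)%N -> B n y -> nm (euler_chain n s t m j f g y) <= Q * nm y.
    move=> jm hy; apply: le_trans (grow j y jm hy) _; rewrite ler_wpM2r ?nm_ge0 // ler_expR.
    rewrite ler_wpM2l ?mulr_ge0 // grid_sum //; last exact: iq.
    rewrite [leRHS](itg_add (grid_ge m j st) (grid_leT st jm)); last exact: iq.
    by rewrite lerDl; apply: itg_ge0 => r _; have := rt1 r; lra.
  (* Euler steps up to the [j]-th grid point, the exact evolution after it; consecutive values of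
     [j] differ on one interval only. *)
  have tele j : (j <= m.+1)%N ->
      nm (euler_chain n s t m j f g (Phi (grid s t m j) t (ctl e f) (ctl e g) x) - phik s t f g x) <=
      D * \sum_(i < j) eps m i ^+ 2.
    elim: j => [|j IH] jm; first by rewrite big_ord0 mulr0 /= grid0 subrr nm0.
    set y := Phi (grid s t m j.+1) t (ctl e f) (ctl e g) x.
    have lt1 : grid s t m j.+1 <= t := grid_leT st jm.
    have hy : B n y := phi_B hPhi cf cg (gs m j.+1) lt1 hx.
    have ey : Phi (grid s t m j) t (ctl e f) (ctl e g) x =
        Phi (grid s t m j) (grid s t m j.+1) (ctl e f) (ctl e g) y.
      by apply: (phi_flow hB hPhi cf cg (gs m j) (grid_le m j st) lt1 hx).
    rewrite big_ord_recr /= mulrDr.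
    apply: le_trans (nmB_trans (euler_chain n s t m j f g (Phi (grid s t m j) t (ctl e f) (ctl e g) x)) _ _) _.
    rewrite addrC lerD ?IH ?(ltnW jm) // /euler_next -(opB (euler_chain_lin n s t m j f g)) ey.
    have hz : B n (Phi (grid s t m j) (grid s t m j.+1) (ctl e f) (ctl e g) y).
      exact: (phi_B hPhi cf cg (gs m j) (grid_le m j st) hy).
    apply: le_trans (growQ j _ (ltnW jm) _) _.
      by apply: (BB hB) => //; exact: (euler_B hB).
    have [e1 _] := est (Ordinal jm) y hy.
    have [_ _ e2] := hM _ _ _ (gs m j) (grid_le m j st) lt1 hy.
    have [e3 _ _] := hM _ _ _ (gs m j.+1) lt1 (lexx t) hx.
    rewrite /D -!mulrA ler_wpM2l ?expR_ge0 //.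
    have h1 := nm_split2 (st_ j y) (Phi (grid s t m j) (grid s t m j.+1) (ctl e f) (ctl e g) y) y
      (gint W n (grid s t m j) (grid s t m j.+1) (ctl e f) (ctl e g) y).
    have h2 : nm (st_ j y - Phi (grid s t m j) (grid s t m j.+1) (ctl e f) (ctl e g) y) <=
        (4 * c + M) * eps m j ^+ 2 * nm y.
      apply: le_trans h1 _; rewrite [X in _ <= X * _]mulrDl [leRHS]mulrDl; exact: lerD e1 e2.
    apply: le_trans h2 _; rewrite -!mulrA ler_wpM2l ?addr_ge0 ?mulr_ge0 //.
    by rewrite [leLHS]mulrA -expr2 [leLHS]mulrC [leRHS]mulrA ler_wpM2r ?sqr_ge0.
  have := tele m.+1 (leqnn _); rewrite gridT (phi_id hB hPhi cf cg (le_trans s0 st) hx) => h.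
  by apply: le_trans h _; rewrite ler_wpM2l //; exact: sum2.
move=> ee e0; pose kap := (t - s) * q; have k0 : 0 <= kap by rewrite mulr_ge0 // subr_ge0.
have [N1 hN1] := inv_small (D * kap) e0; have [N2 hN2] := inv_small (36 * kap) ltr01.
exists (maxn N1 N2) => m mN.
have e1 : (t - s) / m.+1%:R * q = kap / m.+1%:R by rewrite mulrAC.
have s1 := hN1 m (leq_trans (leq_maxl _ _) mN); have s2 := hN2 m (leq_trans (leq_maxr _ _) mN).
apply: le_lt_trans (main m _) _; rewrite e1 mulrA //; exact: ltW.
Qed.

Lemma phik_psd n s t : 0 <= s -> s <= t -> psd (@kk n (phik s t)).
Proof.
move=> s0 st L.
apply: (@to_ge0 _ (fun m => form (@kk n (euler_chain n s t m m.+1)) L L)) => [|m]; last first.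
  exact: euler_chain_psd.
apply: to_sum => p; apply: to_sum => q; apply: toM; last exact: to_cst.
apply: toM; first exact: to_cst.
apply: to_dotr.
have [hX hf] := svalP p.2; have [hY hg] := svalP q.2.
have h := @euler_chain_to n s t (sval p.2).2 (sval q.2).2 (star (sval p.2).1.1 ** (sval q.2).1.1)
  s0 st hf hg (BM hB (BS hB hX) hY).
apply: (to_le (c := nm (sval q.2).1.2)) h => m.
by rewrite -(lmulBl htr hH) mulrC; exact: (lmul_le htr hH).
Qed.

End Positivity.

(** * The flow as operators *)

Section FlowOperators.
Context (R : realType) (A : cstarType R) (tr : A -> R[i]) (htr : is_trace tr)
  (H : hilbertType R) (Lam : A -> H) (lmul : A -> H -> H) (hH : is_gns tr Lam lmul)
  (k : hilbertType R) (e : nat -> k) (he : is_onb e)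
  (G : hilbertType R) (pow : nat -> (R -> k) -> G) (hG : is_sym_fock pow)
  (K : hilbertType R) (tens : H -> G -> K) (hK : is_tensor tens)
  (B : nat -> set A) (W : nat -> A) (hB : filtration B W).
Context (hdense : forall x, exists u : nat -> A, (forall n, exists m, B m (u n)) /\ to u x).
Local Notation C := R[i].
Implicit Types (x y : A) (z w : K) (f g : R -> k) (r s t : R).
Context (Phi : R -> R -> (R -> nat -> C) -> (R -> nat -> C) -> A -> A) (hPhi : evolution B W Phi).
Local Notation phik := (flow e Phi).

Definition ktest := (H * {f : R -> k | L2 f})%type.
Definition exp_vec (p : ktest) : K := tens p.1 (expv pow (sval p.2)).
Local Notation kvec := exp_vec.

Lemma kvec_total : total kvec.
Proof.
apply: (tens_totalr hK (v := fun f : {f : R -> k | L2 f} => expv pow (sval f))) => y h.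
by apply: (expv_total he hG) => f hf; exact: (h (exist _ f hf)).
Qed.

Lemma K_ext (z z' : K) : (forall u f, L2 f -> dot (tens u (expv pow f)) z = dot (tens u (expv pow f)) z') ->
  z = z'.
Proof. by move=> h; apply: (total_inj kvec_total) => -[u [f hf]]; exact: h. Qed.

Lemma dot_kvec (p q : ktest) : dot (kvec p) (kvec q) = dot p.1 q.1 * cexp (L2dot (sval p.2) (sval q.2)).
Proof. by rewrite (tens_dot hK) (expv_dot hG) //; [exact: (svalP p.2)|exact: (svalP q.2)]. Qed.

Section OneOperator.
Context (n : nat) (s t : R) (s0 : 0 <= s) (st : s <= t).

Definition kap x (p q : ktest) : C :=
  dot p.1 (lmul (phik s t (sval p.2) (sval q.2) x) q.1) * cexp (L2dot (sval p.2) (sval q.2)).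

Definition emb x (hx : B n x) (p : ktest) : test H k B n :=
  exist _ (x, p.1, sval p.2) (conj hx (svalP p.2)).

Lemma form_emb x y (hx : B n x) (hy : B n y) S T :
  form (kk lmul (phik s t)) [seq (q.1, emb hx q.2) | q <- S] [seq (q.1, emb hy q.2) | q <- T] =
  form (kap (star x ** y)) S T.
Proof.
by rewrite /form big_map; apply: eq_bigr => p _; rewrite big_map; apply: eq_bigr.
Qed.

Lemma kap1 S T : form (kap aone) S T = dot (vec kvec S) (vec kvec T).
Proof.
rewrite dot_vec; apply: eq_form => p q; rewrite dot_kvec /kap /flow.
rewrite (phi1 hB hPhi _ _ s0 n st) ?(lmul1 htr hH) //; apply: (L2_control he).
- exact: (svalP p.2).
- exact: (svalP q.2).
Qed.

(** Cauchy-Schwarz for the positive kernel, between points with algebra component 1 and points with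
    component [x]. The first factor is a Gram form because the evolution fixes the unit. *)
Lemma kap_CS x S T : B n x -> nm (form (kap x) S T) ^+ 2 <=
  nm (vec kvec S) ^+ 2 * nm (form (kap (star x ** x)) T T).
Proof.
move=> hx; have := psd_CS [seq (q.1, emb (B1 hB n) q.2) | q <- S] [seq (q.1, emb hx q.2) | q <- T]
  (phik_psd htr hH he hG hK hB hPhi s0 st).
rewrite !form_emb star1 !mul_unitl kap1 dotxx /= => h; apply: le_trans h _.
by rewrite ler_wpM2l ?sqr_ge0 // nm_Re_le.
Qed.

Lemma kap_crude T : exists M : R, 0 <= M /\ forall x, B n x -> nm (form (kap x) T T) <= M * nm x.
Proof.
have /choice[M hM] : forall pq : (C * ktest) * (C * ktest), exists M : R, 0 <= M /\ forall x, B n x ->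
    nm (kap x pq.1.2 pq.2.2) <= M * nm x.
  move=> [[a [u [f hf]]] [b [v [g hg]]]] /=.
  have [M [M0 h]] := phi_bd hPhi n t (L2_control he hf) (L2_control he hg).
  exists (nm u * M * nm v * nm (cexp (L2dot f g))); split=> [|x hx].
    by rewrite !mulr_ge0 ?nm_ge0.
  rewrite nmM /=.
  rewrite -[leRHS]mulrA [nm (cexp _) * _]mulrC mulrA ler_wpM2r ?nm_ge0 //.
  apply: le_trans (CS _ _) _; rewrite -!mulrA ler_wpM2l ?nm_ge0 //.
  apply: le_trans (lmul_le htr hH _ _) _; rewrite [nm v * _]mulrC mulrA ler_wpM2r ?nm_ge0 //.
  exact: h.
exists (\sum_(p <- T) \sum_(q <- T) nm (Num.conj p.1 * q.1) * M (p, q)); split=> [|x hx].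
  by do 2!apply: sumr_ge0 => ? _; rewrite mulr_ge0 ?nm_ge0 //; exact: (hM _).1.
rewrite mulr_suml; apply: le_trans (nm_sum _ _ _) _; apply: ler_sum => p _.
rewrite mulr_suml; apply: le_trans (nm_sum _ _ _) _; apply: ler_sum => q _.
by rewrite nmM -mulrA ler_wpM2l ?nm_ge0 //; exact: (hM (p, q)).2.
Qed.

(** For the powers of $h = x^{*}x$, [kap_CS] gives the doubling inequality of [dyadic_bound], and
    [kap_crude] a bound with a constant depending on [T] and the box. That constant does not survive
    in the conclusion. *)
Lemma kap_bound x S T : B n x ->
  nm (form (kap x) S T) <= nm x * (nm (vec kvec S) * nm (vec kvec T)).
Proof.
move=> hx; have hxx : B n (star x ** x) by apply: (BM hB) => //; exact: (BS hB).
rewrite -(@ler_pXn2r _ 2) // ?nnegrE ?mulr_ge0 ?nm_ge0 //.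
apply: le_trans (kap_CS S T hx) _.
rewrite [leRHS](_ : _ = nm (vec kvec S) ^+ 2 * (nm (vec kvec T) ^+ 2 * nm x ^+ 2)); last by ring.
rewrite ler_wpM2l ?sqr_ge0 // -nm_cstar; set h := star x ** x in hxx *.
have hh : star h = h by rewrite /h star_mul star_invol.
have hB' m : B n (apow h m).
  by elim: m => [|m IH]; [exact: (B1 hB)|apply: (BM hB)].
have [M [M0 hM]] := kap_crude T.
rewrite -{1}(apow1 h); apply: (@dyadic_bound _ (fun m => nm (form (kap (apow h m)) T T)) _ M).
- exact: sqr_ge0.
- exact: nm_ge0.
- by move=> m; exact: nm_ge0.
- by move=> m; have := kap_CS T T (hB' m); rewrite star_apow // apowD addnn.
- by move=> m; apply: le_trans (hM _ (hB' m)) _; rewrite ler_wpM2l // nm_apow_le.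
Qed.

Lemma J_local_ex x : B n x -> exists Z : K -> K,
  [/\ forall a z w, Z (a *: z + w) = a *: Z z + Z w, forall z, nm (Z z) <= nm x * nm z &
      forall u v f g, L2 f -> L2 g -> dot (tens u (expv pow f)) (Z (tens v (expv pow g))) =
        dot u (lmul (phik s t f g x) v) * cexp (L2dot f g)].
Proof.
move=> hx; have [Z [Zl Zb Zm]] := kernel_op kvec_total (nm_ge0 x) (fun S T => kap_bound S T hx).
exists Z; split => // u v f g hf hg.
exact: (Zm (u, exist _ f hf) (v, exist _ g hg)).
Qed.

End OneOperator.

(** The co-cycle itself is [J 0 t]; the operators started at [s] supply the shifted Fock components
    in its identity. *)
Record flow_ops (J : R -> R -> A -> K -> K) : Prop := {
  J_lin : forall s t x, 0 <= s -> s <= t -> forall a (z w : K),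
    J s t x (a *: z + w) = a *: J s t x z + J s t x w ;
  J_linx : forall s t (w : K), 0 <= s -> s <= t -> forall a x y,
    J s t (a *: x + y) w = a *: J s t x w + J s t y w ;
  J_nm : forall s t x (z : K), 0 <= s -> s <= t -> nm (J s t x z) <= nm x * nm z ;
  J_mat : forall n s t x u v f g, 0 <= s -> s <= t -> B n x -> L2 f -> L2 g ->
    dot (tens u (expv pow f)) (J s t x (tens v (expv pow g))) =
    dot u (lmul (phik s t f g x) v) * cexp (L2dot f g) }.

Lemma op_ext (Z Z' : K -> K) (c c' : R) :
  (forall a z w, Z (a *: z + w) = a *: Z z + Z w) -> (forall z, nm (Z z) <= c * nm z) ->
  (forall a z w, Z' (a *: z + w) = a *: Z' z + Z' w) -> (forall z, nm (Z' z) <= c' * nm z) ->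
  (forall v g, L2 g -> Z (tens v (expv pow g)) = Z' (tens v (expv pow g))) -> forall z, Z z = Z' z.
Proof.
move=> lZ bZ lZ' bZ' h z; have [u uz] := total_dense kvec_total z.
apply: to_unique (to_op lZ bZ uz) _; apply: to_ev (to_op lZ' bZ' uz).
exists 0%N => n _; rewrite /vec !(op_sum lZ) !(op_sum lZ').
by apply: eq_bigr => p _; rewrite (opZ lZ) (opZ lZ') /exp_vec h //; exact: (svalP p.2.2).
Qed.

Lemma flow_ops_ex : exists J, flow_ops J.
Proof.
have loc2 x y : (exists m, B m x) -> (exists m, B m y) -> exists m, B m x /\ B m y.
  move=> [m hm] [m' hm']; exists (maxn m m').
  by split; [exact: (fil_mono hB (leq_maxl m m'))|exact: (fil_mono hB (leq_maxr m m'))].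
suff /choice[J hJ] : forall st : R * R, exists J : A -> K -> K, 0 <= st.1 -> st.1 <= st.2 ->
    [/\ forall x a (z w : K), J x (a *: z + w) = a *: J x z + J x w,
        forall (w : K) a x y, J (a *: x + y) w = a *: J x w + J y w,
        forall x z, nm (J x z) <= nm x * nm z &
        forall n x u v f g, B n x -> L2 f -> L2 g ->
          dot (tens u (expv pow f)) (J x (tens v (expv pow g))) =
          dot u (lmul (phik st.1 st.2 f g x) v) * cexp (L2dot f g)].
  exists (fun s t => J (s, t)); split.
  - by move=> s t x s0 st; have [h _ _ _] := hJ (s, t) s0 st; exact: h.
  - by move=> s t w s0 st; have [_ h _ _] := hJ (s, t) s0 st; exact: h.
  - by move=> s t x z s0 st; have [_ _ h _] := hJ (s, t) s0 st; exact: h.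
  - by move=> n s t x u v f g s0 st; have [_ _ _ h] := hJ (s, t) s0 st; exact: h.
move=> [s t] /=; have [[s0 st]|no] := pselect (0 <= s /\ s <= t); last first.
  by exists (fun _ z => z) => s0 st; case: no.
have /choice[J0 hJ0] : forall x, exists Z : K -> K, (exists m, B m x) ->
  [/\ forall a z w, Z (a *: z + w) = a *: Z z + Z w, forall z, nm (Z z) <= nm x * nm z &
      forall u v f g, L2 f -> L2 g -> dot (tens u (expv pow f)) (Z (tens v (expv pow g))) =
        dot u (lmul (phik s t f g x) v) * cexp (L2dot f g)].
  move=> x; have [[m hm]|no'] := pselect (exists m, B m x).
    by have [Z hZ] := J_local_ex s0 st hm; exists Z.
  by exists id => h; case: no'.
have J0lin (z : K) a x y : (exists m, B m x) -> (exists m, B m y) ->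
    J0 (a *: x + y) z = a *: J0 x z + J0 y z.
  move=> lx ly; have [m [hx hy]] := loc2 _ _ lx ly; have hxy := BE hB a hx hy.
  have [l1 b1 m1] := hJ0 x lx; have [l2 b2 m2] := hJ0 y ly.
  have [l3 b3 m3] := hJ0 (a *: x + y) (ex_intro _ m hxy).
  apply: (op_ext (Z' := fun z => a *: J0 x z + J0 y z) l3 b3 _
     (c' := nm a * nm x + nm y)) => [b w w'|w|v g hg].
  - by rewrite l1 l2 scalerDr scalerDr !scalerA addrACA [a * b]mulrC.
  - apply: le_trans (nmD _ _) _; rewrite nmZ mulrDl -mulrA lerD ?b2 //.
    by rewrite ler_wpM2l ?nm_ge0.
  - apply: K_ext => u f hf; rewrite m3 // dotDr dotZr m1 // m2 // /flow.
    rewrite (phi_lin hPhi (L2_control he hf) (L2_control he hg) s0 (n := m) st a hx hy).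
    by rewrite (lmulEl htr hH) dotDr dotZr mulrDl mulrA.
(* For fixed [z] the map $x \mapsto J(x)z$ is linear and bounded on local elements, hence extends to
   [A] by density. *)
have ext (z : K) : exists F : A -> K, [/\ forall a x y, F (a *: x + y) = a *: F x + F y,
    forall x, nm (F x) <= nm z * nm x & forall x, (exists m, B m x) -> F x = J0 x z].
  apply: (linear_ext (D := [set x | exists m, B m x]) (c := nm z)).
  - by move=> a x y /= lx ly; have [m [hx hy]] := loc2 _ _ lx ly; exists m; exact: (BE hB).
  - by move=> a x y; exact: J0lin.
  - by move=> x lx; have [_ h _] := hJ0 x lx; rewrite mulrC.
  - exact: hdense.
have /choice[F hF] := ext.
exists (fun x z => F z x) => _ _; split.
- move=> x a z w; have [u [lu ux]] := hdense x.
  have [l1 b1 e1] := hF (a *: z + w); have [l2 b2 e2] := hF z; have [l3 b3 e3] := hF w.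
  apply: to_unique (to_op l1 b1 ux) _.
  apply: to_ev (toD (toZ (to_op l2 b2 ux) (to_cst a)) (to_op l3 b3 ux)).
  by exists 0%N => n _; rewrite e1 // e2 // e3 //; have [h _ _] := hJ0 (u n) (lu n); rewrite h.
- by move=> w a x y; have [h _ _] := hF w; exact: h.
- by move=> x z; have [_ h _] := hF z; rewrite mulrC.
- move=> n x u v f g hx hf hg; have [_ _ h] := hF (tens v (expv pow g)).
  by rewrite h; [have [_ _ h'] := hJ0 x (ex_intro _ n hx); exact: h'|exists n].
Qed.

Context (J : R -> R -> A -> K -> K) (hJ : flow_ops J).

Lemma J_star s t x (z w : K) : 0 <= s -> s <= t -> dot (J s t (star x) z) w = dot z (J s t x w).
Proof.
move=> s0 st.
have key n y (v v' : H) f g : B n y -> L2 f -> L2 g ->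
    dot (J s t (star y) (tens v (expv pow f))) (tens v' (expv pow g)) =
    dot (tens v (expv pow f)) (J s t y (tens v' (expv pow g))).
  move=> hy hf hg; rewrite dot_conj (J_mat hJ _ _ s0 st (BS hB hy) hg hf) (J_mat hJ _ _ s0 st hy hf hg).
  have cc : Num.conj (cexp (L2dot g f)) = cexp (L2dot f g).
    by rewrite -!(expv_dot hG) // -dot_conj.
  rewrite cjM cc; congr (_ * _); rewrite -dot_conj (lmul_star htr hH) /flow.
  by rewrite (phi_star hB hPhi (L2_control he hg) (L2_control he hf) s0 st (BS hB hy)) star_invol.
have loc y (z' w' : K) : (exists m, B m y) -> dot (J s t (star y) z') w' = dot z' (J s t y w').
  move=> [n hy]; have [u uz] := total_dense kvec_total z'; have [u' uw] := total_dense kvec_total w'.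
  have l1 := J_lin hJ (star y) s0 st; have b1 z1 := J_nm hJ (star y) z1 s0 st.
  have l2 := J_lin hJ y s0 st; have b2 z1 := J_nm hJ y z1 s0 st.
  have k2 v f : L2 f -> dot (J s t (star y) (tens v (expv pow f))) w' =
      dot (tens v (expv pow f)) (J s t y w').
    move=> hf; apply: to_unique (to_dotr _ uw) _.
    apply: to_ev (to_dotr _ (to_op l2 b2 uw)); exists 0%N => m _.
    rewrite (op_sum l2) !dot_sumr; apply: eq_bigr => p _.
    by rewrite (opZ l2) !dotZr (key n) //; exact: (svalP p.2.2).
  apply: to_unique (to_dotl _ (to_op l1 b1 uz)) _; apply: to_ev (to_dotl _ uz); exists 0%N => m _.
  rewrite (op_sum l1) !dot_suml; apply: eq_bigr => p _.
  by rewrite (opZ l1) !dotZl k2 //; exact: (svalP p.2.2).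
have [u [lu ux]] := hdense x.
have bx (y : A) (z1 : K) : nm (J s t y z1) <= nm z1 * nm y by rewrite mulrC (J_nm hJ).
have t1 : to (fun n => J s t (star (u n)) z) (J s t (star x) z).
  exact: (to_op (J_linx hJ z s0 st) (fun y => bx y z) (to_star ux)).
have t2 : to (fun n => J s t (u n) w) (J s t x w).
  exact: (to_op (J_linx hJ w s0 st) (fun y => bx y w) ux).
apply: to_unique (to_dotl w t1) _; apply: to_ev (to_dotr z t2).
by exists 0%N => n _; rewrite loc.
Qed.

Lemma J_one s t (z : K) : 0 <= s -> s <= t -> J s t aone z = z.
Proof.
move=> s0 st; apply: (op_ext (Z' := id) (J_lin hJ _ s0 st) (fun z => J_nm hJ _ z s0 st) _ (c' := 1)) => //.
  by move=> w; rewrite mul1r.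
move=> v g hg; apply: K_ext => u f hf.
rewrite (J_mat hJ _ _ s0 st (B1 hB 0) hf hg) /flow.
rewrite (phi1 hB hPhi (L2_control he hf) (L2_control he hg) s0 0 st) (lmul1 htr hH).
by rewrite (tens_dot hK) (expv_dot hG).
Qed.

End FlowOperators.

(** * Multiplicativity *)

Section Defect.
Context (R : realType) (A : cstarType R) (tr : A -> R[i]) (htr : is_trace tr)
  (H : hilbertType R) (Lam : A -> H) (lmul : A -> H -> H) (hH : is_gns tr Lam lmul)
  (k : hilbertType R) (e : nat -> k) (he : is_onb e)
  (G : hilbertType R) (pow : nat -> (R -> k) -> G) (hG : is_sym_fock pow)
  (K : hilbertType R) (tens : H -> G -> K) (hK : is_tensor tens)
  (B : nat -> set A) (W : nat -> A) (hB : filtration B W).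
Local Notation C := R[i].
Implicit Types (x y : A) (z w : K) (f g : R -> k) (r s t : R).
Context (Phi : R -> R -> (R -> nat -> C) -> (R -> nat -> C) -> A -> A) (hPhi : evolution B W Phi).
Local Notation phik := (flow e Phi).
Context (J : R -> R -> A -> K -> K) (hJ : flow_ops lmul e pow tens B Phi J).
Local Notation kvec := (exp_vec pow tens).
Local Notation E f := (expv pow f).

Section DefectKernel.
Context (n : nat) (s : R) (s0 : 0 <= s).

Definition jvec (p : test H k B n) : K := J 0 s (sval p).1.1 (tens (sval p).1.2 (E (sval p).2)).
Definition defect (p q : test H k B n) : C := kk lmul (phik 0 s) p q - dot (jvec p) (jvec q).

Lemma form_jvec (Z : seq (C * ktest H k)) S : dot (vec kvec Z) (vec jvec S) =
  form (kk lmul (phik 0 s)) [seq (q.1, emb (B1 hB n) q.2) | q <- Z] S.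
Proof.
rewrite /vec dot_suml /form big_map; apply: eq_bigr => p _.
rewrite dot_sumr; apply: eq_bigr => q _.
rewrite dotZl dotZr mulrA; congr (_ * _); rewrite /kk /= star1 mul_unitl /jvec /exp_vec.
by rewrite (J_mat hJ _ _ (lexx 0) s0 (proj1 (svalP q.2)) (svalP p.2.2) (proj2 (svalP q.2))).
Qed.

(** Let $a$ be the form of [kk]. Cauchy-Schwarz against points with unit component gives $|\langle
    z, V\rangle| \le \sqrt a\,\|z\|$ for $z$ in a dense subspace, whence $\|V\|^2 \le a$. *)
Lemma defect_psd : psd defect.
Proof.
move=> S; set V := vec jvec S; set a := form (kk lmul (phik 0 s)) S S.
have psdk := phik_psd htr hH he hG hK hB hPhi (lexx 0) s0 (n := n).
have [aE a0] := ge0_Re (psdk S); rewrite -/a in aE a0.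
have -> : form defect S S = a - dot V V.
  rewrite dot_vec /a /form -sumrB; apply: eq_bigr => p _; rewrite -sumrB; apply: eq_bigr => q _.
  by rewrite /defect mulrBr.
rewrite -aE dotxx -rmorphB lecR subr_ge0; set ra := complex.Re a in a0 *.
have key Z : nm (dot (vec kvec Z) V) <= Num.sqrt ra * nm (vec kvec Z).
  rewrite -(@ler_pXn2r _ 2) // ?nnegrE ?mulr_ge0 ?nm_ge0 ?sqrtr_ge0 //.
  rewrite exprMn sqr_sqrtr // mulrC form_jvec; apply: le_trans (psd_CS _ _ psdk) _.
  rewrite (form_emb lmul e Phi 0 s) star1 mul_unitl (kap1 htr hH he hG hK hB hPhi n (lexx 0) s0).
  by rewrite dotxx.
have [u uV] := total_dense (kvec_total he hG hK) V.
have : nm (dot V V) <= nm ((Num.sqrt ra)%:C *: V).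
  apply: to_nm_le2 (to_dotl V uV) (toZ uV (to_cst _)) _ => m.
  by rewrite nmZ nm_real ger0_norm ?sqrtr_ge0.
rewrite dotxx nmZ !nm_real ger0_norm ?sqr_ge0 // ger0_norm ?sqrtr_ge0 // => h.
have [->|vn] := eqVneq (nm V) 0; first by rewrite expr0n.
have vp : 0 < nm V by rewrite lt_def vn nm_ge0.
have : nm V <= Num.sqrt ra by rewrite -(ler_pM2r vp) -expr2.
by move=> h'; rewrite -(sqr_sqrtr a0) ler_pXn2r ?nnegrE ?nm_ge0 ?sqrtr_ge0.
Qed.

End DefectKernel.

Lemma L2dot_gluel s f g h : L2 f -> L2 g -> L2 h ->
  L2dot (glue s f g) h = L2dot (before s f) (before s h) + L2dot (after s g) (after s h).
Proof. by move=> hf hg hh; rewrite -{1}(glue_id s h) (L2dot_glue he). Qed.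
Lemma L2dot_gluer s f g h : L2 f -> L2 g -> L2 h ->
  L2dot h (glue s f g) = L2dot (before s h) (before s f) + L2dot (after s h) (after s g).
Proof. by move=> hf hg hh; rewrite -{1}(glue_id s h) (L2dot_glue he). Qed.

(* A vector [w = Z (v (x) e(f))] with [Z] adapted at time [s] lies in the closed span of the
   [u (x) e(g)] with [g = f] after [s]. *)
Lemma adapted_ext s f w z z' : L2 f ->
  (forall u g, L2 g -> dot (tens u (E g)) w =
    cexp (L2dot (after s g) (after s f) - L2dot (after s f) (after s f)) * dot (tens u (E (glue s g f))) w) ->
  (forall u g, L2 g -> dot (tens u (E (glue s g f))) z = dot (tens u (E (glue s g f))) z') ->
  dot w z = dot w z'.
Proof.
move=> hf hw hz; pose v (p : ktest H k) := tens p.1 (E (glue s (sval p.2) f)).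
pose D : set K := [set x | exists L, x = vec v L].
have D0 : D 0 by exists [::]; rewrite /vec big_nil.
have Dl (a : C) (x y : K) : D x -> D y -> D (a *: x + y).
  by move=> [L ->] [L' ->]; exists (cscale a L ++ L'); rewrite vec_cat vec_scale.
have [p [[u [Du up]] Dp]] := projection w D0 Dl.
(* The pairing of any $e(g)$ with [w], and likewise with [p], is a multiple of the pairing at
   [glue s g f], the same multiple for both; and there [w - p] is orthogonal. *)
have E0 : w - p = 0.
  apply: (kvec_total he hG hK) => -[u0 [g hg]]; rewrite /exp_vec /=.
  set rt := cexp (L2dot (after s g) (after s f) - L2dot (after s f) (after s f)).
  have hp : dot (tens u0 (E g)) p = rt * dot (tens u0 (E (glue s g f))) p.
    apply: to_unique (to_dotr _ up) _; have := to_dotr (rt^* *: tens u0 (E (glue s g f))) up.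
    rewrite dotZl cjK; apply: to_ev; exists 0%N => m _; rewrite dotZl cjK.
    have [L ->] := Du m; rewrite /vec !dot_sumr mulr_sumr; apply: eq_bigr => q _.
    rewrite !dotZr mulrCA; congr (_ * _); rewrite /v !(tens_dot hK) mulrCA; congr (_ * _).
    have hq := svalP q.2.2; have hgq := L2_glue he s hq hf.
    rewrite (expv_dot hG (L2_glue he s hg hf) hgq) (expv_dot hG hg hgq) /rt -cexpD; congr cexp.
    rewrite (L2dot_gluer s hq hf hg) (L2dot_glue he s hg hf hq hf); ring.
  rewrite dotBr (hw _ _ hg) hp -mulrBr -dotBr Dp ?mulr0 //.
  by exists [:: (1, (u0, exist _ g hg))]; rewrite vec1.
have -> : w = p by apply/eqP; rewrite -subr_eq0; apply/eqP.
apply: to_unique (to_dotl z up) _; apply: to_ev (to_dotl z' up); exists 0%N => m _.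
have [L ->] := Du m; rewrite /vec !dot_suml; apply: eq_bigr => q _.
by rewrite !dotZl hz //; exact: (svalP q.2.2).
Qed.

Local Notation P s y v f := (J 0 s y (tens v (E f))).

Lemma phik_loc n s t f g f' g' x : 0 <= s -> s <= t -> L2 f -> L2 g -> L2 f' -> L2 g' ->
  (forall r, s <= r < t -> f r = f' r) -> (forall r, s <= r < t -> g r = g' r) -> B n x ->
  phik s t f g x = phik s t f' g' x.
Proof.
move=> s0 st hf hg hf' hg' ef eg hx; apply: (phi_local hB hPhi (n := n)) => //; try exact: (L2_control he).
  by move=> r hr; rewrite /ctl ef.
by move=> r hr; rewrite /ctl eg.
Qed.

Lemma adapted_J n s y v f u g : 0 <= s -> B n y -> L2 f -> L2 g -> dot (tens u (E g)) (P s y v f) =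
  cexp (L2dot (after s g) (after s f) - L2dot (after s f) (after s f)) *
  dot (tens u (E (glue s g f))) (P s y v f).
Proof.
move=> s0 hy hf hg; have hgl := L2_glue he s hg hf.
rewrite !(J_mat hJ _ _ (lexx 0) s0 hy) // mulrCA; congr (_ * _).
  rewrite (phik_loc (lexx 0) s0 hg hf hgl hf (x := y) (n := n)) // => r /andP[_ rs].
  by rewrite /glue rs.
rewrite -cexpD; congr cexp; rewrite (L2dot_gluel s hg hf hf) (L2dot_split he s hg hf); ring.
Qed.

(** A conditional expectation: against vectors adapted at [s] with future [f], the operator at time
    [t] acts as the one at time [s] after the evolution from [s] to [t], with [f] on the left and
    [g] on the right. *)
Lemma cross_time n s t y x v v' f g : 0 <= s -> s <= t -> B n y -> B n x -> L2 f -> L2 g ->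
  dot (P s y v f) (J 0 t x (tens v' (E g))) = dot (P s y v f) (P s (phik s t f g x) v' g).
Proof.
move=> s0 st hy hx hf hg; apply: (adapted_ext (s := s) (f := f)) => // [u g' hg'|u g' hg'].
  exact: (adapted_J _ _ s0 hy).
have hgl := L2_glue he s hg' hf; have t0 := le_trans s0 st.
have cgl := L2_control he hgl; have cg := L2_control he hg.
have hph : B n (phik s t f g x) := phi_B hPhi (L2_control he hf) cg s0 st hx.
rewrite (J_mat hJ _ _ (lexx 0) t0 hx) // (J_mat hJ _ _ (lexx 0) s0 hph) //; congr (dot _ (lmul _ _) * _).
rewrite (phik_loc s0 st hf hg hgl hg (x := x) (n := n)) //.
  exact: (phi_flow hB hPhi cgl cg (lexx 0) s0 st hx).
by move=> r /andP[sr _]; rewrite /glue ltNge sr.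
Qed.

(** Altering [g] after [s] affects only the Fock inner product with [f] beyond [s]; the quotient is
    written as a product on each side. *)
Lemma cross_right n s y y' v v' f g g' : 0 <= s -> B n y -> B n y' -> L2 f -> L2 g -> L2 g' ->
  (forall r, r < s -> g r = g' r) ->
  cexp (L2dot f g) * dot (P s y v f) (P s y' v' g') =
  cexp (L2dot f g') * dot (P s y v f) (P s y' v' g).
Proof.
move=> s0 hy hy' hf hg hg' eg; rewrite -[LHS]dotZr -[RHS]dotZr.
apply: (adapted_ext (s := s) (f := f)) => // [u h hh|u h hh]; first exact: (adapted_J _ _ s0 hy).
have hgl := L2_glue he s hh hf.
have ep : phik 0 s (glue s h f) g' y' = phik 0 s (glue s h f) g y'.
  by apply: (phik_loc (n := n) (lexx 0) s0 hgl hg' hgl hg) => // r /andP[_ rs]; rewrite eg.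
have ee : L2dot f g + L2dot (glue s h f) g' = L2dot f g' + L2dot (glue s h f) g.
  rewrite (L2dot_split he s hf hg) (L2dot_split he s hf hg').
  rewrite (L2dot_gluel s hh hf hg) (L2dot_gluel s hh hf hg').
  have -> : before s g' = before s g by apply/funext => r; rewrite /before; case: ifP => // /eg ->.
  by rewrite addrACA [RHS]addrACA [X in _ = _ + X]addrC.
rewrite [LHS]dotZr [RHS]dotZr (J_mat hJ _ _ (lexx 0) s0 hy' hgl hg').
rewrite (J_mat hJ _ _ (lexx 0) s0 hy' hgl hg) ep.
move: (dot u _) => D; move: ee.
move: (L2dot f g) (L2dot (glue s h f) g') (L2dot f g') (L2dot (glue s h f) g) => a b c d0 ee.
exact: cexp_swap.
Qed.

Lemma cross_shift n s y y' v v' f f' g g' : 0 <= s -> B n y -> B n y' ->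
  L2 f -> L2 f' -> L2 g -> L2 g' ->
  (forall r, r < s -> f r = f' r) -> (forall r, r < s -> g r = g' r) ->
  cexp (L2dot f g) * dot (P s y v f') (P s y' v' g') =
  cexp (L2dot f' g') * dot (P s y v f) (P s y' v' g).
Proof.
move=> s0 hy hy' hf hf' hg hg' ef eg.
have h1 := cross_right v v' s0 hy hy' hf' hg hg' eg.
have h2 : cexp (L2dot f g) * dot (P s y v f') (P s y' v' g) =
    cexp (L2dot f' g) * dot (P s y v f) (P s y' v' g).
  have cr := cross_right v' v s0 hy' hy hg hf hf' ef.
  have cc (a b : R -> k) : L2 a -> L2 b -> cexp (L2dot b a) = Num.conj (cexp (L2dot a b)).
    by move=> ha hb; rewrite -(expv_dot hG ha hb) -(expv_dot hG hb ha) -dot_conj.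
  rewrite (dot_conj (P s y' v' g) (P s y v f')) (dot_conj (P s y' v' g) (P s y v f)) (cc _ _ hg hf) (cc _ _ hg hf').
  move: cr; move: (dot _ _) (dot _ _) (cexp _) (cexp _) => a b c d cr.
  by rewrite -!cjM cr.
apply: (mulfI (cexp_neq0 (L2dot f' g))).
move: h1 h2; move: (dot _ _) (dot _ _) (dot (P s y v f) _) (cexp _) (cexp _) (cexp _) => a b c d1 d2 d3 h1 h2.
by rewrite mulrCA h1 mulrCA h2 mulrCA.
Qed.

End Defect.

(** * The Ito product formula up to second order *)

Section ItoFormula.
Context (R : realType) (A : cstarType R).
Local Notation C := R[i].
Context (B : nat -> set A) (W : nat -> A) (hB : filtration B W).
Context (Phi : R -> R -> (R -> nat -> C) -> (R -> nat -> C) -> A -> A) (hPhi : evolution B W Phi).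
Implicit Types (x y : A).

Local Ltac inB := repeat first [assumption | apply: (BM hB) | apply: (BB hB) | apply: (BD hB)
  | apply: (BZ hB) | apply: (BN hB) | apply: (BS hB) | exact: (B1 hB)].

(** The commutators obey the Leibniz rule, and the dissipator obeys it up to the last sum, which is
    the Ito correction. *)
Lemma gint_mul n s t f g x y : B n x -> B n y -> gint W n s t f g (x ** y) =
  x ** gint W n s t f g y + gint W n s t f g x ** y +
  \sum_(l < n) (t - s)%:C *: (delta_dag W l.+1 x ** delta W l.+1 y).
Proof.
move=> hx hy; rewrite /gint /dissip !scalerA !scaler_sumr -!big_split /= amul_sumr amul_suml -!big_split /=.
apply: eq_bigr => l _; have h1 := BWn hB (ltn_ord l); have h2 := BS hB h1.
rewrite /delta !delta_dagE; set w := W l.+1 in h1 h2 *; set w' := star w in h1 h2 *.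
move: (ci s t (fun r => f r l)) (ci s t (fun r => g r l)) ((t - s)%:C) => a' b c; move: (Num.conj a') => a.
rewrite !(amulDl, amulDr, amulNl, amulNr, amulZl, amulZr) !mul_assoc.
apply: (B_inj hB (n := n)) => [||psi hp]; try by inB.
rewrite !(opD hp, opN hp, opZ hp) /GRing.scale /=.
by field.
Qed.

Lemma ito_sum (V : zmodType) (p S a b c d u v : V) :
  p - v - S = (p - u - (c + d + S)) - ((a - u - c) + (b - u - d) + (v - b - (a - u))).
Proof.
have -> : (a - u - c) + (b - u - d) + (v - b - (a - u)) = v - u - (c + d).
  rewrite [X in X + _]addrACA -opprD [a - u + (b - u)]addrA; move: (a - u) => m.
  rewrite -[v - b - m]addrA -opprD [b + m]addrC; move: (m + b) => w.
  by rewrite [LHS]addrC -[w - u - (c + d)]addrA addrA subrK addrA.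
move: (c + d) => q; rewrite [q + S]addrC opprD [- (v - u - q)]opprB opprB. 
by rewrite [p - u + _]addrA addrA subrK addrAC addrA [p - u + u]subrK.
Qed.

Lemma ito_estimate n f (T : R) : control f -> exists c : R, 0 <= c /\
  forall s t x, 0 <= s -> s <= t -> t <= T -> B n x ->
  nm (Phi s t f f (star x ** x) - star (Phi s t f f x) ** Phi s t f f x -
      \sum_(l < n) (t - s)%:C *: (star (delta W l.+1 x) ** delta W l.+1 x)) <=
  c * itg s t (rate n f f) ^+ 2 * nm x ^+ 2.
Proof.
move=> hf; have [M [M0 hM]] := phi_estimates hB hPhi n T hf hf.
(* One [M] for each of the three remainders of the evolution, and $M^2$ for the product of two
   first-order increments. *)
exists (3 * M + M ^+ 2); split; first by rewrite addr_ge0 ?mulr_ge0 ?sqr_ge0.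
move=> s t x s0 st tT hx; set eps := itg _ _ _; have hxs := BS hB hx; have hxx := BM hB hxs hx.
rewrite (phi_star hB hPhi hf hf s0 st hx).
have [_ _ r1] := hM s t _ s0 st tT hxx; have [_ a2 r2] := hM s t _ s0 st tT hxs.
have [_ a3 r3] := hM s t _ s0 st tT hx; rewrite -/eps in r1 a2 r2 a3 r3; rewrite nm_star in a2 r2.
have xx : nm (star x ** x) <= nm x ^+ 2 by apply: le_trans (nm_amul _ _) _; rewrite nm_star expr2.
set p1 := Phi _ _ _ _ _ in r1 *; set p2 := Phi _ _ _ _ (star x) in a2 r2 *; set p3 := Phi _ _ _ _ x in a3 r3 *.
set S := \sum_(l < n) _.
have eg : gint W n s t f f (star x ** x) = star x ** gint W n s t f f x + gint W n s t f f (star x) ** x + S.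
  by rewrite gint_mul //; congr (_ + _); apply: eq_bigr => l _; rewrite -star_delta.
rewrite eg in r1; set g2 := gint _ _ _ _ _ _ (star x) in r1 r2 *; set g3 := gint _ _ _ _ _ _ x in r1 r3 *.
have -> : p1 - p2 ** p3 - S = (p1 - star x ** x - (star x ** g3 + g2 ** x + S)) -
    (star x ** (p3 - x - g3) + (p2 - star x - g2) ** x + (p2 - star x) ** (p3 - x)).
  by rewrite !(amulBl, amulBr) -ito_sum.
have n1 : nm (star x ** (p3 - x - g3)) <= M * eps ^+ 2 * nm x ^+ 2.
  apply: le_trans (nm_amul _ _) _; rewrite nm_star.
  by apply: le_trans (ler_wpM2l (nm_ge0 x) r3) _; rewrite mulrCA -expr2.
have n2 : nm ((p2 - star x - g2) ** x) <= M * eps ^+ 2 * nm x ^+ 2.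
  apply: le_trans (nm_amul _ _) _.
  by apply: le_trans (ler_wpM2r (nm_ge0 x) r2) _; rewrite -[leLHS]mulrA -expr2.
have n3 : nm ((p2 - star x) ** (p3 - x)) <= M ^+ 2 * eps ^+ 2 * nm x ^+ 2.
  apply: le_trans (nm_amul _ _) _; apply: le_trans (ler_pM (nm_ge0 _) (nm_ge0 _) a2 a3) _.
  by rewrite le_eqVlt; apply/orP; left; apply/eqP; ring.
have n0 : M * eps ^+ 2 * nm (star x ** x) <= M * eps ^+ 2 * nm x ^+ 2.
  by rewrite ler_wpM2l // mulr_ge0 // sqr_ge0.
apply: le_trans (nmB _ _) _; apply: le_trans (lerD r1 (nmD _ _)) _.
apply: le_trans (lerD n0 (lerD (nmD _ _) (lexx _))) _.
apply: le_trans (lerD (lexx _) (lerD (lerD n1 n2) n3)) _.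
by rewrite le_eqVlt; apply/orP; left; apply/eqP; ring.
Qed.

End ItoFormula.

Lemma cexp_conj (R : realType) (z : R[i]) : Num.conj (cexp z) = cexp (Num.conj z).
Proof.
apply/esym/cexp_unique; apply: to_ev (to_conj (cexp_to z)); exists 0%N => m _.
rewrite /psum cj_sum; apply: eq_bigr => i _.
by rewrite fmorph_div /= -[Num.conj (z ^+ i)]/(Num.conj _) cjX rmorph_nat.
Qed.

Section MultiplicationDefect.
Context (R : realType) (A : cstarType R) (tr : A -> R[i]) (htr : is_trace tr)
  (H : hilbertType R) (Lam : A -> H) (lmul : A -> H -> H) (hH : is_gns tr Lam lmul)
  (k : hilbertType R) (e : nat -> k) (he : is_onb e)
  (G : hilbertType R) (pow : nat -> (R -> k) -> G) (hG : is_sym_fock pow)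
  (K : hilbertType R) (tens : H -> G -> K) (hK : is_tensor tens)
  (B : nat -> set A) (W : nat -> A) (hB : filtration B W).
Local Notation C := R[i].
Context (Phi : R -> R -> (R -> nat -> C) -> (R -> nat -> C) -> A -> A) (hPhi : evolution B W Phi).
Local Notation phik := (flow e Phi).
Context (J : R -> R -> A -> K -> K) (hJ : flow_ops lmul e pow tens B Phi J).
Context (n : nat) (v : H) (f : R -> k) (hf : L2 f).
Local Notation E g := (expv pow g).
Local Notation P s y := (J 0 s y (tens v (E f))).
Implicit Types (x y : A) (s t : R).

(* [branch s t y l.+1 - P s y] approximates the part of [J 0 t y] with one quantum created in
   the direction [e l.+1] during [s, t]; these parts are orthogonal to each other and to [P s y]. *)
Definition branch s t y i : K :=
  cexp (- Num.conj (comp (coef e s t f) i)) *: J 0 s y (tens v (E (cadd e s t f i))).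

Lemma branch0 s t y : branch s t y 0 = P s y.
Proof. by rewrite /branch /= cj0 oppr0 cexp0 scale1r. Qed.

Lemma shift_dot s t y y' i j : 0 <= s -> s <= t -> B n y -> B n y' ->
  dot (J 0 s y (tens v (E (cadd e s t f i)))) (J 0 s y' (tens v (E (cadd e s t f j)))) =
  cexp (step_exp (t - s) (coef e s t f) (coef e s t f) i j) * dot (P s y) (P s y').
Proof.
move=> s0 st hy hy'; have hc l := L2_cadd he s t l hf.
have ec l r : r < s -> f r = cadd e s t f l r by move=> rs; rewrite cadd_out // leNgt rs.
have := cross_shift he hG hK hB hPhi hJ v v s0 hy hy' hf (hc i) hf (hc j) (ec i) (ec j).
rewrite (L2dot_cadd he i j hf hf s0 st).
have := cexpD (L2dot f f) (step_exp (t - s) (coef e s t f) (coef e s t f) i j).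
move: (cexp (_ + _)) => ce ->; have := cexp_neq0 (L2dot f f).
move: (dot _ _) (dot (P s y) _) (cexp _) (cexp _) => a b c d c0 h.
by apply: (mulfI c0); rewrite h mulrA.
Qed.

(** The prefactor of [branch] cancels the coefficients of [f] in [step_exp]; only the diagonal term
    $h = t - s$ remains, whence the factor $e^h - 1$ in the squared norms of the one-quantum
    parts. *)
Lemma branch_dot s t y y' i j : 0 <= s -> s <= t -> B n y -> B n y' ->
  dot (branch s t y i) (branch s t y' j) =
  cexp (((0 < i)%N && (i == j))%:R * (t - s)%:C) * dot (P s y) (P s y').
Proof.
move=> s0 st hy hy'; rewrite /branch dotZl dotZr (shift_dot i j s0 st hy hy') cexp_conj; apply: cexp_mul3.
rewrite /step_exp cjN cjK; move: (comp _ _) (Num.conj _) (_%:R * _) => a b c.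
by rewrite -opprD addKr.
Qed.

(** The prefactor cancels once more, and the added quantum survives only in the left control of the
    evolution, where its first-order effect is $h\,\delta_l$ ([gint_cadd]). *)
Lemma branch_final s t x y i : 0 <= s -> s <= t -> B n x -> B n y ->
  dot (branch s t y i) (P t x) = dot (P s y) (P s (phik s t (cadd e s t f i) f x)).
Proof.
move=> s0 st hx hy; have hc := L2_cadd he s t i hf.
have hp : B n (phik s t (cadd e s t f i) f x).
  exact: (phi_B hPhi (L2_control he hc) (L2_control he hf) s0 st hx).
rewrite /branch dotZl (cross_time he hG hK hB hPhi hJ v v s0 st hy hx hc hf).
have es : step_exp (t - s) (coef e s t f) (coef e s t f) i 0 = comp (coef e s t f) i.
  by rewrite /step_exp /= cj0 addr0; case: (i) => [|l] /=; rewrite mul0r addr0.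
have h : dot (J 0 s y (tens v (E (cadd e s t f i)))) (P s (phik s t (cadd e s t f i) f x)) =
    cexp (comp (coef e s t f) i) * dot (P s y) (P s (phik s t (cadd e s t f i) f x)).
  by rewrite -es; exact: (shift_dot i 0 s0 st hy hp).
by rewrite h cexp_conj cjN cjK mulrA -cexpD addNr cexp0 mul1r.
Qed.

Lemma nm_P s y : 0 <= s -> nm (P s y) <= nm y * nm (tens v (E f)).
Proof. by move=> s0; exact: (J_nm hJ _ _ (lexx 0) s0). Qed.

(** The diagonal value of [defect] at $x$ and $v \otimes e(f)$, as a real number; it vanishes
    exactly when $J_s$ preserves the inner product there. *)
Definition mul_defect s x : R :=
  complex.Re (dot (tens v (E f)) (P s (star x ** x))) - nm (P s x) ^+ 2.
Local Notation mdefect := mul_defect.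

Lemma mdefect_ge0 s x : 0 <= s -> B n x -> 0 <= mdefect s x.
Proof.
move=> s0 hx; have := defect_psd htr hH he hG hK hB hPhi hJ s0 (n := n).
move=> /(_ [:: (1, exist _ (x, v, f) (conj hx hf))]); rewrite /form !big_seq1 /= cj1 !mul1r.
rewrite /defect /kk /jvec /= dotxx.
rewrite -(J_mat hJ v v (lexx 0) s0 (BM hB (BS hB hx) hx) hf hf).
by rewrite lecE /= => /andP[_]; rewrite /mul_defect; case: (dot _ _).
Qed.

End MultiplicationDefect.

Lemma nmB_sqr (R : realType) (H : hilbertType R) (x y : H) :
  nm (x - y) ^+ 2 = nm x ^+ 2 - 2 * complex.Re (dot y x) + nm y ^+ 2.
Proof.
have := congr1 (@complex.Re R) (dotxx (x - y)); rewrite /= => <-.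
rewrite dotBr !dotBl !dotxx [dot x y]dot_conj; case: (dot y x) => a b /=; ring.
Qed.

Section DefectStep.
Context (R : realType) (A : cstarType R) (tr : A -> R[i]) (htr : is_trace tr)
  (H : hilbertType R) (Lam : A -> H) (lmul : A -> H -> H) (hH : is_gns tr Lam lmul)
  (k : hilbertType R) (e : nat -> k) (he : is_onb e)
  (G : hilbertType R) (pow : nat -> (R -> k) -> G) (hG : is_sym_fock pow)
  (K : hilbertType R) (tens : H -> G -> K) (hK : is_tensor tens)
  (B : nat -> set A) (W : nat -> A) (hB : filtration B W).
Local Notation C := R[i].
Context (Phi : R -> R -> (R -> nat -> C) -> (R -> nat -> C) -> A -> A) (hPhi : evolution B W Phi).
Local Notation phik := (flow e Phi).
Context (J : R -> R -> A -> K -> K) (hJ : flow_ops lmul e pow tens B Phi J).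
Context (n : nat) (v : H) (f : R -> k) (hf : L2 f).
Local Notation E g := (expv pow g).
Local Notation P s y := (J 0 s y (tens v (E f))).
Implicit Types (x y : A) (s t : R).
Local Notation mdefect := (mul_defect pow tens J v f).
Local Notation branch := (branch e pow tens J v f).

Lemma gint_cadd s t (l : 'I_n) x : 0 <= s -> s <= t ->
  gint W n s t (ctl e (cadd e s t f l.+1)) (ctl e f) x - gint W n s t (ctl e f) (ctl e f) x =
  (t - s)%:C *: delta W l.+1 x.
Proof.
move=> s0 st; rewrite /gint opprD addrACA subrr add0r -sumrB.
have ec m : ci s t (fun r => ctl e (cadd e s t f l.+1) r m) - ci s t (fun r => ctl e f r m) =
    (m == l)%:R * (t - s)%:C.
  have c1 := control_cg m t (L2_control he (L2_cadd he s t l.+1 hf)) s0.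
  rewrite -ciB //; last by apply: control_cg => //; exact: (L2_control he).
  rewrite (eq_ci_o (h' := fun=> (m == l)%:R)) => [|||r hr].
  - rewrite /ci /cintegral -![\int[_]_(_ in _) _]/(itg _ _ _) !itg_cst //.
    by case: eqP => _; rewrite ?mul1r ?mul0r.
  - by apply: cgB => //; apply: control_cg => //; exact: (L2_control he).
  - exact/cbm_cg/cbm_cst.
  - by rewrite /ctl /cadd /ind hr dotDr addrAC subrr add0r (onb_dot he).
transitivity (\sum_(m < n) ((m == l)%:R * (t - s)%:C) *: delta W m.+1 x).
  apply: eq_bigr => m _; rewrite opprD addrACA subrr addr0 -scalerBl -cjB ec.
  by rewrite cjM cjR rmorph_nat.
rewrite (bigD1 l) //= big1 ?addr0 => [|m ml]; first by rewrite eqxx mul1r.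
by rewrite (negbTE ml) mul0r scale0r.
Qed.

(** The summands are orthogonal, and $e^h - 1 \le h + h^2$ for $0 \le h \le 1$. *)
Lemma branch_sum_nm s t a (b : 'I_n -> A) : 0 <= s -> s <= t -> B n a -> (forall l, B n (b l)) ->
  t - s <= 1 ->
  nm (P s a + \sum_(l < n) (branch s t (b l) l.+1 - P s (b l))) ^+ 2 <=
  nm (P s a) ^+ 2 + (t - s + (t - s) ^+ 2) * \sum_(l < n) nm (P s (b l)) ^+ 2.
Proof.
move=> s0 st ha hb h1; set xi := fun l : 'I_n => branch s t (b l) l.+1 - P s (b l).
have bd := branch_dot he hG hK hB hPhi hJ (n := n) v hf _ _ s0 st.
have b0 y : branch s t y 0 = P s y := branch0 e pow tens J v f s t y.
have a0 l : dot (P s a) (xi l) = 0.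
  rewrite /xi dotBr -!b0 !bd //= mul0r cexp0 !mul1r; exact: subrr.
have x0 l : dot (xi l) (P s a) = 0 by rewrite dot_conj a0 cj0.
have xx l m : dot (xi l) (xi m) = if l == m then (cexp (t - s)%:C - 1) * (nm (P s (b l)) ^+ 2)%:C else 0.
  rewrite /xi dotBr !dotBl -!b0 !bd //= eqSS !mul0r cexp0 !mul1r subrr subr0 val_eqE -dotxx !b0.
  case: eqP => [->|_]; first by rewrite mul1r mulrBl mul1r.
  by rewrite mul0r cexp0 mul1r subrr.
have ds : dot (\sum_l xi l) (\sum_l xi l) = (cexp (t - s)%:C - 1) * (\sum_l nm (P s (b l)) ^+ 2)%:C.
  rewrite dot_suml rmorph_sum mulr_sumr; apply: eq_bigr => l _; rewrite dot_sumr (bigD1 l) //=.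
  by rewrite xx eqxx big1 ?addr0 // => m ml; rewrite xx eq_sym (negbTE ml).
have h0 : 0 <= t - s by rewrite subr_ge0.
have hs := cexp_small (z := (t - s)%:C); rewrite nm_real ger0_norm // in hs.
have hr := le_trans (nm_Re_le _) (hs h1).
have := congr1 (@complex.Re R) (dotxx (P s a + \sum_l xi l)); rewrite /= => <-.
rewrite dotDl !dotDr dot_sumr big1 ?addr0 => [|l _]; last exact: a0.
rewrite dot_suml big1 ?add0r => [|l _]; last exact: x0.
rewrite ds dotxx; set S := \sum_l _; have S0 : 0 <= S by apply: sumr_ge0 => l _; exact: sqr_ge0.
rewrite raddfD /= lerD2l; move: hr; case: (cexp _) => u w /= hr.
rewrite mulr0 subr0 ler_wpM2r //; rewrite ?subr0 ?addr0 in hr *; lra.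
Qed.

Lemma P_linx s : 0 <= s -> lin (fun y => P s y).
Proof. by move=> s0 a x y; exact: (J_linx hJ _ (lexx 0) s0). Qed.

Lemma vacuum_time s t x : 0 <= s -> s <= t -> B n x ->
  dot (tens v (E f)) (P t x) = dot (tens v (E f)) (P s (phik s t f f x)).
Proof.
move=> s0 st hx; have := cross_time he hG hK hB hPhi hJ v v s0 st (B1 hB n) hx hf hf.
by rewrite (J_one htr hH he hG hK hB hPhi hJ).
Qed.

(* [zeta = P t x] is compared with [eta], the sum of [P s (phik s t f f x)] and of the one-quantum
   parts of the [delta W l.+1 x], through [nm zeta ^+ 2 >= 2 * Re (dot eta zeta) - nm eta ^+ 2]. *)
Lemma defect_step T : exists c (w : R -> R), [/\ 0 <= c, forall r, 1 <= w r,
  forall a b, 0 <= a -> sqi a b w &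
  forall s t x, 0 <= s -> s <= t -> t <= T -> B n x -> let eps := itg s t w in eps <= 1 ->
  [/\ nm (phik s t f f x) <= (1 + c * eps) * nm x, t - s <= eps &
    mdefect t x <= mdefect s (phik s t f f x) + (t - s) * \sum_(l < n) mdefect s (delta W l.+1 x) +
      c * eps ^+ 2 * nm x ^+ 2]].
Proof.
(* The quantum is added on all of $[0,T)$, so that neither these controls nor the weight [w] depend
   on [s] and [t]; on $[s,t)$ they agree with the controls of the branches. *)
pose F (l : 'I_n) := cadd e 0 T f l.+1; have hF l : L2 (F l) := L2_cadd he 0 T l.+1 hf.
have cf := L2_control he hf; have cF l := L2_control he (hF l).
have [M [M0 hM]] := phi_estimates hB hPhi n T cf cf.
have /choice[M' hM'] := fun l : 'I_n => phi_estimates hB hPhi n T (cF l) cf.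
have [c1 [c10 hc1]] := ito_estimate hB hPhi n T cf.
pose MM := M + \sum_l M' l; have MM0 : 0 <= MM by rewrite addr_ge0 // sumr_ge0 // => l _; case: (hM' l).
pose w1 := \sum_(l < n) nm (W l.+1); pose w2 := \sum_(l < n) nm (W l.+1) ^+ 2.
have w10 : 0 <= w1 by apply: sumr_ge0 => l _; exact: nm_ge0.
have w20 : 0 <= w2 by apply: sumr_ge0 => l _; exact: sqr_ge0.
pose N := nm (tens v (E f)); have N0 : 0 <= N := nm_ge0 _.
pose w r := rate n (ctl e f) (ctl e f) r + \sum_l rate n (ctl e (F l)) (ctl e f) r.
have wge r : 0 <= \sum_l rate n (ctl e (F l)) (ctl e f) r.
  by apply: sumr_ge0 => l _; apply: le_trans (rate_ge1 _ _ _ _).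
have w1' r : 1 <= w r.
  by apply: le_trans (rate_ge1 n (ctl e f) (ctl e f) r) _; rewrite /w lerDl.
have wF l r : rate n (ctl e (F l)) (ctl e f) r <= w r.
  rewrite /w (bigD1 l) //= addrCA lerDl addr_ge0 //.
    by apply: le_trans (rate_ge1 _ _ _ _).
  by apply: sumr_ge0 => m _; apply: le_trans (rate_ge1 _ _ _ _).
have sw a b : 0 <= a -> sqi a b w.
  by move=> a0; apply: sqiD; [exact: rate_sqi|apply: sqi_sum => l; exact: rate_sqi].
(* In this order: growth of the evolution, Ito remainder, error in the pairing of [eta] with
   [P t x], and the term $h^2$ of [branch_sum_nm]. *)
pose c := M + c1 * N ^+ 2 + 8 * MM * w1 * N ^+ 2 + 4 * w2 * N ^+ 2.
have N2 : 0 <= N ^+ 2 := sqr_ge0 N.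
exists c, w; split => //; first by rewrite !addr_ge0 // !mulr_ge0 // ?mulr_ge0.
move=> s t x s0 st tT hx eps e1; have iw : intg s t w by apply: sqi_intg; exact: sw.
have t0 := le_trans s0 st.
have eps0 : 0 <= eps by apply: itg_ge0 => r _; apply: le_trans (w1' r).
have re (f' g' : R -> nat -> C) : control f' -> control g' -> (forall r, rate n f' g' r <= w r) ->
    0 <= itg s t (rate n f' g') /\ itg s t (rate n f' g') <= eps.
  move=> cf' cg' h; split.
    by apply: itg_ge0 => r _; apply: le_trans (rate_ge1 _ _ _ _).
  by apply: itg_le => //; apply: sqi_intg; exact: rate_sqi.
have sq (a : R) : 0 <= a /\ a <= eps -> a ^+ 2 <= eps ^+ 2.
  by move=> [a0 ae]; rewrite ler_pXn2r ?nnegrE.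
have rf := re _ _ cf cf (fun r => ltac:(by rewrite /w lerDl)).
have rF l := re _ _ (cF l) cf (wF l).
have he' : t - s <= eps.
  by rewrite -[leLHS]mul1r -itg_cst //; apply: itg_le => //; exact: intg_cst.
have h0 : 0 <= t - s by rewrite subr_ge0.
set x' := phik s t f f x; have hx' : B n x' by exact: (phi_B hPhi cf cf s0 st hx).
have hd (l : 'I_n) : B n (delta W l.+1 x) by exact: (delta_B hB).
have [_ m2 m3] := hM s t x s0 st tT hx.
have X0 := nm_ge0 x.
split => //.
  have := nmD (x' - x) x; rewrite subrK => h; apply: le_trans h _.
  have : M * itg s t (rate n (ctl e f) (ctl e f)) * nm x <= c * eps * nm x.
    rewrite ler_wpM2r //; apply: ler_pM => //; try by case: rf.
    by rewrite /c -!addrA lerDl !addr_ge0 // !mulr_ge0 // ?mulr_ge0.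
  by move: m2; rewrite -/x' => a1 a2; lra.
pose rho (l : 'I_n) := phik s t (cadd e s t f l.+1) f x - x'.
have hphl (l : 'I_n) : phik s t (cadd e s t f l.+1) f x = phik s t (F l) f x.
  apply: (phik_loc he hB hPhi (n := n)) => //; first exact: (L2_cadd he).
  by move=> r /andP[sr rt]; rewrite /F /cadd /ind sr rt (le_trans s0 sr) (lt_le_trans rt tT).
have hph (l : 'I_n) : B n (phik s t (cadd e s t f l.+1) f x).
  by rewrite hphl; exact: (phi_B hPhi (cF l) cf s0 st hx).
(* [rho l] is a difference of two evolutions, whose first-order parts differ by $h\,\delta_l(x)$;
   the two second-order remainders are left. *)
have rhoB (l : 'I_n) : nm (rho l - (t - s)%:C *: delta W l.+1 x) <= MM * eps ^+ 2 * nm x.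
  have [_ _ m4] := (hM' l).2 s t x s0 st tT hx.
  have eg : gint W n s t (ctl e (F l)) (ctl e f) x = gint W n s t (ctl e (cadd e s t f l.+1)) (ctl e f) x.
    rewrite /gint; congr (_ + _); apply: eq_bigr => m _; congr (Num.conj _ *: _ + _).
    apply: eq_ci_o; [exact: control_cg|apply: control_cg => //; exact/(L2_control he)/(L2_cadd he)|].
    by move=> r /andP[sr rt]; rewrite /ctl /F /cadd /ind sr rt (le_trans s0 sr) (lt_le_trans rt tT).
  rewrite eg in m4; rewrite -(gint_cadd l x s0 st) /rho hphl.
  set g1 := gint _ _ _ _ _ _ _ in m4 *; set g2 := gint _ _ _ _ _ _ _ in m3 *.
  have -> : phik s t (F l) f x - x' - (g1 - g2) = (phik s t (F l) f x - x - g1) - (x' - x - g2).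
    move: (phik s t (F l) f x) => p.
    rewrite [p - x - g1]addrAC [x' - x - g2]addrAC [- (x' - g2 - x)]opprB [RHS]addrA subrK.
    by rewrite !opprB [g2 - g1]addrC addrACA [- x' + g2]addrC.
  apply: le_trans (nmB _ _) _; apply: le_trans (lerD m4 m3) _; rewrite -mulrDl ler_wpM2r //.
  apply: le_trans (lerD (ler_wpM2l _ (sq _ (rF l))) (ler_wpM2l _ (sq _ rf))) _ => //; first by case: (hM' l).
  rewrite -mulrDl ler_wpM2r ?sqr_ge0 // /MM (bigD1 l) //= [M' l + M]addrC addrA lerDl sumr_ge0 // => m _.
  by case: (hM' m).
pose b (l : 'I_n) := delta W l.+1 x.
pose eta := P s x' + \sum_(l < n) (branch s t (b l) l.+1 - P s (b l)).
have k1 := branch_sum_nm s0 st hx' hd (le_trans he' e1); rewrite -/eta in k1.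
pose S1 := \sum_(l < n) complex.Re (dot (tens v (E f)) (P s (star (b l) ** b l))).
set S2 := \sum_(l < n) nm (P s _) ^+ 2 in k1.
pose S3 := \sum_(l < n) nm (P s (b l)).
have bd i y (hy : B n y) := branch_final he hG hK hB hPhi hJ v hf i s0 st hx hy.
have b0 y : branch s t y 0 = P s y := branch0 e pow tens J v f s t y.
(* By [branch_final], the pairing of a one-quantum part with [P t x] is a pairing with
   [P s (rho l)]. *)
have ez : dot eta (P t x) = (nm (P s x') ^+ 2)%:C + \sum_(l < n) dot (P s (b l)) (P s (rho l)).
  rewrite /eta dotDl dot_suml -dotxx -{1}b0 bd //; congr (_ + _); apply: eq_bigr => l _.
  have e0 := bd 0%N (b l) (hd l); rewrite b0 in e0.
  rewrite dotBl (bd _ _ (hd l)) e0 -dotBr; congr dot.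
  by rewrite -(opB (P_linx s0)).
have k2 : nm (P s x') ^+ 2 + (t - s) * S2 - MM * eps ^+ 2 * nm x * N * S3 <= complex.Re (dot eta (P t x)).
  rewrite ez raddfD /= -addrA lerD2l raddf_sum mulr_sumr mulr_sumr -sumrB; apply: ler_sum => l _.
  have er : P s (rho l) = P s (rho l - (t - s)%:C *: b l) + (t - s)%:C *: P s (b l).
    by rewrite -(opZ (P_linx s0)) -(opD (P_linx s0)) subrK.
  rewrite er dotDr dotZr dotxx.
  have eR (z : C) (u r : R) : complex.Re (z + u%:C * r%:C) = complex.Re z + u * r.
    by case: z => z1 z2 /=; ring.
  rewrite -[leRHS]/(complex.Re _) eR addrC lerD2r.
  have := nm_Re_le (- dot (P s (b l)) (P s (rho l - (t - s)%:C *: b l))).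
  rewrite raddfN nmN /= => h; rewrite lerNl; apply: le_trans h _; apply: le_trans (CS _ _) _.
  rewrite mulrC ler_wpM2r ?nm_ge0 //; apply: le_trans (nm_P hJ v f _ s0) _.
  by rewrite ler_wpM2r //; exact: rhoB.
have k3 : complex.Re (dot (tens v (E f)) (P t (star x ** x))) <=
    complex.Re (dot (tens v (E f)) (P s (star x' ** x'))) + (t - s) * S1 + c1 * eps ^+ 2 * nm x ^+ 2 * N ^+ 2.
  rewrite (vacuum_time s0 st (BM hB (BS hB hx) hx)).
  set q := \sum_(l < n) (t - s)%:C *: (star (b l) ** b l).
  set p := phik s t f f (star x ** x); have hi : nm (p - star x' ** x' - q) <=
      c1 * itg s t (rate n (ctl e f) (ctl e f)) ^+ 2 * nm x ^+ 2 := hc1 s t x s0 st tT hx.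
  pose rr := p - star x' ** x' - q; rewrite -/rr in hi.
  have -> : p = (star x' ** x' + q) + rr by rewrite /rr -[p - _ - q]addrA -opprD [RHS]addrC subrK.
  clearbody rr.
  rewrite !(opD (P_linx s0)) !dotDr !raddfD /=; apply: lerD; first rewrite lerD2l.
    rewrite /q (op_sum (P_linx s0)) dot_sumr raddf_sum /S1 mulr_sumr; apply: ler_sum => l _.
    by rewrite (opZ (P_linx s0)) dotZr; case: (dot _ _) => u z /=; rewrite mul0r subr0.
  apply: le_trans (nm_Re_le _) _; apply: le_trans (CS _ _) _; rewrite mulrC.
  apply: le_trans (ler_wpM2r (nm_ge0 _) (nm_P hJ v f _ s0)) _; rewrite -[leLHS]mulrA -expr2 ler_wpM2r ?sqr_ge0 //.
  apply: le_trans hi _; rewrite ler_wpM2r ?sqr_ge0 // ler_wpM2l //; exact: sq.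
have := sqr_ge0 (nm (P t x - eta)); rewrite nmB_sqr => k4.
have bl (l : 'I_n) : nm (P s (b l)) <= 2 * nm (W l.+1) * nm x * N.
  by apply: le_trans (nm_P hJ v f _ s0) _; rewrite ler_wpM2r //; exact: nm_delta.
have k5 : S3 <= 2 * w1 * nm x * N.
  by rewrite /S3 /w1 mulr_sumr mulr_suml mulr_suml; apply: ler_sum => l _; exact: bl.
have k6 : S2 <= 4 * w2 * nm x ^+ 2 * N ^+ 2.
  rewrite /S2 /w2 mulr_sumr mulr_suml mulr_suml; apply: ler_sum => l _.
  apply: le_trans (_ : (2 * nm (W l.+1) * nm x * N) ^+ 2 <= _); last first.
    by rewrite le_eqVlt; apply/orP; left; apply/eqP; ring.
  by rewrite ler_pXn2r ?nnegrE ?nm_ge0 ?bl // !mulr_ge0 // nm_ge0.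
have eS : \sum_(l < n) mdefect s (delta W l.+1 x) = S1 - S2 by rewrite -sumrB.
rewrite eS /mul_defect; set e2 := eps ^+ 2 in k2 k3 *.
have k7 : MM * e2 * nm x * N * S3 <= 2 * MM * w1 * N ^+ 2 * e2 * nm x ^+ 2.
  apply: le_trans (ler_wpM2l _ k5) _; first by rewrite !mulr_ge0 // sqr_ge0.
  by rewrite le_eqVlt; apply/orP; left; apply/eqP; ring.
have k8 : (t - s) ^+ 2 * S2 <= 4 * w2 * N ^+ 2 * e2 * nm x ^+ 2.
  apply: le_trans (ler_pM _ _ (sq _ (conj h0 he')) k6) _; rewrite ?sqr_ge0 //.
    by apply: sumr_ge0 => l _; exact: sqr_ge0.
  by rewrite le_eqVlt; apply/orP; left; apply/eqP; rewrite -/e2; ring.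
have k9 : 0 <= M * e2 * nm x ^+ 2 by rewrite !mulr_ge0 ?sqr_ge0.
have k10 : 0 <= MM * w1 * N ^+ 2 * e2 * nm x ^+ 2 by rewrite !mulr_ge0 ?sqr_ge0.
have ec : c * e2 * nm x ^+ 2 = M * e2 * nm x ^+ 2 + c1 * e2 * nm x ^+ 2 * N ^+ 2 +
    8 * (MM * w1 * N ^+ 2 * e2 * nm x ^+ 2) + 4 * w2 * N ^+ 2 * e2 * nm x ^+ 2.
  by rewrite /c; ring.
rewrite ec.
move: k1 k2 k3 k4 k7 k8 k9 k10; rewrite [(t - s + _) * S2]mulrDl mulrBr.
have -> : 2 * MM * w1 * N ^+ 2 * e2 * nm x ^+ 2 = 2 * (MM * w1 * N ^+ 2 * e2 * nm x ^+ 2) by ring.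
move: (MM * e2 * nm x * N * S3) ((t - s) ^+ 2 * S2) (4 * w2 * _ * _ * _) (MM * w1 * _ * _ * _) (M * e2 * _) (c1 * _ * _ * _).
move: ((t - s) * S2) ((t - s) * S1) (dot eta (P t x)) (dot (tens v (E f)) (P t (star x ** x)))
  (dot (tens v (E f)) (P s (star x' ** x'))) => a1 a2 [z1 z1'] [z2 z2'] [z3 z3'] /=.
move: (nm (P s x') ^+ 2) (nm eta ^+ 2) (nm (P t x) ^+ 2) => *; lra.
Qed.

Lemma vacuum_op0 x (y : H) : B n x -> J 0 0 x (tens y (E f)) = tens (lmul x y) (E f).
Proof.
move=> hx; apply: (K_ext he hG hK) => u g hg.
rewrite (J_mat hJ u y (lexx 0) (lexx 0) hx hg hf) (tens_dot hK) (expv_dot hG) //.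
by rewrite /flow (phi_id hB hPhi (L2_control he hg) (L2_control he hf) (lexx 0) hx).
Qed.

Lemma mdefect0 x : B n x -> mdefect 0 x = 0.
Proof.
move=> hx; rewrite /mul_defect !vacuum_op0 //; last exact: (BM hB (BS hB hx)).
have -> : lmul (star x ** x) v = lmul (star x) (lmul x v) by rewrite (lmulM htr hH).
rewrite (tens_dot hK) -{1}[x](star_invol) -(lmul_star htr hH) star_invol -(tens_dot hK).
by rewrite dotxx /= subrr.
Qed.

(** [defect_step] involves the defects of other elements of the box, so the induction along the grid
    carries a bound for all [y], quadratic in [nm y]. Its constant is a multiple of $\sum_j
    \epsilon_j^2$ and vanishes with the mesh. *)
Lemma mdefect_zero t x : 0 <= t -> B n x -> mdefect t x = 0.
Proof.
move=> t0 hx; have [c [w [c0 w1 sw hstep]]] := defect_step t.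
have iw a b : 0 <= a -> intg a b w by move=> a0; apply: sqi_intg; exact: sw.
pose eps m j := itg (grid 0 t m j) (grid 0 t m j.+1) w.
pose q := itg 0 t (fun r => w r ^+ 2).
have gs m j : 0 <= grid 0 t m j := grid_ge m j t0.
have eps0 m j : 0 <= eps m j by apply: itg_ge0 => r _; apply: le_trans (w1 r).
have sum2 m : \sum_(i < m.+1) eps m i ^+ 2 <= (t - 0) / m.+1%:R * q.
  by apply: grid_sqr_sum => //; exact: sw.
have one m (j : 'I_m.+1) : eps m j ^+ 2 <= (t - 0) / m.+1%:R * q.
  apply: le_trans (sum2 m); rewrite (bigD1 j) //= lerDl; apply: sumr_ge0 => i _; exact: sqr_ge0.
have q0 : 0 <= q by apply: itg_ge0 => r _; exact: sqr_ge0.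
pose w2 := 4 * \sum_(l < n) nm (W l.+1) ^+ 2.
have w20 : 0 <= w2 by rewrite mulr_ge0 // sumr_ge0 // => l _; exact: sqr_ge0.
(* Chosen so that $(1 + c\epsilon)^2 + w_2\epsilon \le 1 + c'\epsilon \le e^{c'\epsilon}$ for $0 \le
   \epsilon \le 1$; here $w_2\|y\|^2$ bounds $\sum_l \|\delta_l(y)\|^2$. *)
pose c' := 2 * c + c ^+ 2 + w2.
have c'0 : 0 <= c' by rewrite !addr_ge0 // ?mulr_ge0 // sqr_ge0.
pose Q := expR (c' * itg 0 t w).
have main m : (t - 0) / m.+1%:R * q <= 1 -> mdefect t x <= c * Q * nm x ^+ 2 * ((t - 0) / m.+1%:R * q).
  move=> small; have e1 (j : 'I_m.+1) : eps m j <= 1.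
    by rewrite -(@ler_pXn2r _ 2) ?nnegrE // expr1n; apply: le_trans (one m j) small.
  have it j : (j <= m.+1)%N -> forall y, B n y -> mdefect (grid 0 t m j) y <=
      c * expR (c' * \sum_(i < j) eps m i) * (\sum_(i < j) eps m i ^+ 2) * nm y ^+ 2.
    elim: j => [|j IH] jm y hy; first by rewrite grid0 mdefect0 // !big_ord0 !mulr0 mul0r.
    have := hstep _ _ y (gs m j) (grid_le m j t0) (grid_leT t0 jm) hy (e1 (Ordinal jm)).
    rewrite -/(eps m j) => -[h1 h2 h3]; have {}IH := IH (ltnW jm).
    set y' := phik _ _ _ _ _ in h1 h3; set h := grid 0 t m j.+1 - _ in h2 h3.
    have hh : 0 <= h by rewrite subr_ge0 grid_le.
    have hy' : B n y' by exact: (phi_B hPhi (L2_control he hf) (L2_control he hf) (gs m j) (grid_le m j t0) hy).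
    set Z := c * _ * _ in IH; set ep := eps m j in h1 h2 h3.
    have ep0 : 0 <= ep := eps0 m j; have ep1 : ep <= 1 := e1 (Ordinal jm).
    have Z0 : 0 <= Z by rewrite !mulr_ge0 ?expR_ge0 ?sumr_ge0 // => i _; exact: sqr_ge0.
    have Y0 := sqr_ge0 (nm y).
    have i1 : mdefect (grid 0 t m j) y' <= Z * ((1 + c * ep) ^+ 2 * nm y ^+ 2).
      apply: le_trans (IH _ hy') _; rewrite ler_wpM2l // -exprMn ler_pXn2r ?nnegrE ?nm_ge0 //.
      by rewrite mulr_ge0 ?nm_ge0 // addr_ge0 // mulr_ge0.
    have i2 : h * \sum_(l < n) mdefect (grid 0 t m j) (delta W l.+1 y) <= Z * (w2 * ep * nm y ^+ 2).
      have d0 : 0 <= \sum_(l < n) mdefect (grid 0 t m j) (delta W l.+1 y).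
        by apply: sumr_ge0 => l _; apply: (mdefect_ge0 htr hH he hG hK hB hPhi hJ v hf (gs m j)); exact: (delta_B hB).
      apply: le_trans (ler_wpM2r d0 h2) _; clearbody Z.
      have -> : Z * (w2 * ep * nm y ^+ 2) = ep * (Z * (w2 * nm y ^+ 2)).
        by rewrite [w2 * ep]mulrC -mulrA mulrCA.
      rewrite ler_wpM2l // /w2 mulr_sumr mulr_suml mulr_sumr; apply: ler_sum => l _.
      apply: le_trans (IH _ _) _; first exact: (delta_B hB).
      rewrite ler_wpM2l //; apply: le_trans (_ : (2 * nm (W l.+1) * nm y) ^+ 2 <= _).
        by rewrite ler_pXn2r ?nnegrE ?mulr_ge0 ?nm_ge0 //; exact: nm_delta.
      by rewrite le_eqVlt; apply/orP; left; apply/eqP; ring.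
    rewrite !big_ord_recr /= [c' * (_ + _)]mulrDr expRD -/ep.
    set S := \sum_(i < j) eps m i ^+ 2 in Z Z0 IH i1 i2 *.
    set X := expR _ in Z Z0 IH i1 i2 *; set X' := expR (c' * ep).
    have X1 : 1 <= X by rewrite -expR0 ler_expR mulr_ge0 // sumr_ge0.
    have X'1 : 1 + c' * ep <= X' := expR_ge1Dx _.
    have e2 : ep ^+ 2 <= ep by rewrite expr2 -[leRHS]mulr1 ler_wpM2l.
    have S0 : 0 <= S by apply: sumr_ge0 => i _; exact: sqr_ge0.
    have i3 : (1 + c * ep) ^+ 2 + w2 * ep <= X'.
      apply: le_trans X'1; have : c ^+ 2 * ep ^+ 2 <= c ^+ 2 * ep by rewrite ler_wpM2l ?sqr_ge0.
      rewrite sqrrD expr1n mul1r exprMn /c'; lra.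
    have X'0 : 1 <= X' by apply: le_trans X'1; rewrite lerDl mulr_ge0.
    have i4 : c * ep ^+ 2 * nm y ^+ 2 <= c * (X * X') * ep ^+ 2 * nm y ^+ 2.
      rewrite ler_wpM2r // ler_wpM2r ?sqr_ge0 // -[leLHS]mulr1 ler_wpM2l //.
      by rewrite -[1]mulr1; apply: ler_pM.
    have i5 : Z * ((1 + c * ep) ^+ 2 * nm y ^+ 2) + Z * (w2 * ep * nm y ^+ 2) <= Z * X' * nm y ^+ 2.
      by rewrite -mulrDr -mulrDl mulrA ler_wpM2r // ler_wpM2l.
    apply: le_trans h3 _; apply: le_trans (lerD (lerD i1 i2) i4) _; apply: le_trans (lerD i5 (lexx _)) _.
    by rewrite /Z le_eqVlt; apply/orP; left; apply/eqP; ring.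
  have := it m.+1 (leqnn _) x hx; rewrite gridT => h; apply: le_trans h _.
  rewrite grid_sum ?gridT //; last exact: iw.
  rewrite mulrAC; apply: ler_wpM2l; last exact: sum2.
  by rewrite mulr_ge0 ?sqr_ge0 // mulr_ge0 ?expR_ge0.
apply/eqP; rewrite eq_le (mdefect_ge0 htr hH he hG hK hB hPhi hJ v hf t0 hx) andbT.
apply/ler_addgt0Pl => ee e0; rewrite addr0.
pose kap := (t - 0) * q; pose D := c * Q * nm x ^+ 2.
have [N1 hN1] := inv_small (D * kap) e0; have [N2 hN2] := inv_small kap ltr01.
have ek m : (t - 0) / m.+1%:R * q = kap / m.+1%:R by rewrite mulrAC.
have s1 := hN1 (maxn N1 N2) (leq_maxl _ _); have s2 := hN2 (maxn N1 N2) (leq_maxr _ _).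
apply: le_trans (main (maxn N1 N2) _) _; rewrite ek; first exact: ltW.
by rewrite mulrA; exact: ltW.
Qed.

End DefectStep.

Section Homomorphism.
Context (R : realType) (A : cstarType R) (tr : A -> R[i]) (htr : is_trace tr)
  (H : hilbertType R) (Lam : A -> H) (lmul : A -> H -> H) (hH : is_gns tr Lam lmul)
  (k : hilbertType R) (e : nat -> k) (he : is_onb e)
  (G : hilbertType R) (pow : nat -> (R -> k) -> G) (hG : is_sym_fock pow)
  (K : hilbertType R) (tens : H -> G -> K) (hK : is_tensor tens)
  (B : nat -> set A) (W : nat -> A) (hB : filtration B W).
Local Notation C := R[i].
Context (Phi : R -> R -> (R -> nat -> C) -> (R -> nat -> C) -> A -> A) (hPhi : evolution B W Phi).
Local Notation phik := (flow e Phi).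
Context (J : R -> R -> A -> K -> K) (hJ : flow_ops lmul e pow tens B Phi J).
Context (hdense : forall x, exists u, (forall n, exists m, B m (u n)) /\ to u x).
Implicit Types (x y : A) (s t : R).

(** By [mdefect_zero] the positive kernel [defect] has zero diagonal, so it is zero by
    Cauchy-Schwarz: [key] is this statement on exponential vectors. With [J_star] it becomes
    multiplicativity on boxes, which extends by density in each factor. *)
Lemma J_mul t x y (z : K) : 0 <= t -> J 0 t (x ** y) z = J 0 t x (J 0 t y z).
Proof.
move=> t0.
have lJ a := J_lin hJ a (lexx 0) t0; have bJ a b := J_nm hJ a b (lexx 0) t0.
have key n a b u v f g : B n a -> B n b -> L2 f -> L2 g ->
    dot (J 0 t a (tens u (expv pow f))) (J 0 t b (tens v (expv pow g))) =
    dot (tens u (expv pow f)) (J 0 t (star a ** b) (tens v (expv pow g))).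
  move=> ha hb hf hg; rewrite (J_mat hJ _ _ (lexx 0) t0 (BM hB (BS hB ha) hb) hf hg).
  have dz c h w (hc : B n c) (hh : L2 h) : complex.Re (defect lmul e pow tens Phi J t
      (exist _ (c, w, h) (conj hc hh) : test H k B n) (exist _ (c, w, h) (conj hc hh))) = 0.
    have := mdefect_zero htr hH he hG hK hB hPhi hJ w hh t0 hc; rewrite /mul_defect /defect /kk /jvec /= dotxx.
    rewrite (J_mat hJ w w (lexx 0) t0 (BM hB (BS hB hc) hc) hh hh).
    by case: (_ * _) => r1 r2 /=.
  have := psd_CS [:: (1, exist _ (a, u, f) (conj ha hf) : test H k B n)] [:: (1, exist _ (b, v, g) (conj hb hg))]
    (defect_psd htr hH he hG hK hB hPhi hJ t0 (n := n)).
  rewrite /form !big_seq1 /= cj1 !mul1r !dz mul0r => h.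
  have : nm (defect lmul e pow tens Phi J t (exist _ (a, u, f) (conj ha hf) : test H k B n)
     (exist _ (b, v, g) (conj hb hg))) = 0.
    by apply/eqP; rewrite -sqrf_eq0 eq_le h sqr_ge0.
  by move/nm_eq0; rewrite /defect /kk /jvec /= => /eqP; rewrite subr_eq0 => /eqP <-.
have loc n a b w : B n a -> B n b -> J 0 t (a ** b) w = J 0 t a (J 0 t b w).
  move=> ha hb; apply: (op_ext he hG hK (Z' := fun w => J 0 t a (J 0 t b w)) (lJ _) (bJ _) _ (c' := nm a * nm b)) => [c z1 z2|z1|v g hg].
  - by rewrite !lJ.
  - by apply: le_trans (bJ _ _) _; rewrite -mulrA ler_wpM2l ?nm_ge0.
  apply: (K_ext he hG hK) => u f hf; have := key n (star a) b u v f g (BS hB ha) hb hf hg.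
  by rewrite star_invol (J_star htr hH he hG hK hB hdense hPhi hJ _ _ _ (lexx 0) t0).
have [u [lu ux]] := hdense x; have [u' [lu' uy]] := hdense y.
have lx (w : K) := J_linx hJ w (lexx 0) t0.
have bx (w : K) (c : A) : nm (J 0 t c w) <= nm w * nm c by rewrite mulrC (J_nm hJ).
have step b w : (exists m, B m b) -> J 0 t (x ** b) w = J 0 t x (J 0 t b w).
  move=> [m hb]; have h1 := to_op (lx w) (bx w) (to_amul ux (to_cst b)).
  have h2 := to_op (lx (J 0 t b w)) (bx _) ux.
  apply: to_unique h1 (to_ev _ h2); exists 0%N => n' _; have [m' hm'] := lu n'.
  exact/esym/(loc (maxn m m') _ _ _ (fil_mono hB (leq_maxr m m') hm') (fil_mono hB (leq_maxl m m') hb)).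
have h1 := to_op (lx z) (bx z) (to_amul (to_cst x) uy).
have h2 := to_op (lJ x) (bJ x) (to_op (lx z) (bx z) uy).
by apply: to_unique h1 (to_ev _ h2); exists 0%N => n _; apply/esym/step.
Qed.

End Homomorphism.

(** * Adaptedness and the co-cycle identity *)

Section BoundedLinear.
Context (R : realType).
Local Notation C := R[i].

Definition bdlin (X Y : completeNormedModType C) (Z : X -> Y) : Prop :=
  (forall a x y, Z (a *: x + y) = a *: Z x + Z y) /\
  exists c : R, 0 <= c /\ forall x, nm (Z x) <= c * nm x.

Lemma bdlin_comp (X Y V : completeNormedModType C) (Z : Y -> V) (Z' : X -> Y) :
  bdlin Z -> bdlin Z' -> bdlin (fun x => Z (Z' x)).
Proof.
move=> [l [c [c0 h]]] [l' [c' [c'0 h']]]; split=> [a x y|]; first by rewrite l' l.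
exists (c * c'); split=> [|x]; first exact: mulr_ge0.
by apply: le_trans (h _) _; rewrite -mulrA ler_wpM2l.
Qed.

Lemma bdlin_sum (X Y : completeNormedModType C) (I : finType) (Z : I -> X -> Y) :
  (forall i, bdlin (Z i)) -> bdlin (fun x => \sum_i Z i x).
Proof.
move=> h; split=> [a x y|].
  rewrite scaler_sumr -big_split; apply: eq_bigr => i _; exact: (h i).1.
have /choice[c hc] := fun i => (h i).2; exists (\sum_i c i); split=> [|x].
  by apply: sumr_ge0 => i _; case: (hc i).
apply: le_trans (nm_sum _ _ _) _; rewrite mulr_suml; apply: ler_sum => i _; exact: (hc i).2.
Qed.

Lemma bdlin_ext (X : hilbertType R) (Y : completeNormedModType C) (T : Type) (v : T -> X) (Z Z' : X -> Y) :
  total v -> bdlin Z -> bdlin Z' -> (forall t, Z (v t) = Z' (v t)) -> forall x, Z x = Z' x.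
Proof.
move=> tv [l [c [_ h]]] [l' [c' [_ h']]] e x; have [u ux] := total_dense tv x.
apply: to_unique (to_op l h ux) _; apply: to_ev (to_op l' h' ux).
exists 0%N => n _; rewrite /vec !(op_sum l) !(op_sum l').
by apply: eq_bigr => p _; rewrite (opZ l) (opZ l') e.
Qed.

Lemma bdlin_op (X : hilbertType R) (Z : X -> X) : bdlin Z <-> bounded_op Z.
Proof. by split => h; apply/bounded_opP. Qed.

End BoundedLinear.

Section Slices.
Context (R : realType) (A : cstarType R) (tr : A -> R[i]) (htr : is_trace tr)
  (H : hilbertType R) (Lam : A -> H) (lmul : A -> H -> H) (hH : is_gns tr Lam lmul)
  (k : hilbertType R) (e : nat -> k) (he : is_onb e)
  (G : hilbertType R) (pow : nat -> (R -> k) -> G) (hG : is_sym_fock pow)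
  (K : hilbertType R) (tens : H -> G -> K) (hK : is_tensor tens)
  (B : nat -> set A) (W : nat -> A) (hB : filtration B W).
Local Notation C := R[i].
Context (Phi : R -> R -> (R -> nat -> C) -> (R -> nat -> C) -> A -> A) (hPhi : evolution B W Phi).
Local Notation phik := (flow e Phi).
Context (J : R -> R -> A -> K -> K) (hJ : flow_ops lmul e pow tens B Phi J).
Context (hdense : forall x, exists u, (forall n, exists m, B m (u n)) /\ to u x).
Implicit Types (x y : A) (s t : R).
Local Notation E f := (expv pow f).

Lemma E_total : total (fun f : {f : R -> k | L2 f} => E (sval f)).
Proof. by move=> y h; apply: (expv_total he hG) => f hf; exact: (h (exist _ f hf)). Qed.

Lemma bdlin_tensr u : bdlin (tens u).
Proof.
split=> [a x y|]; first exact: (tens_linearr hK).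
by exists (nm u); split=> [|x]; rewrite ?nm_ge0 // (nm_tens hK).
Qed.

Lemma bdlin_J s t x : 0 <= s -> s <= t -> bdlin (J s t x).
Proof.
move=> s0 st; split=> [a z w|]; first exact: (J_lin hJ).
by exists (nm x); split=> [|z]; [exact: nm_ge0|exact: (J_nm hJ)].
Qed.

(** [T] is the partial matrix element of [Z] between [u] and [u'], an operator on the Fock space. *)
Lemma slice_ex (Z : K -> K) u u' : bdlin Z ->
  exists T : G -> G, bdlin T /\ forall y y' : G, dot y (T y') = dot (tens u y) (Z (tens u' y')).
Proof.
move=> hZ; have [lZ [c [c0 nZ]]] := bdlin_comp hZ (bdlin_tensr u').
pose kap (y y' : G) := dot (tens u y) (Z (tens u' y')).
have [||S S'|T [lT nT eT]] := @kernel_op R G G id kap (nm u * c).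
- by move=> y h; have := h y; rewrite dotxx => /complexI /eqP; rewrite sqrf_eq0 => /eqP/nm_eq0.
- by rewrite mulr_ge0 ?nm_ge0.
- have -> : form kap S S' = dot (tens u (vec id S)) (Z (tens u' (vec id S'))).
    have lu := (bdlin_tensr u).1; rewrite /vec (op_sum lu) (op_sum lZ) dot_suml /form.
    apply: eq_bigr => p _; rewrite dot_sumr; apply: eq_bigr => q _.
    by rewrite (opZ lu) (opZ lZ) dotZl dotZr mulrA.
  apply: le_trans (CS _ _) _; rewrite (nm_tens hK) -!mulrA ler_wpM2l ?nm_ge0 //.
  by rewrite mulrCA ler_wpM2l ?nm_ge0.
by exists T; split => //; split => //; exists (nm u * c); rewrite mulr_ge0 ?nm_ge0.
Qed.

Context (n : nat) (I : finType) (b : I -> A) (hb : forall i, B n (b i))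
  (bE : forall x, B n x -> x = \sum_i tr (star (b i) ** x) *: b i).

(** Between $\Lambda(b_i)$ and $\Lambda(1)$ a left multiplication has the matrix element
    $tr(b_i^{*}\,\cdot\,)$, which is the [i]-th coordinate on the box; slices between these vectors
    are thus the Fock components of [J s t x]. *)
Lemma J_slices s t x : 0 <= s -> s <= t -> B n x -> exists T : I -> G -> G,
  [/\ forall i, bdlin (T i),
      forall i f g, L2 f -> L2 g -> dot (E f) (T i (E g)) =
        tr (star (b i) ** phik s t f g x) * cexp (L2dot f g) &
      forall u (y : G), J s t x (tens u y) = \sum_i tens (lmul (b i) u) (T i y)].
Proof.
move=> s0 st hx.
have /choice[T hT] := fun i => slice_ex (Lam (b i)) (Lam aone) (bdlin_J x s0 st).
have me i f g : L2 f -> L2 g -> dot (E f) (T i (E g)) =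
    tr (star (b i) ** phik s t f g x) * cexp (L2dot f g).
  move=> hf hg; rewrite (hT i).2 (J_mat hJ _ _ s0 st hx hf hg); congr (_ * _).
  by rewrite (gns_lmul hH) mul_unitr (gns_dot hH).
exists T; split => // [i|u]; first by case: (hT i).
apply: (bdlin_ext E_total).
- exact: bdlin_comp (bdlin_J x s0 st) (bdlin_tensr u).
- by apply: bdlin_sum => i; apply: bdlin_comp (bdlin_tensr _) _; case: (hT i).
move=> [g hg] /=; apply: (K_ext he hG hK) => u' f hf; rewrite (J_mat hJ _ _ s0 st hx hf hg) dot_sumr.
have hp : B n (phik s t f g x) := phi_B hPhi (L2_control he hf) (L2_control he hg) s0 st hx.
rewrite {1}(bE hp) (lmul_suml htr hH) dot_sumr mulr_suml; apply: eq_bigr => i _.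
by rewrite (lmulZl htr hH) dotZr (tens_dot hK) me // mulrAC mulrC mulrA mulrAC mulrC.
Qed.

Lemma slice_before t x (T : G -> G) i : 0 <= t -> B n x -> bdlin T ->
  (forall f g, L2 f -> L2 g -> dot (E f) (T (E g)) = tr (star (b i) ** phik 0 t f g x) * cexp (L2dot f g)) ->
  fock_op_before pow t T.
Proof.
move=> t0 hx hT me; split; first exact/bdlin_op.
move=> f g hf hg; have hbf := L2_before he t hf; have hbg := L2_before he t hg.
rewrite !me // (expv_dot hG (L2_after he t hf) (L2_after he t hg)) -mulrA -cexpD -(L2dot_split he t hf hg).
congr (tr (_ ** _) * _); apply: (phik_loc he hB hPhi (n := n)) => // r /andP[_ rt];
  by rewrite /before rt.
Qed.

Lemma slice_shift s t x (T T' : G -> G) i : 0 <= s -> 0 <= t -> B n x -> bdlin T' ->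
  (forall f g, L2 f -> L2 g -> dot (E f) (T (E g)) = tr (star (b i) ** phik 0 t f g x) * cexp (L2dot f g)) ->
  (forall f g, L2 f -> L2 g -> dot (E f) (T' (E g)) =
    tr (star (b i) ** phik s (s + t) f g x) * cexp (L2dot f g)) ->
  fock_shift pow s T T'.
Proof.
move=> s0 t0 hx hT' me me'; split; first exact/bdlin_op.
move=> f g hf hg; have hbf := L2_before he s hf; have hbg := L2_before he s hg.
have hsf := L2_shift he s0 hf; have hsg := L2_shift he s0 hg.
rewrite me // me' // (expv_dot hG hbf hbg) mulrCA -cexpD -(L2dot_shift he s0 hf hg) -(L2dot_split he s hf hg).
congr (tr (_ ** _) * _); rewrite addrC -{1}[s]add0r.
exact: (phi_shift hB hPhi (L2_control he hf) (L2_control he hg) s0 (lexx 0) t0 hx).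
Qed.

(** The flow property, with the evolution from [s] to [s + t] expanded in the basis: its
    coefficients are the matrix elements of the [T' i]. *)
Lemma slice_flow s t x (T' : I -> G -> G) : 0 <= s -> 0 <= t -> B n x -> (forall i, bdlin (T' i)) ->
  (forall i f g, L2 f -> L2 g -> dot (E f) (T' i (E g)) =
    tr (star (b i) ** phik s (s + t) f g x) * cexp (L2dot f g)) ->
  forall u (y : G), J 0 (s + t) x (tens u y) = \sum_i J 0 s (b i) (tens u (T' i y)).
Proof.
move=> s0 t0 hx hT' me u; have st : s <= s + t by rewrite lerDl.
have st0 : 0 <= s + t := addr_ge0 s0 t0.
apply: (bdlin_ext E_total).
- exact: bdlin_comp (bdlin_J x (lexx 0) st0) (bdlin_tensr u).
- apply: bdlin_sum => i; apply: bdlin_comp (bdlin_J _ (lexx 0) s0) _.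
  exact: bdlin_comp (bdlin_tensr _) (hT' i).
move=> [g hg] /=; apply: (K_ext he hG hK) => u' f hf.
have cf := L2_control he hf; have cg := L2_control he hg.
have hp : B n (phik s (s + t) f g x) := phi_B hPhi cf cg s0 st hx.
(* Moved to the left, [J 0 s (star (b i))] produces a vector adapted at [s] with future [f]. Against
   it [T' i] acts as a scalar, because its coefficient depends only on the controls after [s]. *)
have key i : dot (tens u' (E f)) (J 0 s (b i) (tens u (T' i (E g)))) =
    tr (star (b i) ** phik s (s + t) f g x) * dot (tens u' (E f)) (J 0 s (b i) (tens u (E g))).
  rewrite -!(J_star htr hH he hG hK hB hdense hPhi hJ _ _ _ (lexx 0) s0) -dotZr.
  have hbs := BS hB (hb i).
  apply: (adapted_ext he hG hK (s := s) (f := f)) => // [u0 h hh|u0 h hh].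
    exact: (adapted_J he hB hPhi hJ _ _ s0 hbs).
  have hgl := L2_glue he s hh hf.
  rewrite dotZr !(tens_dot hK) me // (expv_dot hG hgl hg) mulrCA; congr (tr (_ ** _) * _).
  apply: (phik_loc he hB hPhi (n := n)) => // r /andP[sr _]; by rewrite /glue ltNge sr.
rewrite dot_sumr (J_mat hJ _ _ (lexx 0) st0 hx hf hg).
have -> : phik 0 (s + t) f g x = phik 0 s f g (phik s (s + t) f g x).
  exact: (phi_flow hB hPhi cf cg (lexx 0) s0 st hx).
have lp := phi_lin hPhi cf cg (lexx 0) (n := n) s0.
have -> : phik 0 s f g (phik s (s + t) f g x) =
    \sum_i tr (star (b i) ** phik s (s + t) f g x) *: phik 0 s f g (b i).
  have := congr1 (Phi 0 s (ctl e f) (ctl e g)) (bE hp).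
  rewrite (linB_sum hB _ lp) => [|i]; last exact: (BZ hB).
  by rewrite /flow => h; rewrite [LHS]h; apply: eq_bigr => i _; rewrite (linBZ hB _ lp).
rewrite (lmul_suml htr hH) dot_sumr mulr_suml; apply: eq_bigr => i _.
rewrite key (J_mat hJ _ _ (lexx 0) s0 (hb i) hf hg) (lmulZl htr hH) dotZr.
by rewrite mulrA.
Qed.

End Slices.

(** * Membership in von Neumann tensor products, and the co-cycle identity *)

Section VonNeumann.
Context (R : realType) (A : cstarType R) (tr : A -> R[i]) (htr : is_trace tr)
  (H : hilbertType R) (Lam : A -> H) (lmul : A -> H -> H) (hH : is_gns tr Lam lmul)
  (k : hilbertType R) (e : nat -> k) (he : is_onb e)
  (G : hilbertType R) (pow : nat -> (R -> k) -> G) (hG : is_sym_fock pow)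
  (K : hilbertType R) (tens : H -> G -> K) (hK : is_tensor tens)
  (B : nat -> set A) (W : nat -> A) (hB : filtration B W).
Local Notation C := R[i].
Context (Phi : R -> R -> (R -> nat -> C) -> (R -> nat -> C) -> A -> A) (hPhi : evolution B W Phi).
Local Notation phik := (flow e Phi).
Context (J : R -> R -> A -> K -> K) (hJ : flow_ops lmul e pow tens B Phi J).
Context (hdense : forall x, exists u, (forall n, exists m, B m (u n)) /\ to u x).
Implicit Types (x y : A) (s t : R).
Local Notation E f := (expv pow f).

Context (hbasis : forall n, exists (I : finType) (b : I -> A),
  (forall i, B n (b i)) /\ forall x, B n x -> x = \sum_i tr (star (b i) ** x) *: b i).

Lemma K_total : total (fun p : ktest H k => tens p.1 (E (sval p.2))).
Proof. exact: (kvec_total he hG hK). Qed.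

Lemma lmul_op_total x u (y : G) : (exists n, B n x) -> J 0 0 x (tens u y) = tens (lmul x u) y.
Proof.
move=> [n hx]; move: y; apply: (bdlin_ext (E_total he hG)).
- exact: bdlin_comp (bdlin_J hJ x (lexx 0) (lexx 0)) (bdlin_tensr hK u).
- exact: bdlin_tensr.
by move=> [f hf] /=; exact: (vacuum_op0 he hG hK hB hPhi hJ hf u hx).
Qed.

Lemma lmul_bicommutant x : bicommutant (range lmul) (lmul x).
Proof.
split; first exact: (gns_bounded hH).
by move=> X [_ hX]; rewrite hX //; exists x.
Qed.

(** For local elements [J 0 t] is a finite sum of operators $b_i \otimes T_i$ with $T_i$ adapted, so
    it commutes with whatever commutes with these generators; norm limits give the other elements.
    Taking [L] general covers both the codomain and adaptedness. *)
Lemma J_vN t x (L : set (G -> G)) : 0 <= t -> fock_op_before pow t `<=` L ->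
  vN_tensor tens (bicommutant (range lmul)) L (J 0 t x).
Proof.
move=> t0 hL; split; first by apply/bdlin_op; exact: (bdlin_J hJ _ (lexx 0) t0).
move=> X [hX cX]; apply/funext => z /=; have /bdlin_op[lX [c [c0 nX]]] := hX.
suff loc y : (exists n, B n y) -> J 0 t y (X z) = X (J 0 t y z).
  have [u [lu ux]] := hdense x.
  have lx (w : K) := J_linx hJ w (lexx 0) t0.
  have bx (w : K) (a : A) : nm (J 0 t a w) <= nm w * nm a by rewrite mulrC (J_nm hJ).
  apply: to_unique (to_op (lx _) (bx _) ux) _.
  apply: to_ev (to_op lX nX (to_op (lx z) (bx z) ux)); exists 0%N => n _; exact/esym/loc.
move=> [n hy]; have [I [b [hb bE]]] := hbasis n.
have [T [hT me eT]] := J_slices htr hH he hG hK hPhi hJ bE (lexx 0) t0 hy.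
have TL i : fock_op_before pow t (T i) by apply: (slice_before he hG hB hPhi (b := b) (i := i) t0 hy (hT i) (me i)).
(* [S i] is $1 \otimes T_i$, and [J 0 0 (b i)] is $b_i \otimes 1$; hence [Z i] is $b_i \otimes
   T_i$. *)
have /choice[S hS] : forall i, exists S : K -> K, bdlin S /\ forall u (w : G), S (tens u w) = tens u (T i w).
  move=> i; have [lT [d [d0 nT]]] := hT i; have [S [l1 l2 l3]] := tens_op hK d0 lT nT.
  by exists S; split => //; split => //; exists d.
pose Z i w := J 0 0 (b i) (S i w).
have hZ i : bdlin (Z i) := bdlin_comp (bdlin_J hJ (b i) (lexx 0) (lexx 0)) (hS i).1.
have Zt i u (w : G) : Z i (tens u w) = tens (lmul (b i) u) (T i w).
  by rewrite /Z (hS i).2 lmul_op_total //; exists n.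
have JZ : forall w : K, J 0 t y w = \sum_i Z i w.
  apply: (bdlin_ext K_total); first exact: (bdlin_J hJ y (lexx 0) t0).
    exact: bdlin_sum.
  by move=> p; rewrite eT; apply: eq_bigr => i _; rewrite Zt.
rewrite !JZ (op_sum lX); apply: eq_bigr => i _.
have XZ : X \o Z i = Z i \o X.
  apply: cX; split; first exact/bdlin_op.
  by exists (lmul (b i)), (T i); split; [exact: lmul_bicommutant|exact: hL|exact: Zt].
by have := congr1 (fun F => F z) XZ.
Qed.

Lemma J_cocycle s t x : 0 <= s -> 0 <= t -> (exists n, B n x) -> exists n (Y : 'I_n -> A) (T T' : 'I_n -> G -> G),
  [/\ forall i, [/\ exists m, B m (Y i), bounded_op (T i) & fock_shift pow s (T i) (T' i)],
      forall u (y : G), J 0 t x (tens u y) = \sum_i tens (lmul (Y i) u) (T i y) &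
      forall u (y : G), J 0 (s + t) x (tens u y) = \sum_i J 0 s (Y i) (tens u (T' i y))].
Proof.
move=> s0 t0 [n hx]; have [I [b [hb bE]]] := hbasis n; have st : s <= s + t by rewrite lerDl.
have [T [hT me eT]] := J_slices htr hH he hG hK hPhi hJ bE (lexx 0) t0 hx.
have [T' [hT' me' _]] := J_slices htr hH he hG hK hPhi hJ bE s0 st hx.
have fl := slice_flow htr hH he hG hK hB hPhi hJ hdense hb bE s0 t0 hx hT' me'.
exists #|I|, (fun i => b (enum_val i)), (fun i => T (enum_val i)), (fun i => T' (enum_val i)); split.
- move=> i; split; [by exists n|exact/bdlin_op|].
  exact: (slice_shift he hG hB hPhi (b := b) (i := enum_val i) s0 t0 hx (hT' _) (me _) (me' _)).
- by move=> u y; rewrite eT (reindex _ (onW_bij _ (enum_val_bij I))).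
- by move=> u y; rewrite fl (reindex _ (onW_bij _ (enum_val_bij I))).
Qed.

End VonNeumann.

(** * The vacuum semi-group *)

Section MatrixPositivity.
Context (R : realType) (N d : nat) (hN : (0 < N)%N)
  (A : cstarType R) (site : 'rV[int]_d -> 'M[R[i]]_N -> A) (hA : is_uhf site)
  (tr : A -> R[i]) (htr : is_trace tr)
  (H : hilbertType R) (Lam : A -> H) (lmul : A -> H -> H) (hH : is_gns tr Lam lmul).
Local Notation C := R[i].
Context (n : nat).
Implicit Types (u v w : 'I_n -> H) (Z : 'I_n -> 'I_n -> A).

Definition qform Z u v : C := \sum_i \sum_j dot (u i) (lmul (Z i j) (v j)).
Definition sqsum u : R := \sum_i nm (u i) ^+ 2.

Lemma sqsum_le u i : nm (u i) ^+ 2 <= sqsum u.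
Proof. by rewrite /sqsum (bigD1 i) //= lerDl sumr_ge0 // => j _; exact: sqr_ge0. Qed.

Lemma sqsum_ge0 u : 0 <= sqsum u.
Proof. by apply: sumr_ge0 => i _; exact: sqr_ge0. Qed.

Section Contraction.
Context (Z : 'I_n -> 'I_n -> A) (Z0 : forall u, 0 <= qform Z u u)
  (Z1 : forall u, complex.Re (qform Z u u) <= sqsum u).

Lemma qform_CS u v : nm (qform Z u v) ^+ 2 <= complex.Re (qform Z u u) * complex.Re (qform Z v v).
Proof.
pose kap (p q : 'I_n * H) := dot p.2 (lmul (Z p.1 q.1) q.2).
pose S u : seq (C * ('I_n * H)) := [seq (1, (i, u i)) | i <- index_enum 'I_n].
have eS u' v' : form kap (S u') (S v') = qform Z u' v'.
  rewrite /form big_map; apply: eq_bigr => i _; rewrite big_map; apply: eq_bigr => j _.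
  by rewrite /kap /= cj1 !mul1r.
rewrite -!eS; apply: psd_CS => s.
(* The points of a formal combination are grouped by row index into one vector per row, which turns
   its form into a value of [qform]. *)
pose U i : H := \sum_(p <- s | p.2.1 == i) p.1 *: p.2.2.
suff -> : form kap s s = qform Z U U by exact: Z0.
rewrite /form /qform (partition_big (fun p => p.2.1) xpredT) //=; apply: eq_bigr => i _.
under eq_bigr => p _ do rewrite (partition_big (fun q => q.2.1) xpredT) //=.
rewrite exchange_big; apply: eq_bigr => j _ /=.
rewrite /U dot_suml; apply: eq_bigr => p /eqP <-.
rewrite (big_morph (lmul (Z p.2.1 j)) (id1 := 0) (op1 := +%R)); last 2 first.
- by move=> a b; rewrite (opD (lmulE hH _)).
- by rewrite (op0 (lmulE hH _)).
rewrite dot_sumr; apply: eq_bigr => q /eqP <-.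
by rewrite (opZ (lmulE hH _)) dotZl dotZr mulrA.
Qed.

(** A form between 0 and the identity is contractive: Cauchy-Schwarz for the form between $w = Zv$
    and [v] gives $\|w\|^4 \le \|w\|^2\|v\|^2$. *)
Lemma qform_contract v : sqsum (fun i => \sum_j lmul (Z i j) (v j)) <= sqsum v.
Proof.
set w := fun i : 'I_n => _; have ew : qform Z w v = (sqsum w)%:C.
  rewrite /qform /sqsum rmorph_sum; apply: eq_bigr => i _.
  by rewrite -dot_sumr; exact: dotxx.
have := qform_CS w v; rewrite ew nm_real ger0_norm ?sqsum_ge0 // => h.
have [w0 v0] := (sqsum_ge0 w, sqsum_ge0 v).
have h' : sqsum w ^+ 2 <= sqsum w * sqsum v.
  apply: le_trans h _; have [_ a0] := ge0_Re (Z0 w); have [_ b0] := ge0_Re (Z0 v).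
  by apply: ler_pM => //; exact: Z1.
have [->//|wn] := eqVneq (sqsum w) 0.
have wp : 0 < sqsum w by rewrite lt_def wn.
by rewrite -(ler_pM2l wp) -expr2.
Qed.

(** The hypothesis of [matrix_sqrt]: a column of $Z^m$ applied to a vector is $Z^m$ applied to a
    tuple with a single nonzero component. *)
Lemma mpow_le1 m i j : nm (mpow Z m i j) <= 1.
Proof.
apply: (nm_lmul hN hA htr hH) => h; rewrite mul1r.
have : sqsum (fun i => lmul (mpow Z m i j) h) <= nm h ^+ 2.
  elim: m => [|m IH].
    rewrite /sqsum (bigD1 j) //= big1 => [|l lj].
      by rewrite addr0 /mone eqxx (lmul1 htr hH).
    by rewrite /mone (negbTE lj) (lmul0l htr hH) nm0 expr0n.
  have -> : (fun i => lmul (mpow Z m.+1 i j) h) = fun i => \sum_l lmul (Z i l) (lmul (mpow Z m l j) h).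
    apply/funext => l; rewrite /mpow iterS /mmul (lmul_suml htr hH).
    by apply: eq_bigr => l' _; rewrite (lmulM htr hH).
  exact: le_trans (qform_contract _) IH.
have := sqsum_le (fun i => lmul (mpow Z m i j) h) i => /= h1 h2.
by rewrite -(@ler_pXn2r _ 2) ?nnegrE ?nm_ge0 //; exact: le_trans h1 h2.
Qed.

End Contraction.

(** For [c] large, $Z = 1 - Q/c$ has a form between 0 and the identity, and [matrix_sqrt] provides a
    root of $1 - Z = Q/c$. *)
Lemma mx_positive_test (Q : 'M[A]_n) : (forall i j, star (Q i j) = Q j i) ->
  (forall u, 0 <= qform (fun i j => Q i j) u u) -> mx_positive Q.
Proof.
move=> Qh Q0; pose q := \sum_i \sum_j nm (Q i j); pose c := q + 1.
have q0 : 0 <= q by do 2!apply: sumr_ge0 => ? _; exact: nm_ge0.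
have c0 : 0 < c by rewrite /c; lra.
have Qle u : complex.Re (qform (fun i j => Q i j) u u) <= c * sqsum u.
  apply: le_trans (nm_Re_le _) _; apply: le_trans (_ : q * sqsum u <= _); last first.
    by rewrite ler_wpM2r ?sqsum_ge0 // /c; lra.
  apply: le_trans (nm_sum _ _ _) _; rewrite mulr_suml; apply: ler_sum => i _.
  apply: le_trans (nm_sum _ _ _) _; rewrite mulr_suml; apply: ler_sum => j _.
  apply: le_trans (CS _ _) _; have := lmul_le htr hH (Q i j) (u j).
  have := sqsum_le u i; have := sqsum_le u j; have := nm_ge0 (u i); have := nm_ge0 (u j).
  have := nm_ge0 (Q i j); move: (nm _) (nm _) (nm _) (nm _) (sqsum u) => a b c1 e f.
  move=> e0 c0' b0 cf bf ae; apply: le_trans (ler_wpM2l b0 ae) _; rewrite mulrCA ler_wpM2l //.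
  have := sqr_ge0 (b - c1); rewrite sqrrB => h; lra.
pose Z (i j : 'I_n) := @mone R A n i j - (c^-1)%:C *: Q i j.
have eZ u : qform Z u u = (sqsum u)%:C - (c^-1)%:C * qform (fun i j => Q i j) u u.
  rewrite /qform /sqsum rmorph_sum mulr_sumr -sumrB; apply: eq_bigr => i _.
  transitivity ((nm (u i) ^+ 2)%:C - (c^-1)%:C * \sum_j dot (u i) (lmul (Q i j) (u j))); last by [].
  have -> : (nm (u i) ^+ 2)%:C = \sum_j dot (u i) (lmul (@mone R A n i j) (u j)).
    rewrite (bigD1 i) //= big1 ?addr0 => [|j ji]; first by rewrite /mone eqxx (lmul1 htr hH) dotxx.
    by rewrite /mone eq_sym (negbTE ji) (lmul0l htr hH) dot0r.
  rewrite mulr_sumr -sumrB; apply: eq_bigr => j _.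
  by rewrite /Z (lmulBl htr hH) dotBr (lmulZl htr hH) dotZr.
have ReZ u : complex.Re (qform Z u u) = sqsum u - c^-1 * complex.Re (qform (fun i j => Q i j) u u).
  by rewrite eZ; case: (qform _ u u) => a b /=; ring.
have Z0 u : 0 <= qform Z u u.
  have := Q0 u; have := Qle u; rewrite eZ; case: (qform _ u u) => a b /= h.
  rewrite !lecE /= => /andP[/eqP -> a0]; apply/andP; split; first by rewrite !mulr0 mul0r addr0 subrr.
  by rewrite mul0r subr0 subr_ge0 ler_pdivrMl // mulrC.
have Z1 u : complex.Re (qform Z u u) <= sqsum u.
  rewrite ReZ gerBl mulr_ge0 ?invr_ge0 ?(ltW c0) //.
  by have [_] := ge0_Re (Q0 u).
have Zh i j : star (Z i j) = Z j i.
  rewrite /Z starB starZ cjR Qh; congr (_ - _).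
  by rewrite /mone eq_sym; case: eqP; rewrite ?star1 ?star0.
have [S hS] := matrix_sqrt Zh (mpow_le1 Z0 Z1).
exists (\matrix_(l, i) ((Num.sqrt c)%:C *: S l i)) => i j.
have -> : Q i j = c%:C *: (@mone R A n i j - Z i j).
  by rewrite /Z opprB addrC subrK scalerA -rmorphM divff ?gt_eqF // scale1r.
rewrite hS scaler_sumr; apply: eq_bigr => l _; rewrite !mxE starZ cjR amulZl amulZr scalerA.
by rewrite -rmorphM -expr2 sqr_sqrtr // ltW.
Qed.

End MatrixPositivity.

Section VacuumSemigroup.
Context (R : realType) (N d : nat) (hN : (0 < N)%N) (A : cstarType R)
  (site : 'rV[int]_d -> 'M[R[i]]_N -> A) (hA : is_uhf site) (tr : A -> R[i]) (htr : is_trace tr)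
  (H : hilbertType R) (Lam : A -> H) (lmul : A -> H -> H) (hH : is_gns tr Lam lmul)
  (k : hilbertType R) (e : nat -> k) (he : is_onb e)
  (G : hilbertType R) (pow : nat -> (R -> k) -> G) (hG : is_sym_fock pow)
  (K : hilbertType R) (tens : H -> G -> K) (hK : is_tensor tens)
  (B : nat -> set A) (W : nat -> A) (hB : filtration B W).
Local Notation C := R[i].
Context (Phi : R -> R -> (R -> nat -> C) -> (R -> nat -> C) -> A -> A) (hPhi : evolution B W Phi).
Local Notation phik := (flow e Phi).
Context (J : R -> R -> A -> K -> K) (hJ : flow_ops lmul e pow tens B Phi J).
Context (hdense : forall x, exists u, (forall n, exists m, B m (u n)) /\ to u x).
Implicit Types (x y : A) (s t : R).
Local Notation E f := (expv pow f).

Local Notation z := (fun=> 0 : k).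
Local Notation vac s t := (phik s t z z).
Let L2z : L2 z := L2_0 he.
Let cz : control (ctl e z) := L2_control he L2z.

Lemma vac_mat n t x u v : 0 <= t -> B n x ->
  dot u (lmul (vac 0 t x) v) = dot (tens u (E z)) (J 0 t x (tens v (E z))).
Proof.
move=> t0 hx; rewrite (J_mat hJ _ _ (lexx 0) t0 hx L2z L2z) L2dot0r //.
by rewrite cexp0 mulr1.
Qed.

Lemma vac_flow n s t x : 0 <= s -> 0 <= t -> B n x -> vac 0 (s + t) x = vac 0 s (vac 0 t x).
Proof.
move=> s0 t0 hx; have st : s <= s + t by rewrite lerDl.
rewrite /flow (phi_flow hB hPhi cz cz (lexx 0) s0 st hx); congr (Phi 0 s _ _ _).
have := phi_shift hB hPhi cz cz s0 (lexx 0) t0 hx.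
by rewrite add0r [t + s]addrC.
Qed.

Lemma vac_contract n t x : 0 <= t -> B n x -> nm (vac 0 t x) <= nm x.
Proof.
move=> t0 hx; apply: (nm_lmul hN hA htr hH) => v; set w := lmul _ v.
have h : nm w ^+ 2 <= nm w * (nm x * nm v).
  have := congr1 (@nm R C^o) (dotxx w); rewrite {2}/w (vac_mat _ _ t0 hx) nm_real ger0_norm ?sqr_ge0 // => <-.
  apply: le_trans (CS _ _) _; rewrite (nm_tens hK) (nm_expv0 he hG) mulr1 ler_wpM2l ?nm_ge0 //.
  by apply: le_trans (J_nm hJ _ _ (lexx 0) t0) _; rewrite (nm_tens hK) (nm_expv0 he hG) mulr1.
have [->|wn] := eqVneq (nm w) 0; first by rewrite mulr_ge0 ?nm_ge0.
have wp : 0 < nm w by rewrite lt_def wn nm_ge0.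
by rewrite -(ler_pM2l wp) -expr2.
Qed.

Lemma vac_ex : exists T : R -> A -> A, forall t, 0 <= t ->
  [/\ forall a x y, T t (a *: x + y) = a *: T t x + T t y, forall x, nm (T t x) <= nm x &
      forall n x, B n x -> T t x = vac 0 t x].
Proof.
suff /choice[T hT] : forall t : R, exists F : A -> A, 0 <= t ->
  [/\ forall a x y, F (a *: x + y) = a *: F x + F y, forall x, nm (F x) <= nm x &
      forall n x, B n x -> F x = vac 0 t x] by exists T.
move=> t; have [t0|nt] := boolP (0 <= t); last by exists id => t0; case/negP: nt.
have two x y : (exists n, B n x) -> (exists n, B n y) -> exists n, B n x /\ B n y.
  move=> [m hm] [m' hm']; exists (maxn m m').
  by split; [exact: (fil_mono hB (leq_maxl m m'))|exact: (fil_mono hB (leq_maxr m m'))].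
have [] := @linear_ext R A A [set x | exists n, B n x] (vac 0 t) 1.
- by move=> a x y hx hy; have [n [h1 h2]] := two _ _ hx hy; exists n; exact: (BE hB).
- move=> a x y hx hy; have [n [h1 h2]] := two _ _ hx hy.
  exact: (phi_lin hPhi cz cz (lexx 0) t0 a h1 h2).
- by move=> x [n hx]; rewrite mul1r; exact: (vac_contract t0 hx).
- exact: hdense.
move=> F [l1 l2 l3]; exists F => _; split => // [x|n x hx]; first by have := l2 x; rewrite mul1r.
by apply: l3; exists n.
Qed.

Context (T : R -> A -> A) (hT : forall t, 0 <= t ->
  [/\ forall a x y, T t (a *: x + y) = a *: T t x + T t y, forall x, nm (T t x) <= nm x &
      forall n x, B n x -> T t x = vac 0 t x]).

Lemma to_T t (u : nat -> A) x : 0 <= t -> to u x -> to (fun m => T t (u m)) (T t x).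
Proof.
move=> t0; have [l1 l2 _] := hT t0; apply: (to_op (c := 1)) => // y.
by rewrite mul1r.
Qed.

Lemma T_mat t x u v : 0 <= t ->
  dot u (lmul (T t x) v) = dot (tens u (E z)) (J 0 t x (tens v (E z))).
Proof.
move=> t0; have [_ _ l3] := hT t0; have [s [ls sx]] := hdense x.
have bl (y : A) : nm (lmul y v) <= nm v * nm y by rewrite mulrC; exact: (lmul_le htr hH).
have h1 := to_op (fun a x y => lmulEl htr hH a x y v) bl (to_T t0 sx).
have bx (w : K) (a : A) : nm (J 0 t a w) <= nm w * nm a by rewrite mulrC (J_nm hJ).
have h2 := to_op (J_linx hJ (tens v (E z)) (lexx 0) t0) (bx _) sx.
apply: to_unique (to_dotr u h1) _; apply: to_ev (to_dotr (tens u (E z)) h2).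
by exists 0%N => m _; have [n hn] := ls m; rewrite (l3 n) // (vac_mat _ _ t0 hn).
Qed.

Lemma T_star t x : 0 <= t -> star (T t x) = T t (star x).
Proof.
move=> t0; apply: (lmul_test hN hA htr hH) => u v.
rewrite (T_mat _ _ _ t0) -(J_star htr hH he hG hK hB hdense hPhi hJ _ _ _ (lexx 0) t0) star_invol.
by rewrite -(lmul_star htr hH (T t x) u v) [LHS]dot_conj (T_mat _ _ _ t0) -dot_conj.
Qed.

(** [T t] is the compression of a *-homomorphism to the vacuum: the form of the image of $P =
    Q^{*}Q$ at [u] is $\sum_l \|\sum_j J_t(Q_{lj})(u_j \otimes e(0))\|^2$. *)
Lemma T_cp t : 0 <= t -> completely_positive (T t).
Proof.
move=> t0; have [l1 l2 _] := hT t0; split => // n P [Q hQ].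
apply: (mx_positive_test hN hA htr hH) => [i j|u].
  rewrite !mxE T_star //; congr (T t _); rewrite !hQ star_sum; apply: eq_bigr => l _.
  by rewrite star_mul star_invol.
pose w l := \sum_j J 0 t (Q l j) (tens (u j) (E z)).
suff -> : qform lmul (fun i j => map_mx (T t) P i j) u u = \sum_l dot (w l) (w l).
  by apply: sumr_ge0 => l _; rewrite dotxx lecR sqr_ge0.
have lx (y : K) := J_linx hJ y (lexx 0) t0.
rewrite /qform; transitivity (\sum_i \sum_j \sum_l
    dot (J 0 t (Q l i) (tens (u i) (E z))) (J 0 t (Q l j) (tens (u j) (E z)))).
  apply: eq_bigr => i _; apply: eq_bigr => j _; rewrite mxE (T_mat _ _ _ t0) hQ.
  rewrite (op_sum (lx _)) dot_sumr; apply: eq_bigr => l _.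
  rewrite (J_mul htr hH he hG hK hB hPhi hJ hdense _ _ _ t0).
  by rewrite -(J_star htr hH he hG hK hB hdense hPhi hJ _ _ _ (lexx 0) t0) star_invol.
under eq_bigr => i _ do rewrite exchange_big /=.
rewrite exchange_big; apply: eq_bigr => l _ /=; rewrite /w dot_suml; apply: eq_bigr => i _.
by rewrite dot_sumr.
Qed.

Lemma T_semigroup : cp_contraction_semigroup T.
Proof.
split.
- move=> x; have [_ _ l3] := hT (lexx 0); have [s [ls sx]] := hdense x.
  apply: to_unique (to_T (lexx 0) sx) _; apply: to_ev sx; exists 0%N => m _; have [n hn] := ls m.
  by rewrite (l3 n) // /flow (phi_id hB hPhi cz cz (lexx 0) hn).
- move=> s t x s0 t0; have st0 := addr_ge0 s0 t0; have [u [lu ux]] := hdense x.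
  apply: to_unique (to_T st0 ux) _; apply: to_ev (to_T s0 (to_T t0 ux)); exists 0%N => m _; have [n hn] := lu m.
  have [_ _ l1] := hT s0; have [_ _ l2] := hT t0; have [_ _ l3] := hT st0.
  have hv : B n (vac 0 t (u m)) := phi_B hPhi cz cz (lexx 0) t0 hn.
  by rewrite (l2 n) // (l1 n) // (l3 n) // (vac_flow s0 t0 hn).
- exact: T_cp.
- by move=> t x t0; have [_ h _] := hT t0; rewrite !normE lecR.
Qed.

Lemma T_conservative : conservative T.
Proof.
move=> t t0; have [_ _ l3] := hT t0; rewrite (l3 0%N); last exact: (B1 hB).
exact: (phi1 hB hPhi cz cz (lexx 0) 0 t0).
Qed.

Lemma gen_vac n r x : gen W n (ctl e z) (ctl e z) r x = dissip W n x.
Proof.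
rewrite /gen big1 ?addr0 // => l _; rewrite /ctl dot0r.
by rewrite cj0 !scale0r addr0.
Qed.

Lemma dissip_B n x : B n x -> B n (dissip W n x).
Proof. by move=> hx; rewrite -(gen_vac n 0); exact: (gen_B hB). Qed.

Lemma T_integral n x t (psi : A -> C) : B n x -> 0 <= t -> lin (psi : A -> C^o) ->
  cg 0 t (fun s => psi (T s (dissip W n x))) /\
  psi (T t x) = psi x + ci 0 t (fun s => psi (T s (dissip W n x))).
Proof.
move=> hx t0 hp.
have eT r : 0 <= r <= t -> psi (Phi 0 r (ctl e z) (ctl e z) (gen W n (ctl e z) (ctl e z) r x)) =
    psi (T r (dissip W n x)).
  move=> /andP[r0 _]; have [_ _ l3] := hT r0; rewrite gen_vac (l3 n) //; exact: dissip_B.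
split; first exact: (eq_cg eT (phi_cg hB hPhi cz cz (lexx 0) hp t0 hx)).
have [_ _ l3] := hT t0; rewrite (l3 n) // /flow (phi_eq hPhi cz cz (lexx 0) hp t0 hx).
by congr (_ + _); apply: eq_ci.
Qed.

(** Tested on vector functionals, which separate the points of [A], the difference of the two solves
    on each box the homogeneous equation with zero controls. *)
Lemma T_unique (T' : R -> A -> A) :
  (forall t, 0 <= t -> (forall a x y, T' t (a *: x + y) = a *: T' t x + T' t y) /\
    forall x, nm (T' t x) <= nm x) ->
  (forall n x t (psi : A -> C), B n x -> 0 <= t -> lin (psi : A -> C^o) ->
    (exists M : R, forall y, nm (psi y) <= M * nm y) ->
    cg 0 t (fun s => psi (T' s (dissip W n x))) /\
    psi (T' t x) = psi x + ci 0 t (fun s => psi (T' s (dissip W n x)))) ->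
  forall t x, 0 <= t -> T' t x = T t x.
Proof.
move=> hT' aT'; suff loc n t x : 0 <= t -> B n x -> T' t x = T t x.
  move=> t x t0; have [u [lu ux]] := hdense x; have [h1 h2] := hT' t t0.
  have b1 y : nm (T' t y) <= 1 * nm y by rewrite mul1r.
  apply: to_unique (to_op h1 b1 ux) _; apply: to_ev (to_T t0 ux); exists 0%N => m _.
  by have [n hn] := lu m; rewrite (loc n).
move=> t0 hx; apply: (lmul_test hN hA htr hH) => u v.
pose psi y : C^o := dot u (lmul y v).
have lp : lin psi by move=> a y y'; rewrite /psi (lmulEl htr hH) dotDr dotZr.
have bp : exists M : R, forall y, nm (psi y) <= M * nm y.
  exists (nm u * nm v) => y; apply: le_trans (CS _ _) _; rewrite -mulrA ler_wpM2l ?nm_ge0 //.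
  by rewrite [nm v * _]mulrC; exact: (lmul_le htr hH).
pose F r y : C^o := psi (T' r y) - psi (T r y).
suff : F t x = 0 by move=> /eqP; rewrite subr_eq0 => /eqP.
apply: (evol_uniq hB cz cz (lexx 0) (n := n) (T := t)); rewrite ?lexx ?t0 //.
- move=> r /andP[r0 _] a y y' hy hy'; have [h1 _] := hT' r r0; have [h2 _ _] := hT r0.
  by rewrite /F h1 h2 !lp scalerBr opprD addrACA.
(* The integral equation itself shows that these functions of time are bounded and measurable: each
   is a constant plus an indefinite integral. *)
- move=> y hy; have e1 (S : R -> A -> A) : (forall r, 0 <= r <= t -> cg 0 r (fun s => psi (S s (dissip W n y))) /\
      psi (S r y) = psi y + ci 0 r (fun s => psi (S s (dissip W n y)))) -> cbm 0 t (fun r => psi (S r y)).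
    move=> h; have tt' : 0 <= t <= t by rewrite t0 lexx.
    have [ht _] := h t tt'.
    apply: eq_cbm (cbmD (cbm_cst 0 t (psi y)) (cbm_ci ht)) => r hr.
    by have [_ ->] := h r hr.
  by apply: cbmB; apply: e1 => r /andP[r0 _]; [exact: aT'|exact: T_integral].
- move=> r y /andP[r0 rt] hy; have [c1 e1] := aT' n y r psi hy r0 lp bp.
  have [c2 e2] := T_integral hy r0 lp.
  rewrite /F e1 e2 opprD addrACA subrr add0r -ciB //; apply: eq_ci => q _.
  by rewrite gen_vac.
Qed.

End VacuumSemigroup.

(** * The infinite sums as finite ones, the boxes as a filtration, and the conclusion *)

Lemma nsum_fin (R : realType) (V : completeNormedModType R[i]) (F : nat -> V) n :
  (forall l, (n <= l)%N -> F l.+1 = 0) -> \sum_(1 <= j <oo) F j = \sum_(l < n) F l.+1.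
Proof.
move=> F0; apply: cvg_lim => //; apply/to_cvg; apply: to_ev (to_cst _).
exists n.+1 => -[//|m] nm; rewrite big_add1 /= (big_cat_nat _ (n := n)) //= big_mkord.
by rewrite [X in _ = _ + X]big_nat_cond [X in _ = _ + X]big1 ?addr0 // => i /andP[/andP[ni _] _]; exact: F0.
Qed.

Lemma lindblad_dissip (R : realType) (A : cstarType R) (B : nat -> set A) (W : nat -> A) n x :
  filtration B W -> B n x -> lindblad W x = dissip W n x.
Proof.
move=> hB hx; rewrite /lindblad /dissip (nsum_fin (n := n)) // => l nl.
by rewrite (delta_far hB nl hx) (delta_dag_far hB nl hx) amul0l amul0r addr0.
Qed.

Lemma structure_gen (R : realType) (A : cstarType R) (B : nat -> set A) (W : nat -> A)
    (k : hilbertType R) (e : nat -> k) n (f g : R -> k) s x :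
  filtration B W -> B n x -> lindblad W x
    + \sum_(1 <= j <oo) Num.conj (dot (e j) (f s)) *: delta W j x
    + \sum_(1 <= j <oo) dot (e j) (g s) *: delta_dag W j x = gen W n (ctl e f) (ctl e g) s x.
Proof.
move=> hB hx; rewrite (lindblad_dissip hB hx) (nsum_fin (n := n)) => [|l nl]; last first.
  by rewrite (delta_far hB nl hx) scaler0.
rewrite (nsum_fin (n := n)) => [|l nl]; last by rewrite (delta_dag_far hB nl hx) scaler0.
by rewrite /gen -addrA -big_split.
Qed.

Lemma box_filtration (R : realType) (N d : nat) (hN : (0 < N)%N)
    (A : cstarType R) (site : 'rV[int]_d -> 'M[R[i]]_N -> A) (hA : is_uhf site)
    (tr : A -> R[i]) (htr : is_trace tr)
    (H : hilbertType R) (Lam : A -> H) (lmul : A -> H -> H) (hH : is_gns tr Lam lmul) (W : nat -> A) :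
  (forall j, (1 <= j)%N -> supported site (shell d j) (W j)) ->
  filtration (fun n => supported site (box d n)) W.
Proof.
move=> hW; split.
- by move=> n; exact: supported_algebra.
- by move=> m n mn; exact: box_mono.
- move=> n; have [I [b [hb bo bx]]] := box_basis hN hA htr n.
  exists I, b, (fun i x => tr (star (b i) ** x)); split => //.
  + by move=> i a x y; rewrite mul_linearr (trace_linear htr).
  + exists (\sum_i nm (Lam (b i))); split=> [|i x]; first by apply: sumr_ge0 => i _; exact: nm_ge0.
    rewrite -(gns_dot hH); apply: le_trans (CS _ _) _; apply: ler_pM; rewrite ?nm_ge0 //.
      by rewrite (bigD1 i) //= lerDl sumr_ge0 // => j _; exact: nm_ge0.
    by have := nm_Lam_mul htr hH x aone; rewrite mul_unitr (nm_Lam1 htr hH) mulr1.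
- by move=> l; apply: supported_mono (hW l.+1 isT) => j; rewrite /shell /box /= => ->.
(* The box of radius $n$ and the shell of radius $l + 1 > n$ are disjoint. *)
- move=> n l x nl hx; apply: (supported_comm hA _ hx (hW l.+1 isT)) => j /= h1 h2.
  by move: h1; rewrite /box /shell /= in h2 *; rewrite h2 ltnNge nl.
Qed.

Theorem mainTheorem2 (R : realType) (N d : nat) (hN : (0 < N)%N) (hd : (0 < d)%N)
  (A : cstarType R) (site : 'rV[int]_d -> 'M[R[i]]_N -> A) (hA : is_uhf site)
  (tr : A -> R[i]) (htr : is_trace tr)
  (H : hilbertType R) (Lam : A -> H) (lmul : A -> H -> H) (hH : is_gns tr Lam lmul)
  (k : hilbertType R) (e : nat -> k) (he : is_onb e)
  (G : hilbertType R) (pow : nat -> (R -> k) -> G) (hG : is_sym_fock pow)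
  (K : hilbertType R) (tens : H -> G -> K) (hK : is_tensor tens)
  (W : nat -> A)
  (hW : forall j, (1 <= j)%N -> supported site (shell d j) (W j)) :
  exists J : R -> A -> K -> K,
  [/\ homomorphic_cocycle site lmul pow tens J,
      evans_hudson site e lmul pow tens W J &
      exists T : R -> A -> A,
      [/\ expectation_semigroup lmul pow tens J T,
          conservative T &
          minimal_associated site (lindblad W) T]].

Proof.
have hB := box_filtration hN hA htr hH hW; set B := fun n => supported site (box d n) in hB.
have hdense x : exists u : nat -> A, (forall n, exists m, B m (u n)) /\ to u x.
  have [u [lu ux]] := local_dense hA x; exists u; split => // n.
  by have [m _ hm] := lu n; exists m.
have hbasis n : exists (I : finType) (b : I -> A),
    (forall i, B n (b i)) /\ forall x, B n x -> x = \sum_i tr (star (b i) ** x) *: b i.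
  by have [I [b [hb _ bx]]] := box_basis hN hA htr n; exists I, b.
have loc x : local_elt site x <-> exists n, B n x.
  by split=> [[n _ hn]|[n hn]]; exists n.
have [Phi hPhi] := evolution_ex hB.
have [J hJ] := flow_ops_ex htr hH he hG hK hB hdense hPhi.
have [T hT] := vac_ex hN hA htr hH he hG hK hB hPhi hJ hdense.
exists (fun t => J 0 t); split.
- split.
  + move=> t t0; split.
    * by move=> x; apply/bdlin_op; exact: (bdlin_J hJ x (lexx 0) t0).
    * by move=> a x y z; exact: (J_linx hJ z (lexx 0) t0).
    * by move=> x y; apply/funext => z; exact: (J_mul htr hH he hG hK hB hPhi hJ hdense).
    * by apply/funext => z; exact: (J_one htr hH he hG hK hB hPhi hJ).
    * by move=> x z z'; exact: (J_star htr hH he hG hK hB hdense hPhi hJ).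
  + move=> t x t0; apply: (J_vN htr hH he hG hK hB hPhi hJ hdense hbasis x t0) => S.
    by case.
  + by move=> t x t0; exact: (J_vN htr hH he hG hK hB hPhi hJ hdense hbasis x t0).
  + move=> x u y; have [s [ls sx]] := hdense x.
    have bx (w : K) (a : A) : nm (J 0 0 a w) <= nm w * nm a by rewrite mulrC (J_nm hJ).
    have bl (a : A) : nm (lmul a u) <= nm u * nm a by rewrite mulrC; exact: (lmul_le htr hH).
    have h1 := to_op (J_linx hJ (tens u y) (lexx 0) (lexx 0)) (bx _) sx.
    have h2 := to_op (fun a x y => lmulEl htr hH a x y u) bl sx.
    have lt a w w' : tens (a *: w + w') y = a *: tens w y + tens w' y by exact: (tens_linearl hK).
    have bt w : nm (tens w y) <= nm y * nm w by rewrite (nm_tens hK) mulrC.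
    apply: to_unique h1 _; apply: to_ev (to_op lt bt h2).
    by exists 0%N => n _; rewrite (lmul_op_total he hG hK hB hPhi hJ).
  + move=> s t x s0 t0 /loc lx.
    have [n [Y [S [S' [h1 h2 h3]]]]] := J_cocycle htr hH he hG hK hB hPhi hJ hdense hbasis s0 t0 lx.
    exists n, Y, S, S'; split => // i; have [h4 h5 h6] := h1 i; split => //; exact/loc.
- move=> x t u v f g /loc[n hx] t0 hf hg F.
  have cf := L2_control he hf; have cg' := L2_control he hg.
  (* The factor $\exp\langle f, g\rangle$ is constant in time and goes into the functional, so that
     [phi_eq] becomes the Evans-Hudson equation. *)
  pose psi y : R[i]^o := dot u (lmul y v) * cexp (L2dot f g).
  have lp : lin psi.
    by move=> a y y'; rewrite /psi (lmulEl htr hH) dotDr dotZr mulrDl -mulrA.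
  have eF r : 0 <= r <= t -> psi (Phi 0 r (ctl e f) (ctl e g) (gen W n (ctl e f) (ctl e g) r x)) = F r.
    move=> /andP[r0 _]; rewrite /F (structure_gen e f g r hB hx).
    by rewrite (J_mat hJ _ _ (lexx 0) r0 (gen_B hB _ _ _ hx) hf hg).
  split; first exact: (eq_cg eF (phi_cg hB hPhi cf cg' (lexx 0) lp t0 hx)).
  rewrite (J_mat hJ _ _ (lexx 0) t0 hx hf hg) (tens_dot hK) (expv_dot hG hf hg).
  have := phi_eq hPhi cf cg' (lexx 0) lp t0 hx; rewrite (eq_ci eF) => h; exact: h.
exists T.
have hC := T_conservative he hB hPhi hT.
have aT : associated site (lindblad W) T.
  move=> x t psi /loc[n hx] t0 lp _; rewrite (lindblad_dissip hB hx).
  exact: (T_integral he hB hPhi hT hx t0 lp).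
split=> //; first by move=> t x u v t0; exact: (T_mat htr hH he hJ hdense hT).
split=> //; first exact: (T_semigroup hN hA htr hH he hG hK hB hPhi hJ hdense hT).
move=> T' sT' aT' t x t0 _; have -> : T' t x = T t x.
  apply: (T_unique hN hA htr hH he hB hPhi hdense hT) => // [r r0|n y r psi hy r0 lp [M hM]].
    split; first by case: (semigroup_cp sT' r0).
    by move=> y; have := semigroup_contraction sT' y r0; rewrite !normE lecR.
  rewrite -(lindblad_dissip hB hy); apply: aT' => //; first by apply/loc; exists n.
  by exists M%:C => w; rewrite !normE -rmorphM lecR.
(* The two semi-groups coincide, and their difference is $0 = 0^{*}0$. *)
by exists 0; rewrite subrr amul0r.
Qed.
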